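(* Let $d\ge1$. (i) If $0<p\le 1$ and $p\le q\le \infty$, then there is a constant $c_1=c_1(p,q)>0$ so that $$\mathrm{Op}\big(\mathbb{E}_N,B^{d/p-d}_{p,q}(\mathbb{R}^d), Q\big)\,\ge \, c_1 \; (2^{Nd}|Q|)^{\frac 1p-\frac 1q}$$ for any dyadic cube $Q$ with side length $\ge1$ and any $N>10$. (ii) If in addition $\frac{d}{d+1}\leq p\le q\le 1$, then there is a constant $c_2=c_2(p,q)$ such that for any dyadic cube $Q$ with side length $\ge 1$ and any $N>10$ $$c_1 \,\le\, \frac{\mathrm{Op}\big(\mathbb{E}_N,B^{d/p-d}_{p,q}(\mathbb{R}^d), Q\big)}{ (2^{Nd}|Q|)^{\frac 1p-\frac 1q}} \le \, c_2 .$$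
   Context: $B^s_{p,q}(\mathbb{R}^d)$ is the usual inhomogeneous Besov space. With $I_{N,\mu}=2^{-N}(\mu+[0,1)^d)$, the dyadic averaging operator is $$\mathbb{E}_Nf(x)=\sum_{\mu\in\mathbb{Z}^d}\mathbf{1}_{I_{N,\mu}}(x)\,2^{Nd}\int_{I_{N,\mu}}f(y)\,dy,\qquad f\in L^1_{loc}(\mathbb{R}^d).$$ For an open dyadic cube $Q$, a (quasi-)Banach space $X$ of tempered distributions and a linear operator $T$, $$\mathrm{Op}(T,X,Q)=\sup\big\{\|Tf\|_X:\ \|f\|_X\le1,\ \mathrm{supp}(f)\subset Q\big\}\in[0,\infty],$$ where for $T=\mathbb{E}_N$ the supremum is over locally integrable $f\in X$ (automatic in the range of (ii)). $|Q|$ is the Lebesgue measure of $Q$. The constants $c_1,c_2$ do not depend on $N$ and $Q$ (they may depend on $d$). *)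

(* Defs.v *)
From HB Require Import structures.
From mathcomp Require Import all_boot all_order all_algebra.
From mathcomp Require Import complex.
From mathcomp Require Import all_classical all_reals all_analysis.

Set Implicit Arguments.
Unset Strict Implicit.
Unset Printing Implicit Defensive.

Import Order.TTheory GRing.Theory Num.Theory.
Import numFieldNormedType.Exports.

Local Open Scope classical_set_scope.
Local Open Scope ring_scope.
Local Open Scope complex_scope.

(* R^d is 'rV[R]_d.  The library provides its topology and its normed space
   structure (with the sup norm) but no sigma-algebra and no measure: we use
   the product (= Borel) sigma-algebra and d-fold product Lebesgue measure. *)

Section measurable_row.
Context {R : realType} (n : nat).

Let coord (i : 'I_n) (x : 'rV[R]_n) : R := x ord0 i.

Let row_set0 : g_sigma_preimage coord set0.
Proof. exact: sigma_algebra0. Qed.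

Let row_setC A : g_sigma_preimage coord A -> g_sigma_preimage coord (~` A).
Proof. exact: sigma_algebraC. Qed.

Let row_bigcup (F : (set 'rV[R]_n)^nat) :
  (forall i, g_sigma_preimage coord (F i)) ->
  g_sigma_preimage coord (\bigcup_i (F i)).
Proof. exact: sigma_algebra_bigcup. Qed.

Definition measure_row_display : measure_display.
Proof. exact: default_measure_display. Qed.

HB.instance Definition _ := @isMeasurable.Build measure_row_display
  'rV[R]_n (g_sigma_preimage coord) row_set0 row_setC row_bigcup.

Lemma measurable_coord (i : 'I_n) :
  measurable_fun [set: 'rV[R]_n] (fun x : 'rV[R]_n => x ord0 i).
Proof.
move=> _ Y mY; rewrite setTI; apply: sub_sigma_algebra => /=.
rewrite -bigcup_seq/=; exists i => /=; first by rewrite mem_index_enum.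
by exists Y => //; rewrite setTI.
Qed.

Lemma measurable_fun_row d (T : measurableType d) (f : T -> 'rV[R]_n) :
  (forall i, measurable_fun [set: T] (fun t => f t ord0 i)) ->
  measurable_fun [set: T] f.
Proof.
move=> mf; apply: (@measurability _ _ _ _ _ _
  (\big[setU/set0]_(i < n) preimage_set_system setT (coord i) measurable)).
  by [].
move=> _ [A + <-]; rewrite -bigcup_seq => -[i _ [B mB <-]].
by rewrite !setTI -[_ @^-1` _]setTI; exact: (mf i _ B mB).
Qed.

End measurable_row.

Section lebesgue_row.
Context {R : realType}.

Definition row_cons n (p : R * 'rV[R]_n) : 'rV[R]_n.+1 := row_mx p.1%:M p.2.

Definition row_uncons n (v : 'rV[R]_n.+1) : R * 'rV[R]_n :=
  (v ord0 ord0, \row_j v ord0 (lift ord0 j)).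

Lemma row_consK n : cancel (@row_cons n) (@row_uncons n).
Proof.
case=> x v; rewrite /row_uncons /row_cons /=; congr pair.
  rewrite (_ : ord0 = lshift n (ord0 : 'I_1)); last exact: val_inj.
  by rewrite (@row_mxEl _ 1 1 n) mxE eqxx.
apply/rowP => j; rewrite mxE (_ : lift _ _ = rshift 1 j); last exact: val_inj.
by rewrite (@row_mxEr _ 1 1 n).
Qed.

Lemma measurable_row_cons n : measurable_fun setT (@row_cons n).
Proof.
apply: measurable_fun_row => i.
have [->|[j ->]] : i = ord0 \/ exists j, i = lift ord0 j.
  by case: (unliftP ord0 i) => [j|] ->; [right; exists j|left].
- rewrite (_ : (fun _ => _) = fst) //; apply/funext => p.
  by have := congr1 fst (row_consK p).
- rewrite (_ : (fun _ => _) = (fun v : 'rV[R]_n => v ord0 j) \o snd).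
    by apply: measurableT_comp => //; exact: measurable_coord.
  apply/funext => p /=; have /(congr1 snd) /rowP /(_ j) := row_consK p.
  by rewrite /= mxE.
Qed.

Lemma measurable_row_uncons n : measurable_fun setT (@row_uncons n).
Proof.
apply: measurable_fun_pair; first exact: measurable_coord.
apply: measurable_fun_row => i.
rewrite (_ : (fun _ => _) = fun v : 'rV[R]_n.+1 => v ord0 (lift ord0 i)).
  exact: measurable_coord.
by apply/funext => v; rewrite mxE.
Qed.

Definition lebesgue_row_step n (mu : {sigma_finite_measure set 'rV[R]_n -> \bar R})
    : set 'rV[R]_n.+1 -> \bar R :=
  pushforward (lebesgue_measure \x mu)%E (@row_cons n).

Section step.
Variables (n : nat) (mu : {sigma_finite_measure set 'rV[R]_n -> \bar R}).

Let prod_measure : {measure set (measurableTypeR R * 'rV[R]_n)%type -> \bar R} :=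
  (lebesgue_measure \x mu)%E.

Let step0 : lebesgue_row_step mu set0 = 0%E.
Proof. by rewrite /lebesgue_row_step /pushforward preimage_set0 measure0. Qed.

Let step_ge0 A : (0 <= lebesgue_row_step mu A)%E.
Proof. exact: (measure_ge0 prod_measure). Qed.

Let step_sigma_additive : semi_sigma_additive (lebesgue_row_step mu).
Proof.
have := @measure_semi_sigma_additive _ _ _
  (@measure_function_pushforward__canonical__measure_function_Measure
     _ _ _ _ _ prod_measure _ (@measurable_row_cons n)).
exact.
Qed.

HB.instance Definition _ := isMeasure.Build _ _ _
  (lebesgue_row_step mu) step0 step_ge0 step_sigma_additive.

Let step_sigma_finite : sigma_finite setT (lebesgue_row_step mu).
Proof.
have /sigma_finiteP[F [FT Fnd Foo]] :=
  sigma_finiteT (@lebesgue_measure R : {sigma_finite_measure set _ -> \bar R}).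
have /sigma_finiteP[G [GT Gnd Goo]] := sigma_finiteT mu.
exists (fun k => @row_uncons n @^-1` (F k `*` G k)).
  rewrite -preimage_bigcup -(@preimage_setT _ _ (@row_uncons n)); congr (_ @^-1` _).
  rewrite -setXTT FT GT; apply/seteqP; split => [[x v] [[i _ Fx] [j _ Gv]]|].
    exists (maxn i j) => //; split.
    - by apply: (subsetPset _ _ (Fnd _ _ (leq_maxl i j))).
    - by apply: (subsetPset _ _ (Gnd _ _ (leq_maxr i j))).
  by move=> [x v] [i _ [Fx Gv]]; split; exists i.
move=> k; have [mF Fk] := Foo k; have [mG Gk] := Goo k; split.
  rewrite -[_ @^-1` _]setTI; apply: measurable_row_uncons => //.
  exact: measurableX.
rewrite /lebesgue_row_step /pushforward -comp_preimage.
rewrite (_ : _ \o _ = id); last by apply/funext => p /=; rewrite row_consK.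
by rewrite preimage_id product_measure1E// lte_mul_pinfty// ge0_fin_numE.
Qed.

HB.instance Definition _ := Measure_isSigmaFinite.Build _ _ _
  (lebesgue_row_step mu) step_sigma_finite.

End step.

Fixpoint lebesgue_row n : {sigma_finite_measure set 'rV[R]_n -> \bar R} :=
  match n with
  | 0 => dirac (0 : 'rV[R]_0)
  | m.+1 => lebesgue_row_step (lebesgue_row m)
  end.

End lebesgue_row.

Section euclidean.
Context {R : realType} {d : nat}.
Implicit Types x y : 'rV[R]_d.

Definition dotp x y : R := \sum_(i < d) x ord0 i * y ord0 i.

(* the norm `|x| of the library is the sup norm *)
Definition enorm x : R := Num.sqrt (dotp x x).

End euclidean.

Section complex_functions.
Context {R : realType} {d : nat}.
Local Notation E := 'rV[R]_d.
Implicit Types (f g : E -> R[i]).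

Definition cintegral (D : set E) f : R[i] :=
  (\int[lebesgue_row d]_(x in D) complex.Re (f x))%R
  +i* (\int[lebesgue_row d]_(x in D) complex.Im (f x))%R.

Definition cmeasurable f :=
  measurable_fun [set: E] (fun x => complex.Re (f x)) /\
  measurable_fun [set: E] (fun x => complex.Im (f x)).

Definition clocally_integrable f :=
  cmeasurable f /\
  forall K : set E, compact K ->
    (\int[lebesgue_row d]_(x in K) (Normc.normc (f x))%:E < +oo)%E.

Definition cdifferentiable f x :=
  differentiable (fun y => complex.Re (f y)) x /\
  differentiable (fun y => complex.Im (f y)) x.

Definition cpartial (i : 'I_d) f : E -> R[i] := fun x =>
  'D_(delta_mx ord0 i) (fun y => complex.Re (f y)) x
  +i* 'D_(delta_mx ord0 i) (fun y => complex.Im (f y)) x.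

(* The iterated partial derivative along a word of directions; words
   of length at most k range over all derivatives of order at most k. *)
Definition cpartials (s : seq 'I_d) f : E -> R[i] := foldr cpartial f s.

Definition csmooth f :=
  forall (s : seq 'I_d) x, cdifferentiable (cpartials s f) x.

Definition schwartz f :=
  csmooth f /\
  forall (k : nat) (s : seq 'I_d), exists M : R, forall x,
    (1 + enorm x) ^+ k * Normc.normc (cpartials s f x) <= M.

Definition test_function (U : set E) f :=
  [/\ csmooth f, compact (closure [set x | f x != 0]) &
      closure [set x | f x != 0] `<=` U].

Definition inverse_fourier g : E -> R[i] := fun x =>
  cintegral [set: E]
    (fun xi => g xi * (cos (2 * pi * dotp x xi) +i* sin (2 * pi * dotp x xi))).

End complex_functions.

Section distributions.
Context {R : realType} {d : nat}.
Local Notation E := 'rV[R]_d.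

(* Total on all functions for convenience; for a tempered distribution only
   the values on Schwartz functions are meaningful. *)
Definition functional := (E -> R[i]) -> R[i].
Implicit Types u : functional.

Definition tempered u :=
  (forall (a : R[i]) f g, schwartz f -> schwartz g ->
    u (fun x => a * f x + g x) = a * u f + u g) /\
  exists (C : R) (k : nat), forall f (B : R), schwartz f ->
    (forall (s : seq 'I_d) x, (size s <= k)%N ->
      (1 + enorm x) ^+ k * Normc.normc (cpartials s f x) <= B) ->
    Normc.normc (u f) <= C * B.

Definition dsupport u : set E :=
  ~` \bigcup_(U in [set U | open U /\
                            forall f, test_function U f -> u f = 0]) U.

Definition regular_dist (f : E -> R[i]) : functional := fun g =>
  cintegral [set: E] (fun x => f x * g x).

(* X is the quasi-norm of a space of tempered distributions, extended by +oo
   to the functionals outside of the space.  For bounded Q the functions f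
   below are integrable with compact support, so that the integrals in
   regular_dist f converge. *)
Definition Op (T : (E -> R[i]) -> (E -> R[i])) (X : functional -> \bar R)
    (Q : set E) : \bar R :=
  ereal_sup [set X (regular_dist (T f)) | f in
    [set f | [/\ clocally_integrable f, (X (regular_dist f) <= 1)%E &
                 dsupport (regular_dist f) `<=` Q]]].

End distributions.
Arguments functional R d : clear implicits.

Section besov.
Context {R : realType} {d : nat}.
Local Notation E := 'rV[R]_d.

Definition LP_generator (phi0 : E -> R[i]) :=
  [/\ csmooth phi0,
      forall xi, enorm xi <= 1 -> phi0 xi = 1 &
      forall xi, 3 / 2 <= enorm xi -> phi0 xi = 0].

Definition LP_symbol (phi0 : E -> R[i]) (k : nat) : E -> R[i] :=
  if k is j.+1 then fun xi => phi0 (2 ^- j.+1 *: xi) - phi0 (2 ^- j *: xi)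
  else phi0.

(* F^{-1}[phi_k F u], which is the smooth function (F^{-1} phi_k) * u *)
Definition LP_piece (phi0 : E -> R[i]) (k : nat) (u : functional R d)
    : E -> R[i] := fun x =>
  u (fun y => inverse_fourier (LP_symbol phi0 k) (x - y)).

(* The L^p quasi-norm is that of the library for Lebesgue measure, and the
   l^q quasi-norm over k, q = +oo included, that for the counting measure. *)
Definition besov_norm (phi0 : E -> R[i]) (s p : R) (q : \bar R)
    (u : functional R d) : \bar R :=
  if `[< tempered u >] then
    Lnorm counting q (fun k : nat => (2 `^ (s *+ k))%:E *
      Lnorm (lebesgue_row d) p%:E
        (fun x => (Normc.normc (LP_piece phi0 k u x))%:E))%E
  else +oo%E.

End besov.

Section dyadic.
Context {R : realType} {d : nat}.
Local Notation E := 'rV[R]_d.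

Definition dyadic_box (N : nat) (mu : 'rV[int]_d) : set E :=
  [set x | forall i, 2 ^- N * (mu ord0 i)%:~R <= x ord0 i
                     < 2 ^- N * ((mu ord0 i)%:~R + 1)].

Definition dyadic_avg (N : nat) (f : E -> R[i]) : E -> R[i] := fun x =>
  \sum_(mu \in [set: 'rV[int]_d])
    \1_(dyadic_box N mu) x * ((2 ^+ (N * d))%:C * cintegral (dyadic_box N mu) f).

(* j : int, so the side length 2^-j is any integral power of 2 *)
Definition dyadic_cube (j : int) (mu : 'rV[int]_d) : set E :=
  [set x | forall i, 2 ^ (- j) * (mu ord0 i)%:~R < x ord0 i
                     < 2 ^ (- j) * ((mu ord0 i)%:~R + 1)].

End dyadic.

(* Main.v *)
Require Import Defs.
From HB Require Import structures.
From mathcomp Require Import all_boot all_order all_algebra.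
From mathcomp Require Import complex.
From mathcomp Require Import all_classical all_reals all_analysis.
From mathcomp Require Import measurable_realfun ring lra.

Set Implicit Arguments.
Unset Strict Implicit.
Unset Printing Implicit Defensive.

Import Order.TTheory GRing.Theory Num.Theory.
Import numFieldNormedType.Exports.

Local Open Scope classical_set_scope.
Local Open Scope ring_scope.

(** Why the theorem holds.  Write [n] for the dimension, [f_k] for the
    Littlewood-Paley piece [f * psi_k] and [M = 2^{Nn} |Q|] for the number of
    dyadic cubes of side [2^-N] that make up [Q].  Since the smoothness is
    [n/p - n], the [p]-th power of the [k]-th term of the Besov quasi-norm is
    [2^{kn(1-p)} int |f_k|^p] ([besov_term_powR]): it is invariant under
    [L1]-normalized dilations, up to a shift of [k].

    Lower bound ([Op_lower]).  A wavelet, the difference of two translates of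
    one bump, has mean zero and is smooth, so after an [L1]-normalized dilation
    by [2^m] its [k]-th term decays like [2^{-|k-m|}] ([scaled_piece_pmass]).
    Take the sum of [M'] of them, with pairwise distinct [m], times [lambda]:
    its norm is at most [C lambda M'^{1/q}] ([bump_sum_norm]), whatever the
    places of the wavelets.  Put one into each of the [M' = 2^{-n} M] dyadic
    cubes of side [2^{1-N}] of [Q], with its two bumps in two adjacent cubes of side [2^-N].  All [m] being
    large, averaging forgets them and leaves a sum of equal dipoles of height
    [lambda 2^{Nn}] ([test_avg]).  All the dipoles are in phase with one wave of
    frequency [2^{N-1}], which survives in the piece [N-1] only; so the mass of
    that piece, its [L1] norm, is at least [c lambda M'], while its supremum is at most
    [C lambda 2^{Nn}].  Interpolating [L1] between [Lp] and the supremum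
    ([dipoles_oscillate]) gives a quasi-norm at least [c lambda M'^{1/p}].  The
    ratio of the two is [M'^{1/p-1/q}].

    Upper bound ([Op_upper]).  A distribution supported in [Q] is a function
    that vanishes almost everywhere off [Q] ([dsupport_ae]), so its average only
    involves the [M] cubes of [Q] ([cube_avg]).  Everything reduces to integrals
    of [f] against functions of mean zero that live near one cube [t] of side
    [2^-N] ([full_local]).  Such a pairing with [f_j] is controlled by a weighted
    local mean of [|f_j|]; for [j < N] the slow variation of [f_j] contributes a
    factor [2^{-(N-j)}] and the averaging of [|f_j|] over the larger scale
    [2^-j] a factor [2^{-(N-j)n}] ([piece_local]).  Let [B t] bound the sum over
    [j] of these quantities.
    - For [k <= N] the kernel [psi_k] is nearly constant on each cube, and
      [(E_N f)_k - f_k] is a sum over the cubes of pairings of [f] with small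
      functions of mean zero ([low_piece], [low_pmass]).
    - For [k > N] the function [E_N f] is locally constant on the scale of
      [psi_k], except in a layer of thickness [2^-k] around the faces of the
      cubes, where its jumps are differences of means of [f] over neighbouring
      cubes ([gavg_osc], [high_piece], [high_pmass]).

    In both cases the [p]-th power of the [k]-th term exceeds that of [f] by at
    most a geometric factor in [|k-N|] times [sum_t (B t)^p]; for large [k] its ratio is
    [2^{n(1-p)-1}], below [1] because [p >= n/(n+1)] ([scale_low],
    [scale_high]).  It remains to bound the sum ([local_sums]).  By the weighted
    Nikolskii inequality [wmass_powR] a local mean is controlled by a local
    [Lp] average.  When these are summed over the cubes, about [2^{(N-j)n}] of
    them see the same point at scale [2^-j]; the gain [2^{-(N-j)(n+1)p}]
    compensates that exactly when [p >= n/(n+1)].  This yields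
    [sum_t (B t)^q <= C], where [q <= 1] lets one sum over [j] inside the power,
    and Jensen's inequality turns it into [sum_t (B t)^p <= C M^{1-p/q}].  The
    two bounds on the terms combine in [grid_upper].

    The Fourier analysis behind this is elementary: bumps have rapidly decaying
    inverse transforms ([ift_decay], [ift_lip]), and duality together with an
    approximate identity gives inversion up to a constant
    ([ft_ift_raw]), which cannot vanish ([ift_mass_neq0]); the constant is
    carried along as [LP_const].  Inversion yields the multiplication rule
    [cconv_ift] and from it the reproduction of each piece by a slightly wider
    kernel ([piece_reproduce]). *)

(** * Affine changes of variables and iterated integration on rows *)
Section affine_line.
Context {R : realType}.
Local Open Scope ereal_scope.
Local Notation lam := (@lebesgue_measure R).

(** Both sides are measures in [A], so it is enough to compare them on
    intervals; uniqueness of Lebesgue measure does the rest. *)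
Lemma lebesgue_affine (a r : R) (r0 : r != 0%R) (A : set R) : measurable A ->
  lam A = `|r|%:E * lam ((fun t => a + r * t)%R @^-1` A).
Proof.
move=> mA.
have mphi : measurable_fun [set: measurableTypeR R]
    ((fun t => a + r * t)%R : measurableTypeR R -> measurableTypeR R).
  by apply: measurable_funD => //; exact: measurable_funM.
have r_ge0 : (0 <= `|r|)%R by [].
pose m' : {measure set (measurableTypeR R) -> \bar R} :=
  mscale (NngNum r_ge0)
  (@measure_function_pushforward__canonical__measure_function_Measure
     _ _ _ _ _ lam _ mphi).
rewrite (@lebesgue_measure_unique R m')//.
move=> _ [[x y] _ <-] /=; rewrite lebesgue_measure_itv /= lte_fin.
rewrite /mscale /= /pushforward.
have [rp|rn] := ltP 0%R r.
  have -> : (fun t => a + r * t)%R @^-1` `]x, y]%classic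
      = `]((x - a) / r)%R, ((y - a) / r)%R]%classic :> set R.
    apply/seteqP; split=> t /=; rewrite !in_itv/= ltr_pdivrMr// ler_pdivlMr//;
    rewrite ltrBlDl lerBrDl [(t * r)%R]mulrC //.
  rewrite lebesgue_measure_itv /= lte_fin ltr_pM2r ?invr_gt0// ltrD2r.
  case: ifP => _; rewrite ?mule0// -!EFinD -EFinM (gtr0_norm rp); congr (_%:E).
  by field.
have {}rn : (r < 0)%R by rewrite lt_neqAle r0.
have -> : (fun t => a + r * t)%R @^-1` `]x, y]%classic
      = `[((y - a) / r)%R, ((x - a) / r)%R[%classic :> set R.
  apply/seteqP; split=> t /=; rewrite !in_itv/= ler_ndivrMr// ltr_ndivlMr//;
    rewrite ltrBlDl lerBrDl [(t * r)%R]mulrC => /andP[-> ->] //.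
rewrite lebesgue_measure_itv /= lte_fin ltr_nM2r ?invr_lt0// ltrD2r.
case: ifP => _; rewrite ?mule0// -!EFinD -EFinM (ltr0_norm rn); congr (_%:E).
by field.
Qed.

Lemma ge0_integral_affine (a r : R) (r0 : r != 0%R) (F : R -> \bar R) :
  measurable_fun setT F -> (forall t, 0 <= F t) ->
  \int[lam]_t F t = `|r|%:E * \int[lam]_t F (a + r * t)%R.
Proof.
move=> mF F0.
have mphi : measurable_fun [set: measurableTypeR R]
    ((fun t => a + r * t)%R : measurableTypeR R -> measurableTypeR R).
  by apply: measurable_funD => //; exact: measurable_funM.
have r_ge0 : (0 <= `|r|)%R by [].
pose pf : {measure set (measurableTypeR R) -> \bar R} :=
  (@measure_function_pushforward__canonical__measure_function_Measure
     _ _ _ _ _ lam _ mphi).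
pose m' : {measure set (measurableTypeR R) -> \bar R} :=
  mscale (NngNum r_ge0) pf.
rewrite (@eq_measure_integral _ _ _ setT m').
  rewrite ge0_integral_mscale//=; congr (_ * _).
  rewrite (ge0_integral_pushforward mphi)//=.
by move=> A mA _; exact: (lebesgue_affine a r0 mA).
Qed.
End affine_line.

Section row_measure.
Context {R : realType}.
Local Open Scope ereal_scope.
Local Notation lam := (@lebesgue_measure R).

Lemma measurable_cyl n (Y : 'I_n -> set R) : (forall i, measurable (Y i)) ->
  measurable [set x : 'rV[R]_n | forall i, Y i (x ord0 i)].
Proof.
move=> mY; rewrite (_ : mkset _ =
   \bigcap_(i in [set: 'I_n]) [set x : 'rV[R]_n | Y i (x ord0 i)]).
  apply: fin_bigcap_measurable => // k _; rewrite -[X in measurable X]setTI.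
  exact: (@measurable_coord R n k measurableT _ (mY k)).
by apply/seteqP; split=> x /= h i; [move=> _; exact: h|exact: h].
Qed.

Lemma row_cons0 n (t : R) (v : 'rV[R]_n) : row_cons (t, v) ord0 ord0 = t.
Proof. by have /(congr1 fst) := row_consK (t, v). Qed.

Lemma row_consS n (t : R) (v : 'rV[R]_n) i :
  row_cons (t, v) ord0 (lift ord0 i) = v ord0 i.
Proof. by have /(congr1 snd)/rowP/(_ i) := row_consK (t, v); rewrite /= mxE. Qed.

Lemma lebesgue_row_cyl n (Y : 'I_n -> set R) : (forall i, measurable (Y i)) ->
  lebesgue_row n [set x : 'rV[R]_n | forall i, Y i (x ord0 i)] =
  \big[mule/1]_(i < n) lam (Y i).
Proof.
elim: n Y => [|n IH] Y mY.
  rewrite big_ord0 /= diracE mem_set//= => i; by case: i.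
rewrite big_ord_recl /= /lebesgue_row_step /pushforward.
rewrite (_ : _ @^-1` _ = Y ord0 `*`
    [set v : 'rV[R]_n | forall i, Y (lift ord0 i) (v ord0 i)]).
  rewrite (@product_measure1E _ _ _ _ _ lam (lebesgue_row n) (Y ord0) _ (mY ord0)).
    by rewrite (IH (fun i => Y (lift ord0 i))).
  exact: (@measurable_cyl n (fun i => Y (lift ord0 i))).
apply/seteqP; split=> -[t v] /=.
  by move=> h; split=> [|i]; [move: (h ord0)|move: (h (lift ord0 i))];
    rewrite ?row_cons0 ?row_consS.
move=> [h1 h2] i; case: (unliftP ord0 i) => [j|] ->;
  by rewrite ?row_cons0 ?row_consS.
Qed.

Lemma measurable_row_consR n : @measurable_fun _ _ (measurableTypeR R * 'rV[R]_n)%type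
  _ setT (@row_cons R n).
Proof. exact: measurable_row_cons. Qed.

Lemma ge0_integral_row n (F : 'rV[R]_n.+1 -> \bar R) :
  measurable_fun setT F -> (forall x, 0 <= F x) ->
  \int[lebesgue_row n.+1]_x F x =
  \int[lam]_t \int[lebesgue_row n]_v F (row_cons (t, v)).
Proof.
move=> mF F0.
pose pm : {measure set (measurableTypeR R * 'rV[R]_n)%type -> \bar R} :=
  (lam \x lebesgue_row n).
transitivity (\int[measure_function_pushforward__canonical__measure_function_Measure
     pm (@measurable_row_consR n)]_x F x).
  by apply: eq_measure_integral.
rewrite (_ : integral _ _ _ = \int[pm]_x (F \o @row_cons R n) x); last first.
  have := (ge0_integral_pushforward (@measurable_row_consR n) pm measurableT mF (fun y _ => F0 y)).
  by rewrite preimage_setT => <-.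

rewrite (@fubini_tonelli1 _ _ _ _ _ lam (lebesgue_row n) (F \o @row_cons R n))//=.
  exact: (measurableT_comp mF (@measurable_row_consR n)).
Qed.

Lemma measurable_affine n (a : 'rV[R]_n) (r : R) :
  measurable_fun setT (fun x : 'rV[R]_n => (a + r *: x)%R).
Proof.
apply: measurable_fun_row => i.
rewrite (_ : (fun _ => _) = fun x : 'rV[R]_n => (a ord0 i + r * x ord0 i)%R).
  apply: measurable_funD => //; apply: measurable_funM => //.
  exact: measurable_coord.
by apply/funext => x; rewrite !mxE.
Qed.

(** One coordinate at a time, by Tonelli and the one-dimensional case. *)
Lemma ge0_integral_row_affine n (a : 'rV[R]_n) (r : R) (F : 'rV[R]_n -> \bar R) :
  r != 0%R -> measurable_fun setT F -> (forall x, 0 <= F x) ->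
  \int[lebesgue_row n]_x F x =
  (`|r| ^+ n)%:E * \int[lebesgue_row n]_x F (a + r *: x)%R.
Proof.
move=> r0; elim: n a F => [|n IH] a F mF F0.
  rewrite expr0 mul1e; apply: eq_integral => x _; congr F.
  by apply/rowP => -[].
have mFa : measurable_fun setT (fun x : 'rV[R]_n.+1 => F (a + r *: x)%R).
  by apply: measurableT_comp => //; exact: measurable_affine.
rewrite !ge0_integral_row//.
have mF2 := measurableT_comp mF (@measurable_row_consR n).
rewrite (@ge0_integral_affine R (a ord0 ord0) r)//=; last 2 first.
- have h := @measurable_fun_fubini_tonelli_F _ _ _ _ _ (lebesgue_row n) _ mF2 (fun x => F0 _).
  exact: h.
- by move=> t; exact: integral_ge0.
rewrite exprS EFinM -muleA; congr (_ * _).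
have mF3 := measurableT_comp mFa (@measurable_row_consR n).
rewrite -ge0_integralZl//; last 2 first.
- exact: (@measurable_fun_fubini_tonelli_F _ _ _ _ _ (lebesgue_row n) _ mF3 (fun x => F0 _)).
- by move=> t _; exact: integral_ge0.
apply: eq_integral => t _.
rewrite (IH (\row_j a ord0 (lift ord0 j)))//; last first.
  exact: (measurableT_comp mF2 (measurable_pair1 _)).
congr (_ * _); apply: eq_integral => v _; congr F.
apply/rowP => i; rewrite [RHS]mxE [X in _ = (_ + X)%R]mxE.
by case: (unliftP ord0 i) => [j|] ->; rewrite ?row_cons0 ?row_consS // !mxE.
Qed.
End row_measure.

(** * Topology and volume of boxes and balls *)
Section row_topology.
Context {R : realType} {n : nat}.
Local Notation E := 'rV[R]_n.

Lemma row_norm_le (x : E) (r : R) : 0 <= r ->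
  (`|x| <= r) <-> (forall i, `|x ord0 i| <= r).
Proof.
move=> r0; rewrite [`|x|]/Num.norm /= mx_normrE; split=> [h i|h].
  apply: le_trans h; exact: (le_bigmax _ (fun ij : 'I_1 * 'I_n => `|x ij.1 ij.2|) (ord0, i)).
by apply/bigmax_leP; split=> // -[i j] _ /=; rewrite (ord1 i).
Qed.

Lemma row_norm_lt (x : E) (r : R) : 0 < r ->
  (`|x| < r) <-> (forall i, `|x ord0 i| < r).
Proof.
move=> r0; rewrite [`|x|]/Num.norm /= mx_normrE; split=> [h i|h].
  apply: le_lt_trans h; exact: (le_bigmax _ (fun ij : 'I_1 * 'I_n => `|x ij.1 ij.2|) (ord0, i)).
by apply/bigmax_ltP; split=> // -[i j] _ /=; rewrite (ord1 i).
Qed.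

Lemma coord_le_norm (x : E) i : `|x ord0 i| <= `|x|.
Proof. by have [h _] := row_norm_le x (normr_ge0 x); exact: h. Qed.

(** The sigma-algebra is generated by the coordinates, so this is where it
    meets the topology: an open set is a countable union of rational boxes. *)
Lemma open_measurable_row (U : set E) : open U -> measurable U.
Proof.
move=> oU.
pose q (v : 'rV[rat]_n) : E := \row_i ratr (v ord0 i).
pose C (k : 'rV[rat]_n * nat) := [set x : E | forall i,
  `[q k.1 ord0 i - k.2.+1%:R^-1, q k.1 ord0 i + k.2.+1%:R^-1]%classic (x ord0 i)].
have mC k : measurable (C k).
  by apply: (@measurable_cyl R n (fun i => `[q k.1 ord0 i - k.2.+1%:R^-1, q k.1 ord0 i + k.2.+1%:R^-1]%classic)) => i; exact: measurable_itv.
rewrite (_ : U = \bigcup_(k in [set k | C k `<=` U]) C k).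
  rewrite bigcup_mkcond; apply: countable_bigcupT_measurable; first exact: countableP.
  by move=> k; case: ifP => // _; exact: measurable0.
apply/seteqP; split=> [x Ux|x [k /= kU]]; last exact: kU.
have /nbhs_ballP[e /= e0 eU] : nbhs x U by rewrite nbhsE; exists U.
have [k ke] : exists k : nat, k.+1%:R^-1 < e / 2.
  by have [k _ hk] := near_infty_natSinv_lt (PosNum (divr_gt0 e0 (ltr0n R 2)));
    exists k; exact: (hk k (leqnn k)).
have k0 : 0 < k.+1%:R^-1 :> R by rewrite invr_gt0.
have /choice[v hv] (i : 'I_n) : exists t : rat, `|x ord0 i - ratr t| <= k.+1%:R^-1.
  have [t ht] := @rat_in_itvoo R (x ord0 i) (x ord0 i + k.+1%:R^-1) ltac:(by rewrite ltrDl).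
  exists t; move: ht; rewrite in_itv/= => /andP[h1 h2].
  move: h1 h2 k0; rewrite ler_distl; move: (k.+1%:R^-1) => z h1 h2 z0.
  by apply/andP; split; lra.
have Cx : C (\row_i v i, k) x.
  move=> i /=; rewrite in_itv /= /q !mxE; move: (hv i); rewrite ler_distl => /andP[h1 h2].
  by rewrite h1 h2.
exists (\row_i v i, k) => //= y Cy; apply: eU.
rewrite -ball_normE /ball_ /=; apply/row_norm_lt => // i; rewrite !mxE.
move: (Cy i) (Cx i); rewrite /= !in_itv/= => /andP[h1 h2] /andP[h3 h4].
move: h1 h2 h3 h4 ke; move: (k.+1%:R^-1) => z *.
by rewrite ltr_distl; apply/andP; split; lra.
Qed.

Lemma closed_measurable_row (U : set E) : closed U -> measurable U.
Proof.
by move=> cU; rewrite -[U]setCK; apply: measurableC; apply: open_measurable_row; exact: closed_openC.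
Qed.

Lemma continuous_measurable_row (f : E -> R) :
  continuous f -> measurable_fun setT f.
Proof.
move=> /continuousP cf; apply: (measurability _ (RGenOpens.measurableE R)).
move=> _ [_ [a [b ->] <-]]; rewrite setTI; apply: open_measurable_row.
exact/cf/interval_open.
Qed.

Lemma continuous_coord i : continuous (fun x : E => x ord0 i).
Proof. by move=> x; apply: coord_continuous. Qed.
End row_topology.

Section row_volume.
Context {R : realType}.
Local Notation lam := (@lebesgue_measure R).

Definition box n (a b : 'rV[R]_n) : set 'rV[R]_n :=
  [set x | forall i, a ord0 i <= x ord0 i < b ord0 i].

Lemma box_cyl n (a b : 'rV[R]_n) :
  box a b = [set x : 'rV[R]_n | forall i, `[a ord0 i, b ord0 i[%classic (x ord0 i)].
Proof. by apply/seteqP; split=> x h i; move: (h i); rewrite /= in_itv. Qed.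

Lemma measurable_box n (a b : 'rV[R]_n) : measurable (box a b).
Proof.
rewrite box_cyl; apply: (@measurable_cyl R n (fun i => `[a ord0 i, b ord0 i[%classic)) => i; exact: measurable_itv.
Qed.

Lemma lebesgue_cbox n (a b : 'I_n -> R) : (forall i, a i <= b i) ->
  lebesgue_row n [set x : 'rV[R]_n | forall i, a i <= x ord0 i <= b i] =
  (\prod_(i < n) (b i - a i))%:E.
Proof.
move=> ab.
have -> : [set x : 'rV[R]_n | forall i, a i <= x ord0 i <= b i] =
   [set x : 'rV[R]_n | forall i, `[a i, b i]%classic (x ord0 i)].
  by apply/seteqP; split=> x h i; move: (h i); rewrite /= in_itv.
rewrite (@lebesgue_row_cyl R n (fun i => `[a i, b i]%classic)); last by move=> i; exact: measurable_itv.
elim/big_ind2 : _ => // [x y z t -> ->//|i _].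
rewrite lebesgue_measure_itv /= lte_fin; case: ltP => // h.
by have -> : a i = b i; [apply/eqP; rewrite eq_le h ab|rewrite subrr].
Qed.

Lemma lebesgue_box n (a b : 'rV[R]_n) : (forall i, a ord0 i <= b ord0 i) ->
  lebesgue_row n (box a b) = (\prod_(i < n) (b ord0 i - a ord0 i))%:E.
Proof.
move=> ab.
rewrite box_cyl (@lebesgue_row_cyl R n (fun i => `[a ord0 i, b ord0 i[%classic)); last by move=> i; exact: measurable_itv.
elim/big_ind2 : _ => // [x y z t -> ->//|i _].
rewrite lebesgue_measure_itv /= lte_fin; case: ltP => // h.
have -> : a ord0 i = b ord0 i; [by apply/eqP; rewrite eq_le h ab|by rewrite subrr].
Qed.

Lemma lebesgue_ball n (a : 'rV[R]_n) (r : R) : 0 <= r ->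
  lebesgue_row n [set x | `|x - a| <= r] = ((2 * r) ^+ n)%:E.
Proof.
move=> r0.
have -> : [set x : 'rV[R]_n | `|x - a| <= r] = [set x : 'rV[R]_n | forall i,
   (a ord0 i - r) <= x ord0 i <= (a ord0 i + r)].
  apply/seteqP; split=> x /=; first by move=> /(row_norm_le _ r0) h i;
    move: (h i); rewrite !mxE ler_distl.
  by move=> h; apply/row_norm_le => // i; rewrite !mxE ler_distl.
rewrite lebesgue_cbox => [|i]; last by lra.
congr (_%:E); rewrite (eq_bigr (fun=> 2 * r)); last by move=> i _; ring.
by rewrite prodr_const card_ord.
Qed.

Lemma measurable_cball n (a : 'rV[R]_n) (r : R) : measurable [set x | `|x - a| <= r].
Proof.
apply: closed_measurable_row.
apply: (@preimage_closed _ _ (fun x : 'rV[R]_n => `|x - a|) [set t | t <= r]); last exact: closed_le.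
move=> x _; apply: (@cvg_norm _ _ _ (nbhs x) _ (fun y : 'rV[R]_n => y - a)).
by apply: cvgB; [exact: cvg_id|exact: cvg_cst].
Qed.

Lemma hyperplane_null n (i : 'I_n) (t : R) :
  lebesgue_row n [set x : 'rV[R]_n | x ord0 i = t] = 0%E.
Proof.
have -> : [set x : 'rV[R]_n | x ord0 i = t] =
   [set x : 'rV[R]_n | forall l, (if l == i then [set t] else setT) (x ord0 l)].
  apply/seteqP; split=> x /= h => [l|]; last by move: (h i); rewrite eqxx.
  by case: eqP => // ->.
rewrite (@lebesgue_row_cyl R n (fun l => if l == i then [set t] else setT)) => [|l]; last by case: ifP.
by rewrite (bigD1 i)//= eqxx lebesgue_measure_set1 mul0e.
Qed.

Lemma measurable_hyperplane n (i : 'I_n) (t : R) :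
  measurable [set x : 'rV[R]_n | x ord0 i = t].
Proof.
apply: closed_measurable_row.
by apply: (@preimage_closed _ _ (fun x : 'rV[R]_n => x ord0 i) [set t]); [move=> x _; exact: continuous_coord|exact: closed_eq].
Qed.
End row_volume.

(** * Complex numbers and integrals of complex functions *)
Local Open Scope complex_scope.

Section complex_numbers.
Context {R : realType}.
Implicit Types (z w : R[i]) (t : R).
Local Notation normc := (@Normc.normc R).
Local Notation Re := (@complex.Re R).
Local Notation Im := (@complex.Im R).

Lemma MVT_le (f df : R -> R) (C : R) :
  (forall x : R, is_derive x (1 : R) f (df x)) -> (forall x, `|df x| <= C) ->
  forall s t, `|f s - f t| <= C * `|s - t|.
Proof.
move=> dfE dfC s t; wlog st : s t / s < t.
  move=> h; have [/h//|/h|->] := ltgtP s t; first by rewrite distrC [X in _ * X]distrC.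
  by rewrite !subrr normr0 mulr0.
have cf : continuous f.
  by move=> x; apply/differentiable_continuous/derivable1_diffP; apply: ex_derive.
have [c _ h] := @MVT R f df s t st (fun x _ => dfE x) (continuous_subspaceT cf).
by rewrite distrC h normrM [`|s - t|]distrC ler_wpM2r.
Qed.

Definition cis t : R[i] := cos t +i* sin t.

Lemma cnormE z : normc z = Num.sqrt (Re z ^+ 2 + Im z ^+ 2).
Proof. by case: z. Qed.

Lemma cnorm_ge0 z : 0 <= normc z.
Proof. by rewrite cnormE sqrtr_ge0. Qed.

Lemma sqr_normcE z : normc z ^+ 2 = Re z ^+ 2 + Im z ^+ 2.
Proof. by rewrite cnormE sqr_sqrtr// addr_ge0// sqr_ge0. Qed.

Lemma cReD z w : Re (z + w) = Re z + Re w. Proof. by case: z; case: w. Qed.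
Lemma cImD z w : Im (z + w) = Im z + Im w. Proof. by case: z; case: w. Qed.
Lemma cReN z : Re (- z) = - Re z. Proof. by case: z. Qed.
Lemma cImN z : Im (- z) = - Im z. Proof. by case: z. Qed.
Lemma cReB z w : Re (z - w) = Re z - Re w. Proof. by rewrite cReD cReN. Qed.
Lemma cImB z w : Im (z - w) = Im z - Im w. Proof. by rewrite cImD cImN. Qed.
Lemma cReM z w : Re (z * w) = Re z * Re w - Im z * Im w.
Proof. by case: z; case: w. Qed.
Lemma cImM z w : Im (z * w) = Re z * Im w + Im z * Re w.
Proof. by case: z; case: w. Qed.

Lemma complexP z w : Re z = Re w -> Im z = Im w -> z = w.
Proof. by case: z => a b; case: w => c e /= -> ->. Qed.

Lemma Re_le_normc z : `|Re z| <= normc z.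
Proof. by rewrite cnormE -sqrtr_sqr ler_wsqrtr// lerDl sqr_ge0. Qed.

Lemma Im_le_normc z : `|Im z| <= normc z.
Proof. by rewrite cnormE -sqrtr_sqr ler_wsqrtr// lerDr sqr_ge0. Qed.

Lemma normc_le_ReIm z : normc z <= `|Re z| + `|Im z|.
Proof.
rewrite -(@ler_pXn2r _ 2)// ?nnegrE ?cnorm_ge0 ?addr_ge0//.
rewrite sqr_normcE sqrrD !real_normK ?num_real// lerD2r lerDl.
by rewrite mulrn_wge0// mulr_ge0.
Qed.

Lemma cnormD z w : normc (z + w) <= normc z + normc w.
Proof. exact: le_normcD. Qed.

Lemma cnormN z : normc (- z) = normc z.
Proof. exact: complex.normcN. Qed.

Lemma cnormB z w : normc (z - w) <= normc z + normc w.
Proof. by rewrite -[normc w]cnormN cnormD. Qed.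

Lemma cnorm_distC z w : normc (z - w) = normc (w - z).
Proof. by rewrite -cnormN opprB. Qed.

Lemma cnorm_real (x : R) : normc (x%:C) = `|x|.
Proof. by rewrite cnormE /= expr0n addr0 sqrtr_sqr. Qed.

Lemma cnorm_sum (I : Type) (r : seq I) (P : pred I) (F : I -> R[i]) :
  normc (\sum_(i <- r | P i) F i) <= \sum_(i <- r | P i) normc (F i).
Proof.
elim/big_ind2 : _ => [|x1 x2 y1 y2 h1 h2|//].
  by rewrite Normc.normc0.
by apply: le_trans (cnormD _ _) _; rewrite lerD.
Qed.

Lemma cnorm_eq0 z : (normc z == 0) = (z == 0).
Proof. by apply/eqP/eqP => [/Normc.eq0_normc//|->]; rewrite Normc.normc0. Qed.

Lemma normc_cis t : normc (cis t) = 1.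
Proof. by rewrite cnormE /= cos2Dsin2 sqrtr1. Qed.

Lemma cisD s t : cis (s + t) = cis s * cis t.
Proof. by rewrite /cis cosD sinD; apply: complexP; rewrite ?cReM ?cImM /=; ring. Qed.

Lemma cis0 : cis 0 = 1.
Proof. by rewrite /cis cos0 sin0. Qed.

Lemma cisN t : cis t * cis (- t) = 1.
Proof. by rewrite -cisD subrr cis0. Qed.

(** Waves are Lipschitz with a constant proportional to the frequency; the
    factor [2] comes from treating sine and cosine separately. *)
Lemma normc_cisB s t : normc (cis s - cis t) <= 2 * `|s - t|.
Proof.
apply: le_trans (normc_le_ReIm _) _; rewrite /cis /= mulrDl mul1r lerD//.
  rewrite -[leRHS]mul1r; apply: (MVT_le (df := fun x => - sin x)) => x; rewrite ?normrN.
  by rewrite ler_norml sin_le1 sin_geN1.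
rewrite -[leRHS]mul1r; apply: (MVT_le (df := @cos R)) => x.
by rewrite ler_norml cos_le1 cos_geN1.
Qed.
End complex_numbers.

Section complex_integral.
Context {R : realType} {n : nat}.
Local Notation normc := (@Normc.normc R).
Local Notation Re := (@complex.Re R).
Local Notation Im := (@complex.Im R).
Local Notation E := 'rV[R]_n.
Local Notation mu := (@lebesgue_row R n).
Implicit Types (f g : E -> R[i]).

Definition ccontinuous f :=
  continuous (fun x => Re (f x)) /\ continuous (fun x => Im (f x)).

Definition cintegrable f :=
  cmeasurable f /\ (\int[mu]_x (normc (f x))%:E < +oo)%E.

Lemma ccontinuous_measurable f : ccontinuous f -> cmeasurable f.
Proof. by move=> [h1 h2]; split; exact: continuous_measurable_row. Qed.

Lemma cmeasurableD f g : cmeasurable f -> cmeasurable g ->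
  cmeasurable (fun x => f x + g x).
Proof.
move=> [f1 f2] [g1 g2]; split.
  rewrite (_ : (fun _ => _) = (fun x => Re (f x) + Re (g x))); last by apply/funext => x; rewrite cReD.
  exact: measurable_funD.
rewrite (_ : (fun _ => _) = (fun x => Im (f x) + Im (g x))); last by apply/funext => x; rewrite cImD.
exact: measurable_funD.
Qed.

Lemma cmeasurableM f g : cmeasurable f -> cmeasurable g ->
  cmeasurable (fun x => f x * g x).
Proof.
move=> [f1 f2] [g1 g2]; split.
  rewrite (_ : (fun _ => _) = (fun x => Re (f x) * Re (g x) - Im (f x) * Im (g x))); last by apply/funext => x; rewrite cReM.
  by apply: measurable_funB; exact: measurable_funM.
rewrite (_ : (fun _ => _) = (fun x => Re (f x) * Im (g x) + Im (f x) * Re (g x))); last by apply/funext => x; rewrite cImM.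
by apply: measurable_funD; exact: measurable_funM.
Qed.

Lemma cmeasurable_cst (c : R[i]) : cmeasurable (fun _ : E => c).
Proof. by split; exact: measurable_cst. Qed.

Lemma cmeasurable_indic (D : set E) : measurable D -> cmeasurable (fun x => \1_D x : R[i]).
Proof.
move=> mD; split.
  rewrite (_ : (fun _ => _) = \1_D); first exact: measurable_indic.
  by apply/funext => x; rewrite !indicE; case: (_ \in _).
rewrite (_ : (fun _ => _) = cst 0); first exact: measurable_cst.
by apply/funext => x; rewrite !indicE; case: (_ \in _).
Qed.

Lemma cmeasurable_normc f : cmeasurable f -> measurable_fun setT (fun x => normc (f x)).
Proof.
move=> [f1 f2].
rewrite (_ : (fun _ => _) = Num.sqrt \o (fun x => Re (f x) ^+ 2 + Im (f x) ^+ 2)); last first.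
  by apply/funext => x; rewrite cnormE.
apply: measurableT_comp; first exact: continuous_measurable_fun (@sqrt_continuous R).
by apply: measurable_funD; exact: measurable_funX.
Qed.

Lemma cmeasurable_affine f (a : E) (r : R) : cmeasurable f ->
  cmeasurable (fun x => f (a + r *: x)).
Proof.
by move=> [f1 f2]; split; [apply: (measurableT_comp f1)|apply: (measurableT_comp f2)];
  exact: measurable_affine.
Qed.

Lemma cintegrable_dom f (h : E -> \bar R) : cmeasurable f -> measurable_fun setT h ->
  (forall x, (normc (f x))%:E <= h x)%E -> (\int[mu]_x h x < +oo)%E -> cintegrable f.
Proof.
move=> mf mh fh hoo; split=> //; apply: le_lt_trans hoo.
apply: ge0_le_integral => //=.
- by move=> x _; rewrite lee_fin cnorm_ge0.
- by apply/measurable_EFinP; exact: cmeasurable_normc.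
Qed.

Lemma cintegrable_Re f : cintegrable f -> mu.-integrable setT (EFin \o (fun x => Re (f x))).
Proof.
move=> [mf foo]; apply/integrableP; split; first by apply/measurable_EFinP; case: mf.
apply: le_lt_trans foo; apply: ge0_le_integral => //=.
- by do 2 apply: measurableT_comp => //; case: mf.
- by apply/measurable_EFinP; exact: cmeasurable_normc.
- by move=> x _; rewrite lee_fin Re_le_normc.
Qed.

Lemma cintegrable_Im f : cintegrable f -> mu.-integrable setT (EFin \o (fun x => Im (f x))).
Proof.
move=> [mf foo]; apply/integrableP; split; first by apply/measurable_EFinP; case: mf.
apply: le_lt_trans foo; apply: ge0_le_integral => //=.
- by do 2 apply: measurableT_comp => //; case: mf.
- by apply/measurable_EFinP; exact: cmeasurable_normc.
- by move=> x _; rewrite lee_fin Im_le_normc.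
Qed.

Lemma cintegrableD f g : cintegrable f -> cintegrable g -> cintegrable (fun x => f x + g x).
Proof.
move=> [mf fo] [mg go].
apply: (@cintegrable_dom _ (fun x => (normc (f x))%:E + (normc (g x))%:E)%E).
- exact: cmeasurableD.
- by apply: emeasurable_funD; apply/measurable_EFinP; exact: cmeasurable_normc.
- by move=> x; rewrite -EFinD lee_fin cnormD.
- rewrite ge0_integralD//; first by rewrite lte_add_pinfty.
  + by move=> x _; rewrite lee_fin cnorm_ge0.
  + by apply/measurable_EFinP; exact: cmeasurable_normc.
  + by move=> x _; rewrite lee_fin cnorm_ge0.
  + by apply/measurable_EFinP; exact: cmeasurable_normc.
Qed.

Lemma cintegrableM f g (B : R) : cintegrable f -> cmeasurable g ->
  (forall x, normc (g x) <= B) -> cintegrable (fun x => f x * g x).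
Proof.
move=> [mf fo] mg gB.
have B0 : 0 <= B by apply: le_trans (gB 0); exact: cnorm_ge0.
apply: (@cintegrable_dom _ (fun x => B%:E * (normc (f x))%:E)%E).
- exact: cmeasurableM.
- by apply: measurable_funeM; apply/measurable_EFinP; exact: cmeasurable_normc.
- by move=> x; rewrite -EFinM lee_fin Normc.normcM mulrC ler_wpM2r ?cnorm_ge0.
- rewrite ge0_integralZl_EFin//.
  + by rewrite lte_mul_pinfty ?lee_fin.
  + by move=> x _; rewrite lee_fin cnorm_ge0.
  + by apply/measurable_EFinP; exact: cmeasurable_normc.
Qed.

Lemma cintegrableZ (c : R[i]) f : cintegrable f -> cintegrable (fun x => c * f x).
Proof.
move=> fi; rewrite (_ : (fun _ => _) = fun x => f x * c); last by apply/funext => x; rewrite mulrC.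
by apply: (cintegrableM (B := normc c)) => //; exact: cmeasurable_cst.
Qed.

Lemma cintegrable0 : cintegrable (fun=> 0).
Proof.
split; first exact: cmeasurable_cst.
by under eq_integral do rewrite Normc.normc0; rewrite integral0.
Qed.

Lemma cintegrableN f : cintegrable f -> cintegrable (fun x => - f x).
Proof.
move=> /(cintegrableZ (-1)); congr cintegrable.
by apply/funext => x; rewrite mulN1r.
Qed.

Lemma cintegrableB f g : cintegrable f -> cintegrable g -> cintegrable (fun x => f x - g x).
Proof. by move=> fi gi; apply: cintegrableD => //; exact: cintegrableN. Qed.

Lemma cintegrable_sum (I : Type) (r : seq I) (F : I -> E -> R[i]) :
  (forall i, cintegrable (F i)) -> cintegrable (fun x => \sum_(i <- r) F i x).
Proof.
move=> mF; elim: r => [|i r IH].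
  rewrite (_ : (fun _ => _) = fun _ => 0); last by apply/funext => x; rewrite big_nil.
  exact: cintegrable0.
rewrite (_ : (fun _ => _) = fun x => F i x + \sum_(i <- r) F i x).
  exact: cintegrableD.
by apply/funext => x; rewrite big_cons.
Qed.

Lemma cintegralD f g : cintegrable f -> cintegrable g ->
  cintegral setT (fun x => f x + g x) = cintegral setT f + cintegral setT g.
Proof.
move=> fi gi; apply: complexP; rewrite ?cReD ?cImD /cintegral /=.
  under eq_Rintegral do rewrite cReD.
  by apply: RintegralD => //; exact: cintegrable_Re.
under eq_Rintegral do rewrite cImD.
by apply: RintegralD => //; exact: cintegrable_Im.
Qed.

Lemma cintegralZ (c : R[i]) f : cintegrable f ->
  cintegral setT (fun x => c * f x) = c * cintegral setT f.
Proof.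
move=> fi; have h1 := cintegrable_Re fi; have h2 := cintegrable_Im fi.
have k1 r : mu.-integrable setT (EFin \o (fun x => r * Re (f x))).
  by apply: eq_integrable (integrableZl measurableT r h1) => // x _ /=; rewrite EFinM.
have k2 r : mu.-integrable setT (EFin \o (fun x => r * Im (f x))).
  by apply: eq_integrable (integrableZl measurableT r h2) => // x _ /=; rewrite EFinM.
apply: complexP; rewrite ?cReM ?cImM /cintegral /=.
  under eq_Rintegral do rewrite cReM.
  by rewrite RintegralB// !RintegralZl.
under eq_Rintegral do rewrite cImM.
by rewrite RintegralD// !RintegralZl.
Qed.

Lemma cintegralN f : cintegrable f ->
  cintegral setT (fun x => - f x) = - cintegral setT f.
Proof.
move=> fi; rewrite -mulN1r -cintegralZ//; congr cintegral.
by apply/funext => x; rewrite mulN1r.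
Qed.

Lemma cintegralB f g : cintegrable f -> cintegrable g ->
  cintegral setT (fun x => f x - g x) = cintegral setT f - cintegral setT g.
Proof. by move=> fi gi; rewrite cintegralD ?cintegralN//; exact: cintegrableN. Qed.

Lemma cintegral0 D : cintegral D (fun _ : E => 0 : R[i]) = 0.
Proof.
by rewrite /cintegral /Rintegral integral0 /=.
Qed.

Lemma cintegral_sum (I : Type) (r : seq I) (F : I -> E -> R[i]) :
  (forall i, cintegrable (F i)) ->
  cintegral setT (fun x => \sum_(i <- r) F i x) = \sum_(i <- r) cintegral setT (F i).
Proof.
move=> mF; elim: r => [|i r IH].
  rewrite big_nil -[RHS](cintegral0 setT); congr cintegral.
  by apply/funext => x; rewrite big_nil.
rewrite big_cons -IH -cintegralD//; last exact: cintegrable_sum.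
by congr cintegral; apply/funext => x; rewrite big_cons.
Qed.

(** A rotation by the phase of the integral makes it real, and then only the
    real part of the rotated integrand counts. *)
Lemma normc_cintegral f : cintegrable f ->
  ((normc (cintegral setT f))%:E <= \int[mu]_x (normc (f x))%:E)%E.
Proof.
move=> fi; set z := cintegral setT f.
have [/eqP ->|z0] := boolP (normc z == 0).
  by apply: integral_ge0 => x _; rewrite lee_fin cnorm_ge0.
have zp : 0 < normc z by rewrite lt_neqAle eq_sym z0 cnorm_ge0.
have zi := cintegrableZ (conjc z) fi.
have hz : normc z ^+ 2 = \int[mu]_x Re (conjc z * f x).
  have -> : \int[mu]_x Re (conjc z * f x) = Re (cintegral setT (fun x => conjc z * f x)) by [].
  by rewrite cintegralZ// -/z sqr_normcE; case: (z) => a b /=; ring.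
rewrite -(@lee_pmul2l _ (normc z)%:E) ?lte_fin//.
rewrite -EFinM -expr2 hz -ge0_integralZl_EFin//; last 3 first.
- by move=> x _; rewrite lee_fin cnorm_ge0.
- by apply/measurable_EFinP; apply: cmeasurable_normc; case: fi.
- exact: ltW.
have hR := cintegrable_Re zi.
rewrite /Rintegral fineK; last exact: (integrable_fin_num _ hR).
apply: le_trans (lee_abs (\int[mu]_x (Re (conjc z * f x))%:E)) _.
apply: le_trans (le_abse_integral mu measurableT _) _.
  by case/integrableP : hR.
apply: ge0_le_integral => //=.
- by do 2 apply: measurableT_comp => //; case: (zi) => -[].
- by apply: measurable_funeM; apply/measurable_EFinP; apply: cmeasurable_normc; case: fi.
- move=> x _; rewrite -EFinM lee_fin; apply: le_trans (Re_le_normc _) _.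
  by rewrite Normc.normcM; case: (z) => a b /=; rewrite sqrrN.
Qed.

Lemma cintegral_mkcond D f : cintegral D f = cintegral setT (fun x => \1_D x * f x).
Proof.
apply: complexP; rewrite /cintegral /= Rintegral_mkcond; apply: eq_Rintegral => x _;
  rewrite /patch indicE; case: (_ \in _); rewrite ?mul1r ?mul0r//.
Qed.

Lemma cintegrable_indic D f : measurable D -> cintegrable f ->
  cintegrable (fun x => \1_D x * f x).
Proof.
move=> mD fi; rewrite (_ : (fun _ => _) = fun x => f x * \1_D x); last by apply/funext => x; rewrite mulrC.
apply: (cintegrableM (B := 1)) => //; first exact: cmeasurable_indic.
move=> x; rewrite indicE; case: (_ \in _) => /=; rewrite expr0n /= ?expr1n ?expr0n /= addr0 ?sqrtr1 ?sqrtr0//.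
Qed.
End complex_integral.

(** * Fubini, dominated convergence and approximate identities for complex functions *)
Section complex_fubini.
Context {R : realType} {n : nat}.
Local Notation normc := (@Normc.normc R).
Local Notation Re := (@complex.Re R).
Local Notation Im := (@complex.Im R).
Local Notation E := 'rV[R]_n.
Local Notation mu := (@lebesgue_row R n).
Implicit Types (f g : E -> R[i]).

Lemma eq_cintegral D f g : (forall x, f x = g x) -> cintegral D f = cintegral D g.
Proof. by move=> fg; congr cintegral; apply/funext. Qed.

Lemma eq_cintegrable f g : (forall x, f x = g x) -> cintegrable f -> cintegrable g.
Proof. by move=> fg; have -> : f = g by apply/funext. Qed.

Lemma eq_cmeasurable f g : (forall x, f x = g x) -> cmeasurable f -> cmeasurable g.
Proof. by move=> fg; have -> : f = g by apply/funext. Qed.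

Lemma cmeasurable_conj f : cmeasurable f -> cmeasurable (fun x => conjc (f x)).
Proof.
move=> [m1 m2]; split.
  by move: m1; congr measurable_fun; apply/funext => x; case: (f x).
have := measurable_funN m2.
by congr measurable_fun; apply/funext => x /=; case: (f x).
Qed.

Lemma cintegral_conj f : cintegrable f ->
  conjc (cintegral setT f) = cintegral setT (fun x => conjc (f x)).
Proof.
move=> fi; apply: complexP; rewrite /cintegral /=.
  by apply: eq_Rintegral => x _; case: (f x).
rewrite -[LHS]mulN1r -RintegralZl//; last exact: cintegrable_Im.
by apply: eq_Rintegral => x _; case: (f x) => u v /=; rewrite mulN1r.
Qed.

Lemma cintegral_real (h : E -> R) : cintegral setT (fun x => (h x)%:C) = (fine (\int[mu]_x (h x)%:E)%E)%:C.
Proof.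
by apply: complexP; rewrite /cintegral //= /Rintegral integral0.
Qed.

Lemma integral_row_affine (a : E) (r : R) (g : E -> \bar R) : r != 0 ->
  mu.-integrable setT g ->
  (\int[mu]_x g x = (`|r| ^+ n)%:E * \int[mu]_x g (a + r *: x)%R)%E.
Proof.
move=> r0 gi; have mg : measurable_fun setT g by case/integrableP : gi.
have rn0 : (`|r| ^+ n)%:E != 0%E by rewrite eqe expf_neq0// normr_eq0.
have fin (h : E -> \bar R) : measurable_fun setT h -> (forall x, 0 <= h x)%E ->
    (\int[mu]_x h x < +oo)%E -> (\int[mu]_x h (a + r *: x)%R \is a fin_num)%E.
  move=> mh h0 hoo; rewrite ge0_fin_numE; last by apply: integral_ge0 => x _.
  move: hoo; rewrite (ge0_integral_row_affine a r0 mh h0).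
  have := leey (\int[mu]_x h (a + r *: x)%R); rewrite le_eqVlt => /predU1P[->|//].
  by rewrite gt0_muley// lte_fin exprn_gt0// normr_gt0.
have mp := measurable_funepos mg; have mn := measurable_funeneg mg.
rewrite integralE [in RHS]integralE.
rewrite (ge0_integral_row_affine a r0 mp)// (ge0_integral_row_affine a r0 mn)//.
have fn := fin _ mn (fun x => funeneg_ge0 g x) (integral_funeneg_lt_pinfty measurableT gi).
have -> : (\int[mu]_x (fun x => g (a + r *: x)%R)^\+ x = \int[mu]_x g^\+ (a + r *: x)%R)%E.
  by apply: eq_integral => x _; rewrite funepos_comp.
have -> : (\int[mu]_x (fun x => g (a + r *: x)%R)^\- x = \int[mu]_x g^\- (a + r *: x)%R)%E.
  by apply: eq_integral => x _; rewrite funeneg_comp.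
move: fn; move: (\int[mu]_x g^\+ (a + r *: x)%R)%E (\int[mu]_x g^\- (a + r *: x)%R)%E => A B fB.
by rewrite muleBr// fin_num_adde_defl ?fin_numN.
Qed.

Lemma cintegrable_affine (a : E) (r : R) f : r != 0 -> cintegrable f ->
  cintegrable (fun x => f (a + r *: x)).
Proof.
move=> r0 [mf foo]; split; first exact: cmeasurable_affine.
move: foo; rewrite (ge0_integral_row_affine a r0)//; last 2 first.
- by apply/measurable_EFinP; exact: cmeasurable_normc.
- by move=> x; rewrite lee_fin cnorm_ge0.
set I := (\int[mu]_x _)%E; have := leey I; rewrite le_eqVlt => /predU1P[->|//].
by rewrite gt0_muley// lte_fin exprn_gt0// normr_gt0.
Qed.

Lemma cintegral_affine (a : E) (r : R) f : r != 0 -> cintegrable f ->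
  cintegral setT f = (`|r| ^+ n)%:C * cintegral setT (fun x => f (a + r *: x)).
Proof.
move=> r0 fi; have fa := cintegrable_affine a r0 fi.
have h (g : E -> R) : mu.-integrable setT (EFin \o g) ->
    mu.-integrable setT (EFin \o (fun x => g (a + r *: x))) ->
    (\int[mu]_x g x = `|r| ^+ n * \int[mu]_x g (a + r *: x))%R.
  move=> gi ga; rewrite /Rintegral (integral_row_affine a r0 gi) fineM//.
  exact: (integrable_fin_num measurableT ga).
apply: complexP; rewrite ?cReM ?cImM /cintegral /=.
  rewrite (h _ (cintegrable_Re fi) (cintegrable_Re fa)); ring.
rewrite (h _ (cintegrable_Im fi) (cintegrable_Im fa)); ring.
Qed.

Definition cmeasurable2 (F : E -> E -> R[i]) :=
  measurable_fun setT (fun p : E * E => Re (F p.1 p.2)) /\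
  measurable_fun setT (fun p : E * E => Im (F p.1 p.2)).

Lemma cmeasurable2_comp f (phi : E * E -> E) : cmeasurable f ->
  measurable_fun setT phi -> cmeasurable2 (fun x y => f (phi (x, y))).
Proof.
move=> [f1 f2] mphi; split.
  rewrite (_ : (fun _ => _) = (fun x => Re (f x)) \o phi); first exact: measurableT_comp.
  by apply/funext => -[].
rewrite (_ : (fun _ => _) = (fun x => Im (f x)) \o phi); first exact: measurableT_comp.
by apply/funext => -[].
Qed.

Lemma measurable_lin2 (a : E) (r s : R) :
  measurable_fun setT (fun p : E * E => a + r *: p.1 + s *: p.2).
Proof.
apply: measurable_fun_row => i.
rewrite (_ : (fun _ => _) = (fun p : E * E => (a ord0 i + r * p.1 ord0 i) + s * p.2 ord0 i)).
  apply: measurable_funD; first apply: measurable_funD => //.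
    apply: measurable_funM => //; apply: (measurableT_comp (measurable_coord i)) => //.
  apply: measurable_funM => //; exact: (measurableT_comp (measurable_coord i)).
by apply/funext => p; rewrite !mxE.
Qed.

Lemma cmeasurable2_lin f (a : E) (r s : R) : cmeasurable f ->
  cmeasurable2 (fun x y => f (a + r *: x + s *: y)).
Proof. by move=> mf; exact: (cmeasurable2_comp mf (measurable_lin2 a r s)). Qed.

Lemma cmeasurable2_fst f : cmeasurable f -> cmeasurable2 (fun x y => f x).
Proof. by move=> mf; exact: (@cmeasurable2_comp f fst). Qed.

Lemma cmeasurable2_snd f : cmeasurable f -> cmeasurable2 (fun x y => f y).
Proof. by move=> mf; exact: (@cmeasurable2_comp f snd). Qed.

Lemma cmeasurable2M (F G : E -> E -> R[i]) : cmeasurable2 F -> cmeasurable2 G ->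
  cmeasurable2 (fun x y => F x y * G x y).
Proof.
move=> [f1 f2] [g1 g2]; split.
  rewrite (_ : (fun _ => _) = (fun p : E * E => Re (F p.1 p.2) * Re (G p.1 p.2) - Im (F p.1 p.2) * Im (G p.1 p.2))); last by apply/funext => x; rewrite cReM.
  by apply: measurable_funB; exact: measurable_funM.
rewrite (_ : (fun _ => _) = (fun p : E * E => Re (F p.1 p.2) * Im (G p.1 p.2) + Im (F p.1 p.2) * Re (G p.1 p.2))); last by apply/funext => x; rewrite cImM.
by apply: measurable_funD; exact: measurable_funM.
Qed.

Lemma cmeasurable2_normc F : cmeasurable2 F ->
  measurable_fun setT (fun p : E * E => (normc (F p.1 p.2))%:E).
Proof.
move=> [f1 f2]; apply/measurable_EFinP.
rewrite (_ : (fun _ => _) = Num.sqrt \o (fun p : E * E => Re (F p.1 p.2) ^+ 2 + Im (F p.1 p.2) ^+ 2)); last first.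
  by apply/funext => x /=; rewrite cnormE.
apply: measurableT_comp; first exact: continuous_measurable_fun (@sqrt_continuous R).
by apply: measurable_funD; exact: measurable_funX.
Qed.

(** Real and imaginary parts are both dominated by the norm, and the
    real-valued theorem applies to each. *)
Lemma cfubini (F : E -> E -> R[i]) : cmeasurable2 F ->
  (\int[mu]_x \int[mu]_y (normc (F x y))%:E < +oo)%E ->
  (forall x, cintegrable (F x)) -> (forall y, cintegrable (F ^~ y)) ->
  [/\ cintegrable (fun x => cintegral setT (F x)),
      cintegrable (fun y => cintegral setT (F ^~ y)) &
  cintegral setT (fun x => cintegral setT (F x)) =
  cintegral setT (fun y => cintegral setT (F ^~ y))].
Proof.
move=> mF Foo F1 F2; have mN := cmeasurable2_normc mF.
have main (pr : R[i] -> R) :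
    measurable_fun setT (fun p : E * E => pr (F p.1 p.2)) ->
    (forall z, `|pr z| <= normc z) ->
    (forall f, cintegrable f -> mu.-integrable setT (EFin \o (fun x => pr (f x)))) ->
  [/\ measurable_fun setT (fun x => \int[mu]_y pr (F x y)),
      measurable_fun setT (fun y => \int[mu]_x pr (F x y)) &
   \int[mu]_x \int[mu]_y pr (F x y) = \int[mu]_y \int[mu]_x pr (F x y)].
  move=> mpr prle pri.
  have Gi : ((mu \x mu)%E : {measure set (E * E) -> \bar R}).-integrable setT
      (fun p : E * E => (pr (F p.1 p.2))%:E).
    apply/integrable12ltyP; first exact/measurable_EFinP.
    apply: le_lt_trans Foo; apply: ge0_le_integral => //=.
    - by move=> x _; apply: integral_ge0.
    - apply: (@measurable_fun_fubini_tonelli_F _ _ _ _ _ mu (fun p : E * E => (`|pr (F p.1 p.2)|)%:E)%E) => //.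
      apply/measurable_EFinP; exact: measurableT_comp.
    - apply: (@measurable_fun_fubini_tonelli_F _ _ _ _ _ mu (fun p : E * E => (normc (F p.1 p.2))%:E)%E) => //.
      by move=> x; rewrite lee_fin cnorm_ge0.
    - move=> x _; apply: ge0_le_integral => //=.
      + do 2 apply: measurableT_comp => //.
        by case/integrableP : (pri _ (F1 x)) => /measurable_EFinP.
      + by apply/measurable_EFinP; apply: cmeasurable_normc; case: (F1 x).
      + by move=> y _; rewrite lee_fin.
  have e1 x : (\int[mu]_y (pr (F x y))%:E)%E = (\int[mu]_y pr (F x y))%:E.
    by rewrite fineK//; exact: (integrable_fin_num measurableT (pri _ (F1 x))).
  have e2 y : (\int[mu]_x (pr (F x y))%:E)%E = (\int[mu]_x pr (F x y))%:E.
    by rewrite fineK//; exact: (integrable_fin_num measurableT (pri _ (F2 y))).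
  split.
  - apply/measurable_EFinP; rewrite (_ : EFin \o _ = fubini_F mu (fun p : E * E => (pr (F p.1 p.2))%:E)).
      exact: (measurable_fubini_F Gi).
    by apply/funext => x; rewrite /= /fubini_F /= e1.
  - apply/measurable_EFinP; rewrite (_ : EFin \o _ = fubini_G mu (fun p : E * E => (pr (F p.1 p.2))%:E)).
      exact: (measurable_fubini_G Gi).
    by apply/funext => x; rewrite /= /fubini_G /= e2.
  - rewrite /Rintegral; congr fine.
    have := Fubini Gi => /=.
    by under eq_integral do rewrite e1; move=> ->; apply: eq_integral => y _; rewrite e2.
have [r1 r2 r3] := main Re mF.1 (@Re_le_normc R) (@cintegrable_Re R n).
have [i1 i2 i3] := main Im mF.2 (@Im_le_normc R) (@cintegrable_Im R n).
have mN' : measurable_fun setT (fun x => \int[mu]_y (normc (F x y))%:E)%E.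
  apply: (@measurable_fun_fubini_tonelli_F _ _ _ _ _ mu (fun p : E * E => (normc (F p.1 p.2))%:E)%E) => //.
  by move=> x; rewrite lee_fin cnorm_ge0.
have mN2 : measurable_fun setT (fun y => \int[mu]_x (normc (F x y))%:E)%E.
  apply: (@measurable_fun_fubini_tonelli_G _ _ _ _ _ mu (fun p : E * E => (normc (F p.1 p.2))%:E)%E) => //.
  by move=> x; rewrite lee_fin cnorm_ge0.
have m1 : cmeasurable (fun x => cintegral setT (F x)) by split.
have m2 : cmeasurable (fun y => cintegral setT (F ^~ y)) by split.
have Foo' : (\int[mu]_y \int[mu]_x (normc (F x y))%:E < +oo)%E.
  move: Foo; rewrite -(@fubini_tonelli _ _ _ _ _ mu mu (fun p : E * E => (normc (F p.1 p.2))%:E)%E)//=.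
  by move=> x; rewrite lee_fin cnorm_ge0.
split.
- exact: (cintegrable_dom m1 mN' (fun x => normc_cintegral (F1 x)) Foo).
- exact: (cintegrable_dom m2 mN2 (fun y => normc_cintegral (F2 y)) Foo').
- by apply: complexP; [exact: r3|exact: i3].
Qed.

Definition ccvg (u : nat -> R[i]) (l : R[i]) := forall e : R, 0 < e ->
  exists K : nat, forall k, (K <= k)%N -> normc (u k - l) < e.

Lemma eq_ccvg u v l : (forall k, u k = v k) -> ccvg u l -> ccvg v l.
Proof. by move=> uv; have -> : u = v by apply/funext. Qed.

Lemma ccvg_le u l (B : R) : ccvg u l -> (forall k, normc (u k) <= B) -> normc l <= B.
Proof.
move=> ul uB; apply/ler_addgt0Pr => e e0; have [K hK] := ul e e0.
have -> : l = u K - (u K - l) by ring.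
by apply: le_trans (cnormB _ _) _; rewrite lerD// ltW// hK.
Qed.

Lemma ccvg_unique u a b : ccvg u a -> ccvg u b -> a = b.
Proof.
move=> ua ub; apply/eqP; rewrite -subr_eq0 -cnorm_eq0; apply/eqP/le_anti.
rewrite cnorm_ge0 andbT; apply/ler_addgt0Pr => e e0; rewrite add0r.
have e2 : 0 < e / 2 by rewrite divr_gt0.
have [K hK] := ua _ e2; have [L hL] := ub _ e2.
have -> : a - b = (u (K + L)%N - b) - (u (K + L)%N - a) by ring.
apply: le_trans (cnormB _ _) _; rewrite [leRHS](splitr e) addrC.
by rewrite lerD// ltW// ?hK ?hL ?leq_addr ?leq_addl.
Qed.

Lemma ccvgZ u a c : ccvg u a -> ccvg (fun k => c * u k) (c * a).
Proof.
move=> ua e e0; have c1 : 0 < normc c + 1 by rewrite ltr_pwDr// cnorm_ge0.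
have [K hK] := ua (e / (normc c + 1)) (divr_gt0 e0 c1).
exists K => k /hK; rewrite -mulrBr Normc.normcM ltr_pdivlMr// => h.
apply: le_lt_trans h; rewrite mulrC ler_wpM2l ?cnorm_ge0//.
by rewrite lerDl.
Qed.

Lemma ccvg_cst c : ccvg (fun=> c) c.
Proof. by move=> e e0; exists 0%N => k _; rewrite subrr Normc.normc0. Qed.

Lemma cdominated (f_ : nat -> E -> R[i]) f (h : E -> R) :
  (forall k, cmeasurable (f_ k)) -> cintegrable f ->
  measurable_fun setT h -> (\int[mu]_x (h x)%:E < +oo)%E ->
  (forall k x, normc (f_ k x) <= h x) ->
  {ae mu, forall x, ccvg (f_ ^~ x) (f x)} ->
  ccvg (fun k => cintegral setT (f_ k)) (cintegral setT f).
Proof.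
move=> mf_ fi mh hoo fh fcv.
have h0 x : 0 <= h x by apply: le_trans (fh 0%N x); exact: cnorm_ge0.
have fki k : cintegrable (f_ k).
  apply: (@cintegrable_dom _ _ _ (fun x => (h x)%:E) (mf_ k) _ _ hoo).
    exact/measurable_EFinP.
  by move=> x; rewrite lee_fin.
have mN k : measurable_fun setT (fun x => (normc (f_ k x - f x))%:E).
  apply/measurable_EFinP; apply: cmeasurable_normc.
  by case: (cintegrableB (fki k) fi).
have gi : mu.-integrable setT (fun x => (h x + normc (f x))%:E).
  apply/integrableP; split.
    apply/measurable_EFinP; apply: measurable_funD => //.
    by apply: cmeasurable_normc; case: fi.
  rewrite (eq_integral (fun x => (h x)%:E + (normc (f x))%:E)%E); last first.
    by move=> x _; rewrite gee0_abs ?EFinD// lee_fin addr_ge0// cnorm_ge0.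
  rewrite ge0_integralD//.
  - by rewrite lte_add_pinfty//; case: fi.
  - by move=> x _; rewrite lee_fin.
  - exact/measurable_EFinP.
  - by move=> x _; rewrite lee_fin cnorm_ge0.
  - by apply/measurable_EFinP; apply: cmeasurable_normc; case: fi.
have c0 : {ae mu, forall x, setT x ->
    (fun k => (normc (f_ k x - f x))%:E) @ \oo --> 0%E}.
  apply: filterS fcv => x fx _; apply: cvg_EFin; first exact: nearW.
  apply/cvgrPdist_lt => e /fx[K hK]; exists K => // k /= Kk.
  by rewrite sub0r normrN ger0_norm ?cnorm_ge0// hK.
have dom : {ae mu, forall x k, setT x -> (`|(normc (f_ k x - f x))%:E| <= (h x + normc (f x))%:E)%E}.
  apply: aeW => x k _; rewrite gee0_abs ?lee_fin ?cnorm_ge0//.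
  by apply: le_trans (cnormB _ _) _; rewrite lerD2r.
have [_ _] := dominated_convergence measurableT mN (measurable_cst (0%E : \bar R)) c0 gi dom.
rewrite integral0 => cv e e0.
have /fine_cvgP[_ /cvgrPdist_lt/(_ _ e0)[K _ hK]] := cv.
exists K => k Kk; have {}hK : `|fine (\int[mu]_x (normc (f_ k x - f x))%:E)| < e.
  by have := hK k Kk; rewrite /= sub0r normrN.
rewrite -cintegralB//; have fk := cintegrableB (fki k) fi.
apply: le_lt_trans hK; rewrite -lee_fin; apply: le_trans (normc_cintegral fk) _.
case: fk => _ fk.
rewrite -[leLHS]fineK ?ge0_fin_numE ?lee_fin ?ler_norm//.
by apply: integral_ge0 => x _; rewrite lee_fin cnorm_ge0.
Qed.

Definition ccontinuous_at f (y : E) := forall e : R, 0 < e ->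
  exists2 dl : R, 0 < dl & forall z, `|z - y| < dl -> normc (f z - f y) < e.

Lemma ccontinuousP f : ccontinuous f <-> forall y, ccontinuous_at f y.
Proof.
split=> [[cR cI] y e e0|h].
  have e2 : 0 < e / 2 by rewrite divr_gt0.
  have /cvgrPdist_lt/(_ _ e2)/nbhs_ballP[d1 /= d10 h1] := cR y.
  have /cvgrPdist_lt/(_ _ e2)/nbhs_ballP[d2 /= d20 h2] := cI y.
  exists (Num.min d1 d2); first by rewrite lt_min d10.
  move=> z; rewrite lt_min => /andP[z1 z2].
  apply: le_lt_trans (normc_le_ReIm _) _; rewrite [ltRHS](splitr e) cReB cImB.
  rewrite ltrD// distrC.
    by apply: h1; rewrite -ball_normE /ball_ /= distrC.
  by apply: h2; rewrite -ball_normE /ball_ /= distrC.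
split=> y; apply/(@cvgrPdist_lt _ _ _ (nbhs y) (nbhs_filter y)) => e /(h y)[dl dl0 hd]; apply/nbhs_ballP; exists dl => //= z;
  rewrite -ball_normE /ball_ /= distrC => /hd; apply: le_lt_trans; rewrite distrC.
- by rewrite -cReB Re_le_normc.
- by rewrite -cImB Im_le_normc.
Qed.

Lemma ccontinuous_lip f (L : R) : (forall x y, normc (f x - f y) <= L * `|x - y|) ->
  ccontinuous f.
Proof.
move=> hL; apply/ccontinuousP => y e e0.
have L1 : 0 < `|L| + 1 by rewrite ltr_pwDr.
exists (e / (`|L| + 1)); first by rewrite divr_gt0.
move=> z; rewrite ltr_pdivlMr// => h; apply: le_lt_trans (hL _ _) _.
apply: le_lt_trans h; rewrite mulrC ler_wpM2l//.
by rewrite (le_trans (ler_norm _))// lerDl.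
Qed.

(** Dilating the argument of the bounded function instead of the kernel keeps
    the integrable [theta] as a dominating function. *)
Lemma approximate_identity (theta kap : E -> R[i]) (B : R) (y : E) (r_ : nat -> R) :
  cintegrable theta -> cmeasurable kap -> (forall x, normc (kap x) <= B) ->
  ccontinuous_at kap y -> r_ @ \oo --> (0 : R) ->
  ccvg (fun k => cintegral setT (fun z => theta z * kap (y + r_ k *: z)))
    (cintegral setT theta * kap y).
Proof.
move=> ti mk kB ck r0.
have B0 : 0 <= B by apply: le_trans (kB 0); exact: cnorm_ge0.
rewrite [X in ccvg _ X](_ : _ = cintegral setT (fun z => theta z * kap y)); last first.
  rewrite mulrC -cintegralZ//; congr cintegral; by apply/funext => z; rewrite mulrC.
apply: (@cdominated _ _ (fun z => normc (theta z) * B)).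
- by move=> k; apply: cmeasurableM; [case: ti|exact: cmeasurable_affine].
- by apply: (cintegrableM (B := B)) => //; exact: cmeasurable_cst.
- by apply: measurable_funM => //; apply: cmeasurable_normc; case: ti.
- under eq_integral do rewrite EFinM.
  rewrite ge0_integralZr//; first by rewrite lte_mul_pinfty ?lee_fin//; [apply: integral_ge0 => x _; rewrite lee_fin cnorm_ge0|rewrite ge0_fin_numE; [case: ti|apply: integral_ge0 => x _; rewrite lee_fin cnorm_ge0]|exact: ltry].
  + by apply/measurable_EFinP; apply: cmeasurable_normc; case: ti.
  + by move=> x _; rewrite lee_fin cnorm_ge0.
- by move=> k x; rewrite Normc.normcM ler_wpM2l ?cnorm_ge0.
- apply: aeW => z; apply: ccvgZ => e /ck[dl dl0 hd].
  have z1 : 0 < `|z| + 1 by rewrite ltr_pwDr.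
  have /cvgrPdist_lt/(_ _ (divr_gt0 dl0 z1))[K _ hK] := r0.
  exists K => k Kk; apply: hd; rewrite addrAC subrr add0r normrZ.
  have := hK k Kk; rewrite /= sub0r normrN ltr_pdivlMr//; apply: le_lt_trans.
  by rewrite ler_wpM2l// lerDl.
Qed.
End complex_fubini.

(** * Polynomial weights *)
Section weights.
Context {R : realType} {n : nat}.
Local Notation E := 'rV[R]_n.
Local Notation mu := (@lebesgue_row R n).

Lemma continuous_norm_sub (a : E) : continuous (fun x : E => `|x - a|).
Proof.
move=> x; apply: (@cvg_norm _ _ _ (nbhs x) _ (fun y : E => y - a)).
by apply: cvgB; [exact: cvg_id|exact: cvg_cst].
Qed.

Lemma measurable_norm_sub (a : E) : measurable_fun setT (fun x : E => `|x - a|).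
Proof. by apply: continuous_measurable_row; exact: continuous_norm_sub. Qed.

Lemma weight_ge0 (t : R) (A : nat) : 0 <= t -> 0 <= (1 + t) ^- A.
Proof. by move=> t0; rewrite invr_ge0 exprn_ge0// addr_ge0. Qed.

Lemma weight_le1 (t : R) (A : nat) : 0 <= t -> (1 + t) ^- A <= 1.
Proof. by move=> t0; rewrite invf_le1 ?exprn_gt0 ?exprn_ege1 ?ltr_pwDl ?lerDl. Qed.

Lemma measurable_weight (a : E) (r : R) (A : nat) : 0 <= r ->
  measurable_fun setT (fun x : E => (1 + r * `|x - a|) ^- A).
Proof.
move=> r0.
rewrite (_ : (fun _ => _) = (fun t => t `^ (-1)) \o (fun x : E => (1 + r * `|x - a|) ^+ A)); last first.
  by apply/funext => x /=; rewrite powR_inv1// exprn_ge0// addr_ge0// mulr_ge0.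
apply: measurableT_comp; first exact: measurable_powR.
apply: measurable_funX; apply: measurable_funD => //; apply: measurable_funM => //.
exact: measurable_norm_sub.
Qed.

Lemma integral_indic_ball (a : E) (r : R) : 0 <= r ->
  (\int[mu]_x (\1_[set x : E | `|x - a| <= r] x)%:E = ((2 * r) ^+ n)%:E)%E.
Proof.
move=> r0; rewrite integral_indic; [|exact: measurableT|exact: measurable_cball].
by rewrite setIT; exact: lebesgue_ball.
Qed.

(** Cut into the balls of radius [2 ^+ m]: the weight loses a factor [2 ^-
    n.+1] from one to the next and the volume gains only [2 ^+ n]. *)
Lemma weight_integral_lty : (\int[mu]_x ((1 + `|x|) ^- n.+1)%:E < +oo)%E.
Proof.
pose F (m : nat) (x : E) : \bar R :=
  (2 ^+ n.+1 * 2 ^- (m * n.+1) * \1_[set x : E | `|x - 0| <= 2 ^+ m] x)%:E.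
have F0 m x : (0 <= F m x)%E.
  by rewrite lee_fin !mulr_ge0// ?invr_ge0 ?exprn_ge0.
have mF m : measurable_fun setT (F m).
  apply/measurable_EFinP; apply: measurable_funM => //.
  by apply: measurable_indic; exact: measurable_cball.
apply: (@le_lt_trans _ _ (\int[mu]_x \sum_(m <oo) F m x)%E).
  apply: ge0_le_integral => //=.
  - apply/measurable_EFinP; have := @measurable_weight 0 1 n.+1 ler01.
    by congr measurable_fun; apply/funext => x; rewrite mul1r subr0.
  - exact: (ge0_emeasurable_sum (P := xpredT) (fun k x _ _ => F0 k x) (fun k _ => mF k)).
  (* the first ball that contains [x] *)
  - move=> x _; have [m xm] : exists m : nat, `|x| <= 2 ^+ m.
      exists (Num.truncn `|x|).+1; apply: ltW; apply: lt_trans (truncnS_gt _) _.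
      by rewrite -natrX ltr_nat ltn_expl.
    pose P m := `|x| <= 2 ^+ m.
    have [{xm} m xm mmin] := @ex_minnP P (ex_intro _ m xm).
    apply: (@le_trans _ _ (\sum_(0 <= i < m.+1) F i x)%E); last first.
      by apply: nneseries_lim_ge => *; exact: F0.
    rewrite big_nat_recr//=; apply: (@le_trans _ _ (F m x)); last first.
      by rewrite leeDr// sume_ge0.
    rewrite lee_fin indicE mem_set/= ?subr0// mulr1.
    case: m xm mmin => [|m] xm mmin.
      rewrite mul0n expr0 invr1 mulr1; apply: le_trans (weight_le1 _ _) _ => //.
      by rewrite exprn_ege1// ler1n.
    have : ~~ P m by apply/negP => /mmin; rewrite ltnn.
    rewrite /P -ltNge => xm'.
    have -> : 2 ^+ n.+1 * 2 ^- (m.+1 * n.+1) = ((2 ^+ m) ^+ n.+1)^-1 :> R.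
      by rewrite mulSn exprD invfM mulrA mulfV ?expf_neq0// mul1r exprM.
    rewrite lef_pV2 ?posrE ?exprn_gt0// ?ltr_pwDl//.
    by rewrite lerXn2r ?nnegrE ?exprn_ge0 ?addr_ge0// ltW// (lt_le_trans xm')// lerDr.
rewrite integral_nneseries//.
apply: (@le_lt_trans _ _ (\sum_(m <oo) ((2 ^+ (n + n).+2) / (2 ^ m.+1)%:R)%:E)%E).
  apply: lee_nneseries => m.
  by move=> _ _; apply: integral_ge0 => x _; exact: F0.
move=> _.
rewrite /F; under eq_integral do rewrite EFinM.
rewrite ge0_integralZl_EFin//; last first.
- by apply/measurable_EFinP; apply: measurable_indic; exact: measurable_cball.
rewrite integral_indic_ball ?exprn_ge0// -EFinM lee_fin.
rewrite natrX exprMn -exprM mulnS !exprD !exprS exprD invfM.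
have h1 : (2 : R) ^+ m != 0 by rewrite expf_neq0.
have h2 : (2 : R) ^+ (m * n) != 0 by rewrite expf_neq0.
by rewrite le_eqVlt; apply/orP; left; apply/eqP; field; rewrite h1 h2.
have e0 : 0 <= 2 ^+ (n + n).+2 :> R by rewrite exprn_ge0.
exact: le_lt_trans (epsilon_trick0 xpredT e0) (ltry _).
Qed.

Definition weight_mass : R := fine (\int[mu]_x ((1 + `|x|) ^- n.+1)%:E)%E.

Lemma weight_mass_ge0 : 0 <= weight_mass.
Proof. by apply: fine_ge0; apply: integral_ge0 => x _; rewrite lee_fin weight_ge0. Qed.

Lemma weight_integral (a : E) (r : R) : 0 < r ->
  (\int[mu]_x ((1 + r * `|x - a|) ^- n.+1)%:E = (r ^- n * weight_mass)%:E)%E.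
Proof.
move=> r0.
have mw := @measurable_weight a r n.+1 (ltW r0).
rewrite (@ge0_integral_row_affine _ _ a r^-1)//; last 3 first.
- by rewrite invr_eq0 gt_eqF.
- exact/measurable_EFinP.
- by move=> x; rewrite lee_fin weight_ge0// mulr_ge0// ltW.
rewrite ger0_norm ?invr_ge0 ?ltW// exprVn EFinM; congr (_ * _)%E.
rewrite /weight_mass fineK; last first.
  rewrite ge0_fin_numE ?weight_integral_lty//.
  by apply: integral_ge0 => x _; rewrite lee_fin weight_ge0.
apply: eq_integral => x _; rewrite addrAC subrr add0r normrZ ger0_norm ?invr_ge0 ?(ltW r0)//.
by rewrite mulrA divff ?gt_eqF// mul1r.
Qed.

(** This is what makes convolution with a fast decaying kernel compatible with
    polynomial weights, at the cost of a power of the kernel's argument. *)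
Lemma weight_submul (x y : E) (r : R) (A : nat) : 0 <= r ->
  (1 + r * `|x + y|) ^+ A <= (1 + r * `|x|) ^+ A * (1 + r * `|y|) ^+ A.
Proof.
move=> r0; rewrite -exprMn lerXn2r ?nnegrE ?mulr_ge0 ?addr_ge0 ?mulr_ge0//.
have h := ler_wpM2l r0 (ler_normD x y); apply: (@le_trans _ _ (1 + r * (`|x| + `|y|))).
  by rewrite lerD2l.
have : 0 <= r * `|x| * (r * `|y|) by rewrite !mulr_ge0.
by lra.
Qed.
End weights.

(** * Smooth functions and bumps *)
Section pointwise_derivatives.
Context {R : realType} {V : normedModType R}.
Implicit Types (F G : V -> R) (x v : V).

Lemma derive_addf F G x v : derivable F x v -> derivable G x v ->
  'D_v (fun y => F y + G y) x = 'D_v F x + 'D_v G x.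
Proof. exact: deriveD. Qed.

Lemma derive_mulf F G x v : derivable F x v -> derivable G x v ->
  'D_v (fun y => F y * G y) x = 'D_v F x * G x + F x * 'D_v G x.
Proof. by move=> dF dG; rewrite [LHS](deriveM dF dG) /GRing.scale/= addrC mulrC. Qed.

Lemma derive_oppf F x v : derivable F x v ->
  'D_v (fun y => - F y) x = - 'D_v F x.
Proof. exact: deriveN. Qed.

Lemma derivable_mulf F G x v : derivable F x v -> derivable G x v ->
  derivable (fun y => F y * G y) x v.
Proof. exact: derivableM. Qed.

Lemma derivable_oppf F x v : derivable F x v -> derivable (fun y => - F y) x v.
Proof. exact: derivableN. Qed.

Lemma differentiable_addf F G x : differentiable F x -> differentiable G x ->
  differentiable (fun y => F y + G y) x.
Proof. exact: differentiableD. Qed.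

Lemma differentiable_mulf F G x : differentiable F x -> differentiable G x ->
  differentiable (fun y => F y * G y) x.
Proof. exact: differentiableM. Qed.

Lemma differentiable_oppf F x : differentiable F x -> differentiable (fun y => - F y) x.
Proof. exact: differentiableN. Qed.
End pointwise_derivatives.

Section smooth.
Context {R : realType} {n : nat}.
Local Notation normc := (@Normc.normc R).
Local Notation Re := (@complex.Re R).
Local Notation Im := (@complex.Im R).
Local Notation E := 'rV[R]_n.
Local Notation mu := (@lebesgue_row R n).
Implicit Types (f g : E -> R[i]).

Definition unit_row (l : 'I_n) : E := delta_mx ord0 l.

(** Smoothness speaks of all iterated partial derivatives, so a class of
    differentiable functions that is stable under partial derivatives consists
    of smooth functions; the proofs for products, conjugates and affine
    changes of variables never touch words of directions. *)
Lemma csmooth_coind (P : (E -> R[i]) -> Prop) :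
  (forall f, P f -> (forall x, cdifferentiable f x) /\ forall i, P (cpartial i f)) ->
  forall f, P f -> csmooth f.
Proof.
move=> h f Pf s x; suff /h[] : P (cpartials s f) by [].
by elim: s => //= i s IH; case: (h _ IH).
Qed.

Lemma csmooth_diff f x : csmooth f -> cdifferentiable f x.
Proof. by move=> /(_ [::] x). Qed.

Lemma csmooth_partial i f : csmooth f -> csmooth (cpartial i f).
Proof.
move=> sf s x; rewrite /cpartials -foldr_rcons; exact: (sf (rcons s i) x).
Qed.

Let Re_add f g : (fun y => Re (f y + g y)) = fun y => Re (f y) + Re (g y).
Proof. by apply/funext => y; rewrite cReD. Qed.
Let Im_add f g : (fun y => Im (f y + g y)) = fun y => Im (f y) + Im (g y).
Proof. by apply/funext => y; rewrite cImD. Qed.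
Let Re_mul f g : (fun y => Re (f y * g y)) = fun y => Re (f y) * Re (g y) + - (Im (f y) * Im (g y)).
Proof. by apply/funext => y; rewrite cReM. Qed.
Let Im_mul f g : (fun y => Im (f y * g y)) = fun y => Re (f y) * Im (g y) + Im (f y) * Re (g y).
Proof. by apply/funext => y; rewrite cImM. Qed.

Lemma cpartialD i f g x : cdifferentiable f x -> cdifferentiable g x ->
  cpartial i (fun y => f y + g y) x = cpartial i f x + cpartial i g x.
Proof.
move=> [f1 f2] [g1 g2].
have d1 := diff_derivable (v := unit_row i) f1; have d2 := diff_derivable (v := unit_row i) f2.
have e1 := diff_derivable (v := unit_row i) g1; have e2 := diff_derivable (v := unit_row i) g2.
by rewrite /cpartial Re_add Im_add (derive_addf d1 e1) (derive_addf d2 e2).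
Qed.

Lemma cdifferentiableD f g x : cdifferentiable f x -> cdifferentiable g x ->
  cdifferentiable (fun y => f y + g y) x.
Proof.
move=> [f1 f2] [g1 g2]; split; rewrite ?Re_add ?Im_add; exact: differentiable_addf.
Qed.

Lemma cdifferentiableM f g x : cdifferentiable f x -> cdifferentiable g x ->
  cdifferentiable (fun y => f y * g y) x.
Proof.
move=> [f1 f2] [g1 g2]; split; rewrite ?Re_mul ?Im_mul; apply: differentiable_addf.
- exact: differentiable_mulf.
- by apply: differentiable_oppf; exact: differentiable_mulf.
- exact: differentiable_mulf.
- exact: differentiable_mulf.
Qed.

Lemma cpartialM i f g x : cdifferentiable f x -> cdifferentiable g x ->
  cpartial i (fun y => f y * g y) x = cpartial i f x * g x + f x * cpartial i g x.
Proof.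
move=> [f1 f2] [g1 g2].
have d1 := diff_derivable (v := unit_row i) f1; have d2 := diff_derivable (v := unit_row i) f2.
have e1 := diff_derivable (v := unit_row i) g1; have e2 := diff_derivable (v := unit_row i) g2.
have m1 := derivable_mulf d1 e1; have m2 := derivable_mulf d2 e2.
have m3 := derivable_mulf d1 e2; have m4 := derivable_mulf d2 e1.
rewrite /cpartial Re_mul Im_mul (derive_addf m1 (derivable_oppf m2)) (derive_addf m3 m4).
rewrite (derive_oppf m2) (derive_mulf d1 e1) (derive_mulf d2 e2) (derive_mulf d1 e2) (derive_mulf d2 e1).
by apply: complexP; rewrite ?cReD ?cImD ?cReM ?cImM /=; ring.
Qed.

(** The derivative of a product is a sum of products, so products alone are
    not stable under derivatives; the algebra generated by smooth functions
    is. *)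
Inductive smooth_alg : (E -> R[i]) -> Prop :=
| alg_base f : csmooth f -> smooth_alg f
| alg_add f g : smooth_alg f -> smooth_alg g -> smooth_alg (fun x => f x + g x)
| alg_mul f g : smooth_alg f -> smooth_alg g -> smooth_alg (fun x => f x * g x).

Lemma smooth_algP f : smooth_alg f -> csmooth f.
Proof.
apply: csmooth_coind => {}f; elim => {f}.
- move=> f sf; split=> [x|i]; first exact: csmooth_diff.
  by apply: alg_base; exact: csmooth_partial.
- move=> f g af [df pf] ag [dg pg]; split=> [x|i]; first exact: cdifferentiableD.
  rewrite (_ : cpartial i _ = fun x => cpartial i f x + cpartial i g x); last by apply/funext => x; rewrite cpartialD.
  exact: alg_add.
- move=> f g af [df pf] ag [dg pg]; split=> [x|i]; first exact: cdifferentiableM.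
  rewrite (_ : cpartial i _ = fun x => cpartial i f x * g x + f x * cpartial i g x); last by apply/funext => x; rewrite cpartialM.
  by apply: alg_add; exact: alg_mul.
Qed.

Lemma csmoothD f g : csmooth f -> csmooth g -> csmooth (fun x => f x + g x).
Proof. by move=> sf sg; apply: smooth_algP; apply: alg_add; exact: alg_base. Qed.

Lemma csmoothM f g : csmooth f -> csmooth g -> csmooth (fun x => f x * g x).
Proof. by move=> sf sg; apply: smooth_algP; apply: alg_mul; exact: alg_base. Qed.

Lemma csmooth_cst (c : R[i]) : csmooth (fun _ : E => c).
Proof.
apply: (@csmooth_coind (fun f => exists c, f = fun _ : E => c)); last by exists c.
move=> _ [{}c ->]; split=> [x|i]; first by split; exact: differentiable_cst.
by exists 0; apply/funext => x; rewrite /cpartial !derive_cst.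
Qed.

Let Re_conj f : (fun y => Re (conjc (f y))) = fun y => Re (f y).
Proof. by apply/funext => y; case: (f y). Qed.
Let Im_conj f : (fun y => Im (conjc (f y))) = fun y => - Im (f y).
Proof. by apply/funext => y; case: (f y). Qed.

Lemma csmooth_conj f : csmooth f -> csmooth (fun x => conjc (f x)).
Proof.
move=> sf; apply: (@csmooth_coind (fun f => exists2 g, csmooth g & f = fun x => conjc (g x))); last by exists f.
move=> _ [{sf}f sf ->]; split=> [x|i].
  have [h1 h2] := csmooth_diff x sf; split; rewrite ?Re_conj ?Im_conj//.
  exact: differentiable_oppf.
exists (cpartial i f); first exact: csmooth_partial.
apply/funext => x; have [h1 h2] := csmooth_diff x sf.
rewrite /cpartial Re_conj Im_conj derive_oppf//; exact: diff_derivable.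
Qed.

Lemma differentiable_affine (a : E) (r : R) x :
  differentiable (fun y : E => a + r *: y) x.
Proof.
apply: (@differentiableD _ _ _ (fun=> a) (fun y : E => r *: y)); first exact: differentiable_cst.
exact: (@differentiableZ _ _ _ id r).
Qed.

Lemma derive_affine (F : E -> R) (a : E) (r : R) x v : differentiable F (a + r *: x) ->
  'D_v (fun y => F (a + r *: y)) x = r * 'D_v F (a + r *: x).
Proof.
move=> dF; rewrite [in RHS]deriveE// -[RHS]linearZ/= -deriveE//.
rewrite /derive (_ : (fun h => _) = (fun h : R => h^-1 *: ((F \o shift (a + r *: x)) (h *: (r *: v)) - F (a + r *: x))))//.
apply/funext => h /=; congr (_ *: (F _ - _)).
by rewrite scalerDr addrCA !scalerA mulrC.
Qed.

Lemma csmooth_affine f (a : E) (r : R) : csmooth f -> csmooth (fun x => f (a + r *: x)).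
Proof.
move=> sf; apply: (@csmooth_coind (fun f => exists c : R, exists2 g, csmooth g & f = fun x => c%:C * g (a + r *: x))); last first.
  by exists 1, f => //; apply/funext => x; rewrite mul1r.
move=> _ [c [{sf}f sf ->]].
have dg x : cdifferentiable (fun x => f (a + r *: x)) x.
  have [h1 h2] := csmooth_diff (a + r *: x) sf.
  by split; [apply: (differentiable_comp (differentiable_affine a r x) h1)|apply: (differentiable_comp (differentiable_affine a r x) h2)].
have dc x : cdifferentiable (fun _ : E => c%:C) x by split; exact: differentiable_cst.
split=> [x|i]; first exact: cdifferentiableM.
exists (c * r), (cpartial i f); first exact: csmooth_partial.
apply/funext => x; rewrite cpartialM//.
have -> : cpartial i (fun _ : E => c%:C) x = 0 by rewrite /cpartial !derive_cst.
have [h1 h2] := csmooth_diff (a + r *: x) sf.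
have -> : cpartial i (fun x => f (a + r *: x)) x = r%:C * cpartial i f (a + r *: x).
  by apply: complexP; rewrite ?cReM ?cImM /cpartial /= (derive_affine _ h1, derive_affine _ h2); ring.
by rewrite mul0r add0r mulrA -rmorphM.
Qed.

Lemma csmooth_continuous f : csmooth f -> ccontinuous f.
Proof.
by move=> sf; split=> x; apply: differentiable_continuous; case: (csmooth_diff x sf).
Qed.

(** Test functions, with the compact support expressed by a radius. *)
Definition cbump f := csmooth f /\ exists2 rho : R, 0 < rho & forall x, rho <= `|x| -> f x = 0.

Lemma cbump_partial i f : cbump f -> cbump (cpartial i f).
Proof.
move=> [sf [rho r0 fr]]; split; first exact: csmooth_partial.
exists (rho + 1); first by rewrite addr_gt0.
move=> x xr; have nf : \near x, f x = 0.
  have : \forall y \near x, `|x - y| < 1.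
    by apply/nbhs_ballP; exists 1 => //= y; rewrite -ball_normE.
  apply: filterS => y xy; apply: fr.
  have := ler_normB x (x - y); rewrite opprB addrC subrK.
  by have := ler_normD (x - y) y; rewrite subrK; lra.
rewrite /cpartial (near_eq_derive (g := cst 0)); last by apply: filterS nf => y ->.
rewrite derive_cst (near_eq_derive (g := cst 0)); last by apply: filterS nf => y ->.
by rewrite derive_cst.
Qed.

Lemma cbump_cont f : cbump f -> ccontinuous f.
Proof. by case=> sf _; exact: csmooth_continuous. Qed.

Lemma cbump_bounded f : cbump f -> exists2 C : R, 0 <= C & forall x, normc (f x) <= C.
Proof.
move=> bf; have [sf [rho r0 fr]] := bf; have [fR fI] := cbump_cont bf.
have cN : compact [set x : E | `|x - 0| <= rho].
  apply: bounded_closed_compact.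
    exists rho; split=> [|M rM x /=]; first exact: num_real.
     rewrite subr0 => h; apply: le_trans h _; exact: ltW.
  apply: (@preimage_closed _ _ (fun x : E => `|x - 0|) [set t | t <= rho]); last exact: closed_le.
  by move=> x _; exact: continuous_norm_sub.
have N0 : [set x : E | `|x - 0| <= rho] !=set0 by exists 0; rewrite /= subr0 normr0 ltW.
have fb (F : E -> R) : continuous F -> exists C, forall x, `|x| <= rho -> F x <= C.
  move=> cF; have [c _ hc] := EVT_max_rV N0 cN (continuous_subspaceT cF).
  by exists (F c) => x xr; apply: hc; rewrite inE /= subr0.
have fb2 (F : E -> R) : continuous F -> exists C, forall x, `|x| <= rho -> `|F x| <= C.
  move=> cF; have [C1 h1] := fb _ cF.
  have [|C2 h2] := fb (fun x => - F x); first by move=> x; apply: (@cvgN _ _ _ (nbhs x) _ F); exact: cF.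
  exists (`|C1| + `|C2|) => x xr; have := h1 x xr; have := h2 x xr.
  have := ler_norm C1; have := ler_norm C2; have := normr_ge0 C1; have := normr_ge0 C2.
  by move=> a1 a2 a3 a4 a5 a6; rewrite ler_norml; apply/andP; split; lra.
have [C1 h1] := fb2 _ fR; have [C2 h2] := fb2 _ fI.
have C10 : 0 <= C1 by apply: le_trans (normr_ge0 _) (h1 0 _); rewrite normr0 ltW.
have C20 : 0 <= C2 by apply: le_trans (normr_ge0 _) (h2 0 _); rewrite normr0 ltW.
exists (C1 + C2); first exact: addr_ge0.
move=> x; case: (leP rho `|x|) => [/fr ->|/ltW xr]; first by rewrite Normc.normc0 addr_ge0.
by apply: le_trans (normc_le_ReIm _) _; rewrite lerD ?h1 ?h2.
Qed.

Lemma supported_cintegrable f (C rho : R) : cmeasurable f -> 0 <= rho ->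
  (forall x, normc (f x) <= C) -> (forall x, rho < `|x| -> f x = 0) -> cintegrable f.
Proof.
move=> mf r0 fC fr; have C0 : 0 <= C by apply: le_trans (fC 0); exact: cnorm_ge0.
apply: (@cintegrable_dom _ _ _ (fun x => (C * \1_[set x : E | `|x - 0| <= rho] x)%:E)) => //.
- apply/measurable_EFinP; apply: measurable_funM => //.
  by apply: measurable_indic; exact: measurable_cball.
- move=> x; rewrite lee_fin indicE; case: (boolP (_ \in _)); rewrite ?mulr1//.
  move=> /negP xr; rewrite fr ?Normc.normc0 ?mulr0//.
  by rewrite ltNge; apply/negP => h; apply: xr; rewrite inE /= subr0.
- under eq_integral do rewrite EFinM.
  rewrite ge0_integralZl_EFin//; first by rewrite integral_indic_ball// -EFinM ltry.
  by apply/measurable_EFinP; apply: measurable_indic; exact: measurable_cball.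
Qed.

Lemma cbump_integrable f : cbump f -> cintegrable f.
Proof.
move=> bf; have [C C0 fC] := cbump_bounded bf; have [sf [rho r0 fr]] := bf.
apply: (supported_cintegrable _ (ltW r0) fC).
  by apply: ccontinuous_measurable; exact: cbump_cont.
by move=> x /ltW; exact: fr.
Qed.

Lemma cbump_affine f (a : E) (r : R) : r != 0 -> cbump f -> cbump (fun x => f (a + r *: x)).
Proof.
move=> r0 [sf [rho rho0 fr]]; split; first exact: csmooth_affine.
have nr : 0 < `|r| by rewrite normr_gt0.
exists ((rho + `|a|) / `|r|); first by rewrite divr_gt0// ltr_pwDl.
move=> x; rewrite ler_pdivrMr// => h; apply: fr.
have := ler_normB (a + r *: x) a; rewrite addrAC subrr add0r normrZ [_ * `|x|]mulrC.
by lra.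
Qed.

Lemma cbumpM f g : cbump f -> csmooth g -> cbump (fun x => f x * g x).
Proof.
move=> [sf [rho rho0 fr]] sg; split; first exact: csmoothM.
by exists rho => // x /fr ->; rewrite mul0r.
Qed.

Lemma cbumpD f g : cbump f -> cbump g -> cbump (fun x => f x + g x).
Proof.
move=> [sf [r1 r10 fr]] [sg [r2 r20 gr]]; split; first exact: csmoothD.
exists (r1 + r2); first exact: addr_gt0.
by move=> x xr; rewrite fr ?gr ?addr0//; apply: le_trans xr; rewrite ?lerDl ?lerDr ltW.
Qed.

Lemma cbumpZ f (c : R[i]) : cbump f -> cbump (fun x => c * f x).
Proof.
move=> [sf [rho rho0 fr]]; split; first by apply: csmoothM => //; exact: csmooth_cst.
by exists rho => // x /fr ->; rewrite mulr0.
Qed.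

Lemma cbumpB f g : cbump f -> cbump g -> cbump (fun x => f x - g x).
Proof.
move=> bf bg; apply: cbumpD => //.
rewrite (_ : (fun _ => _) = fun x => (-1) * g x); last by apply/funext => x; rewrite mulN1r.
exact: cbumpZ.
Qed.

Lemma is_derive_line (F : E -> R) (x v : E) (t : R) : differentiable F (x + t *: v) ->
  is_derive t (1 : R) (fun s => F (x + s *: v)) ('D_v F (x + t *: v)).
Proof.
move=> dF; have dd := diff_derivable (v := v) dF.
have e : (fun h : R => h^-1 *: (((fun s => F (x + s *: v)) \o shift t) (h *: (1 : R)) - F (x + t *: v)))
  = (fun h : R => h^-1 *: ((F \o shift (x + t *: v)) (h *: v) - F (x + t *: v))).
  apply/funext => h /=; congr (_ *: (F _ - _)).
  by rewrite [h *: 1]mulr1 [in LHS]scalerDl addrCA.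
by apply: DeriveDef; [rewrite /derivable e|rewrite /derive e].
Qed.

(** The mean value theorem applies to real and imaginary parts separately,
    hence the factor [2]. *)
Lemma cpartial_lip l f (C : R) : csmooth f -> (forall x, normc (cpartial l f x) <= C) ->
  forall x t, normc (f (x + t *: unit_row l) - f x) <= 2 * C * `|t|.
Proof.
move=> sf fC x t; apply: le_trans (normc_le_ReIm _) _.
have h (pr : R[i] -> R) : (forall y, differentiable (fun z => pr (f z)) y) ->
    (forall y, `|'D_(unit_row l) (fun z => pr (f z)) y| <= C) ->
    `|pr (f (x + t *: unit_row l)) - pr (f x)| <= C * `|t|.
  move=> d dC; have := @MVT_le R (fun s => pr (f (x + s *: unit_row l))) _ C
    (fun s => is_derive_line (d (x + s *: unit_row l))) (fun s => dC _) t 0.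
  by rewrite scale0r addr0 subr0.
rewrite mulrDl mul1r mulrDl cReB cImB lerD//.
  apply: h => y; first by case: (csmooth_diff y sf).
  by apply: le_trans (fC y); exact: Re_le_normc (cpartial l f y).
apply: h => y; first by case: (csmooth_diff y sf).
by apply: le_trans (fC y); exact: Im_le_normc (cpartial l f y).
Qed.

(** Sequential form of derivability, the one that dominated convergence needs.
    *)
Lemma derivable_quot (V : normedModType R) (F : V -> R) (x v : V) (t_ : nat -> R) :
  derivable F x v -> (forall k, t_ k != 0) -> t_ @ \oo --> (0 : R) ->
  forall e, 0 < e -> exists K : nat, forall k, (K <= k)%N ->
   `|(t_ k)^-1 * (F (x + t_ k *: v) - F x) - 'D_v F x| < e.
Proof.
move=> dF tn0 t0 e e0; have /cvgrPdist_lt/(_ _ e0)/nbhs_ballP[dl /= dl0 hd] := dF.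
have /cvgrPdist_lt/(_ _ dl0)[K _ hK] := t0.
exists K => k Kk; rewrite distrC [x + _]addrC; apply: hd; last exact: tn0.
by rewrite -ball_normE /ball_ /=; apply: hK.
Qed.
End smooth.

(** * Waves and the inverse Fourier transform *)
Section fourier.
Context {R : realType} {n : nat}.
Local Notation normc := (@Normc.normc R).
Local Notation Re := (@complex.Re R).
Local Notation Im := (@complex.Im R).
Local Notation E := 'rV[R]_n.
Local Notation mu := (@lebesgue_row R n).
Local Notation ift := (@inverse_fourier R n).
Implicit Types (f g : E -> R[i]) (x y z xi h : E).

Lemma dotpC x y : dotp x y = dotp y x.
Proof. by apply: eq_bigr => i _; rewrite mulrC. Qed.

Lemma dotpDl x y z : dotp (x + y) z = dotp x z + dotp y z.
Proof. by rewrite -big_split; apply: eq_bigr => i _ /=; rewrite mxE mulrDl. Qed.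

Lemma dotpZl (r : R) x y : dotp (r *: x) y = r * dotp x y.
Proof. by rewrite /dotp mulr_sumr; apply: eq_bigr => i _; rewrite mxE mulrA. Qed.

Lemma dotpZr (r : R) x y : dotp y (r *: x) = r * dotp y x.
Proof. by rewrite dotpC dotpZl dotpC. Qed.

Lemma dotpNr x y : dotp y (- x) = - dotp y x.
Proof. by rewrite -scaleN1r dotpZr mulN1r. Qed.

Lemma dotpNl x y : dotp (- x) y = - dotp x y.
Proof. by rewrite -scaleN1r dotpZl mulN1r. Qed.

Lemma dotp0l x : dotp 0 x = 0.
Proof. by rewrite -(scale0r 0) dotpZl mul0r. Qed.

Lemma dotp_unit_row x l : dotp x (unit_row l) = x ord0 l.
Proof.
rewrite /dotp (bigD1 l)//= big1 => [|i il]; rewrite mxE eqxx /= ?eqxx ?mulr1 ?addr0//.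
by rewrite (negbTE il) mulr0.
Qed.

Lemma dotp_le x y : `|dotp x y| <= n%:R * `|x| * `|y|.
Proof.
apply: le_trans (ler_norm_sum _ _ _) _.
apply: (@le_trans _ _ (\sum_(i < n) `|x| * `|y|)).
  by apply: ler_sum => i _; rewrite normrM ler_pM ?coord_le_norm.
by rewrite sumr_const card_ord -mulrA mulr_natl.
Qed.

Definition wave x xi : R[i] := cis (2 * pi * dotp x xi).

Lemma waveC x xi : wave x xi = wave xi x.
Proof. by rewrite /wave dotpC. Qed.

Lemma waveDl x y xi : wave (x + y) xi = wave x xi * wave y xi.
Proof. by rewrite /wave dotpDl mulrDr cisD. Qed.

Lemma waveDr x y xi : wave xi (x + y) = wave xi x * wave xi y.
Proof. by rewrite !(waveC xi) waveDl. Qed.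

Lemma waveNN x xi : wave x xi * wave x (- xi) = 1.
Proof. by rewrite /wave dotpNr mulrN cisN. Qed.

Lemma waveZ x xi (r : R) : wave (r *: x) xi = wave x (r *: xi).
Proof. by rewrite /wave dotpZl dotpZr. Qed.

Lemma normc_wave x xi : normc (wave x xi) = 1.
Proof. exact: normc_cis. Qed.

Lemma wave_lip x y xi : normc (wave x xi - wave y xi) <= 4 * pi * n%:R * `|xi| * `|x - y|.
Proof.
apply: le_trans (normc_cisB _ _) _.
rewrite -mulrBr -dotpNl -dotpDl normrM ger0_norm ?mulr_ge0 ?pi_ge0//.
have := dotp_le (x - y) xi; have p0 := @pi_ge0 R.
move=> h; have : 0 <= 4 * (pi : R) by rewrite mulr_ge0.
move=> h4; have := ler_wpM2l h4 h; rewrite (_ : 2 * (2 * pi * `|dotp (x - y) xi|) = 4 * pi * `|dotp (x - y) xi|); last by ring.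
by move=> /le_trans; apply; rewrite le_eqVlt; apply/orP; left; apply/eqP; ring.
Qed.

Lemma wave_ccontinuous xi : ccontinuous (fun x => wave x xi).
Proof. by apply: (@ccontinuous_lip _ _ _ (4 * pi * n%:R * `|xi|)) => x y; exact: wave_lip. Qed.

Lemma wave_measurable xi : cmeasurable (fun x => wave x xi).
Proof. by apply: ccontinuous_measurable; exact: wave_ccontinuous. Qed.

Lemma waver_measurable x : cmeasurable (wave x).
Proof. by have := wave_measurable x; congr cmeasurable; apply/funext => xi; rewrite waveC. Qed.

Lemma wave_measurable2 : cmeasurable2 (fun x xi => wave x xi).
Proof.
have md : measurable_fun setT (fun p : E * E => 2 * pi * dotp p.1 p.2).
  apply: measurable_funM => //; apply: measurable_sum => i.
  apply: measurable_funM; first exact: (measurableT_comp (measurable_coord i)).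
  exact: (measurableT_comp (measurable_coord i)).
split.
  rewrite (_ : (fun _ => _) = @cos R \o (fun p : E * E => 2 * pi * dotp p.1 p.2))//.
  by apply: measurableT_comp => //; apply: continuous_measurable_fun; exact: continuous_cos.
rewrite (_ : (fun _ => _) = @sin R \o (fun p : E * E => 2 * pi * dotp p.1 p.2))//.
by apply: measurableT_comp => //; apply: continuous_measurable_fun; exact: continuous_sin.
Qed.

Lemma cintegrable_wave f x : cintegrable f -> cintegrable (fun xi => f xi * wave x xi).
Proof.
move=> fi; apply: (cintegrableM (B := 1)) => //; first exact: waver_measurable.
by move=> xi; rewrite normc_wave.
Qed.

Lemma iftE f x : ift f x = cintegral setT (fun xi => f xi * wave x xi).
Proof. by []. Qed.

Lemma ccvg_ReIm (u : nat -> R[i]) l :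
  (forall e, 0 < e -> exists K : nat, forall k, (K <= k)%N -> `|Re (u k) - Re l| < e) ->
  (forall e, 0 < e -> exists K : nat, forall k, (K <= k)%N -> `|Im (u k) - Im l| < e) ->
  ccvg u l.
Proof.
move=> h1 h2 e e0; have e2 : 0 < e / 2 by rewrite divr_gt0.
have [K hK] := h1 _ e2; have [L hL] := h2 _ e2.
exists (maxn K L) => k; rewrite geq_max => /andP[Kk Lk].
apply: le_lt_trans (normc_le_ReIm _) _; rewrite cReB cImB [ltRHS](splitr e).
by rewrite ltrD ?hK ?hL.
Qed.

Let t_ (k : nat) : R := k.+1%:R^-1.
Let t_neq0 k : t_ k != 0.
Proof. by rewrite invr_eq0 pnatr_eq0. Qed.
Let t_cvg : t_ @ \oo --> (0 : R).
Proof. exact: cvg_harmonic. Qed.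

Lemma cis_quotient (a : R) :
  ccvg (fun k => (t_ k)^-1%:C * (cis (a * t_ k) - 1)) (a *i).
Proof.
have [->|a0] := eqVneq a 0.
  rewrite (_ : (fun _ => _) = fun _ => 0); first exact: ccvg_cst.
  by apply/funext => k; rewrite mul0r cis0 subrr mulr0.
rewrite (_ : (fun _ => _) = fun k => a%:C * ((a * t_ k)^-1%:C * (cis (a * t_ k) - 1))); last first.
  apply/funext => k; rewrite mulrA -rmorphM; congr ((_)%:C * _).
  by field; rewrite t_neq0 a0.
rewrite (_ : a *i = a%:C * 'i%C); last by apply: complexP; rewrite ?cReM ?cImM /=; ring.
apply: ccvgZ.
have at0 k : a * t_ k != 0 by rewrite mulf_neq0.
have atc : (fun k => a * t_ k) @ \oo --> (0 : R).
  by rewrite -(mulr0 a); apply: cvgM; [exact: cvg_cst|exact: t_cvg].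
have h (F : R -> R) dF : is_derive (0 : R) (1 : R) F dF -> forall e, 0 < e -> exists K : nat, forall k, (K <= k)%N ->
   `|(a * t_ k)^-1 * (F (a * t_ k) - F 0) - dF| < e.
  move=> [d1 <-] e e0; have [K hK] := derivable_quot d1 at0 atc e0.
  by exists K => k /hK; rewrite add0r [_ *: (1 : R)]mulr1.
apply: ccvg_ReIm => e e0.
  have [K hK] := h _ _ (is_derive_cos 0) e e0; exists K => k /hK.
  by rewrite cos0 sin0 oppr0 cReM cReB /=; congr (`|_| < _); ring.
have [K hK] := h _ _ (is_derive_sin 0) e e0; exists K => k /hK.
by rewrite cos0 sin0 cImM cImB /=; congr (`|_| < _); ring.
Qed.

Lemma ift_translate f x z : cintegrable f ->
  cintegral setT (fun xi => f (z + xi) * wave x xi) = wave x (- z) * ift f x.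
Proof.
move=> fi; rewrite iftE -cintegralZ; last exact: cintegrable_wave.
rewrite (@cintegral_affine _ _ z 1 (fun xi => wave x (- z) * (f xi * wave x xi))) ?oner_neq0//.
  rewrite normr1 expr1n mul1r; congr cintegral; apply/funext => xi.
  rewrite scale1r waveDr; transitivity ((wave x z * wave x (- z)) * (f (z + xi) * wave x xi)).
    by rewrite waveNN mul1r.
  by ring.
by apply: cintegrableZ; exact: cintegrable_wave.
Qed.

(** The difference quotient of [f] is transformed into [ift f] times a
    difference quotient of the wave; both sides converge by dominated
    convergence. *)
Lemma ift_partial l f x : cbump f ->
  ift (cpartial l f) x = (- (2 * pi * x ord0 l)) *i * ift f x.
Proof.
move=> bf; have fi := cbump_integrable bf; have [sf [rho r0 fr]] := bf.
have bp := cbump_partial l bf; have [C C0 hC] := cbump_bounded bp.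
pose u k := cintegral setT (fun xi => ((t_ k)^-1%:C * (f (t_ k *: unit_row l + xi) - f xi)) * wave x xi).
have fti k : cintegrable (fun xi => f (t_ k *: unit_row l + xi)).
  have := cintegrable_affine (t_ k *: unit_row l) (oner_neq0 R) fi.
  by congr cintegrable; apply/funext => xi; rewrite scale1r.
have uE k : u k = ((t_ k)^-1%:C * (cis (- (2 * pi * x ord0 l) * t_ k) - 1)) * ift f x.
  transitivity ((t_ k)^-1%:C * (wave x (- (t_ k *: unit_row l)) * ift f x - ift f x)).
    rewrite -ift_translate// iftE -cintegralB; [|exact: cintegrable_wave|exact: cintegrable_wave].
    rewrite -cintegralZ; last by apply: cintegrableB; exact: cintegrable_wave.
    by congr cintegral; apply/funext => xi; ring.
  rewrite /wave dotpNr dotpZr dotp_unit_row (_ : 2 * pi * - (t_ k * x ord0 l) = - (2 * pi * x ord0 l) * t_ k); ring.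
have cv1 : ccvg u ((- (2 * pi * x ord0 l)) *i * ift f x).
  rewrite mulrC (_ : u = fun k => ift f x * ((t_ k)^-1%:C * (cis (- (2 * pi * x ord0 l) * t_ k) - 1))).
    by apply: ccvgZ; exact: cis_quotient.
  by apply/funext => k; rewrite uE mulrC.
apply: ccvg_unique cv1.
have t1 k : `|t_ k| <= 1 by rewrite ger0_norm ?invr_ge0// invf_le1// ler1n.
have qb k xi : normc ((t_ k)^-1%:C * (f (t_ k *: unit_row l + xi) - f xi)) <= 2 * C.
  rewrite Normc.normcM cnorm_real normfV mulrC ler_pdivrMr ?normr_gt0//.
  by rewrite [t_ k *: _ + _]addrC; exact: (cpartial_lip sf hC).
apply: (@cdominated _ _ _ _ (fun xi => 2 * C * \1_[set xi : E | `|xi - 0| <= rho + 1] xi)).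
- move=> k; apply: cmeasurableM; last exact: waver_measurable.
  by case: (cintegrableZ (t_ k)^-1%:C (cintegrableB (fti k) fi)).
- by apply: cintegrable_wave; exact: cbump_integrable.
- by apply: measurable_funM => //; apply: measurable_indic; exact: measurable_cball.
- under eq_integral do rewrite EFinM.
  have r1 : 0 <= rho + 1 by rewrite addr_ge0// ltW.
  rewrite ge0_integralZl_EFin//; first by rewrite integral_indic_ball// -EFinM ltry.
    by apply/measurable_EFinP; apply: measurable_indic; exact: measurable_cball.
  by rewrite mulr_ge0.
- move=> k xi; rewrite Normc.normcM normc_wave mulr1 indicE.
  case: (boolP (xi \in _)) => [_|]; first by rewrite mulr1.
  move=> /negP hxi; have {}hxi : rho + 1 < `|xi|.
    by rewrite ltNge; apply/negP => h; apply: hxi; rewrite inE /= subr0.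
  rewrite mulr0 !fr ?subrr ?mulr0 ?Normc.normc0//; first by lra.
  have b1 : `|t_ k *: unit_row l| <= 1.
    rewrite normrZ mulr_ile1//; apply/row_norm_le => // i; rewrite mxE eqxx/=.
    by case: (i == l) => //=; rewrite ?normr1 ?normr0.
  by have := ler_normB (t_ k *: unit_row l + xi) (t_ k *: unit_row l); rewrite addrAC subrr add0r; lra.
- apply: aeW => xi.
  rewrite mulrC (_ : (fun _ => _) = fun k => wave x xi * ((t_ k)^-1%:C * (f (t_ k *: unit_row l + xi) - f xi))); last first.
    by apply/funext => k; rewrite mulrC.
  apply: ccvgZ; have [d1 d2] := csmooth_diff xi sf.
  apply: ccvg_ReIm => e e0.
    have [K hK] := derivable_quot (diff_derivable (v := unit_row l) d1) t_neq0 t_cvg e0.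
    by exists K => k /hK; rewrite cReM cReB /= mul0r subr0 [xi + _]addrC.
  have [K hK] := derivable_quot (diff_derivable (v := unit_row l) d2) t_neq0 t_cvg e0.
  by exists K => k /hK; rewrite cImM cImB /= mul0r addr0 [xi + _]addrC.
Qed.
End fourier.

(** * Decay of inverse Fourier transforms of bumps *)
Section fourier_decay.
Context {R : realType} {n : nat}.
Local Notation normc := (@Normc.normc R).
Local Notation Re := (@complex.Re R).
Local Notation Im := (@complex.Im R).
Local Notation E := 'rV[R]_n.
Local Notation mu := (@lebesgue_row R n).
Local Notation ift := (@inverse_fourier R n).
Implicit Types (f g : E -> R[i]) (x y z xi h : E).

Definition cmass f : R := fine (\int[mu]_x (normc (f x))%:E)%E.

Lemma cmassE f : cintegrable f -> (\int[mu]_x (normc (f x))%:E = (cmass f)%:E)%E.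
Proof.
move=> [_ foo]; rewrite fineK// ge0_fin_numE//.
by apply: integral_ge0 => x _; rewrite lee_fin cnorm_ge0.
Qed.

Lemma cmass_ge0 f : 0 <= cmass f.
Proof. by apply: fine_ge0; apply: integral_ge0 => x _; rewrite lee_fin cnorm_ge0. Qed.

Lemma le_normc_cintegral f (h : E -> R) (B : R) : cintegrable f -> measurable_fun setT h ->
  (forall x, normc (f x) <= h x) -> (\int[mu]_x (h x)%:E <= B%:E)%E ->
  normc (cintegral setT f) <= B.
Proof.
move=> fi mh fh hB; rewrite -lee_fin; apply: le_trans (normc_cintegral fi) _.
apply: le_trans hB; apply: ge0_le_integral => //=.
- by move=> x _; rewrite lee_fin cnorm_ge0.
- by apply/measurable_EFinP; apply: cmeasurable_normc; case: fi.
- exact/measurable_EFinP.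
- by move=> x _; rewrite lee_fin.
Qed.

Lemma cmassZ f (c : R) : 0 <= c -> cintegrable f ->
  (\int[mu]_x (c * normc (f x))%:E = (c * cmass f)%:E)%E.
Proof.
move=> c0 fi; under eq_integral do rewrite EFinM.
rewrite ge0_integralZl_EFin//; first by rewrite cmassE// EFinM.
  by move=> x _; rewrite lee_fin cnorm_ge0.
by apply/measurable_EFinP; apply: cmeasurable_normc; case: fi.
Qed.

Lemma ift_bounded f x : cintegrable f -> normc (ift f x) <= cmass f.
Proof.
move=> fi; apply: (@le_normc_cintegral _ (fun xi => normc (f xi))).
- exact: cintegrable_wave.
- by apply: cmeasurable_normc; case: fi.
- by move=> xi; rewrite Normc.normcM normc_wave mulr1.
- by rewrite cmassE.
Qed.

(** A bump has bounded frequencies, and each wave is Lipschitz. *)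
Lemma ift_lip0 f : cbump f ->
  exists2 L : R, 0 <= L & forall x h, normc (ift f (x + h) - ift f x) <= L * `|h|.
Proof.
move=> bf; have fi := cbump_integrable bf; have [sf [rho r0 fr]] := bf.
have p0 := @pi_ge0 R.
have L0 : 0 <= 4 * pi * n%:R * rho by rewrite !mulr_ge0// ltW.
exists (4 * pi * n%:R * rho * cmass f); first by rewrite mulr_ge0// cmass_ge0.
move=> x h; rewrite !iftE -cintegralB; [|exact: cintegrable_wave|exact: cintegrable_wave].
apply: (@le_normc_cintegral _ (fun xi => 4 * pi * n%:R * rho * `|h| * normc (f xi))).
- by apply: cintegrableB; exact: cintegrable_wave.
- by apply: measurable_funM => //; apply: cmeasurable_normc; case: fi.
- move=> xi; rewrite -mulrBr Normc.normcM mulrC.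
  case: (leP rho `|xi|) => [/fr ->|/ltW xr]; first by rewrite Normc.normc0 !mulr0.
  rewrite ler_wpM2r ?cnorm_ge0//; apply: le_trans (wave_lip _ _ _) _.
  rewrite addrAC subrr add0r ler_wpM2r// ler_wpM2l// !mulr_ge0//.
- by rewrite (cmassZ (mulr_ge0 L0 (normr_ge0 h)) fi) lee_fin mulrAC.
Qed.

Lemma ift_partial_norm l f x : cbump f ->
  `|x ord0 l| * normc (ift f x) <= normc (ift (cpartial l f) x).
Proof.
move=> bf; rewrite ift_partial// Normc.normcM ler_wpM2r ?cnorm_ge0//.
rewrite cnormE /= expr0n add0r sqrtr_sqr normrN normrM ler_peMl//.
have := @pi_ge2 R; rewrite ger0_norm ?mulr_ge0 ?pi_ge0//; lra.
Qed.

(** By [ift_partial], every coordinate of [x] is paid for by one derivative of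
    [f], which is again a bump. *)
Lemma ift_decay_coord l A : forall f, cbump f ->
  exists2 C : R, 0 <= C & forall x, `|x ord0 l| ^+ A * normc (ift f x) <= C.
Proof.
elim: A => [|A IH] f bf.
  exists (cmass f); first exact: cmass_ge0.
  by move=> x; rewrite expr0 mul1r ift_bounded//; exact: cbump_integrable.
have [C C0 hC] := IH _ (cbump_partial l bf); exists C => // x.
rewrite exprSr -mulrA; apply: le_trans (hC x); rewrite ler_wpM2l ?exprn_ge0//.
exact: ift_partial_norm.
Qed.

Lemma weight_coord x (A : nat) (a B0 : R) (B : 'I_n -> R) : 0 <= a -> a <= B0 ->
  (forall l, `|x ord0 l| ^+ A * a <= B l) ->
  (1 + `|x|) ^+ A * a <= 2 ^+ A * (B0 + \sum_l B l).
Proof.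
move=> a0 aB aBl; have Bl0 l : 0 <= B l.
  by apply: le_trans (aBl l); rewrite mulr_ge0 ?exprn_ge0.
have B00 : 0 <= B0 by exact: le_trans aB.
have S0 : 0 <= \sum_l B l by apply: sumr_ge0.
case: (leP `|x| 1) => x1.
  apply: (@le_trans _ _ (2 ^+ A * B0)); last by rewrite ler_wpM2l ?exprn_ge0// lerDl.
  apply: ler_pM; rewrite ?exprn_ge0 ?addr_ge0// lerXn2r ?nnegrE ?addr_ge0//; lra.
have [l xl] : exists l, `|x| = `|x ord0 l|.
  have [|[i j] h] := @mx_norm_neq0 R 1 n x; first by rewrite gt_eqF// (lt_trans ltr01).
  by exists j; move: h; rewrite (ord1 i).
apply: (@le_trans _ _ (2 ^+ A * (`|x ord0 l| ^+ A * a))).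
  rewrite mulrA ler_wpM2r// -exprMn lerXn2r ?nnegrE ?addr_ge0 ?mulr_ge0// -xl; lra.
rewrite ler_wpM2l ?exprn_ge0//; apply: le_trans (aBl l) _.
rewrite (bigD1 l)//= addrCA lerDl addr_ge0// sumr_ge0//.
Qed.

Lemma ift_decay f (A : nat) : cbump f ->
  exists2 C : R, 0 <= C & forall x, (1 + `|x|) ^+ A * normc (ift f x) <= C.
Proof.
move=> bf.
have /choice[B hB] : forall l : 'I_n, exists C : R, forall x, `|x ord0 l| ^+ A * normc (ift f x) <= C.
  by move=> l; have [C C0 hC] := ift_decay_coord l A bf; exists C.
have hh x : (1 + `|x|) ^+ A * normc (ift f x) <= 2 ^+ A * (cmass f + \sum_l B l).
  apply: weight_coord; rewrite ?cnorm_ge0// ?ift_bounded//; exact: cbump_integrable.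
exists (2 ^+ A * (cmass f + \sum_l B l)) => //.
by apply: le_trans (hh 0); rewrite mulr_ge0 ?cnorm_ge0 ?exprn_ge0 ?addr_ge0.
Qed.

Lemma normDS_le (t : R) (A B : nat) : 0 <= t -> (A <= B)%N -> (1 + t) ^+ A <= (1 + t) ^+ B.
Proof. by move=> t0 AB; rewrite ler_weXn2l// lerDl. Qed.

(** Induction on the number of derivatives as for the decay; the difference of
    the two multiplication rules, at [x + h] and at [x], leaves one term with
    a factor [h]. *)
Lemma ift_lip_coord l A : forall f, cbump f ->
  exists2 C : R, 0 <= C & forall x h,
   `|x ord0 l| ^+ A * normc (ift f (x + h) - ift f x) <= C * (`|h| * (1 + `|h|) ^+ A).
Proof.
elim: A => [|A IH] f bf.
  have [L L0 hL] := ift_lip0 bf; exists L => // x h.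
  by rewrite !expr0 mul1r mulr1.
have [C C0 hC] := IH _ (cbump_partial l bf).
have [D D0 hD] := ift_decay A bf.
exists (C + D); first exact: addr_ge0.
move=> x h; set d := ift f (x + h) - ift f x.
have pp := @pi_ge2 R.
have key : `|x ord0 l| * normc d <= normc (ift (cpartial l f) (x + h) - ift (cpartial l f) x)
     + `|h ord0 l| * normc (ift f (x + h)).
  have e : (2 * pi * x ord0 l) *i * d = - (ift (cpartial l f) (x + h) - ift (cpartial l f) x)
      - (2 * pi * h ord0 l) *i * ift f (x + h).
    rewrite /d !ift_partial//; apply: complexP; rewrite ?(cReB, cReM, cReN, cImB, cImM, cImN) /= mxE; ring.
  have ni (r : R) : normc (r *i) = `|r| by rewrite cnormE /= expr0n add0r sqrtr_sqr.
  have p2 : `|2 * pi| = 2 * pi :> R by rewrite ger0_norm// mulr_ge0// pi_ge0.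
  have : normc ((2 * pi * x ord0 l) *i * d) <= normc (ift (cpartial l f) (x + h) - ift (cpartial l f) x)
     + 2 * pi * (`|h ord0 l| * normc (ift f (x + h))).
    rewrite e; apply: le_trans (cnormB _ _) _; rewrite cnormN lerD2l Normc.normcM ni.
    by rewrite normrM p2 mulrA.
  rewrite Normc.normcM ni normrM p2 => hh.
  have p20 : 0 < 2 * pi :> R by lra.
  rewrite -(ler_pM2l p20) [leLHS]mulrA; apply: le_trans hh _.
  rewrite [leRHS]mulrDr; apply: lerD => //; rewrite ler_peMl ?cnorm_ge0//; lra.
rewrite exprSr -mulrA; apply: (@le_trans _ _ (`|x ord0 l| ^+ A * (normc (ift (cpartial l f) (x + h) - ift (cpartial l f) x)
     + `|h ord0 l| * normc (ift f (x + h))))).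
  by rewrite ler_wpM2l ?exprn_ge0.
have h0 := normr_ge0 h.
have hA : `|h| * (1 + `|h|) ^+ A <= `|h| * (1 + `|h|) ^+ A.+1.
  by rewrite ler_wpM2l// normDS_le.
rewrite mulrDr mulrDl lerD//.
  by apply: le_trans (hC x h) _; rewrite ler_wpM2l.
rewrite mulrCA; apply: (@le_trans _ _ (`|h| * (D * (1 + `|h|) ^+ A))).
  rewrite ler_pM ?coord_le_norm ?mulr_ge0 ?exprn_ge0 ?cnorm_ge0//.
  apply: (@le_trans _ _ (((1 + `|h|) ^+ A * (1 + `|x + h|) ^+ A) * normc (ift f (x + h)))).
    rewrite ler_wpM2r ?cnorm_ge0//.
    have := weight_submul (x + h) (- h) A (ler01 : 0 <= 1 :> R); rewrite addrK normrN !mul1r mulrC.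
    apply: le_trans; rewrite lerXn2r ?nnegrE ?addr_ge0//.
    by apply: le_trans (coord_le_norm x l) _; rewrite lerDr.
  by rewrite -mulrA mulrC ler_wpM2r ?exprn_ge0 ?addr_ge0.
by rewrite mulrCA ler_wpM2l.
Qed.

(** The modulus of continuity decays as fast as the function itself; pairings
    with functions of mean zero rest on this. *)
Lemma ift_lip f (A : nat) : cbump f ->
  exists2 C : R, 0 <= C & forall x h,
   (1 + `|x|) ^+ A * normc (ift f (x + h) - ift f x) <= C * (`|h| * (1 + `|h|) ^+ A).
Proof.
move=> bf; have [L L0 hL] := ift_lip0 bf.
have /choice[B hB] : forall l : 'I_n, exists C : R, 0 <= C /\ forall x h,
   `|x ord0 l| ^+ A * normc (ift f (x + h) - ift f x) <= C * (`|h| * (1 + `|h|) ^+ A).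
  by move=> l; have [C C0 hC] := ift_lip_coord l A bf; exists C.
exists (2 ^+ A * (L + \sum_l B l)).
  by rewrite mulr_ge0 ?exprn_ge0 ?addr_ge0// sumr_ge0// => l _; case: (hB l).
move=> x h; rewrite -mulrA mulrDl mulr_suml; apply: weight_coord.
- exact: cnorm_ge0.
- apply: le_trans (hL x h) _; rewrite ler_wpM2l// ler_peMr// exprn_ege1// lerDl//.
- by move=> l; case: (hB l).
Qed.

Lemma ift_ccontinuous f : cbump f -> ccontinuous (ift f).
Proof.
move=> bf; have [L L0 hL] := ift_lip0 bf; apply: (@ccontinuous_lip _ _ _ L) => x y.
by have := hL y (x - y); rewrite [y + _]addrC subrK.
Qed.

Lemma weight_integrable (C : R) : 0 <= C ->
  (\int[mu]_x (C * (1 + `|x|) ^- n.+1)%:E < +oo)%E.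
Proof.
move=> C0; have mw := @measurable_weight R n 0 1 n.+1 ler01.
under eq_integral do rewrite EFinM.
rewrite ge0_integralZl_EFin//; first by rewrite lte_mul_pinfty ?lee_fin// weight_integral_lty.
apply/measurable_EFinP; move: mw; congr measurable_fun; apply/funext => x; by rewrite mul1r subr0.
Qed.

Lemma decay_cintegrable f (C : R) : cmeasurable f ->
  (forall x, (1 + `|x|) ^+ n.+1 * normc (f x) <= C) -> cintegrable f.
Proof.
move=> mf hC; have C0 : 0 <= C.
  by apply: le_trans (hC 0); rewrite mulr_ge0 ?cnorm_ge0 ?exprn_ge0 ?addr_ge0.
have mw := @measurable_weight R n 0 1 n.+1 ler01.
apply: (@cintegrable_dom _ _ _ (fun x => (C * (1 + `|x|) ^- n.+1)%:E)) => //.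
- apply/measurable_EFinP; apply: measurable_funM => //.
  move: mw; congr measurable_fun; apply/funext => x; by rewrite mul1r subr0.
- by move=> x; rewrite lee_fin ler_pdivlMr ?exprn_gt0 ?ltr_pwDl// mulrC.
- exact: weight_integrable.
Qed.

Lemma ift_cintegrable f : cbump f -> cintegrable (ift f).
Proof.
move=> bf; have [C C0 hC] := ift_decay n.+1 bf.
by apply: decay_cintegrable hC; apply: ccontinuous_measurable; exact: ift_ccontinuous.
Qed.
End fourier_decay.

(** * Fourier inversion for bumps *)
Section fourier_inversion.
Context {R : realType} {n : nat}.
Local Notation normc := (@Normc.normc R).
Local Notation Re := (@complex.Re R).
Local Notation Im := (@complex.Im R).
Local Notation E := 'rV[R]_n.
Local Notation mu := (@lebesgue_row R n).
Local Notation ift := (@inverse_fourier R n).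
Implicit Types (f g : E -> R[i]) (x y z xi h : E).

Lemma cintegral_scale f (r : R) : 0 < r -> cintegrable f ->
  cintegral setT (fun x => f (r *: x)) = (r ^- n)%:C * cintegral setT f.
Proof.
move=> r0 fi; rewrite (@cintegral_affine _ _ 0 r f)//; last by rewrite gt_eqF.
rewrite mulrA -rmorphM ger0_norm ?ltW// mulVf ?expf_neq0 ?gt_eqF// mul1r.
by congr cintegral; apply/funext => x; rewrite add0r.
Qed.

Lemma cintegrable_scale f (r : R) : r != 0 -> cintegrable f ->
  cintegrable (fun x => f (r *: x)).
Proof.
move=> r0 /(cintegrable_affine 0 r0); congr cintegrable.
by apply/funext => x; rewrite add0r.
Qed.

Lemma ift_scale f (r : R) x : 0 < r -> cintegrable f ->
  ift (fun xi => f (r *: xi)) x = (r ^- n)%:C * ift f (r^-1 *: x).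
Proof.
move=> r0 fi; rewrite !iftE -cintegral_scale//; last exact: cintegrable_wave.
congr cintegral; apply/funext => xi; rewrite waveZ scalerA mulVf ?scale1r//.
by rewrite gt_eqF.
Qed.

(** The integrability that Fubini requires is automatic here: the integrand is
    dominated by a tensor product. *)
Lemma cfubini_kernel f g (K : E -> E -> R[i]) (B : R) : cintegrable f -> cintegrable g ->
  cmeasurable2 K -> (forall x, cmeasurable (K x)) -> (forall y, cmeasurable (K ^~ y)) ->
  (forall x y, normc (K x y) <= B) ->
  [/\ cintegrable (fun x => cintegral setT (fun y => f x * (g y * K x y))),
     cintegrable (fun y => cintegral setT (fun x => f x * (g y * K x y))) &
  cintegral setT (fun x => cintegral setT (fun y => f x * (g y * K x y))) =
  cintegral setT (fun y => cintegral setT (fun x => f x * (g y * K x y)))].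
Proof.
move=> fi gi mK mK1 mK2 KB.
have B0 : 0 <= B by apply: le_trans (KB 0 0); exact: cnorm_ge0.
have mf : cmeasurable f by case: fi.
have mg : cmeasurable g by case: gi.
apply: (@cfubini _ _ (fun x y => f x * (g y * K x y))).
- apply: cmeasurable2M; first exact: cmeasurable2_fst.
  by apply: cmeasurable2M => //; exact: cmeasurable2_snd.
- apply: (@le_lt_trans _ _ (\int[mu]_x (B * cmass g * normc (f x))%:E)%E).
    apply: ge0_le_integral => //=.
    + by move=> x _; apply: integral_ge0 => y _; rewrite lee_fin cnorm_ge0.
    + apply: (@measurable_fun_fubini_tonelli_F _ _ _ _ _ mu (fun p : E * E => (normc (f p.1 * (g p.2 * K p.1 p.2)))%:E)).
        apply: cmeasurable2_normc (cmeasurable2M (cmeasurable2_fst mf) (cmeasurable2M (cmeasurable2_snd mg) mK)).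
      by move=> p; rewrite lee_fin cnorm_ge0.
    + by apply/measurable_EFinP; apply: measurable_funM => //; exact: cmeasurable_normc.
    + move=> x _; rewrite mulrC mulrA -(cmassZ (mulr_ge0 (cnorm_ge0 _) B0) gi).
      apply: ge0_le_integral => //=.
      * by move=> y _; rewrite lee_fin cnorm_ge0.
      * apply/measurable_EFinP; apply: cmeasurable_normc; apply: cmeasurableM; first exact: cmeasurable_cst.
        exact: cmeasurableM.
      * by apply/measurable_EFinP; apply: measurable_funM => //; exact: cmeasurable_normc.
      * move=> y _; rewrite lee_fin !Normc.normcM -mulrA ler_wpM2l ?cnorm_ge0// mulrC.
        by rewrite ler_wpM2r ?cnorm_ge0.
  by rewrite cmassZ ?mulr_ge0 ?cmass_ge0// ltry.
- by move=> x; apply: cintegrableZ; apply: (cintegrableM (B := B)).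
- move=> y; apply: (cintegrableM (B := normc (g y) * B)) => //.
    by apply: cmeasurableM => //; exact: cmeasurable_cst.
  by move=> x; rewrite Normc.normcM ler_wpM2l ?cnorm_ge0.
Qed.

(** Fubini, symmetric in the two functions because the wave is; the dilation
    is moved from one to the other by [ift_scale]. *)
Lemma ift_duality f g (r : R) : 0 < r -> cbump f -> cbump g ->
  cintegral setT (fun y => ift f y * g (r *: y)) =
  cintegral setT (fun xi => ift g xi * f (r *: xi)).
Proof.
move=> r0 bf bg; have fi := cbump_integrable bf; have gi := cbump_integrable bg.
have gri : cintegrable (fun y => g (r *: y)) by apply: cintegrable_scale; rewrite ?gt_eqF.
have [_ _ e] := @cfubini_kernel (fun y => g (r *: y)) f wave 1 gri fi wave_measurable2
  waver_measurable wave_measurable (fun x y => ltac:(by rewrite normc_wave)).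
transitivity (cintegral setT (fun x => cintegral setT (fun y => g (r *: x) * (f y * wave x y)))).
  apply: eq_cintegral => y.
  by rewrite mulrC -(cintegralZ (g (r *: y)) (cintegrable_wave y fi)).
rewrite e.
transitivity (cintegral setT (fun y => (r ^- n)%:C * (f y * ift g (r^-1 *: y)))).
  apply: eq_cintegral => y.
  rewrite [RHS]mulrCA -(ift_scale y r0 gi) -(cintegralZ (f y) (cintegrable_wave y gri)).
  by apply: eq_cintegral => x; rewrite (waveC y); ring.
have ifg : cintegrable (fun xi => ift g xi * f (r *: xi)).
  have [C C0 hC] := cbump_bounded bf.
  have [mfr _] : cintegrable (fun xi => f (r *: xi)).
    by apply: cintegrable_scale; rewrite ?gt_eqF.
  exact: (cintegrableM (ift_cintegrable bg) mfr (fun x => hC (r *: x))).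
have ifg2 : cintegrable (fun y => f y * ift g (r^-1 *: y)).
  have rV0 : r^-1 != 0 by rewrite invr_eq0 gt_eqF.
  apply: eq_cintegrable (cintegrable_scale rV0 ifg) => y.
  have -> : r *: (r^-1 *: y) = y by rewrite scalerA (divff (lt0r_neq0 r0)) scale1r.
  exact: mulrC.
rewrite (cintegralZ _ ifg2) -(cintegral_scale r0 ifg2); apply: eq_cintegral => xi.
have -> : r^-1 *: (r *: xi) = xi by rewrite scalerA (mulVf (lt0r_neq0 r0)) scale1r.
exact: mulrC.
Qed.

(** In the duality formula let the dilation tend to [0]: one side is an
    approximate identity for [g], the other for [f]. *)
Lemma ift_mass_symm f g : cbump f -> cbump g ->
  cintegral setT (ift f) * g 0 = cintegral setT (ift g) * f 0.
Proof.
move=> bf bg.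
have r0 : (fun k : nat => k.+1%:R^-1) @ \oo --> (0 : R) by exact: cvg_harmonic.
have h a b : cbump a -> cbump b ->
  ccvg (fun k => cintegral setT (fun y => ift a y * b (k.+1%:R^-1 *: y))) (cintegral setT (ift a) * b 0).
  move=> ba bb; have [C C0 hC] := cbump_bounded bb.
  have [mb _] := cbump_integrable bb.
  have cb : ccontinuous_at b 0 by apply: (ccontinuousP b).1; exact: cbump_cont.
  apply: eq_ccvg (approximate_identity (ift_cintegrable ba) mb hC cb r0) => k.
  by apply: eq_cintegral => y; rewrite add0r.
apply: ccvg_unique (h f g bf bg) _.
apply: eq_ccvg (h g f bg bf) => k; rewrite (@ift_duality g f)// invr_gt0//.
Qed.

(** Fourier inversion up to a constant independent of [f]: translating [f]
    moves the evaluation point of [ift_mass_symm] from [0] to [xi]. *)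
Lemma ft_ift_raw f g xi : cbump f -> cbump g -> g 0 = 1 ->
  cintegral setT (fun y => ift f y * wave y (- xi)) = cintegral setT (ift g) * f xi.
Proof.
move=> bf bg g1.
have bt : cbump (fun z => f (xi + 1 *: z)) by apply: cbump_affine; rewrite ?oner_neq0.
have -> : f xi = (fun z => f (xi + 1 *: z)) 0 by rewrite scaler0 addr0.
rewrite -(ift_mass_symm bt bg) g1 mulr1.
apply: eq_cintegral => y; rewrite mulrC -(ift_translate y xi (cbump_integrable bf)).
by apply: eq_cintegral => z; rewrite scale1r.
Qed.

Lemma bump_sq_mass g : cbump g -> g 0 = 1 ->
  0 < normc (ift (fun x => g x * conjc (g x)) 0).
Proof.
move=> bg g1; pose b x := g x * conjc (g x); rewrite -/b.
have [sg _] := bg.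
have bb : cbump b by apply: cbumpM => //; exact: csmooth_conj.
have bi := cbump_integrable bb.
have bE x : b x = (normc (g x) ^+ 2)%:C.
  rewrite /b sqr_normcE; case: (g x) => u v; apply: complexP; rewrite ?cReM ?cImM /=; ring.
have r1 : forall x, b x = (normc (g x) ^+ 2)%:C by [].
(* at the origin the wave is [1], and [b] is nonnegative *)
have -> : ift b 0 = (cmass b)%:C.
  transitivity (cintegral setT (fun x => (normc (b x))%:C)).
    rewrite iftE; apply: eq_cintegral => x; rewrite /wave dotp0l mulr0 cis0 mulr1 {2}bE cnorm_real.
    by rewrite ger0_norm ?sqr_ge0.
  exact: cintegral_real.
rewrite cnorm_real ger0_norm ?cmass_ge0//.
(* [b] is [1] at [0], hence at least [1 / 2] on a ball *)
have /ccontinuousP/(_ 0 2^-1)[] : ccontinuous b by exact: cbump_cont.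
  by rewrite invr_gt0.
move=> dl dl0 hdl.
have d2 : 0 < dl / 2 by rewrite divr_gt0.
rewrite -lte_fin -cmassE//.
apply: (@lt_le_trans _ _ (\int[mu]_x (2^-1 * \1_[set x : E | `|x - 0| <= dl / 2] x)%:E)%E).
  under eq_integral do rewrite EFinM.
  rewrite ge0_integralZl_EFin ?invr_ge0//; last first.
    by apply/measurable_EFinP; apply: measurable_indic; exact: measurable_cball.
  by rewrite integral_indic_ball ?ltW// -EFinM lte_fin mulr_gt0 ?exprn_gt0 ?mulr_gt0 ?invr_gt0.
apply: ge0_le_integral => //=.
- apply/measurable_EFinP; apply: measurable_funM => //.
  by apply: measurable_indic; exact: measurable_cball.
- by apply/measurable_EFinP; apply: cmeasurable_normc; case: bi.
- move=> x _; rewrite lee_fin indicE; case: (boolP (_ \in _)); last by rewrite mulr0 cnorm_ge0.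
  rewrite inE /= => hx; rewrite mulr1.
  have {}hx : normc (b x - b 0) < 2^-1 by apply: hdl; apply: le_lt_trans hx _; rewrite ltr_pdivrMr// ltr_pMr// ltr1n.
  have b1 : normc (b 0) = 1 by rewrite bE g1 Normc.normc1 expr1n cnorm_real normr1.
  have := cnormB (b x) (b x - b 0); rewrite opprB addrCA subrr addr0 b1; lra.
Qed.

(** If the constant in [ft_ift_raw] were [0] then the Fourier transform of
    [ift b] would vanish for every bump [b]; with [b] the square of the
    modulus of [g] this gives [ift b] square norm [0], although its value at
    [0] is the mass of [b]. *)
Lemma ift_mass_neq0 g : cbump g -> g 0 = 1 -> cintegral setT (ift g) != 0.
Proof.
move=> bg g1; apply/negP => /eqP c0.
pose b x := g x * conjc (g x).
have [sg _] := bg.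
have bb : cbump b by apply: cbumpM => //; exact: csmooth_conj.
have bi := cbump_integrable bb.
have bE x : b x = (normc (g x) ^+ 2)%:C.
  rewrite /b sqr_normcE; case: (g x) => u v; apply: complexP; rewrite ?cReM ?cImM /=; ring.
have bc x : conjc (b x) = b x by rewrite bE; apply: complexP; rewrite /= ?oppr0.
have cw x xi : conjc (wave x xi) = wave x (- xi).
  by rewrite /wave dotpNr mulrN /cis cosN sinN.
have conj_ift x : conjc (ift b x) = cintegral setT (fun xi => b xi * wave x (- xi)).
  rewrite iftE (cintegral_conj (cintegrable_wave x bi)).
  by apply: eq_cintegral => xi; rewrite -{2}(bc xi) -cw; exact: rmorphM.
have iib := ift_cintegrable bb.
(* the square norm of [ift b], up to the constant that is assumed to vanish *)
have plancherel : cintegral setT (fun y => ift b y * conjc (ift b y)) = 0.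
  have mw2 : cmeasurable2 (fun y xi : E => wave y (- xi)).
    have := wave_measurable2 (R := R) (n := n).
    rewrite /cmeasurable2 /wave.
    have e (y xi : E) : 2 * pi * dotp y (- xi) = - (2 * pi * dotp y xi) by rewrite dotpNr mulrN.
    rewrite /cis /= => -[h1 h2]; split.
      by move: h1; congr measurable_fun; apply/funext => p; rewrite e cosN.
    have := measurable_funN h2.
    by congr measurable_fun; apply/funext => p; rewrite e sinN.
  have mwN y : cmeasurable (fun xi : E => wave y (- xi)).
    apply: eq_cmeasurable (cmeasurable_affine 0 (-1) (waver_measurable y)) => xi.
    by rewrite add0r scaleN1r.
  have cwN y f : cintegrable f -> cintegrable (fun xi : E => f xi * wave y (- xi)).
    by move=> fi; apply: (cintegrableM (B := 1)) => // z; rewrite normc_wave.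
  have [_ _ e] := @cfubini_kernel (ift b) b (fun y xi => wave y (- xi)) 1 iib bi mw2
    mwN (fun y => wave_measurable (- y)) (fun x y => ltac:(by rewrite normc_wave)).
  transitivity (cintegral setT (fun x => cintegral setT (fun y => ift b x * (b y * wave x (- y))))).
    by apply: eq_cintegral => y; rewrite conj_ift -(cintegralZ (ift b y) (cwN y _ bi)).
  rewrite e -[RHS](@cintegral0 R n setT); apply: eq_cintegral => xi.
  have wi : cintegrable (fun y => ift b y * wave y (- xi)).
    have w1 z : normc (wave z (- xi)) <= 1 by rewrite normc_wave.
    exact: (cintegrableM iib (wave_measurable (- xi)) w1).
  transitivity (b xi * cintegral setT (fun y => ift b y * wave y (- xi))).
    by rewrite -(cintegralZ (b xi) wi); apply: eq_cintegral => y; ring.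
  by rewrite (ft_ift_raw _ bb bg g1) c0 mul0r mulr0.
have nn (z : R[i]) : z * conjc z = (normc z ^+ 2)%:C.
  rewrite sqr_normcE; case: z => u v; apply: complexP; rewrite ?cReM ?cImM /=; ring.
have int0 : (\int[mu]_y (normc (ift b y) ^+ 2)%:E = 0)%E.
  have h : cintegrable (fun y => ift b y * conjc (ift b y)).
    have [mib _] := iib.
    have cb y : normc (conjc (ift b y)) <= cmass b.
      apply: le_trans (ift_bounded y bi).
      by rewrite !cnormE; case: (ift b y) => u v /=; rewrite sqrrN.
    exact: (cintegrableM iib (cmeasurable_conj mib) cb).
  have f := integrable_fin_num measurableT (cintegrable_Re h).
  have e : fine (\int[mu]_y (Re (ift b y * conjc (ift b y)))%:E)%E = 0.
    exact: (congr1 Re plancherel).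
  rewrite -[RHS]/((0 : R)%:E) -e fineK//; apply: eq_integral => y _.
  by rewrite nn.
have b0 : 0 < normc (ift b 0) by exact: bump_sq_mass.
have /ccontinuousP/(_ 0 (normc (ift b 0) / 2))[] : ccontinuous (ift b) by exact: ift_ccontinuous.
  by rewrite divr_gt0.
move=> dl dl0 hdl; have d2 : 0 < dl / 2 by rewrite divr_gt0.
set e := normc (ift b 0) in b0 hdl *.
have : (0 < \int[mu]_y (normc (ift b y) ^+ 2)%:E)%E.
  apply: (@lt_le_trans _ _ (\int[mu]_x ((e / 2) ^+ 2 * \1_[set x : E | `|x - 0| <= dl / 2] x)%:E)%E).
    under eq_integral do rewrite EFinM.
    rewrite ge0_integralZl_EFin ?sqr_ge0//; last first.
      by apply/measurable_EFinP; apply: measurable_indic; exact: measurable_cball.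
    by rewrite integral_indic_ball ?ltW// -EFinM lte_fin mulr_gt0 ?exprn_gt0 ?divr_gt0// mulr_gt0.
  apply: ge0_le_integral => //.
  - by move=> x _; rewrite lee_fin mulr_ge0 ?sqr_ge0.
  - apply/measurable_EFinP; apply: measurable_funM => //.
    by apply: measurable_indic; exact: measurable_cball.
  - apply/measurable_EFinP; apply: measurable_funX; case: iib => miib _; exact: (cmeasurable_normc miib).
  - move=> x _; rewrite lee_fin indicE; case: (boolP (_ \in _)); last by rewrite mulr0 exprn_ge0 ?cnorm_ge0.
    rewrite inE => hx; rewrite mulr1 lerXn2r ?nnegrE ?cnorm_ge0 ?divr_ge0 ?cnorm_ge0//.
    have {}hx : normc (ift b x - ift b 0) < e / 2 by apply: hdl; apply: le_lt_trans hx _; rewrite ltr_pdivrMr// ltr_pMr// ltr1n.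
    have := cnormB (ift b x) (ift b x - ift b 0); rewrite opprB addrCA subrr addr0 -/e; lra.
by rewrite int0 ltxx.
Qed.
End fourier_inversion.

(** * Convolution *)
Arguments Normc.normc : simpl never.
Opaque cintegral inverse_fourier.

Section convolution.
Context {R : realType} {n : nat}.
Local Notation normc := (@Normc.normc R).
Local Notation E := 'rV[R]_n.
Local Notation mu := (@lebesgue_row R n).
Local Notation ift := (@inverse_fourier R n).
Implicit Types (f g h kap : E -> R[i]) (x y z xi : E).

Definition cconv f h x := cintegral setT (fun y => f y * h (x - y)).

Lemma cintegral_translate f y : cintegrable f ->
  cintegral setT f = cintegral setT (fun z => f (y + z)).
Proof.
move=> fi; rewrite (cintegral_affine y (oner_neq0 R) fi) normr1 expr1n mul1r.
by apply: eq_cintegral => z; rewrite scale1r.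
Qed.

Lemma cintegrable_translate f y : cintegrable f -> cintegrable (fun z => f (y + z)).
Proof.
move=> /(cintegrable_affine y (oner_neq0 R)); apply: eq_cintegrable => z.
by rewrite scale1r.
Qed.

Lemma cmeasurable_translate f y : cmeasurable f -> cmeasurable (fun z => f (y + z)).
Proof.
move=> /(@cmeasurable_affine _ _ f y 1); apply: eq_cmeasurable => z.
by rewrite scale1r.
Qed.

Lemma cintegrable_reflect f x : cintegrable f -> cintegrable (fun z => f (x - z)).
Proof.
have N0 : (-1 : R) != 0 by rewrite oppr_eq0 oner_neq0.
move=> /(cintegrable_affine x N0); apply: eq_cintegrable => z.
by rewrite scaleN1r.
Qed.

Lemma cintegral_reflect f x : cintegrable f ->
  cintegral setT f = cintegral setT (fun z => f (x - z)).
Proof.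
have N0 : (-1 : R) != 0 by rewrite oppr_eq0 oner_neq0.
move=> fi; rewrite (cintegral_affine x N0 fi) normrN1 expr1n mul1r.
by apply: eq_cintegral => z; rewrite scaleN1r.
Qed.

Lemma cmeasurable_reflect f x : cmeasurable f -> cmeasurable (fun z => f (x - z)).
Proof.
move=> /(@cmeasurable_affine _ _ f x (-1)); apply: eq_cmeasurable => z.
by rewrite scaleN1r.
Qed.

Lemma cmass_translate f y : cintegrable f ->
  (\int[mu]_x (normc (f (x - y)))%:E = (cmass f)%:E)%E.
Proof.
move=> fi; rewrite -cmassE// [RHS](ge0_integral_row_affine (- y) (oner_neq0 R)).
- rewrite normr1 expr1n mul1e; apply: eq_integral => x _; congr (normc (f _))%:E.
  by rewrite scale1r addrC.
- by apply/measurable_EFinP; apply: cmeasurable_normc; case: fi.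
- by move=> x; rewrite lee_fin cnorm_ge0.
Qed.

Lemma cconv_integrand_integrable f h x (D : R) : cintegrable f -> cmeasurable h ->
  (forall z, normc (h z) <= D) -> cintegrable (fun y => f y * h (x - y)).
Proof.
move=> fi mh hD.
exact: (cintegrableM fi (cmeasurable_reflect x mh) (fun y => hD (x - y))).
Qed.

(** One application of Fubini from which integrability and associativity of
    convolutions follow, and also the passage of a limit through a
    convolution. *)
Lemma cconv_pairing f h kap (B D : R) : cintegrable f -> cintegrable h ->
  (forall x, normc (h x) <= D) -> cmeasurable kap -> (forall x, normc (kap x) <= B) ->
  [/\ cintegrable (fun x => kap x * cconv f h x),
      cintegrable (fun y => f y * cintegral setT (fun x => kap x * h (x - y))) &
      cintegral setT (fun x => kap x * cconv f h x) =
      cintegral setT (fun y => f y * cintegral setT (fun x => kap x * h (x - y)))].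
Proof.
move=> fi hi hD mk kB.
have mf : cmeasurable f by case: fi.
have mh : cmeasurable h by case: hi.
have B0 : 0 <= B by apply: le_trans (kB 0); exact: cnorm_ge0.
have D0 : 0 <= D by apply: le_trans (hD 0); exact: cnorm_ge0.
have hti y : cintegrable (fun x => h (x - y)).
  by apply: eq_cintegrable (cintegrable_translate (- y) hi) => x; rewrite addrC.
have khi y : cintegrable (fun x => kap x * h (x - y)).
  apply: eq_cintegrable (cintegrableM (hti y) mk kB) => x; exact: mulrC.
have fhi x := cconv_integrand_integrable x fi mh hD.
pose F y x := f y * (kap x * h (x - y)).
have mF : cmeasurable2 F.
  apply: cmeasurable2M; first exact: cmeasurable2_fst.
  apply: cmeasurable2M; first exact: cmeasurable2_snd.
  have [h1 h2] := cmeasurable2_lin 0 (-1) 1 mh.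
  by split; [move: h1|move: h2]; congr measurable_fun; apply/funext => p;
    rewrite add0r scaleN1r scale1r addrC.
have F1 y : cintegrable (F y) by apply: cintegrableZ; exact: khi.
have F2 x : cintegrable (F ^~ x).
  by apply: eq_cintegrable (cintegrableZ (kap x) (fhi x)) => y; rewrite /F; ring.
have Flty : (\int[mu]_y \int[mu]_x (normc (F y x))%:E < +oo)%E.
  apply: (@le_lt_trans _ _ (\int[mu]_y (B * cmass h * normc (f y))%:E)%E).
    apply: ge0_le_integral => //.
    + by move=> y _; apply: integral_ge0 => x _; rewrite lee_fin cnorm_ge0.
    + apply: (@measurable_fun_fubini_tonelli_F _ _ _ _ _ mu (fun p : E * E => (normc (F p.1 p.2))%:E)).
        exact: cmeasurable2_normc.
      by move=> p; rewrite lee_fin cnorm_ge0.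
    + by apply/measurable_EFinP; apply: measurable_funM => //; exact: cmeasurable_normc.
    + move=> y _.
      rewrite mulrAC EFinM -(cmass_translate y hi) -ge0_integralZl_EFin ?mulr_ge0 ?cnorm_ge0//; last 2 first.
      * by move=> x _; rewrite lee_fin cnorm_ge0.
      * by apply/measurable_EFinP; apply: cmeasurable_normc; case: (hti y).
      apply: ge0_le_integral => //.
      * by move=> x _; rewrite lee_fin cnorm_ge0.
      * by apply/measurable_EFinP; apply: cmeasurable_normc; case: (F1 y).
      * apply/measurable_EFinP; apply: measurable_funM => //.
        by apply: cmeasurable_normc; case: (hti y).
      * move=> x _; rewrite -EFinM lee_fin /F !Normc.normcM mulrCA mulrA.
        by rewrite ler_wpM2r ?cnorm_ge0// ler_wpM2r ?cnorm_ge0.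
  by rewrite cmassZ ?mulr_ge0 ?cmass_ge0// ltry.
have [i1 i2 e] := cfubini mF Flty F1 F2.
have e1 y : f y * cintegral setT (fun x => kap x * h (x - y)) = cintegral setT (F y).
  by rewrite -(cintegralZ (f y) (khi y)).
have e2 x : kap x * cconv f h x = cintegral setT (F ^~ x).
  rewrite /cconv -(cintegralZ (kap x) (fhi x)); apply: eq_cintegral => y.
  by rewrite /F; ring.
split.
- by apply: eq_cintegrable i2 => x; rewrite e2.
- by apply: eq_cintegrable i1 => x; rewrite e1.
- exact: etrans (eq_cintegral setT e2) (etrans (esym e) (esym (eq_cintegral setT e1))).
Qed.

Lemma cconv_cintegrable f h (D : R) : cintegrable f -> cintegrable h ->
  (forall x, normc (h x) <= D) -> cintegrable (cconv f h).
Proof.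
move=> fi hi hD.
have k1 (x : E) : normc ((fun=> 1) x) <= 1 by rewrite Normc.normc1.
have [+ _ _] := cconv_pairing fi hi hD (cmeasurable_cst 1) k1.
by apply: eq_cintegrable => x; rewrite mul1r.
Qed.

Lemma cconvDr f h k x (D D' : R) : cintegrable f -> cmeasurable h -> cmeasurable k ->
  (forall z, normc (h z) <= D) -> (forall z, normc (k z) <= D') ->
  cconv f (fun y => h y + k y) x = cconv f h x + cconv f k x.
Proof.
move=> fi mh mk hD kD; have fi' := cconv_integrand_integrable x fi mh hD.
have gi' := cconv_integrand_integrable x fi mk kD.
by rewrite -(cintegralD fi' gi'); apply: eq_cintegral => y; rewrite mulrDr.
Qed.

Lemma cconv_assoc f h k x (D D' : R) : cintegrable f -> cintegrable h -> cmeasurable k ->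
  (forall z, normc (h z) <= D) -> (forall z, normc (k z) <= D') ->
  cconv (cconv f h) k x = cconv f (cconv h k) x.
Proof.
move=> fi hi mk hD kD.
have [_ _ e] := cconv_pairing fi hi hD (cmeasurable_reflect x mk) (fun y => kD (x - y)).
transitivity (cintegral setT (fun z => k (x - z) * cconv f h z)).
  by apply: eq_cintegral => y; exact: mulrC.
rewrite e; apply: eq_cintegral => y; congr (_ * _).
have hti : cintegrable (fun z => h (z - y)).
  by apply: eq_cintegrable (cintegrable_translate (- y) hi) => z; rewrite addrC.
have ki := cintegrableM hti (cmeasurable_reflect x mk) (fun y => kD (x - y)).
transitivity (cintegral setT (fun z => h (z - y) * k (x - z))).
  by apply: eq_cintegral => z; exact: mulrC.
rewrite (cintegral_translate y ki); apply: eq_cintegral => z.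
by rewrite addrAC subrr add0r opprD addrA.
Qed.

Lemma ift_sub f g x : cintegrable f -> cintegrable g ->
  ift (fun xi => f xi - g xi) x = ift f x - ift g x.
Proof.
move=> fi gi; rewrite !iftE -(cintegralB (cintegrable_wave x fi) (cintegrable_wave x gi)).
by apply: eq_cintegral => xi; rewrite mulrBl.
Qed.

(** The constant is that of the inversion formula [ft_ift_raw]. *)
Lemma cconv_ift f g x (g0 : E -> R[i]) : cbump f -> cbump g -> cbump g0 -> g0 0 = 1 ->
  cconv (ift f) (ift g) x = cintegral setT (ift g0) * ift (fun xi => g xi * f xi) x.
Proof.
move=> bf bg bg0 g01.
have gi := cbump_integrable bg.
have fi := ift_cintegrable bf.
have mw2 : cmeasurable2 (fun y xi : E => wave (x - y) xi).
  have mh : measurable_fun setT (fun p : E * E => (x - p.1, p.2)).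
    apply: measurable_fun_pair => //.
    have := measurable_lin2 x (-1) 0.
    apply: eq_measurable_fun => p _.
    by rewrite scale0r addr0 scaleN1r.
  have [h1 h2] := wave_measurable2 (R := R) (n := n).
  by split; [have := measurableT_comp h1 mh|have := measurableT_comp h2 mh].
have mw (y : E) : cmeasurable (fun z => wave (x - z) y).
  by apply: cmeasurable_reflect (wave_measurable y).
have [_ _ e] := @cfubini_kernel _ _ (ift f) g (fun y xi => wave (x - y) xi) 1 fi gi mw2
  (fun y => waver_measurable (x - y)) mw (fun x y => ltac:(by rewrite normc_wave)).
transitivity (cintegral setT (fun y => cintegral setT (fun xi => ift f y * (g xi * wave (x - y) xi)))).
  by apply: eq_cintegral => y; rewrite iftE -(cintegralZ _ (cintegrable_wave (x - y) gi)).
rewrite e iftE.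
have gfi : cintegrable (fun xi => g xi * f xi) by exact: cbump_integrable (cbumpM bg (proj1 bf)).
rewrite -(cintegralZ _ (cintegrable_wave x gfi)); apply: eq_cintegral => xi.
have w1 z : normc (wave z (- xi)) <= 1 by rewrite normc_wave.
have fwi := cintegrableM fi (wave_measurable (- xi)) w1.
transitivity (g xi * wave x xi * cintegral setT (fun y => ift f y * wave y (- xi))).
  rewrite -(cintegralZ _ fwi); apply: eq_cintegral => y.
  have -> : wave (x - y) xi = wave x xi * wave y (- xi).
    by rewrite waveDl; congr (_ * _); rewrite /wave dotpNl dotpNr.
  ring.
by rewrite (ft_ift_raw xi bf bg0 g01); ring.
Qed.

Lemma tempered_regular f : cintegrable f -> tempered (regular_dist f).
Proof.
move=> fi.
have sb g : schwartz g -> exists2 B : R, cmeasurable g & forall x, normc (g x) <= B.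
  case=> sg /(_ 0%N [::])[B hB]; exists B; last by move=> x; have := hB x; rewrite expr0 mul1r.
  by apply: ccontinuous_measurable; exact: csmooth_continuous.
have fgi g : schwartz g -> cintegrable (fun x => f x * g x).
  by move=> /sb[B mg gB]; exact: (cintegrableM fi mg gB).
split.
  move=> a g h sg sh; rewrite /regular_dist.
  rewrite -(cintegralZ a (fgi _ sg)) -(cintegralD (cintegrableZ a (fgi _ sg)) (fgi _ sh)).
  by apply: eq_cintegral => x; rewrite mulrDr mulrCA.
exists (cmass f), 0%N => g B sg hB.
have {}hB x : normc (g x) <= B.
  by have := hB [::] x (leqnn _); rewrite expr0 mul1r.
apply: (le_normc_cintegral (h := fun x => B * normc (f x)) (fgi _ sg)).
- by apply: measurable_funM => //; apply: cmeasurable_normc; case: fi.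
- by move=> x; rewrite Normc.normcM mulrC ler_wpM2r ?cnorm_ge0.
- rewrite cmassZ// ?[B * _]mulrC//; apply: le_trans (hB 0); exact: cnorm_ge0.
Qed.

End convolution.

(** * Littlewood-Paley kernels *)
Opaque cconv.

Section LP_kernels.
Context {R : realType} {n : nat}.
Local Notation normc := (@Normc.normc R).
Local Notation E := 'rV[R]_n.
Local Notation mu := (@lebesgue_row R n).
Local Notation ift := (@inverse_fourier R n).
Implicit Types (f g h : E -> R[i]) (x y z xi : E).

Lemma norm_le_enorm x : `|x| <= enorm x.
Proof.
have d0 : 0 <= dotp x x by apply: sumr_ge0 => i _; rewrite -expr2 sqr_ge0.
apply/row_norm_le; first exact: sqrtr_ge0.
move=> i; rewrite -sqrtr_sqr ler_sqrt// /dotp (bigD1 i)//= -expr2 lerDl.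
by apply: sumr_ge0 => j _; rewrite -expr2 sqr_ge0.
Qed.

Lemma enormZ (r : R) x : enorm (r *: x) = `|r| * enorm x.
Proof.
by rewrite /enorm dotpZl dotpZr mulrA -expr2 sqrtrM ?sqr_ge0// sqrtr_sqr.
Qed.

(** An [L1]-normalized kernel concentrated at scale [r^-1]: its size and its
    modulus of continuity, the latter with a growth in [t] that allows
    arbitrary translations. *)
Definition kdecay (A : nat) (C r : R) h :=
  (forall x, normc (h x) <= C * (r ^+ n * (1 + r * `|x|) ^- A)) /\
  (forall x t, normc (h (x + t) - h x) <=
     C * (r ^+ n * (r * `|t|) * (1 + r * `|t|) ^+ A * (1 + r * `|x|) ^- A)).

Lemma kdecay_le (A : nat) (C D r : R) h : 0 <= r -> C <= D -> kdecay A C r h -> kdecay A D r h.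
Proof.
move=> r0 CD [h1 h2]; split => [x|x t].
  apply: (le_trans (h1 x)); rewrite ler_wpM2r// mulr_ge0 ?exprn_ge0 ?weight_ge0//.
  by rewrite mulr_ge0.
apply: (le_trans (h2 x t)); rewrite ler_wpM2r//.
by rewrite !mulr_ge0 ?exprn_ge0 ?weight_ge0 ?addr_ge0 ?mulr_ge0.
Qed.

(** The two parts of a Littlewood-Paley kernel live at adjacent scales; this
    brings them to the same one. *)
Lemma kdecay_coarse (A : nat) (C r : R) h : 0 <= C -> 0 < r ->
  kdecay A C r h -> kdecay A (2 ^+ A * C) (2 * r) h.
Proof.
move=> C0 r0 [h1 h2].
have r2 : r <= 2 * r by lra.
have w x : (1 + r * `|x|) ^- A <= 2 ^+ A * (1 + 2 * r * `|x|) ^- A.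
  have p1 : 0 < 1 + r * `|x| by rewrite ltr_pwDl// mulr_ge0// ltW.
  have p2 : 0 < 1 + 2 * r * `|x| by rewrite ltr_pwDl// !mulr_ge0// ltW.
  rewrite -ler_pdivrMr ?invr_gt0 ?exprn_gt0// invrK mulrC -ler_pdivlMr ?invr_gt0 ?exprn_gt0//.
  rewrite invrK -exprMn lerXn2r ?nnegrE ?mulr_ge0 ?ltW//.
  by lra.
have hn : r ^+ n <= (2 * r) ^+ n by rewrite lerXn2r ?nnegrE ?mulr_ge0// ltW.
have r0' := ltW r0.
have wx x : 0 <= (1 + r * `|x|) ^- A by rewrite weight_ge0// mulr_ge0// ltW.
split => [x|x t].
  apply: (le_trans (h1 x)); rewrite [2 ^+ A * C]mulrC -[leRHS]mulrA ler_wpM2l//.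
  by rewrite mulrCA; apply: ler_pM => //; exact: exprn_ge0.
have t0 : 0 <= r * `|t| by rewrite mulr_ge0.
have t1 : r * `|t| <= 2 * r * `|t| by rewrite ler_wpM2r.
apply: (le_trans (h2 x t)); rewrite [2 ^+ A * C]mulrC -[leRHS]mulrA ler_wpM2l//.
rewrite [leRHS]mulrCA; apply: ler_pM => //.
  apply: mulr_ge0; last by apply: exprn_ge0; exact: addr_ge0.
  by apply: mulr_ge0 => //; exact: exprn_ge0.
apply: ler_pM => //.
- by apply: mulr_ge0 => //; exact: exprn_ge0.
- by apply: exprn_ge0; exact: addr_ge0.
- by apply: ler_pM => //; exact: exprn_ge0.
- by rewrite lerXn2r ?nnegrE ?addr_ge0 ?lerD2l// (le_trans t0).
Qed.

Lemma kdecayB (A : nat) (C D r : R) f g : kdecay A C r f -> kdecay A D r g ->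
  kdecay A (C + D) r (fun x => f x - g x).
Proof.
move=> [f1 f2] [g1 g2]; split => [x|x t].
  by apply: (le_trans (cnormB _ _)); rewrite mulrDl lerD.
rewrite opprB addrACA addrC.
rewrite (_ : _ + _ = (f (x + t) - f x) - (g (x + t) - g x)); last by ring.
by apply: (le_trans (cnormB _ _)); rewrite mulrDl lerD.
Qed.

Variable phi0 : E -> R[i].
Hypothesis LP : LP_generator phi0.

Lemma LP_cbump : cbump phi0.
Proof.
have [s0 _ s2] := LP; split => //; exists (3 / 2) => // x hx.
by apply: s2; apply: le_trans hx (norm_le_enorm x).
Qed.

Lemma LP_at0 : phi0 0 = 1.
Proof.
have [_ s1 _] := LP; apply: s1.
by rewrite /enorm dotp0l sqrtr0.
Qed.

Definition lowsym (j : nat) xi := phi0 (2 ^- j *: xi).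
Definition low j := ift (lowsym j).
Definition psi k := ift (LP_symbol phi0 k).

Lemma lowsym_cbump j : cbump (lowsym j).
Proof.
have h : (2 ^- j : R) != 0 by rewrite invr_eq0 expf_neq0.
have := cbump_affine 0 h LP_cbump; congr cbump.
by apply/funext => x; rewrite add0r.
Qed.

Lemma LP_symbol0 : LP_symbol phi0 0 = lowsym 0.
Proof. by apply/funext => x; rewrite /lowsym expr0 invr1 scale1r. Qed.

Lemma LP_symbol_cbump k : cbump (LP_symbol phi0 k).
Proof.
case: k => [|k]; first exact: LP_cbump.
exact: cbumpB (lowsym_cbump k.+1) (lowsym_cbump k).
Qed.

Lemma psi0E : psi 0 = low 0.
Proof. by rewrite /psi LP_symbol0. Qed.

Lemma psiS k x : psi k.+1 x = low k.+1 x - low k x.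
Proof. exact: ift_sub (cbump_integrable (lowsym_cbump _)) (cbump_integrable (lowsym_cbump _)). Qed.

Lemma low_scale j x : low j x = ((2 ^+ j) ^+ n)%:C * ift phi0 (2 ^+ j *: x).
Proof.
have r0 : 0 < (2 ^- j : R) by rewrite invr_gt0 exprn_gt0.
rewrite /low /lowsym (ift_scale x r0 (cbump_integrable LP_cbump)).
by rewrite exprVn !invrK.
Qed.

Lemma low_kdecay A : exists2 C : R, 0 <= C & forall j, kdecay A C (2 ^+ j) (low j).
Proof.
have [C1 C10 h1] := ift_decay A LP_cbump; have [C2 C20 h2] := ift_lip A LP_cbump.
exists (C1 + C2); first exact: addr_ge0.
move=> j; set r : R := 2 ^+ j; have r0 : 0 < r by rewrite exprn_gt0.
have rn0 : 0 <= r ^+ n by rewrite exprn_ge0// ltW.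
have nr x : `|r *: x| = r * `|x| by rewrite normrZ gtr0_norm.
have w0 x : 0 < (1 + r * `|x|) ^+ A by rewrite exprn_gt0// ltr_pwDl// mulr_ge0// ltW.
split => [x|x t].
  rewrite low_scale -/r Normc.normcM cnorm_real ger0_norm// mulrCA ler_wpM2l//.
  rewrite ler_pdivlMr// mulrC; have := h1 (r *: x); rewrite nr => /le_trans; apply.
  by rewrite lerDl.
rewrite !low_scale -/r -mulrBr Normc.normcM cnorm_real ger0_norm// scalerDr.
rewrite -!mulrA [leRHS]mulrCA ler_wpM2l// !mulrA ler_pdivlMr// mulrC.
have := h2 (r *: x) (r *: t); rewrite !nr => /le_trans; apply.
rewrite -!mulrA ler_wpM2r ?lerDr//.
by rewrite !mulr_ge0 ?exprn_ge0 ?addr_ge0 ?mulr_ge0// ltW.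
Qed.

Lemma psi_kdecay A : exists2 C : R, 0 <= C & forall k, kdecay A C (2 ^+ k) (psi k).
Proof.
have [C C0 h] := low_kdecay A; exists (C + 2 ^+ A * C).
  by rewrite addr_ge0// mulr_ge0// exprn_ge0.
case=> [|k].
  by rewrite psi0E; apply: kdecay_le (h 0%N); rewrite ?expr0// lerDl mulr_ge0 ?exprn_ge0.
have -> : psi k.+1 = fun x => low k.+1 x - low k x by apply/funext => x; rewrite psiS.
by apply: kdecayB => //; rewrite exprS; apply: kdecay_coarse; rewrite ?exprn_gt0.
Qed.

(** The constant of Fourier inversion for the present normalization, see
    [ft_psi]. *)
Definition LP_const := cintegral setT (ift phi0).

Lemma LP_const_neq0 : LP_const != 0.
Proof. exact: ift_mass_neq0 LP_cbump LP_at0. Qed.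

Lemma low_integrable j : cintegrable (low j).
Proof. exact: ift_cintegrable (lowsym_cbump j). Qed.

Lemma psi_integrable k : cintegrable (psi k).
Proof. exact: ift_cintegrable (LP_symbol_cbump k). Qed.

Lemma low_bounded j x : normc (low j x) <= cmass (lowsym j).
Proof. exact: ift_bounded x (cbump_integrable (lowsym_cbump j)). Qed.

Lemma psi_bounded k x : normc (psi k x) <= cmass (LP_symbol phi0 k).
Proof. exact: ift_bounded x (cbump_integrable (LP_symbol_cbump k)). Qed.

Lemma ft_psi k xi : cintegral setT (fun y => psi k y * wave y (- xi)) =
  LP_const * LP_symbol phi0 k xi.
Proof. exact: ft_ift_raw xi (LP_symbol_cbump k) LP_cbump LP_at0. Qed.

Lemma low_mass j : cintegral setT (low j) = LP_const.
Proof.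
have := ft_ift_raw 0 (lowsym_cbump j) LP_cbump LP_at0.
rewrite {2}/lowsym scaler0 LP_at0 mulr1 /LP_const => <-.
by apply: eq_cintegral => y; rewrite /wave dotpNr dotpC dotp0l oppr0 mulr0 cis0 mulr1.
Qed.

Lemma psi_mass0 k : cintegral setT (psi k.+1) = 0.
Proof.
rewrite (eq_cintegral setT (psiS k)) (cintegralB (low_integrable _) (low_integrable _)).
by rewrite !low_mass subrr.
Qed.

(** On the support of the lower symbol the higher one is [1]. *)
Lemma lowsym_absorb a b xi : (a < b)%N -> lowsym b xi * lowsym a xi = lowsym a xi.
Proof.
move=> ab; have [_ s1 s2] := LP.
have [h|h] := lerP (3 / 2) (enorm (2 ^- a *: xi)).
  by rewrite /lowsym (s2 _ h) mulr0.
rewrite /lowsym (s1 (2 ^- b *: xi)) ?mul1r//.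
have -> : (2 ^- b *: xi : E) = 2 ^- (b - a) *: (2 ^- a *: xi).
  by rewrite scalerA -invfM -exprD subnK// ltnW.
rewrite enormZ ger0_norm ?invr_ge0 ?exprn_ge0//.
have e0 : 0 <= enorm (2 ^- a *: xi) by exact: sqrtr_ge0.
have h2 : (2 ^- (b - a) : R) <= 2^-1.
  rewrite lef_pV2 ?posrE ?exprn_gt0//; have : (0 < b - a)%N by rewrite subn_gt0.
  by case: (b - a)%N => // m _; rewrite exprS ler_peMr// exprn_ege1// ler1n.
apply: le_trans (ler_wpM2r e0 h2) _; move: h; set u := enorm _; lra.
Qed.

Lemma psi_reproduce k x : cconv (psi k) (low k.+1) x = LP_const * psi k x.
Proof.
rewrite (cconv_ift x (LP_symbol_cbump k) (lowsym_cbump k.+1) LP_cbump LP_at0).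
suff -> : (fun xi => lowsym k.+1 xi * LP_symbol phi0 k xi) = LP_symbol phi0 k by [].
apply/funext => xi; case: k => [|k].
  by rewrite LP_symbol0; exact: lowsym_absorb.
have -> : LP_symbol phi0 k.+1 xi = lowsym k.+1 xi - lowsym k xi by [].
rewrite mulrBr !lowsym_absorb//.
Qed.

(** A frequency-localized function is its own convolution with a kernel of the
    same scale: smoothness and local size of [f] times [psi k] come from here.
    *)
Lemma piece_reproduce f k x : cintegrable f ->
  cconv (cconv f (psi k)) (low k.+1) x = LP_const * cconv f (psi k) x.
Proof.
move=> fi.
have [ml _] := low_integrable k.+1; have [mp _] := psi_integrable k.
rewrite (cconv_assoc x fi (psi_integrable k) ml (psi_bounded k) (low_bounded k.+1)).
have fpi := cconv_integrand_integrable x fi mp (psi_bounded k).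
transitivity (cintegral setT (fun y => LP_const * (f y * psi k (x - y)))); last first.
  exact: cintegralZ fpi.
by apply: eq_cintegral => y; rewrite psi_reproduce; ring.
Qed.

(** Telescoping. *)
Lemma sum_pieces f K x : cintegrable f ->
  \sum_(k < K.+1) cconv f (psi k) x = cconv f (low K) x.
Proof.
move=> fi; elim: K => [|K IH]; first by rewrite big_ord_recr big_ord0 /= add0r psi0E.
rewrite big_ord_recr /= IH.
have [ml _] := low_integrable K; have [mp _] := psi_integrable K.+1.
rewrite -(cconvDr x fi ml mp (low_bounded K) (psi_bounded K.+1)).
by apply: eq_cintegral => y; rewrite psiS addrC subrK.
Qed.

Lemma piece_integrable f k : cintegrable f -> cintegrable (cconv f (psi k)).
Proof. by move=> fi; apply: cconv_cintegrable (psi_bounded k) => //; exact: psi_integrable. Qed.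

End LP_kernels.

(** * Supports of distributions and mollification *)
Section support.
Context {R : realType} {n : nat}.
Local Notation normc := (@Normc.normc R).
Local Notation Re := (@complex.Re R).
Local Notation Im := (@complex.Im R).
Local Notation E := 'rV[R]_n.
Local Notation mu := (@lebesgue_row R n).
Local Notation ift := (@inverse_fourier R n).
Implicit Types (f g h kap : E -> R[i]) (x y z xi a b : E).

Definition boxes : set (set E) := [set A | exists a b, A = box a b].

Lemma boxI a b a' b' : box a b `&` box a' b' =
  box (\row_i Order.max (a ord0 i) (a' ord0 i)) (\row_i Order.min (b ord0 i) (b' ord0 i)).
Proof.
apply/seteqP; split => x /=.
  move=> [h h'] i; rewrite !mxE ge_max lt_min.
  by have /andP[-> ->] := h i; have /andP[-> ->] := h' i.
move=> h; split => i; have := h i; rewrite !mxE ge_max lt_min;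
  by move=> /andP[/andP[h1 h2] /andP[h3 h4]]; apply/andP.
Qed.

(** Half-lines generate the sigma-algebra of the line, and the half-space
    where a coordinate lies in one of them is a countable union of boxes. *)
Lemma boxes_sigma (A : set E) : measurable A -> <<s boxes >> A.
Proof.
move=> mA.
have mid : measurable_fun [set: g_sigma_algebraType boxes]
    ((fun x => x) : g_sigma_algebraType boxes -> E).
  apply: measurable_fun_row => i.
  apply: (measurability _ (RGenCInfty.measurableE R)) => _ [_ [a ->] <-].
  rewrite setTI.
  pose F (k : nat) : set E := box (\row_j (if j == i then a else - k%:R)) (const_mx k%:R).
  have -> : (fun x : E => x ord0 i) @^-1` `[a, +oo[%classic = \bigcup_k F k.
    apply/seteqP; split => x /=.
      rewrite in_itv /= andbT => ax; exists (Num.bound `|x|) => // j.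
      have /ltr_normlP[h1 h2] : `|x ord0 j| < (Num.bound `|x|)%:R.
        by apply: le_lt_trans (coord_le_norm x j) _; apply: archi_boundP.
      rewrite !mxE h2 andbT; case: eqP => [->//|_].
      by rewrite lerNl ltW.
    move=> [k _ /(_ i)]; rewrite !mxE eqxx => /andP[+ _].
    by rewrite in_itv /= andbT.
  apply: bigcupT_measurable => k; apply: sub_sigma_algebra.
  by eexists; eexists; reflexivity.
by have := mid measurableT A mA; rewrite setTI.
Qed.

(** The sets on which the integral vanishes form a Dynkin system, and boxes
    are stable under intersection. *)
Lemma box_integral_eq0 (g : E -> R) a b : mu.-integrable setT (EFin \o g) ->
  (forall x, ~ box a b x -> g x = 0) ->
  (forall a' b', (\int[mu]_(x in box a' b') (g x)%:E = 0)%E) ->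
  ae_eq mu setT (EFin \o g) (cst 0%E).
Proof.
move=> gi g0 gbox.
have mg := measurable_int _ gi.
pose D : set (set E) := [set A | measurable A /\ (\int[mu]_(x in A) (g x)%:E = 0)%E].
have gT : (\int[mu]_x (g x)%:E = 0)%E.
  rewrite -(gbox a b) [RHS]integral_mkcond; apply: eq_integral => x _.
  rewrite patchE; case: ifPn => //; rewrite notin_setE => h; by rewrite g0.
have dynD : dynkin D.
  split.
  - by split.
  - move=> A [mA hA]; split; first exact: measurableC.
    have := @integral_setU _ _ R mu A (~` A) (EFin \o g) mA (measurableC mA).
    rewrite setUv => /(_ mg)/(_ _)/esym; rewrite gT hA add0e; apply.
    by apply/disj_setPCl.
  - move=> F tF hF; split; first by apply: bigcupT_measurable => k; case: (hF k).
    rewrite integral_bigcup//.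
    + by apply: eseries0 => k _ _; case: (hF k).
    + by move=> k; case: (hF k).
    + apply: integrableS gi => //; by apply: bigcupT_measurable => k; case: (hF k).
apply: integral_ae_eq => // A _ mA; rewrite integral0.
have setIb : setI_closed boxes.
  by move=> _ _ [a1 [b1 ->]] [a2 [b2 ->]]; rewrite boxI; do 2 eexists; reflexivity.
have bD : boxes `<=` D.
  by move=> _ [a1 [b1 ->]]; split; [exact: measurable_box|exact: gbox].
have /(_ (fun _ _ => @subsetT _ _) A (boxes_sigma mA))[] :=
  lambda_system_subset setIb (proj1 (dynkin_lambda_system D) dynD) bD.
by [].
Qed.

Lemma cbox_integral_eq0 f a b : cintegrable f ->
  (forall x, ~ box a b x -> f x = 0) ->
  (forall a' b', cintegral (box a' b') f = 0) ->
  {ae mu, forall x, f x = 0}.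
Proof.
move=> fi f0 fbox.
have hRe : ae_eq mu setT (EFin \o (fun x => Re (f x))) (cst 0%E).
  apply: (@box_integral_eq0 _ a b) => //; first exact: cintegrable_Re.
    by move=> x /f0 ->.
  move=> a' b'; have /(congr1 Re) := fbox a' b'.
  have := integrable_fin_num (measurable_box a' b')
    (integrableS measurableT (measurable_box a' b') (@subsetT _ _) (cintegrable_Re fi)).
  by move=> /fineK <- h; congr EFin.
have hIm : ae_eq mu setT (EFin \o (fun x => Im (f x))) (cst 0%E).
  apply: (@box_integral_eq0 _ a b) => //; first exact: cintegrable_Im.
    by move=> x /f0 ->.
  move=> a' b'; have /(congr1 Im) := fbox a' b'.
  have := integrable_fin_num (measurable_box a' b')
    (integrableS measurableT (measurable_box a' b') (@subsetT _ _) (cintegrable_Im fi)).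
  by move=> /fineK <- h; congr EFin.
move: hRe hIm; apply: filterS2 => x /(_ I)[h1] /(_ I)[h2].
by apply: complexP; rewrite ?h1 ?h2.
Qed.

Lemma pos_lower_bound (F : 'I_n -> R) : (forall i, 0 < F i) ->
  exists2 dl : R, 0 < dl & forall i, dl <= F i.
Proof.
move=> F0; exists (\sum_i (F i)^-1 + 1)^-1.
  by rewrite invr_gt0 ltr_wpDl// sumr_ge0// => i _; rewrite invr_ge0 ltW.
move=> i; rewrite -[leRHS]invrK lef_pV2 ?posrE ?invr_gt0//; last first.
  by rewrite ltr_wpDl// sumr_ge0// => j _; rewrite invr_ge0 ltW.
rewrite (bigD1 i)//= -addrA lerDl addr_ge0// sumr_ge0// => j _.
by rewrite invr_ge0 ltW.
Qed.

Lemma box_cut_continuous f a b y : ccontinuous_at f y ->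
  (forall i, y ord0 i != a ord0 i /\ y ord0 i != b ord0 i) ->
  ccontinuous_at (fun x => \1_(box a b) x * f x) y.
Proof.
move=> fy hy.
have [dl dl0 hdl] := @pos_lower_bound
  (fun i => Order.min `|y ord0 i - a ord0 i| `|y ord0 i - b ord0 i|)
  (fun i => ltac:(by have [h1 h2] := hy i; rewrite lt_min !normr_gt0 !subr_eq0 h1 h2)).
have same z : `|z - y| < dl -> (z \in box a b) = (y \in box a b).
  move=> zy; apply/idP/idP; rewrite !inE => h i.
  - have := h i; have := hdl i; rewrite le_min => /andP[].
    have := le_lt_trans (coord_le_norm (z - y) i) zy; rewrite !mxE.
    move: (z ord0 i) (y ord0 i) (a ord0 i) (b ord0 i) => z' y' a' b'.
    by rewrite !ler_normr ltr_norml => ? ? ? ?; apply/andP; split; lra.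
  - have := h i; have := hdl i; rewrite le_min => /andP[].
    have := le_lt_trans (coord_le_norm (z - y) i) zy; rewrite !mxE.
    move: (z ord0 i) (y ord0 i) (a ord0 i) (b ord0 i) => z' y' a' b'.
    by rewrite !ler_normr ltr_norml => ? ? ? ?; apply/andP; split; lra.
move=> e e0; have [d1 d10 hd1] := fy e e0.
exists (Order.min dl d1); first by rewrite lt_min dl0.
move=> z; rewrite lt_min => /andP[/same h /hd1 h1].
rewrite !indicE h -mulrBr; case: (_ \in _); first by rewrite mul1r.
by rewrite mul0r Normc.normc0.
Qed.

Lemma box_boundary_null a b : {ae mu, forall y, forall i, y ord0 i != a ord0 i /\ y ord0 i != b ord0 i}.
Proof.
have H (t : R) (i : 'I_n) : {ae mu, forall y, y ord0 i != t}.
  exists [set x : E | x ord0 i = t]; split.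
  - exact: measurable_hyperplane.
  - exact: hyperplane_null.
  - by move=> x /= /negP; rewrite negbK => /eqP.
apply: filter_forall => i.
by apply: filterS2 (H (a ord0 i) i) (H (b ord0 i) i) => y.
Qed.

(** The kernel is moved over to [kap] by [cconv_pairing], where it is an
    approximate identity; [f] is merely integrable. *)
Lemma cconv_approx f theta kap (B D : R) (r_ : nat -> R) :
  cintegrable f -> cintegrable theta -> (forall x, normc (theta x) <= D) ->
  cmeasurable kap -> (forall x, normc (kap x) <= B) ->
  {ae mu, forall y, ccontinuous_at kap y} ->
  (forall k, 0 < r_ k) -> r_ @ \oo --> (0 : R) ->
  ccvg (fun k => cintegral setT (fun x =>
      kap x * cconv f (fun x => (r_ k ^- n)%:C * theta ((r_ k)^-1 *: x)) x))
    (cintegral setT theta * cintegral setT (fun x => kap x * f x)).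
Proof.
move=> fi ti tD mk kB kc r0 rc.
have B0 : 0 <= B by apply: le_trans (kB 0); exact: cnorm_ge0.
have D0 : 0 <= D by apply: le_trans (tD 0); exact: cnorm_ge0.
pose G k y := cintegral setT (fun z => theta z * kap (y + r_ k *: z)).
pose h k x := (r_ k ^- n)%:C * theta ((r_ k)^-1 *: x).
have hi k : cintegrable (h k).
  by apply: cintegrableZ; apply: cintegrable_scale => //; rewrite invr_eq0 gt_eqF.
have hD k x : normc (h k x) <= r_ k ^- n * D.
  have rn0 : 0 <= r_ k ^- n by rewrite invr_ge0 exprn_ge0// ltW.
  by rewrite Normc.normcM cnorm_real ger0_norm// ler_wpM2l.
have inner k y : cintegral setT (fun x => kap x * h k (x - y)) = G k y.
  have hti : cintegrable (fun x => h k (x - y)).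
    by apply: eq_cintegrable (cintegrable_translate (- y) (hi k)) => x; rewrite addrC.
  have ki : cintegrable (fun x => kap x * h k (x - y)).
    apply: eq_cintegrable (cintegrableM hti mk kB) => x; exact: mulrC.
  rewrite (cintegral_affine y (lt0r_neq0 (r0 k)) ki) ger0_norm ?ltW//.
  have ki2 := cintegrable_affine y (lt0r_neq0 (r0 k)) ki.
  rewrite -(cintegralZ _ ki2); apply: eq_cintegral => z.
  rewrite /h addrAC subrr add0r scalerA (mulVf (lt0r_neq0 (r0 k))) scale1r.
  have e : (r_ k ^+ n)%:C * (r_ k ^- n)%:C = 1 :> R[i].
    by rewrite -rmorphM divff// expf_neq0// lt0r_neq0.
  transitivity (((r_ k ^+ n)%:C * (r_ k ^- n)%:C) * (theta z * kap (y + r_ k *: z))); first ring.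
  by rewrite e mul1r.
have pair k := cconv_pairing fi (hi k) (hD k) mk kB.
have Gb k y : normc (G k y) <= B * cmass theta.
  have mky : cmeasurable (fun z => kap (y + r_ k *: z)) by exact: cmeasurable_affine.
  apply: (le_normc_cintegral (h := fun z => B * normc (theta z))
    (cintegrableM ti mky (fun z => kB (y + r_ k *: z)))).
  - by apply: measurable_funM => //; apply: cmeasurable_normc; case: ti.
  - by move=> z; rewrite Normc.normcM mulrC ler_wpM2r ?cnorm_ge0.
  - by rewrite cmassZ.
have fGi k : cintegrable (fun y => f y * G k y).
  have [_ + _] := pair k; apply: eq_cintegrable => y; by rewrite inner.
have fki : cintegrable (fun x => kap x * f x).
  by apply: eq_cintegrable (cintegrableM fi mk kB) => x; exact: mulrC.
have lim : ccvg (fun k => cintegral setT (fun y => f y * G k y))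
    (cintegral setT (fun y => cintegral setT theta * (kap y * f y))).
  apply: (@cdominated _ _ _ _ (fun y => B * cmass theta * normc (f y))).
  - by move=> k; case: (fGi k).
  - exact: cintegrableZ.
  - by apply: measurable_funM => //; apply: cmeasurable_normc; case: fi.
  - by rewrite cmassZ ?mulr_ge0 ?cmass_ge0// ltry.
  - by move=> k x; rewrite Normc.normcM mulrC ler_wpM2r ?cnorm_ge0.
  - move: kc; apply: filterS => y ky.
    have := ccvgZ (f y) (approximate_identity ti mk kB ky rc).
    have -> : f y * (cintegral setT theta * kap y) = cintegral setT theta * (kap y * f y).
      by rewrite mulrCA; congr (_ * _); exact: mulrC.
    exact.
rewrite -(cintegralZ _ fki); apply: eq_ccvg lim => k.
have [_ _ e] := pair k.
rewrite [RHS]e; apply: eq_cintegral => y; by rewrite inner.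
Qed.

(** The bump is normalized by its own mass after squaring its modulus, since
    the mass of [g] might be [0]. *)
Lemma unit_bump g (rho : R) : cbump g -> g 0 = 1 -> 0 < rho ->
  exists beta : E -> R[i], [/\ cbump beta, cintegral setT beta = 1 &
    forall x, rho <= `|x| -> beta x = 0].
Proof.
move=> bg g1 rho0; have := bump_sq_mass bg g1.
set b := fun x => _ => m0; have [sg [r0 r00 hr]] := bg.
have bb : cbump b by apply: cbumpM => //; exact: csmooth_conj.
have be : ift b 0 = cintegral setT b.
  by rewrite iftE; apply: eq_cintegral => x; rewrite /wave dotp0l mulr0 cis0 mulr1.
rewrite be in m0; pose s := r0 / rho.
have s0 : 0 < s by rewrite divr_gt0.
have bs : cbump (fun x => b (0 + s *: x)) by apply: cbump_affine; rewrite ?gt_eqF.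
have bsi := cbump_integrable bs.
have N0 : cintegral setT (fun x => b (0 + s *: x)) != 0.
  have := cintegral_affine 0 (lt0r_neq0 s0) (cbump_integrable bb).
  move=> e; apply/negP => /eqP h; move: m0; rewrite e h mulr0 Normc.normc0 ltxx//.
exists (fun x => (cintegral setT (fun x => b (0 + s *: x)))^-1 * b (0 + s *: x)); split.
- exact: cbumpZ.
- by rewrite (cintegralZ _ bsi) mulVf.
- move=> x hx; rewrite /b hr ?mul0r ?mulr0//.
  rewrite add0r normrZ gtr0_norm// /s mulrAC ler_pdivlMr//.
  by rewrite ler_wpM2l// ltW.
Qed.

Lemma cball_compact x (r : R) : 0 <= r -> compact [set y : E | `|y - x| <= r].
Proof.
move=> r0; apply: bounded_closed_compact.
  exists (`|x| + r); split; first exact: num_real.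
  move=> M hM y /= hy; apply: le_trans (ltW hM).
  by rewrite -{1}(subrK x y); apply: le_trans (ler_normD _ _) _; rewrite [leRHS]addrC lerD2r.
rewrite (_ : [set y | _] = (fun y : E => `|y - x|) @^-1` [set t | t <= r]) //.
by apply: closed_comp => [y _|]; [exact: continuous_norm_sub|exact: closed_le].
Qed.

(** Mollifiers centred near [x0] are test functions in [U], so mollifications
    of [f] vanish near [x0]; in the limit the integrals of [f] over small
    boxes do. *)
Lemma locally_zero f beta x0 (U : set E) : clocally_integrable f ->
  cbump beta -> cintegral setT beta = 1 -> (forall x, 1 <= `|x| -> beta x = 0) ->
  open U -> U x0 -> (forall g, test_function U g -> regular_dist f g = 0) ->
  exists2 dl : R, 0 < dl & forall a b, (forall x, box a b x -> `|x - x0| <= dl) ->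
    {ae mu, forall x, box a b x -> f x = 0}.
Proof.
move=> [mf fK] bb b1 bs oU Ux0 fU.
have [d1 /= d10 hd1] : exists2 d1 : R, 0 < d1 & forall y, `|y - x0| < d1 -> U y.
  have /nbhs_ballP[d1 /= d10 h] : nbhs x0 U by exact: open_nbhs_nbhs.
  by exists d1 => // y hy; apply: h; rewrite -ball_normE /= distrC.
pose dl := d1 / 4; have dl0 : 0 < dl by rewrite divr_gt0.
exists dl => // a b hab.
pose W := [set y : E | `|y - x0| <= 2 * dl].
have mW : measurable W by exact: measurable_cball.
pose F x := \1_W x * f x.
have Fi : cintegrable F.
  split; first by apply: cmeasurableM => //; exact: cmeasurable_indic.
  have /fK : compact W by apply: cball_compact; rewrite mulr_ge0// ltW.
  rewrite integral_mkcond; apply: le_lt_trans; apply: ge0_le_integral => //.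
  - by move=> x _; rewrite lee_fin cnorm_ge0.
  - apply/measurable_EFinP; apply: cmeasurable_normc; apply: cmeasurableM => //.
    exact: cmeasurable_indic.
  - apply/(measurable_restrictT _ mW); apply: measurable_funTS.
    by apply/measurable_EFinP; exact: cmeasurable_normc.
  - move=> x _; rewrite patchE /F indicE; case: ifPn => _; first by rewrite mul1r.
    by rewrite mul0r Normc.normc0.
have [C C0 hC] := cbump_bounded bb.
pose r_ (k : nat) : R := dl / k.+1%:R.
have r0 k : 0 < r_ k by rewrite divr_gt0.
have rdl k : r_ k <= dl by rewrite ler_pdivrMr// ler_pMr// ler1n.
have rc : r_ @ \oo --> (0 : R).
  rewrite -(mulr0 dl); apply: cvgM; first exact: cvg_cst.
  exact: cvg_harmonic.
pose h k x := (r_ k ^- n)%:C * beta ((r_ k)^-1 *: x).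
have Fh k x : `|x - x0| <= dl -> cconv F (h k) x = 0.
  move=> hx.
  pose t y := beta ((r_ k)^-1 *: x + (- (r_ k)^-1) *: y).
  have tE y : t y = beta ((r_ k)^-1 *: (x - y)) by rewrite /t scaleNr scalerBr.
  have tsup : [set y | t y != 0] `<=` [set y | `|y - x| <= r_ k].
    move=> y /=; rewrite tE; apply: contraNT; rewrite -ltNge => hy.
    rewrite bs// normrZ gtr0_norm ?invr_gt0// ler_pdivlMl// mulr1 distrC; exact: ltW.
  have clB : closed [set y : E | `|y - x| <= r_ k].
    apply: (@compact_closed E); first exact: norm_hausdorff.
    by apply: cball_compact; exact: ltW.
  have csup : closure [set y | t y != 0] `<=` [set y | `|y - x| <= r_ k].
    by rewrite closureE; apply: smallest_sub.
  have BU : [set y | `|y - x| <= r_ k] `<=` W.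
    move=> y /= hy; rewrite /W /= (_ : y - x0 = (y - x) + (x - x0)); last by rewrite addrA subrK.
    apply: le_trans (ler_normD _ _) _; have := rdl k; lra.
  have tt : test_function U t.
    split.
    - by apply: csmooth_affine; case: bb.
    - apply: subclosed_compact csup; first exact: closed_closure.
      by apply: cball_compact; exact: ltW.
    - move=> y /csup/BU /= hy; apply: hd1; apply: le_lt_trans hy _.
      by rewrite /dl; lra.
  have tm : cmeasurable t.
    by apply: ccontinuous_measurable; apply: csmooth_continuous; case: tt.
  have Fti : cintegrable (fun y => F y * t y).
    exact: (cintegrableM Fi tm (fun y => hC ((r_ k)^-1 *: x + (- (r_ k)^-1) *: y))).
  transitivity ((r_ k ^- n)%:C * cintegral setT (fun y => F y * t y)).
    rewrite -(cintegralZ _ Fti); apply: eq_cintegral => y.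
    by rewrite /h tE mulrCA.
  suff -> : cintegral setT (fun y => F y * t y) = 0 by rewrite mulr0.
  rewrite -(fU t tt); apply: eq_cintegral => y; rewrite /F indicE.
  have [->|ty] := eqVneq (t y) 0; first by rewrite !mulr0.
  have /BU Wy := tsup y ty.
  by rewrite mem_set// mul1r.
have key a' b' : cintegral (box a' b') (fun x => \1_(box a b) x * F x) = 0.
  rewrite cintegral_mkcond.
  pose kap x : R[i] := \1_(box a b `&` box a' b') x * 1.
  have mk : cmeasurable kap.
    apply: cmeasurableM (cmeasurable_cst 1); apply: cmeasurable_indic.
    by apply: measurableI; exact: measurable_box.
  have kB x : normc (kap x) <= 1.
    rewrite /kap mulr1 indicE; case: (_ \in _); rewrite ?Normc.normc0 ?Normc.normc1//.
  have kc : {ae mu, forall y, ccontinuous_at kap y}.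
    rewrite /kap boxI; set a2 := \row_i _; set b2 := \row_i _.
    apply: filterS (box_boundary_null a2 b2) => y hy.
    apply: box_cut_continuous hy => e e0; exists 1 => // z _.
    by rewrite subrr Normc.normc0.
  have := cconv_approx Fi (cbump_integrable bb) hC mk kB kc r0 rc.
  rewrite b1 mul1r => lim.
  transitivity (cintegral setT (fun x => kap x * F x)).
    apply: eq_cintegral => x; rewrite /kap indicI /= mulr1 !mulrA; congr (_ * _ * _).
    exact: mulrC.
  apply: (ccvg_unique lim); apply: eq_ccvg (ccvg_cst 0) => k; symmetry.
  rewrite -[RHS](@cintegral0 R n setT); apply: eq_cintegral => x.
  rewrite /kap mulr1 indicE; case: (boolP (_ \in _)); last by rewrite mul0r.
  rewrite inE => -[hx _]; rewrite Fh ?mulr0//; exact: hab.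
have i1 : cintegrable (fun x => \1_(box a b) x * F x).
  by apply: cintegrable_indic => //; exact: measurable_box.
have i2 x : ~ box a b x -> \1_(box a b) x * F x = 0.
  by move=> nx; rewrite indicE memNset// mul0r.
apply: filterS (cbox_integral_eq0 i1 i2 key) => x hx bx.
move: hx; rewrite /F !indicE !mem_set// ?mul1r//=.
by apply: le_trans (hab _ bx) _; rewrite ler_peMl ?ltW//; lra.
Qed.

Lemma dyadic_boxE (m : nat) (k : 'rV[int]_n) : dyadic_box (R := R) m k =
  box (\row_i (2 ^- m * (k ord0 i)%:~R)) (\row_i (2 ^- m * ((k ord0 i)%:~R + 1))).
Proof. by apply/seteqP; split => x hx i; have := hx i; rewrite !mxE. Qed.

Definition dyadic_index (m : nat) x : 'rV[int]_n := \row_i Num.floor (2 ^+ m * x ord0 i).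

Lemma dyadic_indexP (m : nat) x : dyadic_box m (dyadic_index m x) x.
Proof.
move=> i; rewrite mxE; have := floor_itv (2 ^+ m * x ord0 i).
rewrite intrD => /andP[h1 h2]; rewrite ler_pdivrMl ?exprn_gt0// h1 /=.
by rewrite mulrC ltr_pdivlMr ?exprn_gt0// mulrC.
Qed.

Lemma dyadic_box_diam (m : nat) (k : 'rV[int]_n) x y :
  dyadic_box m k x -> dyadic_box m k y -> `|x - y| <= 2 ^- m.
Proof.
have p0 : 0 < (2 ^- m : R) by rewrite invr_gt0 exprn_gt0.
move=> hx hy; apply/row_norm_le; first exact: ltW.
move=> i; rewrite !mxE; have := hx i; have := hy i; rewrite !mulrDr !mulr1.
move: (2 ^- m * (k ord0 i)%:~R) => c; move: (2 ^- m) => e /andP[? ?] /andP[? ?].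
by rewrite ler_norml; apply/andP; split; lra.
Qed.

(** Each point off [Q] has a dyadic neighbourhood on which [f] vanishes almost
    everywhere, and there are countably many dyadic boxes. *)
Lemma dsupport_ae f beta (Q : set E) : clocally_integrable f ->
  cbump beta -> cintegral setT beta = 1 -> (forall x, 1 <= `|x| -> beta x = 0) ->
  dsupport (regular_dist f) `<=` Q -> {ae mu, forall x, ~ Q x -> f x = 0}.
Proof.
move=> lf bb b1 bs fQ.
pose good (p : nat * 'rV[int]_n) := `[< {ae mu, forall x, dyadic_box p.1 p.2 x -> f x = 0} >].
pose F (k : nat) : set E := if unpickle k is Some p then
  (if good p then [set x | dyadic_box p.1 p.2 x /\ f x <> 0] else set0) else set0.
have nF : mu.-negligible (\bigcup_k F k).
  apply: negligible_bigcup => k; rewrite /F; case: unpickle => [p|]; last exact: negligible_set0.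
  case: ifPn => [/asboolP|_]; last exact: negligible_set0.
  apply: negligibleS => x [h1 h2] /= h; exact: h2 (h h1).
apply: negligibleS nF => x /= /not_implyP[Qx fx].
have : ~ dsupport (regular_dist f) x by move=> /fQ.
rewrite /dsupport /= => /contrapT[U [oU fU] Ux].
have [dl dl0 hdl] := locally_zero lf bb b1 bs oU Ux fU.
have [m hm] : exists m : nat, 2 ^- m <= dl.
  exists (Num.bound dl^-1); rewrite -[leRHS]invrK lef_pV2 ?posrE ?invr_gt0 ?exprn_gt0//.
  by apply: ltW; apply: upper_nthrootP.
have gp : good (m, dyadic_index m x).
  apply/asboolP; rewrite dyadic_boxE; apply: hdl => y; rewrite -dyadic_boxE => hy.
  by apply: le_trans (dyadic_box_diam hy (dyadic_indexP m x)) hm.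
exists (pickle (m, dyadic_index m x)) => //; rewrite /F pickleK gp; split => //.
exact: dyadic_indexP.
Qed.

End support.

(** * Weighted local means *)
Opaque Normc.normc.

Section local_means.
Context {R : realType} {n : nat}.
Local Notation normc := (@Normc.normc R).
Local Notation E := 'rV[R]_n.
Local Notation mu := (@lebesgue_row R n).
Implicit Types (f g h kap ker : E -> R[i]) (x y z w : E).

Lemma cmeasurable_real (u : E -> R) : measurable_fun setT u -> cmeasurable (fun x => (u x)%:C).
Proof. by move=> mu; split => //; exact: measurable_cst. Qed.

(** Soft indicator of the ball of radius [r^-1] about [x]. *)
Definition wt (r : R) (A : nat) x w : R := (1 + r * `|w - x|) ^- A.

Lemma wtE r A x w : wt r A x w = (1 + r * `|w - x|) ^- A. Proof. by []. Qed.

Definition wmass h (r : R) (A : nat) x := cmass (fun w => h w * (wt r A x w)%:C).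

Lemma wt_ge0 r A x w : 0 <= r -> 0 <= wt r A x w.
Proof. by move=> r0; rewrite weight_ge0// mulr_ge0. Qed.

Lemma wt_le1 r A x w : 0 <= r -> wt r A x w <= 1.
Proof. by move=> r0; rewrite weight_le1// mulr_ge0. Qed.

Lemma normc_wt h r A x w : 0 <= r -> normc (h w * (wt r A x w)%:C) = normc (h w) * wt r A x w.
Proof. by move=> r0; rewrite Normc.normcM cnorm_real ger0_norm// wt_ge0. Qed.

Lemma wmeasurable r A x : 0 <= r -> cmeasurable (fun w => (wt r A x w)%:C).
Proof. by move=> r0; apply: cmeasurable_real; exact: measurable_weight. Qed.

Lemma wt_integrable h r A x : cintegrable h -> 0 <= r ->
  cintegrable (fun w => h w * (wt r A x w)%:C).
Proof.
move=> hi r0.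
have w1 z : normc (wt r A x z)%:C <= 1 by rewrite cnorm_real ger0_norm ?wt_ge0 ?wt_le1.
exact: (cintegrableM hi (wmeasurable A x r0) w1).
Qed.

Lemma wmass_ge0 h r A x : 0 <= wmass h r A x.
Proof. exact: cmass_ge0. Qed.

Lemma wt_shift r A x z w : 0 <= r ->
  wt r A x z <= wt r A x w * (1 + r * `|z - w|) ^+ A.
Proof.
move=> r0.
have p (v : E) : 0 < (1 + r * `|v|) ^+ A by rewrite exprn_gt0// ltr_pwDl// mulr_ge0.
rewrite /wt [leRHS]mulrC ler_pdivlMr// mulrC ler_pdivrMr// [leRHS]mulrC.
have -> : w - x = (z - x) + (w - z) by rewrite [RHS]addrC addrA subrK.
by rewrite (distrC z w); exact: weight_submul.
Qed.

Opaque wt.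

(** On the support of [kap] the weight is bounded below. *)
Lemma local_pairing h kap (S rho r : R) A x0 : cintegrable h -> cmeasurable kap ->
  (forall y, normc (kap y) <= S) -> (forall y, rho < `|y - x0| -> kap y = 0) ->
  0 <= r -> 0 <= rho ->
  normc (cintegral setT (fun y => kap y * h y)) <= S * (1 + r * rho) ^+ A * wmass h r A x0.
Proof.
move=> hi mk kS ks r0 rho0.
have S0 : 0 <= S by apply: le_trans (kS 0); exact: cnorm_ge0.
have c0 : 0 <= (1 + r * rho) ^+ A by rewrite exprn_ge0// addr_ge0// mulr_ge0.
have khi : cintegrable (fun y => kap y * h y).
  by apply: eq_cintegrable (cintegrableM hi mk kS) => x; exact: mulrC.
have wi := wt_integrable A x0 hi r0.
apply: (le_normc_cintegral
  (h := fun y => S * (1 + r * rho) ^+ A * normc (h y * (wt r A x0 y)%:C)) khi).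
- by apply: measurable_funM => //; apply: cmeasurable_normc; case: wi.
- move=> y; rewrite Normc.normcM normc_wt//.
  have [hy|hy] := lerP `|y - x0| rho; last first.
    by rewrite ks// Normc.normc0 mul0r !mulr_ge0 ?cnorm_ge0 ?wt_ge0.
  rewrite -mulrA; apply: ler_pM => //; rewrite ?cnorm_ge0//.
  rewrite mulrCA ler_peMr ?cnorm_ge0// wtE ler_pdivlMr ?mul1r; last first.
    by rewrite exprn_gt0// ltr_pwDl// mulr_ge0.
  by rewrite lerXn2r ?nnegrE ?addr_ge0 ?mulr_ge0// lerD2l ler_wpM2l.
- by rewrite cmassZ ?mulr_ge0.
Qed.

Lemma centered_cintegrable kap (S rho : R) x0 : cmeasurable kap ->
  (forall y, normc (kap y) <= S) -> (forall y, rho < `|y - x0| -> kap y = 0) ->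
  0 <= rho -> cintegrable kap.
Proof.
move=> mk kS ks rho0; apply: (@supported_cintegrable _ _ kap S (rho + `|x0|)) => //.
  exact: addr_ge0.
move=> y hy; apply: ks; rewrite -(ltrD2r `|x0|); apply: lt_le_trans hy _.
by rewrite -{1}(subrK x0 y); exact: ler_normD.
Qed.

Lemma growth_mono (m A : nat) (r u v : R) : 0 <= r -> 0 <= u -> u <= v ->
  r ^+ m * (r * u) * (1 + r * u) ^+ A <= r ^+ m * (r * v) * (1 + r * v) ^+ A.
Proof.
move=> r0 u0 uv; have v0 := le_trans u0 uv.
have m1 : r * u <= r * v by exact: ler_wpM2l.
have m4 : (1 + r * u) ^+ A <= (1 + r * v) ^+ A.
  by rewrite lerXn2r ?nnegrE ?addr_ge0 ?lerD2l ?mulr_ge0.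
apply: ler_pM m4; last by rewrite ler_wpM2l ?exprn_ge0.
- by rewrite mulr_ge0 ?exprn_ge0 ?mulr_ge0.
- by rewrite exprn_ge0 ?addr_ge0 ?mulr_ge0.
Qed.

(** A function reproduced by convolution with a kernel at scale [r^-1] varies
    slowly at smaller scales, so pairing with a mean-zero [kap] gains a power
    of [r * rho]. *)
Lemma local_pairing_mean0 h kap ker (c : R[i]) (D C S rho r : R) A x0 :
  cintegrable h -> cintegrable ker -> (forall x, normc (ker x) <= D) ->
  kdecay A C r ker -> 0 <= C -> 0 < normc c -> (forall x, cconv h ker x = c * h x) ->
  cmeasurable kap ->
  (forall y, normc (kap y) <= S) -> (forall y, rho < `|y - x0| -> kap y = 0) ->
  cintegral setT kap = 0 -> 0 <= r -> 0 <= rho ->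
  normc (cintegral setT (fun y => kap y * h y)) <=
   (normc c)^-1 * (S * C * ((2 * rho) ^+ n * (r ^+ n * (r * rho) * (1 + r * rho) ^+ A)))
     * wmass h r A x0.
Proof.
move=> hi ki kD kd C0 c0 rep mk kS ks k0 r0 rho0.
have S0 : 0 <= S by apply: le_trans (kS 0); exact: cnorm_ge0.
have kapi := centered_cintegrable mk kS ks rho0.
have mker : cmeasurable ker by case: ki.
have [P PE] : {P : R | P = r ^+ n * (r * rho) * (1 + r * rho) ^+ A} by eexists.
rewrite -PE; have P0 : 0 <= P by rewrite PE !mulr_ge0 ?exprn_ge0 ?addr_ge0 ?mulr_ge0.
have wi := wt_integrable A x0 hi r0.
have khi : cintegrable (fun y => kap y * h y).
  by apply: eq_cintegrable (cintegrableM hi mk kS) => x; exact: mulrC.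
(* subtracting the constant [ker (x0 - w)] is free since [kap] has mean zero *)
have J w : normc (cintegral setT (fun y => kap y * ker (y - w))) <=
    S * C * ((2 * rho) ^+ n * P) * wt r A x0 w.
  have kti : cintegrable (fun y => kap y * ker (y - w)).
    have mt : cmeasurable (fun y => ker (y - w)).
      by apply: eq_cmeasurable (cmeasurable_translate (- w) mker) => y; rewrite addrC.
    exact: (cintegrableM kapi mt (fun y => kD (y - w))).
  have ci : cintegrable (fun y => kap y * ker (x0 - w)).
    exact: (cintegrableM kapi (cmeasurable_cst _) (fun y => kD (x0 - w))).
  have -> : cintegral setT (fun y => kap y * ker (y - w)) =
      cintegral setT (fun y => kap y * (ker (y - w) - ker (x0 - w))).
    transitivity (cintegral setT (fun y => kap y * ker (y - w)) -
                  cintegral setT (fun y => kap y * ker (x0 - w))).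
      suff -> : cintegral setT (fun y => kap y * ker (x0 - w)) = 0 by rewrite subr0.
      transitivity (cintegral setT (fun y => ker (x0 - w) * kap y)).
        by apply: eq_cintegral => y; exact: mulrC.
      by rewrite (cintegralZ _ kapi) k0 mulr0.
    by rewrite -(cintegralB kti ci); apply: eq_cintegral => y; rewrite mulrBr.
  have di : cintegrable (fun y => kap y * (ker (y - w) - ker (x0 - w))).
    by apply: eq_cintegrable (cintegrableB kti ci) => y; rewrite mulrBr.
  apply: (le_normc_cintegral (h := fun y => S * C * P * wt r A x0 w *
      \1_[set y : E | `|y - x0| <= rho] y) di).
  - apply: measurable_funM; first exact: measurable_cst.
    exact: measurable_indic (measurable_cball x0 rho).
  - move=> y; rewrite Normc.normcM indicE; case: (boolP (_ \in _)); last first.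
      by rewrite notin_setE /= => /negP; rewrite -ltNge => /ks ->; rewrite Normc.normc0 mul0r mulr0 lexx.
    rewrite inE /= => hy; rewrite mulr1 -!mulrA; apply: (ler_pM (cnorm_ge0 _) (cnorm_ge0 _) (kS y)).
    have -> : y - w = (x0 - w) + (y - x0) by rewrite [RHS]addrC addrA subrK.
    apply: (le_trans (proj2 kd _ _)); apply: (ler_wpM2l C0).
    rewrite (distrC x0 w) -(wtE r A x0 w) PE.
    apply: (ler_wpM2r (wt_ge0 A x0 w r0)).
    move: (normr_ge0 (y - x0)) hy; move: `|y - x0| => u u0 hu.
    exact: growth_mono r0 u0 hu.
  - under eq_integral do rewrite EFinM.
    have K0 : 0 <= S * C * P * wt r A x0 w.
      by rewrite mulr_ge0 ?wt_ge0// mulr_ge0// mulr_ge0.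
    have mI : measurable_fun setT (fun y : E => (\1_[set y : E | `|y - x0| <= rho] y : R)%:E).
      by apply/measurable_EFinP; exact: measurable_indic (measurable_cball x0 rho).
    have I0 (y : E) : setT y -> (0 <= (\1_[set y : E | `|y - x0| <= rho] y : R)%:E)%E.
      by rewrite lee_fin.
    rewrite (ge0_integralZl_EFin _ measurableT I0 mI K0).
    rewrite (integral_indic_ball x0 rho0) -EFinM lee_fin.
    suff -> : S * C * P * wt r A x0 w * (2 * rho) ^+ n = S * C * ((2 * rho) ^+ n * P) * wt r A x0 w by exact: lexx.
    ring.
have [_ i2 e] := cconv_pairing hi ki kD mk kS.
have e' : c * cintegral setT (fun y => kap y * h y) =
    cintegral setT (fun y => h y * cintegral setT (fun x => kap x * ker (x - y))).
  rewrite -e -(cintegralZ c khi); apply: eq_cintegral => y; rewrite rep; ring.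
rewrite -mulrA (ler_pdivlMl _ _ c0) -Normc.normcM e' {e e'}.
set K0 := S * C * _ in J *.
have K00 : 0 <= K0 by rewrite !mulr_ge0 ?exprn_ge0 ?mulr_ge0.
apply: (le_normc_cintegral (h := fun y => K0 * normc (h y * (wt r A x0 y)%:C)) i2).
- by apply: measurable_funM => //; apply: cmeasurable_normc; case: wi.
- move=> y; rewrite Normc.normcM normc_wt// mulrCA ler_wpM2l ?cnorm_ge0//.
- by rewrite cmassZ.
Qed.

(** A weighted Nikolskii inequality: the reproducing kernel bounds a value by
    a mean over its scale. *)
Lemma weighted_sup h ker (c : R[i]) (D C s r : R) A x z :
  cintegrable h -> cintegrable ker -> (forall x, normc (ker x) <= D) ->
  kdecay A C s ker -> 0 <= C -> 0 < normc c -> (forall x, cconv h ker x = c * h x) ->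
  0 <= r -> r <= s ->
  normc (h z) * wt r A x z <= (normc c)^-1 * C * s ^+ n * wmass h r A x.
Proof.
move=> hi ki kD kd C0 c0 rep r0 rs.
have s0 : 0 <= s by exact: le_trans rs.
have mker : cmeasurable ker by case: ki.
rewrite -!mulrA ler_pdivlMl// [normc c * _]mulrA -Normc.normcM -rep [leRHS]mulrA.
have wi := wt_integrable A x hi r0.
have hki := cconv_integrand_integrable z hi mker kD.
have W0 := wt_ge0 A x z r0.
have -> : normc (cconv h ker z) * wt r A x z =
    normc (cintegral setT (fun w => (wt r A x z)%:C * (h w * ker (z - w)))).
  by rewrite (cintegralZ _ hki) Normc.normcM cnorm_real ger0_norm// mulrC.
have whki := cintegrableZ (wt r A x z)%:C hki.
apply: (le_normc_cintegral (h := fun y => C * s ^+ n * normc (h y * (wt r A x y)%:C)) whki).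
- by apply: measurable_funM => //; apply: cmeasurable_normc; case: wi.
- move=> w; rewrite normc_wt// !Normc.normcM cnorm_real ger0_norm//.
  rewrite [leLHS]mulrCA [leRHS]mulrCA ler_wpM2l ?cnorm_ge0//.
  have p : 0 < (1 + s * `|z - w|) ^+ A by rewrite exprn_gt0// ltr_pwDl// mulr_ge0.
  apply: (@le_trans _ _ (wt r A x w * (1 + s * `|z - w|) ^+ A * normc (ker (z - w)))).
    rewrite ler_wpM2r ?cnorm_ge0//; apply: (le_trans (wt_shift A x z w r0)).
    rewrite ler_wpM2l ?wt_ge0// lerXn2r ?nnegrE ?addr_ge0 ?mulr_ge0// lerD2l.
    by rewrite ler_wpM2r.
  rewrite -mulrA [leRHS]mulrC ler_wpM2l ?wt_ge0// mulrC -ler_pdivlMr//.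
  by rewrite -mulrA; exact: (proj1 kd).
- by rewrite cmassZ ?mulr_ge0 ?exprn_ge0.
Qed.

End local_means.

(** * Littlewood-Paley pieces against local functions *)
Section pieces.
Context {R : realType} {n : nat}.
Local Notation normc := (@Normc.normc R).
Local Notation E := 'rV[R]_n.
Local Notation mu := (@lebesgue_row R n).
Local Notation ift := (@inverse_fourier R n).
Implicit Types (f g h kap ker : E -> R[i]) (x y z w : E).
Variable phi0 : E -> R[i].
Hypothesis LP : LP_generator phi0.
Local Notation piece f j := (cconv f (psi phi0 j)).

Lemma LP_const_gt0 : 0 < normc (LP_const phi0).
Proof. by rewrite lt_neqAle cnorm_ge0 andbT eq_sym cnorm_eq0; exact: LP_const_neq0. Qed.

Lemma wmass_scale h (r s : R) A x : cintegrable h -> 0 <= r -> r <= s ->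
  wmass h s A x <= wmass h r A x.
Proof.
move=> hi r0 rs; have s0 := le_trans r0 rs.
have h1 := wt_integrable A x hi s0; have h2 := wt_integrable A x hi r0.
rewrite -lee_fin /wmass -(cmassE h1) -(cmassE h2); apply: ge0_le_integral => //.
- by move=> w _; rewrite lee_fin cnorm_ge0.
- by apply/measurable_EFinP; apply: cmeasurable_normc; case: h1.
- by apply/measurable_EFinP; apply: cmeasurable_normc; case: h2.
- move=> w _; rewrite lee_fin (normc_wt h A x w s0) (normc_wt h A x w r0).
  apply: (ler_wpM2l (cnorm_ge0 _)); rewrite !wtE.
  move: `|w - x| (normr_ge0 (w - x)) => u u0.
  rewrite lef_pV2 ?posrE ?exprn_gt0 ?ltr_pwDl ?mulr_ge0//.
  by rewrite lerXn2r ?nnegrE ?addr_ge0 ?mulr_ge0// lerD2l ler_wpM2r.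
Qed.

(** Piece [j] is observed from a cube of side [2 ^- N] at the coarser of the
    two scales, and it contributes with the gain [gam]. *)
Definition rr (N j : nat) : R := 2 ^+ minn j N.
Definition gam (N j : nat) : R := (2 ^+ (N - j)) ^- n.+1.

Lemma rr_gt0 N j : 0 < rr N j. Proof. by rewrite exprn_gt0. Qed.
Lemma gam_ge0 N j : 0 <= gam N j. Proof. by rewrite invr_ge0 !exprn_ge0. Qed.
Lemma rr_le N j : rr N j <= 2 ^+ j.
Proof. by rewrite ler_eXn2l ?ltr1n// geq_minl. Qed.

Definition pterm A N f x j := gam N j * wmass (piece f j) (rr N j) A x.

Lemma pterm_ge0 A N f x j : 0 <= pterm A N f x j.
Proof. by rewrite mulr_ge0 ?gam_ge0 ?wmass_ge0. Qed.

(** For [j >= N] only the size of [kap] is used. For [j < N] the cube is small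
    compared with the wave length: mean zero gains [2 ^- (N - j)], and the
    volume of the cube compared with that of the ball over which [wmass]
    averages gains its [n]-th power. *)
Lemma piece_local A : exists2 C : R, 0 <= C & forall N j f kap (S rho : R) x0,
  cintegrable f -> cmeasurable kap -> (forall y, normc (kap y) <= S) -> 1 <= rho ->
  (forall y, rho * 2 ^- N < `|y - x0| -> kap y = 0) -> cintegral setT kap = 0 ->
  normc (cintegral setT (fun y => kap y * piece f j y)) <=
   C * (S * (1 + rho) ^+ (A + n.+1) * pterm A N f x0 j).
Proof.
have [C1 C10 hC1] := low_kdecay LP A.
set c := normc (LP_const phi0); have c0 : 0 < c := LP_const_gt0.
exists (c^-1 * C1 * (4 ^+ n * 2) + 1).
  have ci : 0 <= c^-1 by rewrite invr_ge0 ltW.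
  by rewrite addr_ge0// mulr_ge0 ?mulr_ge0 ?exprn_ge0.
move=> N j f kap S rho x0 fi mk kS rho1 ks k0.
have S0 : 0 <= S by apply: le_trans (kS 0); exact: cnorm_ge0.
have rho0 : 0 <= rho by exact: le_trans rho1.
have fji : cintegrable (piece f j) by exact: piece_integrable.
have rN0 : 0 <= rho * 2 ^- N by rewrite mulr_ge0// invr_ge0 exprn_ge0.
have W0 := wmass_ge0 (piece f j) (rr N j) A x0.
have r1 : 1 <= 1 + rho by rewrite lerDl.
(* [j >= N]: the gain is [1] and the scale of observation is that of the
   cube *)
rewrite /pterm; have [jN|Nj] := ltnP j N; last first.
  have -> : gam N j = 1.
    by rewrite /gam (eqP (_ : (N - j)%N == 0%N)) ?subn_eq0// expr0 expr1n invr1.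
  have rE : rr N j = 2 ^+ N by rewrite /rr (minn_idPr Nj).
  have := local_pairing A fji mk kS ks (ltW (rr_gt0 N j)) rN0.
  have -> : rr N j * (rho * 2 ^- N) = rho.
    by rewrite rE mulrC -mulrA mulVf ?mulr1// expf_neq0.
  move=> /le_trans; apply.
  rewrite mulrDl mul1r mul1r; apply: ler_wpDl.
    by rewrite !mulr_ge0 ?exprn_ge0 ?invr_ge0 ?(ltW c0)// (le_trans _ r1).
  apply: (ler_wpM2r W0); apply: (ler_wpM2l S0).
  by rewrite ler_weXn2l// leq_addr.
set r : R := 2 ^+ j.+1.
have r0 : 0 <= r by rewrite exprn_ge0.
have := local_pairing_mean0 fji (low_integrable LP j.+1) (low_bounded LP j.+1)
  (hC1 j.+1) C10 c0 (fun x => piece_reproduce LP j x fi) mk kS ks k0 r0 rN0.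
move=> /le_trans; apply.
(* the reproducing kernel has scale [2 ^- j.+1], finer than the scale of
   observation *)
have sc : wmass (piece f j) r A x0 <= wmass (piece f j) (rr N j) A x0.
  apply: wmass_scale => //; first exact/ltW/rr_gt0.
  by rewrite ler_eXn2l ?ltr1n// (leq_trans (geq_minl _ _)).
pose e : R := 2 ^- (N - j).
have e0 : 0 <= e by rewrite invr_ge0 exprn_ge0.
have e2 : 2 * e <= 1.
  rewrite ler_pdivrMr ?exprn_gt0// mul1r -{1}(expr1 2) ler_eXn2l ?ltr1n//.
  by rewrite subn_gt0.
have re : r * (rho * 2 ^- N) = rho * (2 * e).
  rewrite mulrCA; congr (_ * _).
  rewrite /r /e exprS -mulrA; congr (_ * _).
  apply: (mulIf (x := 2 ^+ N)); first by rewrite expf_neq0.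
  rewrite -mulrA mulVf ?expf_neq0// mulr1.
  rewrite -[X in _ = _ * 2 ^+ X](subnK (ltnW jN)) exprD mulrA mulVf ?mul1r//.
set Z := _ ^+ n * _.
have Zle : Z <= (4 ^+ n * 2) * ((1 + rho) ^+ (A + n.+1) * gam N j).
  have -> : Z = (2 * (r * (rho * 2 ^- N))) ^+ n * (r * (rho * 2 ^- N)) * (1 + r * (rho * 2 ^- N)) ^+ A.
    by rewrite /Z !mulrA -exprMn; congr (_ ^+ n * _ * _ * _ * _); ring.
  rewrite re.
  have -> : gam N j = e ^+ n * e by rewrite /gam -exprSr exprVn.
  have -> : (1 + rho) ^+ (A + n.+1) = (1 + rho) ^+ A * ((1 + rho) ^+ n * (1 + rho)).
    by rewrite exprD exprSr.
  have h1 : (2 * (rho * (2 * e))) ^+ n * (rho * (2 * e)) <= (4 ^+ n * 2) * ((1 + rho) ^+ n * (1 + rho)) * (e ^+ n * e).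
    have -> : (2 * (rho * (2 * e))) ^+ n * (rho * (2 * e)) = 4 ^+ n * 2 * (rho ^+ n * rho) * (e ^+ n * e).
      have -> : 2 * (rho * (2 * e)) = 4 * rho * e by ring.
      by rewrite !exprMn; ring.
    have ee : 0 <= e ^+ n * e by rewrite mulr_ge0 ?exprn_ge0.
    apply: (ler_wpM2r ee).
    have c4 : 0 <= 4 ^+ n * 2 :> R by rewrite mulr_ge0 ?exprn_ge0.
    apply: (ler_wpM2l c4); rewrite -!exprSr lerXn2r ?nnegrE ?addr_ge0//.
    by rewrite lerDr.
  have h2 : (1 + rho * (2 * e)) ^+ A <= (1 + rho) ^+ A.
    by rewrite lerXn2r ?nnegrE ?addr_ge0 ?mulr_ge0// lerD2l ler_piMr.
  apply: le_trans (ler_pM _ _ h1 h2) _.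
  - by rewrite !mulr_ge0 ?exprn_ge0 ?mulr_ge0.
  - by rewrite exprn_ge0 ?addr_ge0 ?mulr_ge0.
  - suff -> : 4 ^+ n * 2 * ((1 + rho) ^+ n * (1 + rho)) * (e ^+ n * e) * (1 + rho) ^+ A =
     4 ^+ n * 2 * ((1 + rho) ^+ A * ((1 + rho) ^+ n * (1 + rho)) * (e ^+ n * e)) by exact: lexx.
    ring.
have ci : 0 <= c^-1 by rewrite invr_ge0 ltW.
apply: (@le_trans _ _ (c^-1 * (S * C1 * ((4 ^+ n * 2) * ((1 + rho) ^+ (A + n.+1) * gam N j)))
   * wmass (piece f j) (rr N j) A x0)).
  have Z0 : 0 <= Z by rewrite /Z !mulr_ge0 ?exprn_ge0 ?addr_ge0 ?mulr_ge0.
  have Q0 : 0 <= S * C1 by exact: mulr_ge0.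
  apply: (ler_pM _ (wmass_ge0 _ _ _ _) _ sc).
    exact: mulr_ge0 ci (mulr_ge0 Q0 Z0).
  exact: (ler_wpM2l ci (ler_wpM2l Q0 Zle)).
rewrite mulrDl mul1r; apply: ler_wpDr.
  by rewrite !mulr_ge0 ?exprn_ge0 ?gam_ge0// (le_trans _ r1).
suff -> : c^-1 * (S * C1 * ((4 ^+ n * 2) * ((1 + rho) ^+ (A + n.+1) * gam N j)))
   * wmass (piece f j) (rr N j) A x0 = c^-1 * C1 * (4 ^+ n * 2) *
  (S * (1 + rho) ^+ (A + n.+1) * (gam N j * wmass (piece f j) (rr N j) A x0)) by exact: lexx.
ring.
Qed.

(** Smoothing by [low K] converges weakly against functions that are
    continuous almost everywhere, such as indicators of boxes. *)
Lemma low_approx f kap (B : R) : cintegrable f -> cmeasurable kap ->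
  (forall x, normc (kap x) <= B) -> {ae mu, forall y, ccontinuous_at kap y} ->
  ccvg (fun K => cintegral setT (fun x => kap x * cconv f (low phi0 K) x))
    (LP_const phi0 * cintegral setT (fun x => kap x * f x)).
Proof.
move=> fi mk kB kc.
have bi := ift_cintegrable (LP_cbump LP).
have bb x : normc (ift phi0 x) <= cmass phi0.
  exact: ift_bounded x (cbump_integrable (LP_cbump LP)).
have r0 (k : nat) : 0 < (2 ^- k : R) by rewrite invr_gt0 exprn_gt0.
have rc : (fun k : nat => 2 ^- k : R) @ \oo --> (0 : R).
  have h : `|2^-1 : R| < 1 by rewrite ger0_norm ?invr_ge0// invf_lt1// ltr1n.
  rewrite (_ : (fun k : nat => 2 ^- k : R) = (fun k => 2^-1 ^+ k)); first exact: cvg_expr.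
  by apply/funext => k; rewrite exprVn.
apply: eq_ccvg (cconv_approx fi bi bb mk kB kc r0 rc) => k.
apply: eq_cintegral => x; congr (_ * _).
suff -> : low phi0 k = fun x => ((2 ^- k) ^- n)%:C * ift phi0 ((2 ^- k)^-1 *: x) by [].
by apply/funext => z; rewrite (low_scale LP) invrK exprVn invrK.
Qed.

(** The sum of [piece_local] over all pieces, in the limit of [low_approx]. *)
Lemma full_local A : exists2 C : R, 0 <= C & forall N f kap (S rho B : R) x0,
  cintegrable f -> cmeasurable kap -> (forall y, normc (kap y) <= S) -> 1 <= rho ->
  (forall y, rho * 2 ^- N < `|y - x0| -> kap y = 0) -> cintegral setT kap = 0 ->
  {ae mu, forall y, ccontinuous_at kap y} ->
  (forall K : nat, \sum_(j < K) pterm A N f x0 j <= B) ->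
  normc (cintegral setT (fun y => kap y * f y)) <=
   C * (S * (1 + rho) ^+ (A + n.+1) * B).
Proof.
have [C C0 hC] := piece_local A.
have c0 := LP_const_gt0; set c := normc (LP_const phi0) in c0 *.
exists (c^-1 * C); first by rewrite mulr_ge0// invr_ge0 ltW.
move=> N f kap S rho B x0 fi mk kS rho1 ks k0 kc hB.
have S0 : 0 <= S by apply: le_trans (kS 0); exact: cnorm_ge0.
rewrite -[leRHS]mulrA (ler_pdivlMl _ _ c0) -Normc.normcM.
apply: (ccvg_le (low_approx fi mk kS kc)) => K.
have kfi j : cintegrable (fun x => kap x * piece f j x).
  by apply: eq_cintegrable (cintegrableM (piece_integrable LP j fi) mk kS) => x; exact: mulrC.
have -> : cintegral setT (fun x => kap x * cconv f (low phi0 K) x) =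
    \sum_(j < K.+1) cintegral setT (fun x => kap x * piece f j x).
  have kfi' (j : 'I_K.+1) : cintegrable (fun x => kap x * piece f j x) := kfi j.
  rewrite -(cintegral_sum _ kfi'); apply: eq_cintegral => x.
  by rewrite -(sum_pieces LP K x fi) mulr_sumr.
apply: (le_trans (cnorm_sum _ _ _)).
have P0 : 0 <= S * (1 + rho) ^+ (A + n.+1).
  by rewrite mulr_ge0// exprn_ge0// addr_ge0// (le_trans _ rho1).
apply: (@le_trans _ _ (\sum_(j < K.+1) C * (S * (1 + rho) ^+ (A + n.+1) * pterm A N f x0 j))).
  by apply: ler_sum => j _; exact: hC.
by rewrite -mulr_sumr -mulr_sumr; apply: (ler_wpM2l C0); apply: (ler_wpM2l P0).
Qed.

(** Nikolskii once more: [int u] is at most the supremum of [u] to the power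
    [1 - p] times [int u^p], and the supremum is bounded by [int u] itself. *)
Lemma wmass_powR (p : R) A : 0 < p -> p <= 1 -> exists2 C : R, 0 <= C &
  forall N j f x0, cintegrable f ->
  (((wmass (piece f j) (rr N j) A x0) `^ p)%:E <=
   (C * ((2 ^+ j) ^+ n) `^ (1 - p))%:E *
   \int[mu]_w ((normc (piece f j w)) `^ p * (wt (rr N j) A x0 w) `^ p)%:E)%E.
Proof.
move=> p0 p1.
have [C1 C10 hC1] := low_kdecay LP A.
have c0 := LP_const_gt0; set c := normc (LP_const phi0) in c0 *.
pose D := c^-1 * C1 * 2 ^+ n.
have D0 : 0 <= D by rewrite !mulr_ge0 ?invr_ge0 ?exprn_ge0// ltW.
exists (D `^ (1 - p)); first exact: powR_ge0.
move=> N j f x0 fi; set X := wmass _ _ _ _.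
have X0 : 0 <= X by exact: wmass_ge0.
(* [X] occurs on both sides of [key] and is divided out below *)
have [->|Xn0] := eqVneq X 0.
  rewrite powR0 ?gt_eqF// mule_ge0//.
    by rewrite lee_fin mulr_ge0 ?powR_ge0.
  by apply: integral_ge0 => w _; rewrite lee_fin mulr_ge0 ?powR_ge0.
have Xp : 0 < X by rewrite lt_neqAle eq_sym Xn0.
have fji : cintegrable (piece f j) by exact: piece_integrable.
have rr0 := ltW (rr_gt0 N j).
have wi := wt_integrable A x0 fji rr0.
pose u w := normc (piece f j w) * wt (rr N j) A x0 w.
have u0 w : 0 <= u w by rewrite mulr_ge0 ?cnorm_ge0 ?wt_ge0.
pose M := D * (2 ^+ j) ^+ n * X.
have jn0 : 0 <= (2 ^+ j) ^+ n :> R by rewrite !exprn_ge0.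
have M0 : 0 <= M := mulr_ge0 (mulr_ge0 D0 jn0) X0.
have uM w : u w <= M.
  have rs : rr N j <= 2 ^+ j.+1 by rewrite (le_trans (rr_le N j))// ler_eXn2l ?ltr1n.
  have := weighted_sup x0 w fji (low_integrable LP j.+1) (low_bounded LP j.+1)
    (hC1 j.+1) C10 c0 (fun x => piece_reproduce LP j x fi) rr0 rs.
  rewrite -/c -/X -/(u w) => /le_trans; apply.
  suff -> : c^-1 * C1 * (2 ^+ j.+1) ^+ n * X = M by exact: lexx.
  by rewrite /M /D exprS exprMn; ring.
have um w : u w <= M `^ (1 - p) * (u w) `^ p.
  have [->|un0] := eqVneq (u w) 0; first by rewrite mulr_ge0 ?powR_ge0.
  have up : 0 < u w by rewrite lt_neqAle eq_sym un0 u0.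
  rewrite -{1}(powRr1 (u0 w)) -{1}(subrK p 1) powRD; last first.
    by rewrite un0 implybT.
  apply: (ler_wpM2r (powR_ge0 _ _)); apply: ge0_ler_powR; rewrite ?nnegrE ?subr_ge0//.
have mu1 : measurable_fun setT u.
  have [m1 _] := wi; have := cmeasurable_normc m1; apply: eq_measurable_fun => w _.
  exact: normc_wt.
have mup : measurable_fun setT (fun w => (u w) `^ p).
  exact: (measurableT_comp (measurable_powR p) mu1).
pose I := (\int[mu]_w ((u w) `^ p)%:E)%E.
have -> : (\int[mu]_w ((normc (piece f j w)) `^ p * (wt (rr N j) A x0 w) `^ p)%:E = I)%E.
  by apply: eq_integral => w _; rewrite /u powRM ?cnorm_ge0 ?wt_ge0.
have key : (X%:E <= (M `^ (1 - p))%:E * I)%E.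
  rewrite /X /wmass -(cmassE wi) -ge0_integralZl_EFin ?powR_ge0//; last 2 first.
  - by move=> w _; rewrite lee_fin powR_ge0.
  - exact/measurable_EFinP.
  apply: ge0_le_integral => //.
  - by move=> w _; rewrite lee_fin cnorm_ge0.
  - by apply/measurable_EFinP; apply: cmeasurable_normc; case: wi.
  - by apply/measurable_EFinP; apply: measurable_funM.
  - by move=> w _; rewrite -EFinM lee_fin (normc_wt _ _ _ _ rr0); exact: um.
have Xq : 0 < X `^ (1 - p) by rewrite powR_gt0.
rewrite -(lee_pmul2l (_ : (X `^ (1 - p))%:E \is a fin_num)) ?lte_fin//.
rewrite -EFinM -powRD ?subrK; last by rewrite Xn0 implybT.
rewrite (powRr1 X0) muleA -EFinM.
suff -> : X `^ (1 - p) * (D `^ (1 - p) * ((2 ^+ j) ^+ n) `^ (1 - p)) = M `^ (1 - p) by [].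
by rewrite /M (powRM _ (mulr_ge0 D0 jn0) X0) (powRM _ D0 jn0); exact: mulrC.
Qed.

End pieces.

(** * Local quantities summed over a grid of cubes *)
Lemma pterm_unfold (R : realType) (n : nat) (phi0 : 'rV[R]_n -> R[i]) A N f x j :
  pterm phi0 A N f x j = @gam R n N j * wmass (cconv f (psi phi0 j)) (rr N j) A x.
Proof. by []. Qed.

Opaque wmass pterm.

Section sums_of_powers.
Context {R : realType}.

Lemma powR_pred (y th : R) : 0 < y -> y `^ th = y * y `^ (th - 1).
Proof.
move=> y0; rewrite -{2}(powRr1 (ltW y0)) -powRD ?(lt0r_neq0 y0) ?implybT//.
by rewrite addrC subrK.
Qed.

Lemma powR_predV (y z th : R) : 0 < y -> y <= z -> th <= 1 -> z `^ (th - 1) <= y `^ (th - 1).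
Proof.
move=> y0 yz th1; have z0 := lt_le_trans y0 yz.
rewrite -opprB !powRN lef_pV2 ?posrE ?powR_gt0//.
by apply: ge0_ler_powR; rewrite ?nnegrE ?subr_ge0// ltW.
Qed.

Lemma powR_inv (y th : R) : 0 < y -> y^-1 `^ th = y `^ (- th).
Proof. by move=> y0; rewrite -(powR_inv1 (ltW y0)) -powRrM mulN1r. Qed.

Lemma sum_powR_ge1 (I : finType) (x : I -> R) (th : R) : (forall i, 0 <= x i) -> 1 <= th ->
  \sum_i (x i) `^ th <= (\sum_i x i) `^ th.
Proof.
move=> x0 th1; set S := \sum_i x i.
have S0 : 0 <= S by apply: sumr_ge0.
have th0 : 0 <= th - 1 by rewrite subr_ge0.
have split (y : R) : 0 <= y -> y `^ th = y * y `^ (th - 1).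
  move=> y0; have [->|yn] := eqVneq y 0.
    by rewrite mul0r powR0// gt_eqF// (lt_le_trans _ th1).
  by rewrite -{2}(powRr1 y0) -powRD ?yn ?implybT// addrC subrK.
rewrite (split S S0) {1}/S mulr_suml; apply: ler_sum => i _.
rewrite (split _ (x0 i)); apply: (ler_wpM2l (x0 i)).
apply: ge0_ler_powR; rewrite ?nnegrE//.
by rewrite /S (bigD1 i)//= lerDl sumr_ge0.
Qed.

Lemma sum_powR_le1 (I : Type) (r : seq I) (x : I -> R) (th : R) :
  (forall i, 0 <= x i) -> 0 < th -> th <= 1 ->
  (\sum_(i <- r) x i) `^ th <= \sum_(i <- r) (x i) `^ th.
Proof.
move=> x0 th0 th1.
have sub (a b : R) : 0 <= a -> 0 <= b -> (a + b) `^ th <= a `^ th + b `^ th.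
  move=> a0 b0; have [->|S0] := eqVneq (a + b) 0.
    by rewrite powR0 ?gt_eqF// addr_ge0 ?powR_ge0.
  have ab : 0 < a + b by rewrite lt_neqAle eq_sym S0 addr_ge0.
  have h (y : R) : 0 <= y -> y <= a + b -> y * (a + b) `^ (th - 1) <= y `^ th.
    move=> y0 yab; have [->|yn] := eqVneq y 0; first by rewrite mul0r powR_ge0.
    have yp : 0 < y by rewrite lt_neqAle eq_sym yn.
    by rewrite (powR_pred _ yp); apply: (ler_wpM2l y0); exact: powR_predV.
  rewrite (powR_pred _ ab) mulrDl.
  by apply: lerD; apply: h => //; rewrite ?lerDl ?lerDr.
elim: r => [|i r IH]; first by rewrite !big_nil powR0 ?gt_eqF.
rewrite !big_cons; apply: (le_trans (sub _ _ (x0 i) _)); first exact: sumr_ge0.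
by rewrite lerD2l.
Qed.

(** Jensen's inequality up to a constant: split the terms at the threshold
    [#|I|^-1]. *)
Lemma sum_powR_card (I : finType) (b : I -> R) (th C : R) : (0 < #|I|)%N ->
  (forall i, 0 <= b i) -> 0 <= th -> th <= 1 -> \sum_i b i <= C ->
  \sum_i (b i) `^ th <= (1 + C) * (#|I|%:R) `^ (1 - th).
Proof.
move=> I0 b0 th0 th1 bC; pose M : R := #|I|%:R.
have M0 : 0 < M by rewrite ltr0n.
have h i : (b i) `^ th <= M `^ (- th) + b i * M `^ (1 - th).
  have [bM|bM] := lerP (b i) M^-1.
    apply: (@le_trans _ _ (M^-1 `^ th)).
      by apply: ge0_ler_powR => //; rewrite nnegrE// invr_ge0 ltW.
    by rewrite (powR_inv _ M0) lerDl mulr_ge0 ?powR_ge0.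
  have Mi : 0 < M^-1 by rewrite invr_gt0.
  have bp : 0 < b i by exact: lt_trans bM.
  apply: ler_wpDl; first exact: powR_ge0.
  have -> : M `^ (1 - th) = M^-1 `^ (th - 1) by rewrite (powR_inv _ M0) opprB.
  rewrite (powR_pred _ bp); apply: (ler_wpM2l (b0 i)).
  by apply: powR_predV => //; exact: ltW.
apply: (@le_trans _ _ (\sum_i (M `^ (- th) + b i * M `^ (1 - th)))).
  by apply: ler_sum.
rewrite big_split /= sumr_const -mulr_suml mulrDl mul1r.
apply: lerD; last by apply: ler_wpM2r; rewrite ?powR_ge0.
by rewrite -[_ *+ _]mulr_natl powRD ?(lt0r_neq0 M0) ?implybT// powRr1// ltW.
Qed.

End sums_of_powers.

Section grid.
Context {R : realType} {n : nat}.
Local Notation normc := (@Normc.normc R).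
Local Notation E := 'rV[R]_n.
Local Notation mu := (@lebesgue_row R n).
Implicit Types (f g h kap ker : E -> R[i]) (x y z w : E).

Lemma measurable_wt (r : R) A x : 0 <= r -> measurable_fun setT (wt r A x).
Proof.
move=> r0; have -> : wt r A x = fun w => (1 + r * `|w - x|) ^- A.
  by apply/funext => w; rewrite wtE.
exact: measurable_weight.
Qed.

Definition gbox (N : nat) x : set E := box x (x + const_mx (2 ^- N)).

Lemma measurable_gbox N x : measurable (gbox N x). Proof. exact: measurable_box. Qed.

Lemma gbox_dist N x y : gbox N x y -> `|y - x| <= 2 ^- N.
Proof.
have p0 : 0 <= (2 ^- N : R) by rewrite invr_ge0 exprn_ge0.
move=> h; apply/row_norm_le => // i; have := h i; rewrite !mxE.
by move: (2 ^- N) => e /andP[? ?]; rewrite ler_norml; apply/andP; split; lra.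
Qed.

Lemma lebesgue_gbox N x : mu (gbox N x) = (((2 ^- N) ^+ n)%:E)%E.
Proof.
rewrite /gbox lebesgue_box.
  rewrite (eq_bigr (fun=> 2 ^- N)) ?prodr_const ?card_ord// => i _.
  by rewrite !mxE addrC addrK.
by move=> i; rewrite !mxE lerDl invr_ge0 exprn_ge0.
Qed.

Lemma integral_indic_gbox N x :
  (\int[mu]_y (\1_(gbox N x) y)%:E = ((2 ^- N) ^+ n)%:E)%E.
Proof.
rewrite integral_indic; [|exact: measurableT|exact: measurable_gbox].
by rewrite setIT; exact: lebesgue_gbox.
Qed.

Variables (T : finType) (pt : T -> E) (N : nat).
Hypothesis disj : forall y, \sum_t (\1_(gbox N (pt t)) y : R) <= 1.

(** A Riemann sum of the weight: its value at the corner of a cube is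
    comparable to its mean over the cube, the cubes being no larger than the
    scale of the weight. *)
Lemma grid_weight_sum (r : R) w : 0 < r -> r <= 2 ^+ N ->
  \sum_t wt r n.+1 (pt t) w <= 2 ^+ n.+1 * @weight_mass R n * (2 ^+ N / r) ^+ n.
Proof.
move=> r0 rN; have N0 : 0 < (2 ^+ N : R) by rewrite exprn_gt0.
pose F t y : R := (2 ^+ N) ^+ n * (\1_(gbox N (pt t)) y * (2 ^+ n.+1 * wt r n.+1 w y)).
have mF t : measurable_fun setT (F t).
  apply: measurable_funM; first exact: measurable_cst.
  apply: measurable_funM; first exact: measurable_indic (measurable_gbox N (pt t)).
  apply: measurable_funM; first exact: measurable_cst.
  exact: measurable_wt (ltW r0).
have w0 y : 0 <= 2 ^+ n.+1 * wt r n.+1 w y by rewrite mulr_ge0 ?exprn_ge0 ?wt_ge0 ?ltW.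
have F0 t y : 0 <= F t y by rewrite mulr_ge0 ?exprn_ge0 ?(ltW N0)// mulr_ge0.
have key t : ((wt r n.+1 (pt t) w)%:E <= \int[mu]_y (F t y)%:E)%E.
  have -> : ((wt r n.+1 (pt t) w)%:E =
      \int[mu]_y (((2 ^+ N) ^+ n * wt r n.+1 (pt t) w)%:E * (\1_(gbox N (pt t)) y)%:E))%E.
    rewrite ge0_integralZl_EFin//; last 2 first.
    - by apply/measurable_EFinP; exact: measurable_indic (measurable_gbox N (pt t)).
    - by rewrite mulr_ge0 ?exprn_ge0 ?wt_ge0// ltW.
    rewrite integral_indic_gbox -EFinM mulrAC -exprMn divff ?expr1n ?mul1r//.
  apply: ge0_le_integral => //.
  - by move=> y _; rewrite -EFinM lee_fin !mulr_ge0 ?exprn_ge0 ?wt_ge0// ltW.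
  - apply/measurable_EFinP; apply: measurable_funM; first exact: measurable_cst.
    exact: measurable_indic (measurable_gbox N (pt t)).
  - exact/measurable_EFinP.
  - move=> y _; rewrite -EFinM lee_fin /F -mulrA; apply: ler_wpM2l.
      by rewrite !exprn_ge0.
    rewrite indicE; case: (boolP (_ \in _)); last by rewrite mulr0 mul0r.
    rewrite inE => /gbox_dist hy; rewrite mulr1 mul1r !wtE.
    have h3 : `|y - w| <= `|w - pt t| + 2 ^- N.
      have -> : y - w = (y - pt t) + (pt t - w) by rewrite addrA subrK.
      by apply: le_trans (ler_normD _ _) _; rewrite addrC (distrC (pt t) w) lerD2l.
    move: `|y - w| `|w - pt t| (normr_ge0 (y - w)) (normr_ge0 (w - pt t)) h3 => u v u0 v0 uv.
    have r0' := ltW r0.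
    have p1 : 0 < 1 + r * u by rewrite ltr_pwDl ?mulr_ge0.
    have p2 : 0 < 1 + r * v by rewrite ltr_pwDl ?mulr_ge0.
    rewrite -[leLHS]mul1r ler_pdivrMr ?exprn_gt0// mulrAC ler_pdivlMr ?exprn_gt0// mul1r.
    rewrite -exprMn lerXn2r ?nnegrE ?(ltW p1) ?mulr_ge0 ?(ltW p2)//.
    have : r * u <= r * v + r * 2 ^- N by rewrite -mulrDr ler_wpM2l// ltW.
    have : r * 2 ^- N <= 1 by rewrite ler_pdivrMr// mul1r.
    have : 0 <= r * v by rewrite mulr_ge0// ltW.
    by move: (r * 2 ^- N) (r * u) (r * v) => a b c; lra.
rewrite -lee_fin -sumEFin.
apply: (@le_trans _ _ (\sum_t \int[mu]_y (F t y)%:E)%E); first by apply: lee_sum => t _.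
rewrite -ge0_integral_sum//; last 2 first.
- by move=> t; exact/measurable_EFinP.
- by move=> t y _; rewrite lee_fin.
apply: (@le_trans _ _ (\int[mu]_y (((2 ^+ N) ^+ n * 2 ^+ n.+1)%:E * ((1 + r * `|y - w|) ^- n.+1)%:E))%E).
  apply: ge0_le_integral => //.
  - by move=> y _; apply: sume_ge0 => t _; rewrite lee_fin.
  - by apply: emeasurable_sum => // t; exact/measurable_EFinP.
  - apply/measurable_EFinP; apply: measurable_funM; first exact: measurable_cst.
    exact: measurable_weight (ltW r0).
  - move=> y _; rewrite sumEFin -EFinM lee_fin /F -mulr_sumr -mulr_suml -wtE -[leRHS]mulrA.
    apply: ler_wpM2l; first by rewrite !exprn_ge0.
    by rewrite -[leRHS]mul1r; apply: ler_wpM2r.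
rewrite ge0_integralZl_EFin//; last 2 first.
- by move=> y _; rewrite lee_fin weight_ge0// mulr_ge0// ltW.
- by apply/measurable_EFinP; exact: measurable_weight (ltW r0).
rewrite (weight_integral _ r0) -EFinM lee_fin expr_div_n.
suff -> : (2 ^+ N) ^+ n * 2 ^+ n.+1 * (r ^- n * @weight_mass R n) =
  2 ^+ n.+1 * @weight_mass R n * ((2 ^+ N) ^+ n / r ^+ n) by exact: lexx.
ring.
Qed.

Lemma weight_powR (t p : R) (A m : nat) : 0 <= t -> m%:R <= A%:R * p ->
  ((1 + t) ^- A) `^ p <= (1 + t) ^- m.
Proof.
move=> t0 mA; have p1 : 1 <= 1 + t by rewrite lerDl.
have p2 : 0 < 1 + t by exact: lt_le_trans p1.
rewrite powR_inv ?exprn_gt0// -!powR_mulrn ?(ltW p2)// -powRrM mulrN powRN.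
by rewrite lef_pV2 ?posrE ?powR_gt0//; apply: ler_powR.
Qed.

Lemma wt_powR (r p : R) (A m : nat) x w : 0 <= r -> m%:R <= A%:R * p ->
  (wt r A x w) `^ p <= wt r m x w.
Proof. by move=> r0 mA; rewrite !wtE; apply: weight_powR => //; exact: mulr_ge0. Qed.

Definition pmass (p : R) h : \bar R := (\int[mu]_x ((normc (h x)) `^ p)%:E)%E.

Lemma pmass_ge0 p h : (0 <= pmass p h)%E.
Proof. by apply: integral_ge0 => x _; rewrite lee_fin powR_ge0. Qed.

Lemma measurable_normc_powR p h : cmeasurable h ->
  measurable_fun setT (fun x => (normc (h x)) `^ p).
Proof. by move=> /cmeasurable_normc mh; exact: (measurableT_comp (measurable_powR p) mh). Qed.

(** At scale [r^-1] about [(2 ^+ N / r) ^+ n] of the cubes see the same point.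
    *)
Lemma grid_pmass_sum (r p : R) (A : nat) h : 0 < r -> r <= 2 ^+ N ->
  n.+1%:R <= A%:R * p -> 0 <= p -> cmeasurable h ->
  (\sum_t \int[mu]_w ((normc (h w)) `^ p * (wt r A (pt t) w) `^ p)%:E <=
  (2 ^+ n.+1 * @weight_mass R n * (2 ^+ N / r) ^+ n)%:E * pmass p h)%E.
Proof.
move=> r0 rN Ap p0 mh; have mp := measurable_normc_powR p mh.
have mw t : measurable_fun setT (fun w => (wt r A (pt t) w) `^ p).
  apply: (measurableT_comp (measurable_powR p)).
  exact: measurable_wt (ltW r0).
set K := _ * _ * _; have K0 : 0 <= K.
  by rewrite !mulr_ge0 ?exprn_ge0 ?weight_mass_ge0// divr_ge0 ?exprn_ge0 ?ltW.
rewrite /pmass -ge0_integralZl_EFin//; last 2 first.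
- by move=> w _; rewrite lee_fin powR_ge0.
- exact/measurable_EFinP.
have mF t : measurable_fun setT (fun w => ((normc (h w)) `^ p * (wt r A (pt t) w) `^ p)%:E).
  by apply/measurable_EFinP; apply: measurable_funM.
rewrite -ge0_integral_sum//; last first.
  by move=> t w _; rewrite lee_fin mulr_ge0 ?powR_ge0.
apply: ge0_le_integral => //.
- by move=> y _; apply: sume_ge0 => t _; rewrite lee_fin mulr_ge0 ?powR_ge0.
- by apply: emeasurable_sum.
- by apply/measurable_EFinP; apply: measurable_funM.
- move=> w _; rewrite sumEFin -EFinM lee_fin -mulr_sumr mulrC.
  apply: (ler_wpM2r (powR_ge0 _ _)); apply: le_trans (grid_weight_sum w r0 rN).
  by apply: ler_sum => t _; apply: wt_powR => //; exact: ltW.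
Qed.

End grid.

Section local_sums.
Context {R : realType} {n : nat}.
Local Notation normc := (@Normc.normc R).
Local Notation E := 'rV[R]_n.
Local Notation mu := (@lebesgue_row R n).
Implicit Types (f g h kap ker : E -> R[i]) (x y z w : E).
Variable phi0 : E -> R[i].
Hypothesis LP : LP_generator phi0.
Local Notation piece f j := (cconv f (psi phi0 j)).
Local Notation gam := (@gam R n).

Variables (p q : R).
Hypotheses (p0 : 0 < p) (p1 : p <= 1) (pq : p <= q) (q1 : q <= 1).
Hypothesis np : n%:R <= n.+1%:R * p.

(** The heart of the upper bound. The overlap [2 ^+ ((N - j) * n)] of the
    weights is compensated by the [p]-th power of the gain, [2 ^- ((N - j) *
    n.+1 * p)]; this is what the lower bound on [p] is for. *)
Lemma sum_pterm_q (A : nat) : n.+1%:R <= A%:R * p ->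
  exists2 C : R, 0 <= C & forall N j (T : finType) (pt : T -> E) f (a : R),
  (forall y, \sum_t (\1_(gbox N (pt t)) y : R) <= 1) -> cintegrable f ->
  (pmass p (piece f j) <= a%:E)%E ->
  \sum_t (pterm phi0 A N f (pt t) j) `^ q <= C * (((2 ^+ j) ^+ n) `^ (1 - p) * a) `^ (q / p).
Proof.
move=> Ap; have [C1 C10 hC1] := wmass_powR LP A p0 p1.
pose C2 : R := 2 ^+ n.+1 * @weight_mass R n.
have C20 : 0 <= C2 by rewrite mulr_ge0 ?exprn_ge0 ?weight_mass_ge0.
exists ((C1 * C2) `^ (q / p)); first exact: powR_ge0.
move=> N j T pt f a disj fi ha.
have a0 : 0 <= a by rewrite -lee_fin; apply: le_trans ha; exact: pmass_ge0.
have [mf _] := piece_integrable LP j fi.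
have qp1 : 1 <= q / p by rewrite ler_pdivlMr// mul1r.
have q0 : 0 < q by exact: lt_le_trans pq.
set x := fun t => pterm phi0 A N f (pt t) j.
have x0 t : 0 <= x t by exact: pterm_ge0.
have -> : \sum_t (x t) `^ q = \sum_t ((x t) `^ p) `^ (q / p).
  apply: eq_bigr => t _; rewrite -powRrM; congr (_ `^ _).
  by rewrite mulrCA divff ?mulr1// gt_eqF.
apply: (le_trans (sum_powR_ge1 (fun t => powR_ge0 (x t) p) qp1)).
set b := ((2 ^+ j) ^+ n) `^ (1 - p).
have b0 : 0 <= b by exact: powR_ge0.
rewrite -(powRM _ (mulr_ge0 C10 C20) (mulr_ge0 b0 a0)); apply: ge0_ler_powR.
- by apply: le_trans qp1.
- by rewrite nnegrE; apply: sumr_ge0 => t _; exact: powR_ge0.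
- by rewrite nnegrE; exact: mulr_ge0 (mulr_ge0 C10 C20) (mulr_ge0 b0 a0).
have g0 : 0 <= gam N j := gam_ge0 N j.
pose W t := wmass (piece f j) (rr N j) A (pt t).
have xE t : (x t) `^ p = (gam N j) `^ p * (W t) `^ p.
  by rewrite /x pterm_unfold powRM// wmass_ge0.
rewrite (eq_bigr _ (fun t _ => xE t)) -mulr_sumr.
set z : R := 2 ^+ (N - j).
have z1 : 1 <= z by rewrite exprn_ege1// ler1n.
have z0 : 0 < z by exact: lt_le_trans z1.
have zE : 2 ^+ N / rr N j = z.
  rewrite /rr /z; have [jN|Nj] := leqP j N.
    by rewrite -{1}(subnK jN) exprD mulfK// expf_neq0.
  rewrite divff ?expf_neq0//.
  by rewrite (eqP (_ : (N - j)%N == 0%N)) ?subn_eq0 ?expr0// ltnW.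
(* the hypothesis [np]: gain against overlap *)
have gz : (gam N j) `^ p * z ^+ n <= 1.
  rewrite /gam -/z powR_inv ?exprn_gt0// -!powR_mulrn ?(ltW z0)// -powRrM -powRD; last first.
    by rewrite (lt0r_neq0 z0) implybT.
  rewrite -[leRHS](powRr0 z); apply: ler_powR => //.
  by rewrite mulrN addrC subr_le0.
have hW : \sum_t (W t) `^ p <= C1 * b * (C2 * z ^+ n * a).
  rewrite -lee_fin -sumEFin.
  have h t := hC1 N j f (pt t) fi.
  apply: (le_trans (lee_sum _ (fun t _ => h t))).
  have Ib t : (0 <= \int[mu]_w ((normc (piece f j w)) `^ p * (wt (rr N j) A (pt t) w) `^ p)%:E)%E.
    by apply: integral_ge0 => w _; rewrite lee_fin mulr_ge0 ?powR_ge0.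
  rewrite -ge0_sume_distrr; last by move=> t _; exact: Ib.
  rewrite [leRHS]EFinM; apply: lee_wpmul2l; first by rewrite lee_fin mulr_ge0.
  have rN : rr N j <= 2 ^+ N :> R by rewrite /rr ler_eXn2l ?ltr1n// geq_minr.
  apply: (le_trans (grid_pmass_sum disj (rr_gt0 N j) rN Ap (ltW p0) mf)).
  rewrite zE -/C2 [leRHS]EFinM; apply: lee_wpmul2l => //.
  by rewrite lee_fin mulr_ge0 ?exprn_ge0 ?(ltW z0).
apply: (@le_trans _ _ ((gam N j) `^ p * (C1 * b * (C2 * z ^+ n * a)))).
  by apply: ler_wpM2l; rewrite ?powR_ge0.
have -> : (gam N j) `^ p * (C1 * b * (C2 * z ^+ n * a)) =
  ((gam N j) `^ p * z ^+ n) * (C1 * C2 * (b * a)) by ring.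
rewrite -[leRHS]mul1r; apply: ler_wpM2r => //.
exact: mulr_ge0 (mulr_ge0 C10 C20) (mulr_ge0 b0 a0).
Qed.

(** Since [q <= 1], the [q]-th power of the sum over [j] is at most the sum of
    the [q]-th powers, so [sum_t (B t)^q] is bounded. That there are [#|T|]
    cubes costs the power of [#|T|] that separates [lp] from [lq]. *)
Lemma local_sums (A : nat) : n.+1%:R <= A%:R * p ->
  exists2 C : R, 0 <= C & forall N (T : finType) (pt : T -> E) f (a : nat -> R),
  (0 < #|T|)%N -> (forall y, \sum_t (\1_(gbox N (pt t)) y : R) <= 1) -> cintegrable f ->
  (forall j, 0 <= a j) -> (forall j, (pmass p (piece f j) <= (a j)%:E)%E) ->
  (forall K : nat, \sum_(j < K) (((2 ^+ j) ^+ n) `^ (1 - p) * a j) `^ (q / p) <= 1) ->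
  exists B : T -> R, [/\ forall t, 0 <= B t,
    forall t (K : nat), \sum_(j < K) pterm phi0 A N f (pt t) j <= B t &
    \sum_t (B t) `^ p <= C * (#|T|%:R) `^ (1 - p / q)].
Proof.
move=> Ap; have [C C0 hC] := sum_pterm_q Ap.
have q0 : 0 < q by exact: lt_le_trans pq.
exists (1 + C); first exact: addr_ge0.
move=> N T pt f a T0 disj fi a0 ha hq.
pose x t j := (pterm phi0 A N f (pt t) j) `^ q.
have x0 t j : 0 <= x t j by exact: powR_ge0.
pose S t : \bar R := (\sum_(j <oo) (x t j)%:E)%E.
have S0 t : (0 <= S t)%E by apply: nneseries_ge0 => j _ _; rewrite lee_fin.
have SC : (\sum_t S t <= C%:E)%E.
  rewrite /S -nneseries_sum//; last by move=> t j _; rewrite lee_fin.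
  apply: lime_le; first by apply: is_cvg_nneseries => j _ _; apply: sume_ge0 => t _; rewrite lee_fin.
  apply: nearW => K; rewrite big_mkord.
  have -> : (\sum_(j < K) \sum_t (x t j)%:E = (\sum_(j < K) \sum_t x t j)%:E)%E.
    by rewrite -sumEFin; apply: eq_bigr => j _; rewrite sumEFin.
  rewrite lee_fin; apply: (@le_trans _ _ (\sum_(j < K) C * (((2 ^+ j) ^+ n) `^ (1 - p) * a j) `^ (q / p))).
    by apply: ler_sum => j _; apply: hC.
  by rewrite -mulr_sumr -[leRHS]mulr1; apply: ler_wpM2l.
have Sfin t : (S t \is a fin_num)%E.
  rewrite ge0_fin_numE//; apply: le_lt_trans (ltry C); apply: le_trans SC.
  rewrite (bigD1 t)//=; apply: leeDl; apply: sume_ge0 => s _; exact: S0.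
exists (fun t => (fine (S t)) `^ q^-1); split.
- by move=> t; exact: powR_ge0.
- move=> t K.
  have h : \sum_(j < K) x t j <= fine (S t).
    rewrite -lee_fin fineK// -sumEFin.
    have := @nneseries_lim_ge R (fun j => (x t j)%:E) xpredT 0 K.
    rewrite big_mkord; apply => j _ _; by rewrite lee_fin.
  set s := \sum_(j < K) pterm phi0 A N f (pt t) j.
  have s0 : 0 <= s by apply: sumr_ge0 => j _; exact: pterm_ge0.
  have -> : s = (s `^ q) `^ q^-1 by rewrite -powRrM divff ?powRr1// gt_eqF.
  apply: ge0_ler_powR; rewrite ?nnegrE ?invr_ge0 ?powR_ge0 ?fine_ge0 ?(ltW q0)//.
  apply: le_trans h; apply: (sum_powR_le1 _ _ q0 q1) => j; exact: pterm_ge0.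
- have th0 : 0 <= p / q by rewrite divr_ge0// ltW.
  have th1 : p / q <= 1 by rewrite ler_pdivrMr// mul1r.
  have -> : \sum_t ((fine (S t)) `^ q^-1) `^ p = \sum_t (fine (S t)) `^ (p / q).
    by apply: eq_bigr => t _; rewrite -powRrM mulrC.
  apply: sum_powR_card => //; first by move=> t; exact: fine_ge0.
  rewrite -lee_fin -sumEFin; apply: le_trans SC.
  by apply: lee_sum => t _; rewrite fineK.
Qed.

End local_sums.

(** * Plates around the faces of a cube *)
Section product_integral.
Context {R : realType}.
Local Notation lam := (@lebesgue_measure R).

Lemma integral_prod_row n (v : 'I_n -> R -> R) : (forall l, measurable_fun setT (v l)) ->
  (forall l s, 0 <= v l s) ->
  (\int[lebesgue_row n]_x (\prod_l v l (x ord0 l))%:E =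
   \big[mule/1]_(l < n) \int[lam]_s (v l s)%:E)%E.
Proof.
elim: n v => [|n IH] v mv v0.
  under eq_integral do rewrite big_ord0.
  by rewrite big_ord0 /= integral_dirac// diracT mul1e.
have mP : measurable_fun setT (fun x : 'rV[R]_n.+1 => \prod_l v l (x ord0 l)).
  apply: measurable_prod => l _.
  exact: (measurableT_comp (mv l) (measurable_coord l)).
rewrite ge0_integral_row; last 2 first.
- exact/measurable_EFinP.
- by move=> x; rewrite lee_fin prodr_ge0.
rewrite big_ord_recl.
pose P := (\int[lebesgue_row n]_x (\prod_l v (lift ord0 l) (x ord0 l))%:E)%E.
have inner t : (\int[lebesgue_row n]_w (\prod_l v l (row_cons (t, w) ord0 l))%:E = (v ord0 t)%:E * P)%E.
  have mQ : measurable_fun setT (fun x : 'rV[R]_n => \prod_l v (lift ord0 l) (x ord0 l)).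
    apply: measurable_prod => l _.
    exact: (measurableT_comp (mv (lift ord0 l)) (measurable_coord l)).
  rewrite /P -ge0_integralZl_EFin//; last 2 first.
  - by move=> x _; rewrite lee_fin prodr_ge0.
  - exact/measurable_EFinP.
  apply: eq_integral => w _; rewrite -EFinM big_ord_recl row_cons0; congr (_ * _)%:E.
  by apply: eq_bigr => l _; rewrite row_consS.
under eq_integral do rewrite inner.
have P0 : (0 <= P)%E by apply: integral_ge0 => x _; rewrite lee_fin prodr_ge0.
rewrite ge0_integralZr//; last first.
- by move=> t _; rewrite lee_fin.
- by apply/measurable_EFinP; exact: mv.
by rewrite /P (IH _ (fun l => mv (lift ord0 l)) (fun l => v0 (lift ord0 l))).
Qed.

Lemma integral_weight1 (r a : R) : 0 < r ->
  (\int[lam]_s ((1 + r * `|s - a|) ^- 2)%:E = (r^-1 * @weight_mass R 1)%:E)%E.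
Proof.
move=> r0.
have := weight_integral (const_mx a : 'rV[R]_1) r0; rewrite expr1 => <-.
pose v (l : 'I_1) (s : R) := (1 + r * `|s - a|) ^- 2.
have mv l : measurable_fun setT (v l).
  have mabs : measurable_fun setT (fun s : R => `|s - a|).
    apply: measurableT_comp => //; exact: measurable_funB.
  have mu1 : measurable_fun setT (fun s : R => 1 + r * `|s - a|).
    by apply: measurable_funD => //; exact: measurable_funM.
  rewrite (_ : v l = (fun t => t `^ (-1)) \o (fun s : R => (1 + r * `|s - a|) ^+ 2)); last first.
    by apply/funext => s /=; rewrite powR_inv1// exprn_ge0// addr_ge0// mulr_ge0// ltW.
  apply: measurableT_comp; first exact: measurable_powR.
  exact: measurable_funX.
have v0 l s : 0 <= v l s by rewrite weight_ge0// mulr_ge0// ltW.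
have := integral_prod_row mv v0; rewrite big_ord_recl big_ord0 mule1 => <-.
apply: eq_integral => x _; rewrite big_ord_recl big_ord0 mulr1 /v; congr ((1 + r * _) ^- 2)%:E.
apply/eqP; rewrite eq_le; apply/andP; split.
  by have := coord_le_norm (x - const_mx a) ord0; rewrite !mxE.
apply/row_norm_le; first exact: normr_ge0.
move=> i; rewrite !mxE (ord1 i); exact: lexx.
Qed.

End product_integral.

Section faces.
Context {R : realType} {n : nat}.
Local Notation normc := (@Normc.normc R).
Local Notation E := 'rV[R]_n.
Local Notation mu := (@lebesgue_row R n).
Implicit Types (f g h kap ker : E -> R[i]) (x y z w : E).

Definition face (N : nat) x (ib : 'I_n * bool) : R := x ord0 ib.1 + (ib.2%:R * 2 ^- N).

(** Soft indicator of the layer of thickness [2 ^- k] around the hyperplane of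
    a face. *)
Definition slab (N k A : nat) x ib w : R := (1 + 2 ^+ k * `|w ord0 ib.1 - face N x ib|) ^- A.

Lemma slab_ge0 N k A x ib w : 0 <= slab N k A x ib w.
Proof. by rewrite weight_ge0// mulr_ge0// exprn_ge0. Qed.

Lemma measurable_weight1 (r a : R) A : 0 <= r -> measurable_fun setT (fun s : R => (1 + r * `|s - a|) ^- A).
Proof.
move=> r0.
have mabs : measurable_fun setT (fun s : R => `|s - a|).
  apply: measurableT_comp => //; exact: measurable_funB.
have mu1 : measurable_fun setT (fun s : R => 1 + r * `|s - a|).
  by apply: measurable_funD => //; exact: measurable_funM.
rewrite (_ : (fun _ => _) = (fun t => t `^ (-1)) \o (fun s : R => (1 + r * `|s - a|) ^+ A)); last first.
  by apply/funext => s /=; rewrite powR_inv1// exprn_ge0// addr_ge0// mulr_ge0.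
apply: measurableT_comp; first exact: measurable_powR.
exact: measurable_funX.
Qed.

Lemma measurable_slab N k A x ib : measurable_fun setT (slab N k A x ib).
Proof.
have r0 : 0 <= 2 ^+ k :> R by rewrite exprn_ge0.
exact: (measurableT_comp (measurable_weight1 (face N x ib) A r0) (measurable_coord ib.1)).
Qed.

(** The integrand is dominated by a product of functions of one coordinate:
    one of width [2 ^- k] and [n.-1] of width [2 ^- N]. *)
Lemma slab_integral (p : R) (A2 A3 N k : nat) x ib : 2 <= A2%:R * p -> (2 * n)%:R <= A3%:R * p ->
  (\int[mu]_w ((wt (2 ^+ N) A3 x w) `^ p * (slab N k A2 x ib w) `^ p)%:E <=
   ((@weight_mass R 1) ^+ n * ((2 ^+ N) ^- n.-1 * 2 ^- k))%:E)%E.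
Proof.
case: ib => i b A2p A3p.
pose c := face N x (i, b).
pose v (l : 'I_n) (s : R) := if l == i then (1 + 2 ^+ k * `|s - c|) ^- 2
   else (1 + 2 ^+ N * `|s - x ord0 l|) ^- 2.
have N0 : 0 <= 2 ^+ N :> R by rewrite exprn_ge0.
have k0 : 0 <= 2 ^+ k :> R by rewrite exprn_ge0.
have Np : 0 < 2 ^+ N :> R by rewrite exprn_gt0.
have kp : 0 < 2 ^+ k :> R by rewrite exprn_gt0.
have mv l : measurable_fun setT (v l).
  by rewrite /v; case: eqP => _; exact: measurable_weight1.
have v0 l s : 0 <= v l s by rewrite /v; case: eqP => _; rewrite weight_ge0// mulr_ge0.
have mI : measurable_fun setT (fun w => (wt (2 ^+ N) A3 x w) `^ p * (slab N k A2 x (i, b) w) `^ p).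
  apply: measurable_funM; first exact: (measurableT_comp (measurable_powR p) (measurable_wt A3 x N0)).
  exact: (measurableT_comp (measurable_powR p) (measurable_slab N k A2 x (i, b))).
apply: (@le_trans _ _ (\int[mu]_w (\prod_l v l (w ord0 l))%:E)%E).
  apply: ge0_le_integral => //.
  - by move=> w _; rewrite lee_fin mulr_ge0 ?powR_ge0.
  - exact/measurable_EFinP.
  - apply/measurable_EFinP; apply: measurable_prod => l _.
    exact: (measurableT_comp (mv l) (measurable_coord l)).
  - move=> w _; rewrite lee_fin (bigD1 i)//= mulrC; apply: ler_pM; rewrite ?powR_ge0//.
      rewrite /v eqxx /slab /=; apply: weight_powR => //.
    apply: (le_trans (wt_powR x w N0 A3p)); rewrite wtE.
    move: (fun l => coord_le_norm (w - x) l) (normr_ge0 (w - x)).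
    move: `|w - x| => u hu u0.
    have p1 : 1 <= 1 + 2 ^+ N * u by rewrite lerDl mulr_ge0.
    have p0 : 0 < 1 + 2 ^+ N * u by exact: lt_le_trans p1.
    apply: (@le_trans _ _ (\prod_(l | l != i) (1 + 2 ^+ N * u) ^- 2)).
      rewrite prodr_const -exprVn -exprVn -exprM cardC1 card_ord.
      apply: ler_wiXn2l; rewrite ?invr_ge0 ?(ltW p0) ?invf_le1//.
      by rewrite leq_mul2l leq_pred.
    apply: ler_prod => l li; rewrite invr_ge0 exprn_ge0 ?(ltW p0)//= /v (negPf li).
    have hl := hu l; rewrite !mxE in hl.
    have q0 : 0 < 1 + 2 ^+ N * `|w ord0 l - x ord0 l| by rewrite ltr_pwDl// mulr_ge0.
    rewrite lef_pV2 ?posrE ?exprn_gt0//.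
    by rewrite lerXn2r ?nnegrE ?(ltW p0) ?(ltW q0)// lerD2l ler_wpM2l.
rewrite integral_prod_row// (bigD1 i)//=.
have e1 : (\int[lebesgue_measure]_s (v i s)%:E = (2 ^- k * @weight_mass R 1)%:E)%E.
  by rewrite /v eqxx; exact: integral_weight1.
have e2 l : l != i -> (\int[lebesgue_measure]_s (v l s)%:E = (2 ^- N * @weight_mass R 1)%:E)%E.
  by move=> li; rewrite /v (negPf li); exact: integral_weight1.
rewrite e1 (eq_bigr _ e2).
have -> : (\big[mule/1]_(l < n | l != i) (2 ^- N * @weight_mass R 1)%:E =
   (\prod_(l < n | l != i) (2 ^- N * @weight_mass R 1))%:E)%E by rewrite prodEFin.
rewrite -EFinM lee_fin prodr_const cardC1 card_ord exprMn exprVn.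
have -> : n = n.-1.+1 by rewrite prednK// (leq_ltn_trans _ (ltn_ord i)).
rewrite succnK exprS.
set m := weight_mass; set z := m ^+ _; set t := (2 ^+ N ^+ _)^-1; set t' := 2 ^- k.
suff -> : t' * m * (t * z) = m * z * (t * t') by exact: lexx.
ring.
Qed.

(** Two points separated by the boundary of a cube are at least as far from
    each other as the first one is from some face, and the first one is within
    their distance of the cube. *)
Lemma jump_bound (N k A2 A3 : nat) x y z : (N <= k)%N ->
  (gbox N z x /\ ~ gbox N z y) \/ (~ gbox N z x /\ gbox N z y) ->
  wt (2 ^+ k) (A2 + A3) x y <=
   2 ^+ A3 * (wt (2 ^+ N) A3 z x * \sum_ib slab N k A2 z ib x).
Proof.
move=> Nk xy; have k0 : 0 < 2 ^+ k :> R by rewrite exprn_gt0.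
have N0 : 0 < 2 ^+ N :> R by rewrite exprn_gt0.
have kN : 2 ^+ N <= 2 ^+ k :> R by rewrite ler_eXn2l ?ltr1n.
have e0 : 0 < (2 ^- N : R) by rewrite invr_gt0.
have [ib hib] : exists ib, `|x ord0 ib.1 - face N z ib| <= `|y - x|.
  have out w : ~ gbox N z w -> exists i, w ord0 i < z ord0 i \/ z ord0 i + 2 ^- N <= w ord0 i.
    move=> h; apply: contrapT => h2; apply: h => i; rewrite !mxE; apply/andP.
    split; [rewrite leNgt|rewrite ltNge]; apply/negP => h3; apply: h2; exists i;
      by [left|right].
  have side (u v s t d : R) : (u < s \/ t <= u) -> s <= v < t -> `|v - u| <= d ->
     (`|u - s| <= d /\ `|v - s| <= d) \/ (`|u - t| <= d /\ `|v - t| <= d).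
    rewrite !ler_norml => -[us|tu] /andP[sv vt] /andP[d1 d2]; [left|right];
      split; apply/andP; split; lra.
  case: xy => -[h1 h2].
    have [i hi] := out y h2; have := h1 i; rewrite !mxE => hz.
    have := coord_le_norm (y - x) i; rewrite !mxE distrC => hd.
    by case: (side _ _ _ _ _ hi hz hd) => -[_ ?]; [exists (i, false)|exists (i, true)];
      rewrite /face /= ?mul0r ?addr0 ?mul1r.
  have [i hi] := out x h1; have := h2 i; rewrite !mxE => hz.
  have := coord_le_norm (y - x) i; rewrite !mxE => hd.
  by case: (side _ _ _ _ _ hi hz hd) => -[? _]; [exists (i, false)|exists (i, true)];
    rewrite /face /= ?mul0r ?addr0 ?mul1r.
have hz : `|x - z| <= `|y - x| + 2 ^- N.
  case: xy => -[h1 h2].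
    by apply: le_trans (gbox_dist h1) _; rewrite lerDr.
  have -> : x - z = (x - y) + (y - z) by rewrite addrA subrK.
  apply: le_trans (ler_normD _ _) _; rewrite (distrC x y) lerD2l.
  exact: gbox_dist h2.
rewrite !wtE.
apply: (@le_trans _ _ (2 ^+ A3 * ((1 + 2 ^+ N * `|x - z|) ^- A3 * slab N k A2 z ib x))); last first.
  apply: ler_wpM2l; first by rewrite exprn_ge0.
  apply: ler_wpM2l; first by rewrite weight_ge0// mulr_ge0// ltW.
  rewrite (bigD1 ib)//= lerDl sumr_ge0// => jb _; exact: slab_ge0.
rewrite /slab; move: hib hz (normr_ge0 (y - x)) (normr_ge0 (x - z)).
move: `|y - x| `|x - z| => u v; move: `|_ - _| (normr_ge0 (x ord0 ib.1 - face N z ib)) => s s0 su vu u0 v0.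
have ku : 0 <= 2 ^+ k * u by rewrite mulr_ge0// ltW.
have Nv : 0 <= 2 ^+ N * v by rewrite mulr_ge0// ltW.
have ks : 0 <= 2 ^+ k * s by rewrite mulr_ge0// ltW.
have h1 : 1 + 2 ^+ k * s <= 1 + 2 ^+ k * u by rewrite lerD2l ler_wpM2l// ltW.
have h2 : 1 + 2 ^+ N * v <= 2 * (1 + 2 ^+ k * u).
  have a1 : 2 ^+ N * v <= 2 ^+ N * u + 1.
    apply: (@le_trans _ _ (2 ^+ N * (u + 2 ^- N))); first by rewrite ler_wpM2l// ltW.
    by rewrite mulrDr divff// gt_eqF.
  have a2 : 2 ^+ N * u <= 2 ^+ k * u by rewrite ler_wpM2r.
  by move: (2 ^+ N * v) (2 ^+ N * u) (2 ^+ k * u) a1 a2 ku => a b c; lra.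
rewrite exprD invfM mulrC mulrA; apply: ler_pM.
- by rewrite invr_ge0 exprn_ge0// addr_ge0.
- by rewrite invr_ge0 exprn_ge0// addr_ge0.
- rewrite -[leLHS]mul1r ler_pdivrMr ?exprn_gt0 ?ltr_pwDl// mulrAC ler_pdivlMr ?exprn_gt0 ?ltr_pwDl//.
  rewrite mul1r -exprMn lerXn2r ?nnegrE ?mulr_ge0 ?addr_ge0//.
- rewrite lef_pV2 ?posrE ?exprn_gt0 ?ltr_pwDl//.
  by rewrite lerXn2r ?nnegrE ?addr_ge0.
Qed.

End faces.

(** * Littlewood-Paley pieces of averages *)
Opaque slab.

Section grid_averages.
Context {R : realType} {n : nat}.
Local Notation normc := (@Normc.normc R).
Local Notation Re := (@complex.Re R).
Local Notation Im := (@complex.Im R).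
Local Notation E := 'rV[R]_n.
Local Notation mu := (@lebesgue_row R n).
Implicit Types (f g h kap ker : E -> R[i]) (x y z w : E).

Lemma eq_cintegral_ae f g : cmeasurable f -> cmeasurable g -> {ae mu, forall x, f x = g x} ->
  cintegral setT f = cintegral setT g.
Proof.
move=> [mf1 mf2] [mg1 mg2] fg; apply: complexP.
  congr fine; apply: ae_eq_integral => //; [exact/measurable_EFinP|exact/measurable_EFinP|].
  by apply: filterS fg => x -> _.
congr fine; apply: ae_eq_integral => //; [exact/measurable_EFinP|exact/measurable_EFinP|].
by apply: filterS fg => x -> _.
Qed.

Lemma ccontinuous_atB f g y : ccontinuous_at f y -> ccontinuous_at g y ->
  ccontinuous_at (fun x => f x - g x) y.
Proof.
move=> hf hg e e0; have e2 : 0 < e / 2 by rewrite divr_gt0.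
have [d1 d10 h1] := hf _ e2; have [d2 d20 h2] := hg _ e2.
exists (Order.min d1 d2); first by rewrite lt_min d10.
move=> z; rewrite lt_min => /andP[/h1 a1 /h2 a2].
have -> : f z - g z - (f y - g y) = (f z - f y) - (g z - g y) by ring.
apply: le_lt_trans (cnormB _ _) _; move: a1 a2; lra.
Qed.

Lemma cnorm_tri (a b c : R[i]) : normc (a - b) <= normc (a - c) + normc (b - c).
Proof. have -> : a - b = (a - c) - (b - c) by ring. exact: cnormB. Qed.

Lemma indic_ccontinuous_ae a b : {ae mu, forall y, ccontinuous_at (fun x => \1_(box a b) x : R[i]) y}.
Proof.
apply: filterS (box_boundary_null a b) => y hy.
have c1 : ccontinuous_at (fun _ : E => 1 : R[i]) y.
  by move=> e e0; exists 1 => // z _; rewrite subrr Normc.normc0.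
have := box_cut_continuous c1 hy; congr ccontinuous_at.
by apply/funext => z; rewrite mulr1.
Qed.

Lemma normc_indic (D : set E) x : normc (\1_D x) = \1_D x :> R.
Proof. by rewrite !indicE; case: (_ \in _); rewrite ?Normc.normc1 ?Normc.normc0. Qed.

Lemma indic_real (D : set E) x : (\1_D x : R[i]) = (\1_D x : R)%:C.
Proof. by rewrite !indicE; case: (_ \in _). Qed.

Lemma gbox_cintegrable N z : cintegrable (fun x => \1_(gbox N z) x : R[i]).
Proof.
split; first by apply: cmeasurable_indic; exact: measurable_gbox.
under eq_integral do rewrite normc_indic.
by rewrite integral_indic_gbox ltry.
Qed.

Lemma cintegral_gbox N z : cintegral setT (fun x => \1_(gbox N z) x : R[i]) = ((2 ^- N) ^+ n)%:C.
Proof.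
transitivity (cintegral setT (fun x => (\1_(gbox N z) x : R)%:C)).
  by apply: eq_cintegral => x; exact: indic_real.
by rewrite cintegral_real integral_indic_gbox.
Qed.

Definition bmean N z f := ((2 ^+ N) ^+ n)%:C * cintegral setT (fun y => \1_(gbox N z) y * f y).

(** Finitely many cubes of one mesh that carry [f]. The second clause is the
    presence of the other cubes of the mesh, on which the mean of [f] is [0];
    thanks to it every difference of values of the average is a difference of
    two means over cubes of the same volume. *)
Definition grid_for N (T : finType) (pt : T -> E) f :=
  [/\ forall y, \sum_t (\1_(gbox N (pt t)) y : R) <= 1,
      forall y, (exists t, gbox N (pt t) y) \/
        (exists z, gbox N z y /\ forall x, gbox N z x -> forall t, ~ gbox N (pt t) x),
      cintegrable f &
      {ae mu, forall x, (forall t, ~ gbox N (pt t) x) -> f x = 0}].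

Definition gavg N (T : finType) (pt : T -> E) f x :=
  \sum_t \1_(gbox N (pt t)) x * bmean N (pt t) f.

Lemma grid_disj N (T : finType) (pt : T -> E) f s t x : grid_for N pt f ->
  gbox N (pt s) x -> gbox N (pt t) x -> s = t.
Proof.
move=> [disj _ _ _] hs ht; apply/eqP; apply: contraT => st.
have := disj x; rewrite (bigD1 s)//= (bigD1 t) 1?eq_sym//= !indicE (mem_set hs) (mem_set ht).
have : 0 <= \sum_(i | (i != s) && (i != t)) (\1_(gbox N (pt i)) x : R) by apply: sumr_ge0.
by rewrite /=; lra.
Qed.

Lemma gavg_in N (T : finType) (pt : T -> E) f t x : grid_for N pt f ->
  gbox N (pt t) x -> gavg N pt f x = bmean N (pt t) f.
Proof.
move=> gr ht; rewrite /gavg (bigD1 t)//= indicE mem_set// mul1r big1 ?addr0// => s st.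
rewrite indicE memNset ?mul0r// => hs; move: st.
by rewrite (grid_disj gr hs ht) eqxx.
Qed.

Lemma gavg_out N (T : finType) (pt : T -> E) f x :
  (forall t, ~ gbox N (pt t) x) -> gavg N pt f x = 0.
Proof. by move=> h; rewrite /gavg big1// => t _; rewrite indicE memNset ?mul0r. Qed.

Lemma gavg_integrable N (T : finType) (pt : T -> E) f : cintegrable (gavg N pt f).
Proof.
apply: cintegrable_sum => t.
by apply: eq_cintegrable (cintegrableZ (bmean N (pt t) f) (gbox_cintegrable N (pt t))) => x; exact: mulrC.
Qed.

Lemma gavg_bmean N (T : finType) (pt : T -> E) f y : grid_for N pt f ->
  exists z, gbox N z y /\ gavg N pt f y = bmean N z f.
Proof.
move=> gr; have [_ cov [mf _] fs] := gr.
have [[t ht]|[z [hz hz2]]] := cov y; first by exists (pt t); rewrite (gavg_in gr ht).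
exists z; split => //; rewrite (gavg_out _ (hz2 y hz)) /bmean.
have -> : cintegral setT (fun y => \1_(gbox N z) y * f y) = cintegral setT (fun _ : E => 0 : R[i]).
  apply: eq_cintegral_ae.
  - by apply: cmeasurableM => //; apply: cmeasurable_indic; exact: measurable_gbox.
  - exact: cmeasurable_cst.
  - apply: filterS fs => x hx; rewrite indicE.
    by case: (boolP (_ \in _)); rewrite ?mul0r// inE => /hz2/hx ->; rewrite mulr0.
by rewrite cintegral0 mulr0.
Qed.

Variable phi0 : E -> R[i].
Hypothesis LP : LP_generator phi0.

Definition majorizes A N (T : finType) (pt : T -> E) f (B : T -> R) :=
  (forall t, 0 <= B t) /\
  (forall t (K : nat), \sum_(j < K) pterm phi0 A N f (pt t) j <= B t).

(** The difference of two normalized indicators has mean zero, and lives in a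
    ball whose radius is the distance of the points in units of [2 ^- N]. *)
Lemma gavg_osc A : exists2 C : R, 0 <= C & forall N (T : finType) (pt : T -> E) f B t x y,
  grid_for N pt f -> majorizes A N pt f B -> gbox N (pt t) x ->
  normc (gavg N pt f x - gavg N pt f y) <=
   C * (2 ^+ N) ^+ n * (1 + 2 ^+ N * `|x - y|) ^+ (A + n.+1) * B t.
Proof.
have [C C0 hC] := full_local LP A.
exists (C * 3 ^+ (A + n.+1)); first by rewrite mulr_ge0 ?exprn_ge0.
move=> N T pt f B t x y gr [B0 hB] hx.
have [_ _ fi _] := gr; have [z [hz ->]] := gavg_bmean y gr.
rewrite (gavg_in gr hx) /bmean -mulrBr Normc.normcM cnorm_real.
have N0 : 0 < 2 ^+ N :> R by rewrite exprn_gt0.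
have Nn : 0 <= (2 ^+ N) ^+ n :> R by rewrite exprn_ge0 ?ltW.
rewrite (ger0_norm Nn).
have i1 := cintegrable_indic (measurable_gbox N (pt t)) fi.
have i2 := cintegrable_indic (measurable_gbox N z) fi.
rewrite -(cintegralB i1 i2).
pose kap v : R[i] := \1_(gbox N (pt t)) v - \1_(gbox N z) v.
have -> : cintegral setT (fun v => \1_(gbox N (pt t)) v * f v - \1_(gbox N z) v * f v) =
  cintegral setT (fun v => kap v * f v) by apply: eq_cintegral => v; rewrite mulrBl.
have mk : cmeasurable kap by case: (cintegrableB (gbox_cintegrable N (pt t)) (gbox_cintegrable N z)).
have kS v : normc (kap v) <= 1.
  rewrite /kap !indicE; case: (_ \in _); case: (_ \in _);
    by rewrite ?subrr ?subr0 ?sub0r ?cnormN ?Normc.normc0 ?Normc.normc1.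
have k0 : cintegral setT kap = 0.
  by rewrite (cintegralB (gbox_cintegrable N (pt t)) (gbox_cintegrable N z)) !cintegral_gbox subrr.
have kc : {ae mu, forall y, ccontinuous_at kap y}.
  apply: filterS2 (indic_ccontinuous_ae (pt t) (pt t + const_mx (2 ^- N)))
     (indic_ccontinuous_ae z (z + const_mx (2 ^- N))) => v.
  exact: ccontinuous_atB.
pose u := 2 ^+ N * `|x - y|.
have u0 : 0 <= u by rewrite mulr_ge0// ltW.
have rho1 : 1 <= 2 + u by move: u0; lra.
have ks v : (2 + u) * 2 ^- N < `|v - pt t| -> kap v = 0.
  move=> hv; rewrite /kap !indicE.
  have e1 : (2 + u) * 2 ^- N = 2 ^- N + 2 ^- N + `|x - y|.
    by rewrite mulrDl /u mulrAC divff ?gt_eqF// mul1r; congr (_ + _); ring.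
  have p0 : 0 < 2 ^- N :> R by rewrite invr_gt0.
  rewrite e1 in hv.
  have n1 : ~ gbox N (pt t) v.
    move=> /gbox_dist h; move: hv; rewrite ltNge => /negP; apply.
    by apply: (le_trans h); rewrite -addrA lerDl addr_ge0// ltW.
  have n2 : ~ gbox N z v.
    move=> h; move: hv; rewrite ltNge => /negP; apply.
    have h1 := gbox_dist hx.
    have h2 : `|v - y| <= 2 ^- N.
      apply/row_norm_le; first exact: ltW.
      move=> i; have := h i; have := hz i; rewrite !mxE.
      move: (2 ^- N) => e /andP[? ?] /andP[? ?].
      by rewrite ler_norml; apply/andP; split; lra.
    have -> : v - pt t = (v - y) + (x - pt t) + (y - x).
      by rewrite addrACA addrA; apply/rowP => i; rewrite !mxE; ring.
    apply: le_trans (ler_normD _ _) _; rewrite (distrC y x) lerD2r.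
    by apply: le_trans (ler_normD _ _) _; exact: lerD.
  by rewrite !memNset// subrr.
have := hC N f kap 1 (2 + u) (B t) (pt t) fi mk kS rho1 ks k0 kc (hB t).
move=> h; have : (1 + (2 + u)) ^+ (A + n.+1) <= 3 ^+ (A + n.+1) * (1 + u) ^+ (A + n.+1).
  rewrite -exprMn lerXn2r ?nnegrE ?mulr_ge0 ?addr_ge0//.
  by move: u0; lra.
rewrite mul1r in h; move=> h2.
rewrite -/u; move: ((1 + u) ^+ (A + n.+1)) ((1 + (2 + u)) ^+ (A + n.+1)) h2 h => P Q h2 h.
have -> : C * 3 ^+ (A + n.+1) * (2 ^+ N) ^+ n * P * B t =
  (2 ^+ N) ^+ n * (C * (3 ^+ (A + n.+1) * P * B t)) by ring.
apply: (ler_wpM2l Nn); apply: (le_trans h); apply: (ler_wpM2l C0).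
exact: ler_wpM2r.
Qed.

(** As [psi k] has mean zero, only those [y] count at which the averaged
    function differs from its value at [x], and these are beyond a face. *)
Lemma high_piece A A2 A3 : exists2 C : R, 0 <= C &
  forall N k (T : finType) (pt : T -> E) f B x,
  grid_for N pt f -> majorizes A N pt f B -> (N <= k)%N -> (0 < k)%N ->
  normc (cconv (gavg N pt f) (psi phi0 k) x) <=
   C * (2 ^+ N) ^+ n *
   \sum_t B t * (wt (2 ^+ N) A3 (pt t) x * \sum_ib slab N k A2 (pt t) ib x).
Proof.
have [C C0 hC] := gavg_osc A.
pose A' := (A + n.+1)%N.
have [C2 C20 hC2] := psi_kdecay LP (A' + (n.+1 + (A2 + A3))).
exists (C * C2 * 2 ^+ A3 * @weight_mass R n).
  by rewrite !mulr_ge0 ?exprn_ge0 ?weight_mass_ge0.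
move=> N k T pt f B x gr maj Nk k0.
have [B0 _] := maj.
set g := gavg N pt f; set Q := \sum_t _.
have N0 : 0 < 2 ^+ N :> R by rewrite exprn_gt0.
have kp : 0 < 2 ^+ k :> R by rewrite exprn_gt0.
have Nn : 0 <= (2 ^+ N) ^+ n :> R by rewrite exprn_ge0 ?ltW.
have kn : 0 <= (2 ^+ k) ^+ n :> R by rewrite exprn_ge0 ?ltW.
have gi : cintegrable g by exact: gavg_integrable.
have pi := psi_integrable LP k; have [mp _] := pi.
have rpi : cintegrable (fun y => psi phi0 k (x - y)) by exact: cintegrable_reflect.
have i1 := cconv_integrand_integrable x gi mp (psi_bounded LP k).
have i2 : cintegrable (fun y => g x * psi phi0 k (x - y)) by exact: cintegrableZ.
have z0 : cintegral setT (fun y => g x * psi phi0 k (x - y)) = 0.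
  rewrite (cintegralZ _ rpi) -(cintegral_reflect x pi).
  by case: (k) k0 => // k' _; rewrite (psi_mass0 LP) mulr0.
have -> : cconv g (psi phi0 k) x = cintegral setT (fun y => (g y - g x) * psi phi0 k (x - y)).
  transitivity (cconv g (psi phi0 k) x - cintegral setT (fun y => g x * psi phi0 k (x - y))).
    by rewrite z0 subr0.
  by rewrite -(cintegralB i1 i2); apply: eq_cintegral => y; rewrite mulrBl.
have {z0} i3 : cintegrable (fun y => (g y - g x) * psi phi0 k (x - y)).
  by apply: eq_cintegrable (cintegrableB i1 i2) => y; rewrite mulrBl.
have Q0 : 0 <= Q.
  apply: sumr_ge0 => t _; rewrite mulr_ge0// mulr_ge0 ?wt_ge0 ?(ltW N0)// sumr_ge0// => ib _.
  exact: slab_ge0.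
pose D := C * C2 * 2 ^+ A3 * (2 ^+ N) ^+ n * Q * (2 ^+ k) ^+ n.
have D0 : 0 <= D.
  by apply: mulr_ge0 kn; apply: mulr_ge0 Q0; apply: mulr_ge0 Nn; rewrite !mulr_ge0 ?exprn_ge0.
(* a change of value crosses the boundary of some listed cube, since the
   function vanishes off them *)
have jump y : g y = g x \/ exists t,
    ((gbox N (pt t) x /\ ~ gbox N (pt t) y) \/ (~ gbox N (pt t) x /\ gbox N (pt t) y)) /\
    normc (g y - g x) <= C * (2 ^+ N) ^+ n * (1 + 2 ^+ N * `|y - x|) ^+ A' * B t.
  have [[t ht]|nx] := pselect (exists t, gbox N (pt t) x).
    have [hy|hy] := pselect (gbox N (pt t) y).
      by left; rewrite /g (gavg_in gr ht) (gavg_in gr hy).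
    right; exists t; split; first by left.
    by rewrite cnorm_distC (distrC y x); exact: hC.
  have [[t ht]|ny] := pselect (exists t, gbox N (pt t) y).
    right; exists t; split; first by right; split => // hx; apply: nx; exists t.
    exact: hC.
  by left; rewrite /g !gavg_out// => t h; [apply: nx|apply: ny]; exists t.
have mw := measurable_wt n.+1 x (ltW kp).
apply: (le_normc_cintegral (h := fun y => D * wt (2 ^+ k) n.+1 x y) i3).
- by apply: measurable_funM => //; exact: measurable_cst.
- move=> y; rewrite Normc.normcM.
  have W0 := wt_ge0 n.+1 x y (ltW kp).
  have [->|[t [hj ht]]] := jump y.
    by rewrite subrr Normc.normc0 mul0r; exact: mulr_ge0 D0 W0.
  have h2 := (hC2 k).1 (x - y).
  have h3 := jump_bound A2 A3 Nk hj.
  have h4 : B t * (wt (2 ^+ N) A3 (pt t) x * \sum_ib slab N k A2 (pt t) ib x) <= Q.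
    rewrite /Q (bigD1 t)//= lerDl sumr_ge0// => s _; rewrite mulr_ge0// mulr_ge0 ?wt_ge0 ?(ltW N0)// sumr_ge0// => ib _.
    exact: slab_ge0.
  rewrite (distrC x y) -wtE in h2.
  have h5 : wt (2 ^+ k) (A' + (n.+1 + (A2 + A3))) x y * (1 + 2 ^+ N * `|y - x|) ^+ A' <=
      wt (2 ^+ k) n.+1 x y * wt (2 ^+ k) (A2 + A3) x y.
    rewrite !wtE; move: `|y - x| (normr_ge0 (y - x)) => u u0.
    have ku : 0 <= 2 ^+ k * u by rewrite mulr_ge0// ltW.
    have p0 : 0 < 1 + 2 ^+ k * u by rewrite ltr_pwDl.
    have Nu : 1 + 2 ^+ N * u <= 1 + 2 ^+ k * u.
      by rewrite lerD2l ler_wpM2r// ler_eXn2l ?ltr1n.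
    move: (1 + 2 ^+ k * u) (1 + 2 ^+ N * u) p0 Nu (addr_ge0 ler01 (mulr_ge0 (ltW N0) u0)) => P P' P0 PP P'0.
    have -> : P ^- (A' + (n.+1 + (A2 + A3))) = P ^- A' * (P ^- n.+1 * P ^- (A2 + A3)).
      by rewrite -!invfM -!exprD.
    rewrite mulrAC -[leRHS]mul1r; apply: ler_wpM2r.
      by rewrite mulr_ge0// invr_ge0 exprn_ge0// ltW.
    rewrite mulrC ler_pdivrMr ?exprn_gt0// mul1r lerXn2r ?nnegrE//; exact: ltW.
  apply: (le_trans (ler_pM (cnorm_ge0 _) (cnorm_ge0 _) ht h2)).
  move: ((1 + 2 ^+ N * `|y - x|) ^+ A') h5 => P h5.
  have c0 : 0 <= C * (2 ^+ N) ^+ n * B t * C2 * (2 ^+ k) ^+ n by rewrite !mulr_ge0.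
  have -> : C * (2 ^+ N) ^+ n * P * B t *
      (C2 * ((2 ^+ k) ^+ n * wt (2 ^+ k) (A' + (n.+1 + (A2 + A3))) x y)) =
    (C * (2 ^+ N) ^+ n * B t * C2 * (2 ^+ k) ^+ n) *
      (wt (2 ^+ k) (A' + (n.+1 + (A2 + A3))) x y * P) by ring.
  apply: (le_trans (ler_wpM2l c0 h5)).
  apply: (le_trans (ler_wpM2l c0 (ler_wpM2l W0 h3))).
  set V := wt _ _ _ _ * _ in h4 *.
  have -> : C * (2 ^+ N) ^+ n * B t * C2 * (2 ^+ k) ^+ n * (wt (2 ^+ k) n.+1 x y * (2 ^+ A3 * V)) =
    (C * C2 * 2 ^+ A3 * (2 ^+ N) ^+ n * (2 ^+ k) ^+ n * wt (2 ^+ k) n.+1 x y) * (B t * V) by ring.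
  have -> : D * wt (2 ^+ k) n.+1 x y =
    (C * C2 * 2 ^+ A3 * (2 ^+ N) ^+ n * (2 ^+ k) ^+ n * wt (2 ^+ k) n.+1 x y) * Q.
    by rewrite /D; ring.
  by apply: (ler_wpM2l _ h4); apply: mulr_ge0 W0; rewrite !mulr_ge0 ?exprn_ge0.
- under eq_integral do rewrite EFinM wtE.
  rewrite ge0_integralZl_EFin//; last first.
    by apply/measurable_EFinP; exact: measurable_weight (ltW kp).
  rewrite (weight_integral x kp) -EFinM lee_fin.
  suff -> : D * ((2 ^+ k) ^- n * @weight_mass R n) =
    C * C2 * 2 ^+ A3 * @weight_mass R n * (2 ^+ N) ^+ n * Q by exact: lexx.
  have e : (2 ^+ k) ^+ n * (2 ^+ k) ^- n = 1 :> R by rewrite divff// gt_eqF// exprn_gt0.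
  transitivity (C * C2 * 2 ^+ A3 * @weight_mass R n * (2 ^+ N) ^+ n * Q * ((2 ^+ k) ^+ n * (2 ^+ k) ^- n)).
    by rewrite /D; ring.
  by rewrite e mulr1.
Qed.

(** For [p <= 1] the [p]-th power is subadditive; the [Lp] quasi-norm has no
    triangle inequality. *)
Lemma pmass_le (p : R) (I : finType) h (F : I -> E -> R) : 0 < p -> p <= 1 -> cmeasurable h ->
  (forall i, measurable_fun setT (F i)) -> (forall i x, 0 <= F i x) ->
  (forall x, normc (h x) <= \sum_i F i x) ->
  (pmass p h <= \sum_i \int[mu]_x ((F i x) `^ p)%:E)%E.
Proof.
move=> p0 p1 mh mF F0 hF.
have mFp i : measurable_fun setT (fun x => ((F i x) `^ p)%:E).
  by apply/measurable_EFinP; exact: (measurableT_comp (measurable_powR p) (mF i)).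
rewrite -ge0_integral_sum//; last by move=> i x _; rewrite lee_fin powR_ge0.
apply: ge0_le_integral => //.
- by move=> x _; rewrite lee_fin powR_ge0.
- by apply/measurable_EFinP; exact: measurable_normc_powR.
- exact: emeasurable_sum.
- move=> x _; rewrite sumEFin lee_fin.
  apply: (@le_trans _ _ ((\sum_i F i x) `^ p)).
    apply: ge0_ler_powR; rewrite ?nnegrE ?cnorm_ge0 ?(ltW p0)//.
    by apply: sumr_ge0.
  by apply: sum_powR_le1.
Qed.

Lemma high_pmass (p : R) A : 0 < p -> p <= 1 -> exists2 C : R, 0 <= C &
  forall N k (T : finType) (pt : T -> E) f B,
  grid_for N pt f -> majorizes A N pt f B -> (N <= k)%N -> (0 < k)%N ->
  (pmass p (cconv (gavg N pt f) (psi phi0 k)) <=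
   (C * (((2 ^+ N) ^+ n) `^ p * ((2 ^+ N) ^- n.-1 * 2 ^- k)) * \sum_t (B t) `^ p)%:E)%E.
Proof.
move=> p0 p1.
(* large enough for the [p]-th powers of the weights to be integrable *)
pose A2 := Num.bound (2 / p); pose A3 := Num.bound ((2 * n)%:R / p).
have hA2 : 2 <= A2%:R * p.
  by rewrite -ler_pdivrMr//; apply: ltW; apply: archi_boundP; rewrite divr_ge0 ?ler0n ?(ltW p0).
have hA3 : (2 * n)%:R <= A3%:R * p.
  by rewrite -ler_pdivrMr//; apply: ltW; apply: archi_boundP; rewrite divr_ge0 ?ler0n ?(ltW p0).
have [C C0 hC] := high_piece A A2 A3.
pose m := (@weight_mass R 1) ^+ n.
have m0 : 0 <= m by rewrite exprn_ge0 ?weight_mass_ge0.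
exists (C `^ p * m * #|{: 'I_n * bool}|%:R).
  by rewrite !mulr_ge0 ?powR_ge0.
move=> N k T pt f B gr maj Nk k0; have [B0 _] := maj.
have N0 : 0 <= 2 ^+ N :> R by rewrite exprn_ge0.
have Nn : 0 <= (2 ^+ N) ^+ n :> R by rewrite exprn_ge0.
pose c t := C * (2 ^+ N) ^+ n * B t.
have c0 t : 0 <= c t by rewrite !mulr_ge0.
pose F (s : T * ('I_n * bool)) x := c s.1 * (wt (2 ^+ N) A3 (pt s.1) x * slab N k A2 (pt s.1) s.2 x).
have F0 s x : 0 <= F s x.
  by apply: mulr_ge0; [exact: c0|apply: mulr_ge0; [exact: wt_ge0|exact: slab_ge0]].
have mWS t ib : measurable_fun setT (fun x => wt (2 ^+ N) A3 (pt t) x * slab N k A2 (pt t) ib x).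
  by apply: measurable_funM; [exact: measurable_wt|exact: measurable_slab].
have mF s : measurable_fun setT (F s).
  by apply: measurable_funM; [exact: measurable_cst|exact: mWS].
have [mg _] : cintegrable (cconv (gavg N pt f) (psi phi0 k)).
  apply: cconv_cintegrable (psi_bounded LP k); last exact: psi_integrable.
  exact: gavg_integrable.
have hF x : normc (cconv (gavg N pt f) (psi phi0 k) x) <= \sum_s F s x.
  apply: (le_trans (hC N k T pt f B x gr maj Nk k0)).
  rewrite -(pair_bigA _ (fun t ib => F (t, ib) x)) /= mulr_sumr; apply: ler_sum => t _.
  rewrite /F /c /= -mulr_sumr -mulr_sumr.
  set V := wt _ _ _ _ * _.
  suff -> : C * (2 ^+ N) ^+ n * (B t * V) = C * (2 ^+ N) ^+ n * B t * V by exact: lexx.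
  ring.
apply: (le_trans (pmass_le p0 p1 mg mF F0 hF)).
have bound s : (\int[mu]_x ((F s x) `^ p)%:E <=
    ((c s.1) `^ p * (m * ((2 ^+ N) ^- n.-1 * 2 ^- k)))%:E)%E.
  have -> : (\int[mu]_x ((F s x) `^ p)%:E = \int[mu]_x (((c s.1) `^ p)%:E *
      ((wt (2 ^+ N) A3 (pt s.1) x) `^ p * (slab N k A2 (pt s.1) s.2 x) `^ p)%:E))%E.
    apply: eq_integral => x _; rewrite -EFinM -(powRM _ (wt_ge0 _ _ _ N0) (slab_ge0 _ _ _ _ _ _)).
    by rewrite -powRM// mulr_ge0 ?wt_ge0 ?slab_ge0.
  rewrite ge0_integralZl_EFin ?powR_ge0//; last 2 first.
  - by move=> x _; rewrite lee_fin mulr_ge0 ?powR_ge0.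
  - apply/measurable_EFinP; apply: measurable_funM.
      exact: (measurableT_comp (measurable_powR p) (measurable_wt A3 (pt s.1) N0)).
    exact: (measurableT_comp (measurable_powR p) (measurable_slab N k A2 (pt s.1) s.2)).
  rewrite [leRHS]EFinM; apply: lee_wpmul2l; first by rewrite lee_fin powR_ge0.
  exact: slab_integral.
apply: (le_trans (lee_sum _ (fun s _ => bound s))).
rewrite sumEFin lee_fin.
rewrite -(pair_bigA _ (fun t (ib : 'I_n * bool) => (c t) `^ p * (m * ((2 ^+ N) ^- n.-1 * 2 ^- k)))) /=.
set V := (2 ^+ N) ^- n.-1 * 2 ^- k.
rewrite (eq_bigr (fun t => (C `^ p * m * #|{: 'I_n * bool}|%:R * (((2 ^+ N) ^+ n) `^ p * V)) * (B t) `^ p)); last first.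
  move=> t _; rewrite sumr_const -[_ *+ _]mulr_natl.
  rewrite /c (powRM _ (mulr_ge0 C0 Nn) (B0 t)) (powRM _ C0 Nn).
  set z := #|_|%:R; ring.
rewrite -mulr_sumr; exact: lexx.
Qed.

(** Averaging is self-adjoint, so it may be applied to the kernel instead: on
    each cube the kernel differs from its mean by a small function of mean
    zero. *)
Lemma low_piece A : exists2 C : R, 0 <= C &
  forall N k (T : finType) (pt : T -> E) f B x,
  grid_for N pt f -> majorizes A N pt f B -> (k <= N)%N ->
  normc (cconv (gavg N pt f) (psi phi0 k) x) <= normc (cconv f (psi phi0 k) x) +
   \sum_t C * ((2 ^+ k) ^+ n * (2 ^+ k * 2 ^- N)) * B t * wt (2 ^+ k) A (pt t) x.
Proof.
have [C C0 hC] := full_local LP A.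
have [C2 C20 hC2] := psi_kdecay LP A.
exists (C * (2 * C2 * 2 ^+ A) * (1 + 1) ^+ (A + n.+1)).
  by rewrite !mulr_ge0 ?exprn_ge0 ?addr_ge0.
move=> N k T pt f B x gr maj kN.
have [B0 hB] := maj; have [disj cov fi fs] := gr.
have N0 : 0 < 2 ^+ N :> R by rewrite exprn_gt0.
have kp : 0 < 2 ^+ k :> R by rewrite exprn_gt0.
have k0 := ltW kp; have N0' := ltW N0.
have NN : (2 ^+ N) ^+ n * (2 ^- N) ^+ n = 1 :> R by rewrite -exprMn divff ?expr1n// gt_eqF.
have NN0 : 0 <= (2 ^+ N) ^+ n :> R by rewrite exprn_ge0.
have Nn0 : 0 <= (2 ^- N) ^+ n :> R by rewrite exprn_ge0 ?invr_ge0.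
have e0 : 0 <= 2 ^- N :> R by rewrite invr_ge0.
have pi := psi_integrable LP k; have [mp _] := pi.
pose P y := psi phi0 k (x - y).
have Pi : cintegrable P by exact: cintegrable_reflect.
have mP : cmeasurable P by case: Pi.
have Pb y : normc (P y) <= cmass (LP_symbol phi0 k) by exact: psi_bounded.
have bi t := gbox_cintegrable N (pt t).
have bPi t := cintegrable_indic (measurable_gbox N (pt t)) Pi.
have bfi t := cintegrable_indic (measurable_gbox N (pt t)) fi.
(* [m t] is the mean of the kernel over the cube [t] *)
pose m t := ((2 ^+ N) ^+ n)%:C * cintegral setT (fun y => \1_(gbox N (pt t)) y * P y).
pose S t := C2 * ((2 ^+ k) ^+ n * (2 ^+ k * 2 ^- N) * 2 ^+ A) * wt (2 ^+ k) A (pt t) x.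
have S0 t : 0 <= S t by rewrite /S !mulr_ge0 ?exprn_ge0 ?wt_ge0.
pose kap t y := \1_(gbox N (pt t)) y * (P y - m t).
have kapE t y : kap t y = \1_(gbox N (pt t)) y * P y - m t * \1_(gbox N (pt t)) y.
  by rewrite /kap mulrBr; congr (_ - _); exact: mulrC.
have kapi t : cintegrable (kap t).
  by apply: eq_cintegrable (cintegrableB (bPi t) (cintegrableZ (m t) (bi t))) => y; rewrite kapE.
have osc t y z : gbox N (pt t) y -> gbox N (pt t) z -> normc (P y - P z) <= 2 * S t.
  have one w : gbox N (pt t) w -> normc (P w - psi phi0 k (x - pt t)) <= S t.
    move=> hw; have := (hC2 k).2 (x - pt t) (pt t - w); rewrite addrA subrK => /le_trans; apply.
    rewrite /S [in leRHS]wtE -[leRHS]mulrA; apply: (ler_wpM2l C20).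
    have := gbox_dist hw; rewrite distrC; move: (normr_ge0 (pt t - w)).
    move: `|pt t - w| => u u0 hu; move: `|x - pt t| (normr_ge0 (x - pt t)) => v v0.
    apply: ler_wpM2r; first by rewrite weight_ge0// mulr_ge0.
    apply: (le_trans (growth_mono n A k0 u0 hu)).
    apply: ler_wpM2l; first by rewrite !mulr_ge0 ?exprn_ge0.
    rewrite lerXn2r ?nnegrE ?addr_ge0 ?mulr_ge0//.
    have : 2 ^+ k * 2 ^- N <= 1 :> R by rewrite ler_pdivrMr// mul1r ler_eXn2l ?ltr1n.
    by move: (2 ^+ k * 2 ^- N) => s; lra.
  move=> /one h1 /one h2; apply: (le_trans (cnorm_tri _ _ (psi phi0 k (x - pt t)))).
  by rewrite mulr_natl mulr2n; exact: lerD h1 h2.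
have kapS t y : normc (kap t y) <= 2 * S t.
  rewrite /kap indicE; case: (boolP (_ \in _)); last first.
    by rewrite mul0r Normc.normc0 mulr_ge0.
  rewrite inE => hy; rewrite mul1r.
  have i1 : cintegrable (fun z => P y * \1_(gbox N (pt t)) z) by exact: cintegrableZ.
  have e1 : P y - m t = ((2 ^+ N) ^+ n)%:C *
      cintegral setT (fun z => P y * \1_(gbox N (pt t)) z - \1_(gbox N (pt t)) z * P z).
    rewrite (cintegralB i1 (bPi t)) (cintegralZ _ (bi t)) cintegral_gbox mulrBr; congr (_ - _).
    by rewrite mulrCA -rmorphM NN mulr1.
  rewrite {}e1 Normc.normcM cnorm_real (ger0_norm NN0).
  have i2 : cintegrable (fun z => P y * \1_(gbox N (pt t)) z - \1_(gbox N (pt t)) z * P z).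
    exact: cintegrableB i1 (bPi t).
  have -> : 2 * S t = (2 ^+ N) ^+ n * (2 * S t * (2 ^- N) ^+ n).
    by rewrite [RHS]mulrCA NN mulr1.
  apply: (ler_wpM2l NN0).
  apply: (le_normc_cintegral (h := fun z => 2 * S t * \1_(gbox N (pt t)) z) i2).
  - apply: measurable_funM; first exact: measurable_cst.
    exact: measurable_indic (measurable_gbox N (pt t)).
  - move=> z; rewrite !indicE; case: (boolP (_ \in _)); last first.
      by rewrite mulr0 mul0r subr0 Normc.normc0 mulr0.
    by rewrite inE => hz; rewrite mulr1 mul1r mulr1; exact: osc.
  - under eq_integral do rewrite EFinM.
    rewrite ge0_integralZl_EFin//; last 2 first.
    + by apply/measurable_EFinP; exact: measurable_indic (measurable_gbox N (pt t)).
    + exact: mulr_ge0.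
    by rewrite integral_indic_gbox -EFinM.
have kap0 t : cintegral setT (kap t) = 0.
  rewrite (eq_cintegral _ (kapE t)) (cintegralB (bPi t) (cintegrableZ (m t) (bi t))).
  rewrite (cintegralZ _ (bi t)) cintegral_gbox /m mulrAC -rmorphM NN mul1r.
  exact: subrr.
have kaps t y : 1 * 2 ^- N < `|y - pt t| -> kap t y = 0.
  rewrite mul1r => hy; rewrite /kap indicE memNset ?mul0r// => /gbox_dist h.
  by move: hy; rewrite ltNge h.
have kapc t : {ae mu, forall y, ccontinuous_at (kap t) y}.
  apply: filterS (box_boundary_null (pt t) (pt t + const_mx (2 ^- N))) => y hy.
  apply: box_cut_continuous hy => e e1.
  have cp : ccontinuous (psi phi0 k) by exact: ift_ccontinuous (LP_symbol_cbump LP k).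
  have [dl dl0 hdl] := (ccontinuousP (psi phi0 k)).1 cp (x - y) e e1.
  exists dl => // z hz; have -> : P z - m t - (P y - m t) = P z - P y by rewrite opprB addrA subrK.
  apply: hdl; have -> : x - z - (x - y) = y - z.
    by rewrite opprB addrC addrA subrK.
  by rewrite distrC.
have kapf t : normc (cintegral setT (fun y => kap t y * f y)) <=
    C * (2 * S t * (1 + 1) ^+ (A + n.+1) * B t).
  have [mk _] := kapi t.
  exact: (hC N f (kap t) (2 * S t) 1 (B t) (pt t) fi mk (kapS t) (lexx 1) (kaps t) (kap0 t) (kapc t) (hB t)).
have kfi t : cintegrable (fun y => kap t y * f y).
  have [mk _] := kapi t.
  by apply: eq_cintegrable (cintegrableM fi mk (kapS t)) => y; exact: mulrC.
have diff : cconv f (psi phi0 k) x - cconv (gavg N pt f) (psi phi0 k) x =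
    \sum_t cintegral setT (fun y => kap t y * f y).
  have bPfi t : cintegrable (fun y => (\1_(gbox N (pt t)) y * f y) * P y).
    exact: (cintegrableM (bfi t) mP Pb).
  have -> : cconv f (psi phi0 k) x = \sum_t cintegral setT (fun y => (\1_(gbox N (pt t)) y * f y) * P y).
    rewrite -(cintegral_sum _ bPfi); apply: eq_cintegral_ae.
    - by apply: cmeasurableM => //; case: fi.
    - by case: (cintegrable_sum (index_enum T) bPfi).
    - apply: filterS fs => y hy.
      have [[t ht]|nt] := pselect (exists t, gbox N (pt t) y).
        rewrite (bigD1 t)//= indicE mem_set// mul1r big1 ?addr0// => s st.
        rewrite indicE memNset ?mul0r// => hs; move: st.
        by rewrite (grid_disj gr hs ht) eqxx.
      have -> : f y = 0 by apply: hy => t ht; apply: nt; exists t.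
      by rewrite mul0r big1// => t _; rewrite mulr0 mul0r.
  have gPi t : cintegrable (fun y => bmean N (pt t) f * (\1_(gbox N (pt t)) y * P y)).
    exact: cintegrableZ.
  have -> : cconv (gavg N pt f) (psi phi0 k) x =
      \sum_t cintegral setT (fun y => bmean N (pt t) f * (\1_(gbox N (pt t)) y * P y)).
    rewrite -(cintegral_sum _ gPi); apply: eq_cintegral => y.
    by rewrite /gavg mulr_suml; apply: eq_bigr => t _; rewrite /P; ring.
  rewrite -sumrB; apply: eq_bigr => t _.
  rewrite (cintegralZ _ (bPi t)) /bmean.
  transitivity (cintegral setT (fun y => (\1_(gbox N (pt t)) y * f y) * P y) -
     m t * cintegral setT (fun y => \1_(gbox N (pt t)) y * f y)).
    by congr (_ - _); rewrite /m mulrAC.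
  rewrite -(cintegralZ (m t) (bfi t)) -(cintegralB (bPfi t) (cintegrableZ (m t) (bfi t))).
  by apply: eq_cintegral => y; rewrite /kap; ring.
have -> : cconv (gavg N pt f) (psi phi0 k) x = cconv f (psi phi0 k) x -
   (cconv f (psi phi0 k) x - cconv (gavg N pt f) (psi phi0 k) x) by ring.
rewrite {}diff; apply: (le_trans (cnormB _ _)); rewrite lerD2l.
apply: (le_trans (cnorm_sum _ _ _)); apply: ler_sum => t _.
apply: (le_trans (kapf t)).
have -> : C * (2 * S t * (1 + 1) ^+ (A + n.+1) * B t) =
  C * (2 * C2 * 2 ^+ A) * (1 + 1) ^+ (A + n.+1) * ((2 ^+ k) ^+ n * (2 ^+ k * 2 ^- N)) * B t * wt (2 ^+ k) A (pt t) x.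
  by rewrite /S; ring.
exact: lexx.
Qed.

Lemma low_pmass (p : R) : 0 < p -> p <= 1 -> exists A0 : nat, forall A, (A0 <= A)%N ->
  exists2 C : R, 0 <= C &
  forall N k (T : finType) (pt : T -> E) f B,
  grid_for N pt f -> majorizes A N pt f B -> (k <= N)%N ->
  (pmass p (cconv (gavg N pt f) (psi phi0 k)) <= pmass p (cconv f (psi phi0 k)) +
   (C * (((2 ^+ k) ^+ n * (2 ^+ k * 2 ^- N)) `^ p * (2 ^+ k) ^- n) * \sum_t (B t) `^ p)%:E)%E.
Proof.
(* large enough for the [p]-th power of the weight to be integrable *)
move=> p0 p1; exists (Num.bound (n.+1%:R / p)) => A hA.
have Ap : n.+1%:R <= A%:R * p.
  rewrite -ler_pdivrMr//; apply: ltW; apply: lt_le_trans (archi_boundP _) _.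
    by rewrite divr_ge0 ?ler0n ?(ltW p0).
  by rewrite ler_nat.
have [C C0 hC] := low_piece A.
exists (C `^ p * @weight_mass R n); first by rewrite mulr_ge0 ?powR_ge0 ?weight_mass_ge0.
move=> N k T pt f B gr maj kN; have [B0 _] := maj; have [_ _ fi _] := gr.
have kp : 0 < 2 ^+ k :> R by rewrite exprn_gt0.
have k0 := ltW kp.
set V := (2 ^+ k) ^+ n * (2 ^+ k * 2 ^- N).
have V0 : 0 <= V by rewrite !mulr_ge0 ?exprn_ge0 ?invr_ge0 ?exprn_ge0.
pose c t := C * V * B t.
have c0 t : 0 <= c t by exact: mulr_ge0 (mulr_ge0 C0 V0) (B0 t).
pose F (s : option T) x := if s is Some t then c t * wt (2 ^+ k) A (pt t) x
  else normc (cconv f (psi phi0 k) x).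
have [mf _] := piece_integrable LP k fi.
have F0 s x : 0 <= F s x.
  by case: s => [t|]; [exact: mulr_ge0 (c0 t) (wt_ge0 _ _ _ k0)|exact: cnorm_ge0].
have mF s : measurable_fun setT (F s).
  case: s => [t|]; last exact: cmeasurable_normc.
  by apply: measurable_funM; [exact: measurable_cst|exact: measurable_wt].
have [mg _] : cintegrable (cconv (gavg N pt f) (psi phi0 k)).
  apply: cconv_cintegrable (psi_bounded LP k); last exact: psi_integrable.
  exact: gavg_integrable.
have optsum (V' : nmodType) (G : option T -> V') : \sum_s G s = G None + \sum_t G (Some t).
  rewrite (bigD1 None)//=; congr (_ + _).
  rewrite (reindex_omap Some id) /=; last by case.
  by apply: eq_bigl => t; rewrite eqxx.
have hF x : normc (cconv (gavg N pt f) (psi phi0 k) x) <= \sum_s F s x.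
  by rewrite optsum; exact: (hC N k T pt f B x gr maj kN).
apply: (le_trans (pmass_le p0 p1 mg mF F0 hF)).
rewrite optsum; apply: leeD2l.
have bound t : (\int[mu]_x ((F (Some t) x) `^ p)%:E <=
    ((c t) `^ p * ((2 ^+ k) ^- n * @weight_mass R n))%:E)%E.
  apply: (@le_trans _ _ (\int[mu]_x (((c t) `^ p)%:E * ((1 + 2 ^+ k * `|x - pt t|) ^- n.+1)%:E))%E).
    apply: ge0_le_integral => //.
    - by move=> x _; rewrite lee_fin powR_ge0.
    - by apply/measurable_EFinP; exact: (measurableT_comp (measurable_powR p) (mF (Some t))).
    - apply/measurable_EFinP; apply: measurable_funM; first exact: measurable_cst.
      exact: measurable_weight.
    - move=> x _; rewrite -EFinM lee_fin (powRM _ (c0 t) (wt_ge0 _ _ _ k0)).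
      apply: (ler_wpM2l (powR_ge0 _ _)); rewrite -wtE.
      exact: wt_powR.
  rewrite ge0_integralZl_EFin ?powR_ge0//; last first.
    by apply/measurable_EFinP; exact: measurable_weight.
  by rewrite (weight_integral (pt t) kp) -EFinM.
apply: (le_trans (lee_sum _ (fun t _ => bound t))).
rewrite sumEFin lee_fin.
rewrite (eq_bigr (fun t => (C `^ p * @weight_mass R n * (V `^ p * (2 ^+ k) ^- n)) * (B t) `^ p)); last first.
  move=> t _; rewrite /c (powRM _ (mulr_ge0 C0 V0) (B0 t)) (powRM _ C0 V0).
  ring.
rewrite -mulr_sumr; exact: lexx.
Qed.

End grid_averages.

(** * The Besov quasi-norm through masses of pieces *)
Section besov_interface.
Context {R : realType} {n : nat}.
Local Notation normc := (@Normc.normc R).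
Local Notation E := 'rV[R]_n.
Local Notation mu := (@lebesgue_row R n).
Implicit Types (f g h kap ker : E -> R[i]) (x y z w : E).
Variable phi0 : E -> R[i].
Hypothesis LP : LP_generator phi0.
Variables (p : R).
Hypotheses (p0 : 0 < p) (p1 : p <= 1).
Local Notation s := (n%:R / p - n%:R : R).
Local Notation piece f j := (cconv f (psi phi0 j)).

(** The [p]-th power of the Besov weight [2 ^+ k] to the [n/p - n]. *)
Definition scale_wt (k : nat) : R := ((2 ^+ k) ^+ n) `^ (1 - p).

Lemma scale_wt_gt0 k : 0 < scale_wt k.
Proof. by rewrite powR_gt0 ?exprn_gt0. Qed.

Lemma scale_wtE k : (2 `^ (s *+ k)) `^ p = scale_wt k.
Proof.
rewrite /scale_wt -powRrM -exprM -powR_mulrn// -powRrM; congr (_ `^ _).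
rewrite natrM -[_ *+ k]mulr_natr mulrAC.
rewrite mulrBl divfK ?(lt0r_neq0 p0)//; ring.
Qed.

Definition besov_term f k : \bar R := ((2 `^ (s *+ k))%:E * Lnorm mu p%:E
  (fun x => (normc (piece f k x))%:E))%E.

Lemma besov_term_ge0 f k : (0 <= besov_term f k)%E.
Proof. by apply: mule_ge0; [rewrite lee_fin powR_ge0|exact: Lnorm_ge0]. Qed.

Lemma besov_term_powR f k :
  ((besov_term f k) `^ p = (scale_wt k)%:E * pmass p (piece f k))%E.
Proof.
rewrite /besov_term (poweRM p _ (Lnorm_ge0 _ _ _)) ?lee_fin ?powR_ge0//= scale_wtE; congr (_ * _)%E.
rewrite (poweR_Lnorm _ _ (lt0r_neq0 p0)); apply: eq_integral => x _.
by rewrite gee0_abs// lee_fin; exact: cnorm_ge0.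
Qed.

Lemma besov_normE q f : tempered (regular_dist f) ->
  besov_norm phi0 s p q (regular_dist f) = Lnorm counting q (besov_term f).
Proof. by move=> h; rewrite /besov_norm asboolT. Qed.

Lemma le_poweR_inv (x y : \bar R) (r : R) : 0 < r -> (0 <= x)%E -> (0 <= y)%E ->
  (x `^ r <= y)%E -> (x <= y `^ r^-1)%E.
Proof.
move=> r0 x0 y0 h; rewrite -(poweRe1 x0) -(mulfV (lt0r_neq0 r0)) poweRrM.
by apply: gt0_ler_poweR => //; rewrite ?invr_ge0 ?ltW// ?in_itv/= ?poweR_ge0 ?leey ?y0.
Qed.

Lemma besov_term_ub f k (a : R) : (pmass p (piece f k) <= a%:E)%E ->
  (besov_term f k <= ((scale_wt k * a) `^ p^-1)%:E)%E.
Proof.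
move=> h; have a0 : 0 <= a by rewrite -lee_fin; apply: le_trans h; exact: pmass_ge0.
rewrite -poweR_EFin; apply: le_poweR_inv => //; first exact: besov_term_ge0.
  by rewrite lee_fin mulr_ge0 ?(ltW (scale_wt_gt0 _)).
by rewrite besov_term_powR EFinM lee_pmul2l// lte_fin scale_wt_gt0.
Qed.

Lemma besov_ub (q S : R) f (a : nat -> R) : 0 < q -> tempered (regular_dist f) ->
  (forall k, (pmass p (piece f k) <= (a k)%:E)%E) ->
  (forall K : nat, \sum_(k < K) (scale_wt k * a k) `^ (q / p) <= S) ->
  (besov_norm phi0 s p q%:E (regular_dist f) <= (S `^ q^-1)%:E)%E.
Proof.
move=> q0 tf ha hS; rewrite besov_normE// Lnorm_counting//.
have S0 : 0 <= S by apply: le_trans (hS 0%N); rewrite big_ord0.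
have h0 k : (0 <= `|besov_term f k| `^ q)%E by exact: poweR_ge0.
rewrite -poweR_EFin; apply: gt0_ler_poweR; rewrite ?invr_ge0 ?(ltW q0)// ?in_itv/= ?lee_fin ?S0 ?leey ?nneseries_ge0//.
apply: lime_le; first by apply: is_cvg_nneseries => k _ _; exact: h0.
apply: nearW => K; apply: (@le_trans _ _ (\sum_(0 <= k < K) ((scale_wt k * a k) `^ (q / p))%:E)%E).
  apply: lee_sum => k _; rewrite gee0_abs ?besov_term_ge0//.
  rewrite [q / p]mulrC powRrM -poweR_EFin; apply: (gt0_ler_poweR (ltW q0)).
  - by rewrite in_itv/= besov_term_ge0 leey.
  - by rewrite in_itv/= leey lee_fin powR_ge0.
  - exact: besov_term_ub.
by rewrite sumEFin lee_fin big_mkord.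
Qed.

Lemma besov_ub_sup (S : R) f (a : nat -> R) : tempered (regular_dist f) ->
  (forall k, (pmass p (piece f k) <= (a k)%:E)%E) ->
  (forall k, scale_wt k * a k <= S) ->
  (besov_norm phi0 s p +oo%E (regular_dist f) <= (S `^ p^-1)%:E)%E.
Proof.
move=> tf ha hS; rewrite besov_normE// unlock.
case: ifPn => [_|_]; last by rewrite lee_fin powR_ge0.
apply/ess_sup_inf.ess_supP; apply: aeW => k /=; rewrite gee0_abs ?besov_term_ge0//.
apply: le_trans (besov_term_ub (ha k)) _; rewrite lee_fin.
have a0 : 0 <= a k by rewrite -lee_fin; apply: le_trans (ha k); exact: pmass_ge0.
apply: ge0_ler_powR; rewrite ?invr_ge0 ?nnegrE ?(ltW p0)//.
- by rewrite mulr_ge0 ?(ltW (scale_wt_gt0 _)).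
- by apply: le_trans (hS k); rewrite mulr_ge0 ?(ltW (scale_wt_gt0 _)).
Qed.

Lemma counting_gt0 (A : set nat) k : A k -> (0 < @counting _ R A)%E.
Proof.
move=> Ak; rewrite /counting; case: asboolP => [fA|]; last by [].
rewrite lte_fin ltr0n finmap.cardfs_gt0; apply/finmap.fset0Pn; exists k.
by rewrite in_fset_set// inE.
Qed.

Lemma besov_term_le q f k : tempered (regular_dist f) -> (p%:E <= q)%E ->
  (besov_term f k <= besov_norm phi0 s p q (regular_dist f))%E.
Proof.
move=> tf pq; rewrite besov_normE//; case: q pq => [q pq|_|//].
- have q0 : 0 < q by apply: lt_le_trans p0 _; rewrite -lee_fin.
  rewrite Lnorm_counting//; apply: le_poweR_inv => //; first exact: besov_term_ge0.
    by apply: nneseries_ge0 => i _ _; exact: poweR_ge0.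
  apply: le_trans (nneseries_lim_ge k.+1 _) => [|i _ _]; last exact: poweR_ge0.
  rewrite big_nat_recr//= gee0_abs ?besov_term_ge0//; apply: leeDr.
  by apply: sume_ge0 => i _; exact: poweR_ge0.
- rewrite unlock ifT ?(counting_gt0 (k := 0%N))//.
  have [B [_ B0 hB]] := @ess_sup_inf.ess_sup_ge _ _ _ (@counting _ R) (abse \o besov_term f).
  have : ~ B k by move=> Bk; have := counting_gt0 Bk; rewrite B0 ltxx.
  by move=> /(contra_not (@hB k))/contrapT /=; rewrite gee0_abs ?besov_term_ge0.
Qed.

(** The quasi-norm is turned into finite sums over real numbers; here they are
    read off from a function of norm at most [1]. *)
Lemma besov_lb (q : R) f : p <= q -> tempered (regular_dist f) ->
  (besov_norm phi0 s p q%:E (regular_dist f) <= 1)%E ->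
  exists a : nat -> R, [/\ forall k, 0 <= a k,
    forall k, (pmass p (piece f k) <= (a k)%:E)%E &
    forall K : nat, \sum_(k < K) (scale_wt k * a k) `^ (q / p) <= 1].
Proof.
move=> pq tf h; have q0 : 0 < q by exact: lt_le_trans pq.
have fin k : besov_term f k \is a fin_num.
  rewrite ge0_fin_numE ?besov_term_ge0//; apply: le_lt_trans (besov_term_le (q := q%:E) k tf _) _ => //.
  by apply: le_lt_trans h _; rewrite ltry.
pose b k := fine (besov_term f k).
have bE k : besov_term f k = (b k)%:E by rewrite fineK.
have b0 k : 0 <= b k by rewrite -lee_fin -bE besov_term_ge0.
exists (fun k => (b k) `^ p / scale_wt k); split.
- by move=> k; rewrite divr_ge0 ?powR_ge0 ?ltW ?scale_wt_gt0.
- move=> k; rewrite -(@lee_pmul2l _ (scale_wt k)%:E) ?lte_fin ?scale_wt_gt0//.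
  rewrite -besov_term_powR bE poweR_EFin -EFinM mulrCA mulfV ?mulr1//.
  by rewrite gt_eqF ?scale_wt_gt0.
move=> K; rewrite -lee_fin -sumEFin.
move: h; rewrite besov_normE// Lnorm_counting// => h.
have {h} : (\sum_(k <oo) `|besov_term f k| `^ q <= 1)%E.
  rewrite -(@poweRe1 _ (\sum_(k <oo) _)%E); last by apply: nneseries_ge0 => i _ _; exact: poweR_ge0.
  rewrite -(mulVf (lt0r_neq0 q0)) poweRrM.
  have -> : ((q^-1 * q)%:E = (1 : \bar R) `^ q)%E by rewrite mulVf ?gt_eqF// poweR1r.
  apply: gt0_ler_poweR => //; rewrite ?(ltW q0)// in_itv/= ?leey ?poweR_ge0// ?lee01//.
apply: le_trans; apply: le_trans (nneseries_lim_ge K _) => [|k _ _]; last exact: poweR_ge0.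
rewrite big_mkord; apply: lee_sum => k _.
rewrite bE abse_EFin ger0_norm// poweR_EFin lee_fin.
rewrite mulrCA mulfV ?gt_eqF ?scale_wt_gt0// mulr1 -powRrM mulrCA mulfV ?gt_eqF// mulr1.
exact: lexx.
Qed.

End besov_interface.

(** * The upper bound on a grid *)
Section geometric.
Context {R : realType}.

Lemma eqle (a b : R) : a = b -> a <= b.
Proof. by move->. Qed.

Lemma sum_geometric_dist (z : R) (N K : nat) : 0 <= z -> z < 1 ->
  \sum_(k < K) z ^+ ((k - N) + (N - k)) <= 2 / (1 - z).
Proof.
move=> z0 z1; have d0 : 0 < 1 - z by lra.
have lo L : (L <= N)%N -> \sum_(k < L) z ^+ ((k - N) + (N - k)) <= z ^+ (N - L).+1 / (1 - z).
  elim: L => [|L IH] h; first by rewrite big_ord0 divr_ge0 ?exprn_ge0 ?(ltW d0).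
  rewrite big_ord_recr/= (eqP (ltnW h : (L - N == 0)%N)) add0n; apply: le_trans (lerD (IH (ltnW h)) (lexx _)) _.
  have -> : (N - L = (N - L.+1).+1)%N by rewrite subnSK.
  rewrite [in leLHS]exprS; move: (z ^+ _) => y; apply: eqle; field; exact: lt0r_neq0.
have hi L : \sum_(k < N + L) z ^+ ((k - N) + (N - k)) <= (1 + z - z ^+ L) / (1 - z).
  elim: L => [|L IH]; first by rewrite addn0; apply: le_trans (lo N (leqnn N)) _; rewrite subnn expr1 expr0; apply: eqle; congr (_ / _); ring.
  rewrite addnS big_ord_recr/= addKn subnDA subnn sub0n addn0; apply: le_trans (lerD IH (lexx _)) _.
  rewrite [in leRHS]exprS; move: (z ^+ _) => y; apply: eqle; field; exact: lt0r_neq0.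
have [KN|NK] := leqP K N.
  apply: le_trans (lo K KN) _; apply: ler_wpM2r; first by rewrite invr_ge0 ltW.
  by apply: (@le_trans _ _ 1); [apply: exprn_ile1 => //; exact: ltW|lra].
rewrite -(subnKC (ltnW NK)); apply: le_trans (hi _) _; apply: ler_wpM2r; first by rewrite invr_ge0 ltW.
have := exprn_ge0 (K - N) z0; lra.
Qed.

Lemma powR2_lt1 (c : R) : c < 0 -> 2 `^ c < 1 :> R.
Proof.
move=> c0; rewrite -(opprK c) powRN invf_lt1 ?powR_gt0//.
have : 1 `^ (- c) < 2 `^ (- c) :> R by apply: gt0_ltr_powR; rewrite ?oppr_gt0 ?nnegrE ?ler0n// ltr1n.
by rewrite powR1.
Qed.

Lemma powRD_le (a b th : R) : 0 <= a -> 0 <= b -> 0 <= th ->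
  (a + b) `^ th <= 2 `^ th * (a `^ th + b `^ th).
Proof.
move=> a0 b0 th0.
suff h (u v : R) : 0 <= u -> u <= v -> (u + v) `^ th <= 2 `^ th * (u `^ th + v `^ th).
  have [ab|ba] := leP a b; first exact: h.
  by rewrite addrC [X in _ * X]addrC; apply: h => //; exact: ltW.
move=> u0 uv; have v0 := le_trans u0 uv.
apply: (@le_trans _ _ ((2 * v) `^ th)).
  by apply: ge0_ler_powR => //; rewrite ?nnegrE ?addr_ge0 ?mulr_ge0//; lra.
rewrite powRM//; apply: ler_wpM2l; first exact: powR_ge0.
by rewrite lerDr powR_ge0.
Qed.

(** The correction is geometrically small away from the index [N], so its
    [th]-th powers have a sum comparable to [D `^ th]. *)
Lemma sum_dist_powR (K : nat) (a : nat -> R) (N : nat) (z th D : R) :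
  0 <= z -> z < 1 -> 1 <= th -> 0 <= D -> (forall k, 0 <= a k) ->
  \sum_(k < K) (a k) `^ th <= 1 ->
  \sum_(k < K) (a k + D * z ^+ ((k - N) + (N - k))) `^ th <=
    2 `^ th * (1 + D `^ th * (2 / (1 - z))).
Proof.
move=> z0 z1 th1 D0 a0 ha; have th0 : 0 <= th by lra.
apply: (@le_trans _ _ (\sum_(k < K) 2 `^ th * ((a k) `^ th + D `^ th * z ^+ ((k - N) + (N - k))))).
  apply: ler_sum => k _; move: (_ + _)%N => m.
  apply: le_trans (powRD_le (a0 k) (mulr_ge0 D0 (exprn_ge0 m z0)) th0) _.
  apply: ler_wpM2l; first exact: powR_ge0.
  rewrite lerD2l powRM ?exprn_ge0//; apply: ler_wpM2l; first exact: powR_ge0.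
  have zm1 : z ^+ m <= 1 by apply: exprn_ile1 => //; exact: ltW.
  have [->|y0] := eqVneq (z ^+ m) 0; first by rewrite powR0// gt_eqF// (lt_le_trans ltr01).
  have y1 : 0 < z ^+ m by rewrite lt_neqAle eq_sym y0 exprn_ge0.
  rewrite powR_pred// ler_piMr ?(ltW y1)//.
  apply: (@le_trans _ _ (1 `^ (th - 1))); last by rewrite powR1.
  apply: ge0_ler_powR; rewrite ?nnegrE ?subr_ge0 ?(ltW y1)//.
rewrite -mulr_sumr; apply: ler_wpM2l; first exact: powR_ge0.
rewrite big_split/= -mulr_sumr; apply: lerD => //.
by apply: ler_wpM2l; [exact: powR_ge0|exact: sum_geometric_dist].
Qed.

End geometric.

Section grid_upper.
Context {R : realType} {n : nat}.
Local Notation normc := (@Normc.normc R).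
Local Notation E := 'rV[R]_n.
Local Notation mu := (@lebesgue_row R n).
Implicit Types (f g h kap ker : E -> R[i]) (x y z w : E).
Variable phi0 : E -> R[i].
Hypothesis LP : LP_generator phi0.
Variables (p q : R).
Hypotheses (p0 : 0 < p) (p1 : p <= 1) (pq : p <= q) (q1 : q <= 1).
Hypothesis np : n%:R <= n.+1%:R * p.
Hypothesis n0 : (0 < n)%N.
Local Notation s := (n%:R / p - n%:R : R).
Local Notation scale_wt := (scale_wt (n := n) p).

Lemma powR2V (c : R) m : (2 ^- m) `^ c = (2 `^ (- c)) ^+ m.
Proof.
rewrite powR_inv ?exprn_gt0// -(powR_mulrn m (ler0n R 2)) -(powR_mulrn m (powR_ge0 _ _)).
by rewrite -!powRrM mulrC.
Qed.

(** At low frequencies the gain is one power of [2 ^- (N - k)], raised to [p].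
    *)
Lemma scale_low N k : (k <= N)%N ->
  scale_wt k * (((2 ^+ k) ^+ n * (2 ^+ k * 2 ^- N)) `^ p * (2 ^+ k) ^- n) =
  (2 `^ (- p)) ^+ (N - k).
Proof.
move=> kN; rewrite /scale_wt.
have e0 j : 0 < (2 ^+ j : R) by rewrite exprn_gt0.
have -> : 2 ^+ k * 2 ^- N = (2 ^+ (N - k))^-1 :> R.
  by rewrite -{1}(subnK kN) exprD invfM mulrCA mulfV ?mulr1 // gt_eqF.
have u0 : 0 < ((2 ^+ k) ^+ n : R) by rewrite exprn_gt0.
move: ((2 ^+ k) ^+ n) u0 => u u0.
rewrite powRM ?invr_ge0 ?(ltW (e0 _)) ?(ltW u0)// powR2V.
have h : u `^ (1 - p) * u `^ p = u.
  by rewrite -powRD ?(lt0r_neq0 u0) ?implybT// subrK powRr1// ltW.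
by rewrite !mulrA h mulrAC mulfV ?mul1r// gt_eqF.
Qed.

(** At high frequencies the thin layers lose against the weight by a factor
    whose exponent is negative exactly when [p > (n - 1) / n]. *)
Lemma scale_high N k : (N <= k)%N ->
  scale_wt k * (((2 ^+ N) ^+ n) `^ p * ((2 ^+ N) ^- n.-1 * 2 ^- k)) =
  (2 `^ (n%:R * (1 - p) - 1)) ^+ (k - N).
Proof.
move=> kN; rewrite /scale_wt -{1 2}(subnK kN); set m := (k - N)%N.
have e0 j : 0 < (2 ^+ j : R) by rewrite exprn_gt0.
have v0 : 0 < ((2 ^+ N) ^+ n : R) by rewrite exprn_gt0.
have -> : (2 ^+ N) ^- n.-1 = 2 ^+ N / (2 ^+ N) ^+ n :> R.
  by case: (n) n0 => [//|l] _; rewrite /= [in RHS]exprS invfM mulrA mulfV ?mul1r// gt_eqF.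
rewrite exprD exprMn.
have w0 : 0 < ((2 ^+ m) ^+ n : R) by rewrite exprn_gt0.
rewrite (powRM _ (ltW w0) (ltW v0)).
have v1 : ((2 ^+ N) ^+ n) `^ (1 - p) * ((2 ^+ N) ^+ n) `^ p = (2 ^+ N) ^+ n :> R.
  by rewrite -powRD ?(lt0r_neq0 v0) ?implybT// subrK powRr1// ltW.
have -> : (2 `^ (n%:R * (1 - p) - 1)) ^+ m = ((2 ^+ m) ^+ n) `^ (1 - p) * 2 ^- m :> R.
  rewrite -exprM -(powR_mulrn m (powR_ge0 _ _)) -!(powR_mulrn _ (ler0n R 2)) -!powRrM -powRN -powRD ?pnatr_eq0 ?implybT//.
  by congr (_ `^ _); rewrite natrM; ring.
move: v1 v0 (e0 N) (e0 m); move: (2 ^+ m : R) (2 ^+ N : R) ((2 ^+ N) ^+ n : R) (((2 ^+ m) ^+ n) `^ (1 - p)).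
move=> w x v W v1 v0 x0 w0'; move: (v `^ (1 - p)) (v `^ p) v1 => a b v1.
transitivity (a * b / v * (W / w)); first by field; rewrite !gt_eqF.
by rewrite v1 mulfV ?mul1r// gt_eqF.
Qed.

(** Each term of the average is that of [f] plus a geometrically small
    multiple of [sum_t (B t)^p], and the latter is [M^{1-p/q}] by
    [local_sums]. *)
Lemma grid_upper : exists C : R, forall N (T : finType) (pt : T -> E) f,
  (0 < #|T|)%N -> (0 < N)%N -> grid_for N pt f ->
  (besov_norm phi0 s p q%:E (regular_dist f) <= 1)%E ->
  (besov_norm phi0 s p q%:E (regular_dist (gavg N pt f)) <=
    (C * (#|T|%:R) `^ (p^-1 - q^-1))%:E)%E.
Proof.
have [A0 hA0] := low_pmass LP p0 p1.
pose A := maxn A0 (Num.bound (n.+1%:R / p)).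
have Ap : n.+1%:R <= A%:R * p.
  rewrite -ler_pdivrMr//; apply: le_trans (ltW (archi_boundP _)) _.
    by rewrite divr_ge0 ?ler0n ?(ltW p0).
  by rewrite ler_nat leq_maxr.
have [C1 C10 h1] := local_sums LP p0 p1 pq q1 np Ap.
have [C2 C20 h2] := hA0 A (leq_maxl _ _).
have [C3 C30 h3] := high_pmass LP A p0 p1.
have q0 : 0 < q by exact: lt_le_trans pq.
(* the two ratios of decay, below and above [N] *)
pose y : R := n%:R * (1 - p) - 1; pose z := 2 `^ (Num.max (- p) y).
have y0 : y < 0.
  rewrite /y; move: np; rewrite -natr1.
  have [->|pn] := eqVneq p 1; first by rewrite subrr mulr0; lra.
  have pl : p < 1 by rewrite lt_neqAle pn.
  by move: (n%:R : R) => m; nra.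
have z0 : 0 <= z by exact: powR_ge0.
have z1 : z < 1.
  have m0 : Num.max (- p) y < 0 by rewrite gt_max y0 oppr_lt0 p0.
  exact: powR2_lt1.
have th1 : 1 <= q / p by rewrite ler_pdivlMr// mul1r.
pose K0 := 2 `^ (q / p) * (1 + ((C2 + C3) * C1) `^ (q / p) * (2 / (1 - z))).
have K00 : 0 <= K0.
  by rewrite mulr_ge0 ?powR_ge0// addr_ge0// mulr_ge0 ?powR_ge0// divr_ge0//; lra.
exists (K0 `^ q^-1) => N T pt f T0 N0 gr hf.
have [disj _ fi _] := gr.
have [a [a0 ha hq]] := besov_lb p0 pq (tempered_regular fi) hf.
have [B [B0 hB hs]] := h1 N T pt f a T0 disj fi a0 ha hq.
have mj : majorizes phi0 A N pt f B by split.
set S := \sum_t _ in hs.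
have S0 : 0 <= S by apply: sumr_ge0 => t _; exact: powR_ge0.
pose M : R := #|T|%:R.
have M1 : 1 <= M by rewrite ler1n.
pose D := (C2 + C3) * (C1 * M `^ (1 - p / q)).
have D0 : 0 <= D by rewrite !mulr_ge0 ?powR_ge0// addr_ge0.
pose sh k := ((k - N) + (N - k))%N.
have sw k : 0 < scale_wt k by exact: scale_wt_gt0.
(* common treatment of the two geometric factors *)
have hX k c e m X : 0 <= c -> c <= C2 + C3 -> scale_wt k * X = e ^+ m -> 0 <= e -> e <= z ->
    c * X * S * scale_wt k <= D * z ^+ m.
  move=> c0 cC hX e0 ez; rewrite (_ : _ * scale_wt k = c * S * e ^+ m); last by rewrite -hX; ring.
  apply: ler_pM; rewrite ?exprn_ge0 ?(mulr_ge0 c0 S0)//; first exact: ler_pM.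
  by apply: lerXn2r; rewrite ?nnegrE.
have hb k : (pmass p (cconv (gavg N pt f) (psi phi0 k)) <=
             ((scale_wt k * a k + D * z ^+ sh k) / scale_wt k)%:E)%E.
  have [kN|Nk] := leqP k N.
  - apply: le_trans (h2 N k T pt f B gr mj kN) _.
    apply: le_trans (leeD (ha k) (lexx _)) _; rewrite -EFinD lee_fin ler_pdivlMr//.
    rewrite mulrDl [a k * _]mulrC lerD2l.
    have -> : sh k = (N - k)%N by rewrite /sh (eqP (kN : (k - N == 0)%N)).
    apply: (hX k _ (2 `^ (- p))); rewrite ?lerDl ?powR_ge0//; first exact: scale_low.
    by apply: ler_powR; rewrite ?le_max ?lexx// ler1n.
  - apply: le_trans (h3 N k T pt f B gr mj (ltnW Nk) (leq_ltn_trans (leq0n N) Nk)) _.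
    rewrite lee_fin ler_pdivlMr//.
    have -> : sh k = (k - N)%N by rewrite /sh (eqP (ltnW Nk : (N - k == 0)%N)) addn0.
    apply: le_trans (_ : D * z ^+ (k - N) <= _); last by rewrite lerDr mulr_ge0 ?(ltW (sw k)).
    apply: (hX k _ (2 `^ y)); rewrite ?lerDr ?powR_ge0//; first exact: (scale_high (ltnW Nk)).
    by apply: ler_powR; rewrite ?le_max ?lexx ?orbT// ler1n.
apply: le_trans (besov_ub p0 (S := K0 * M `^ (q / p - 1)) q0 _ hb _) _.
- exact/tempered_regular/gavg_integrable.
- move=> K; rewrite (eq_bigr (fun k : 'I_K => (scale_wt k * a k + D * z ^+ ((k - N) + (N - k))) `^ (q / p))); last first.
    by move=> k _; rewrite mulrC divfK// gt_eqF.
  apply: le_trans (sum_dist_powR (a := fun k => scale_wt k * a k) N z0 z1 th1 D0 _ (hq K)) _.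
    by move=> k; rewrite mulr_ge0 ?(ltW (sw k)).
  have -> : D `^ (q / p) = ((C2 + C3) * C1) `^ (q / p) * M `^ (q / p - 1).
    rewrite /D mulrA powRM ?mulr_ge0 ?addr_ge0 ?powR_ge0// -powRrM; congr (_ * _ `^ _).
    by field; rewrite (lt0r_neq0 p0) (lt0r_neq0 q0).
  have M2 : 1 <= M `^ (q / p - 1) by apply: (@le_trans _ _ (M `^ 0)); [rewrite powRr0|apply: ler_powR => //; rewrite subr_ge0].
  rewrite /K0 -[leRHS]mulrA; apply: ler_wpM2l; first exact: powR_ge0.
  by rewrite [leRHS]mulrDl mul1r [X in _ <= _ + X]mulrAC; apply: lerD; [exact: M2|exact: lexx].
- rewrite lee_fin powRM ?powR_ge0// -powRrM.
  have -> : (q / p - 1) * q^-1 = p^-1 - q^-1 by field; rewrite (lt0r_neq0 p0) (lt0r_neq0 q0).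
  exact: lexx.
Qed.

End grid_upper.

(** * Dyadic cubes *)
Section dyadic_grid.
Context {R : realType} {n : nat}.
Local Notation normc := (@Normc.normc R).
Local Notation E := 'rV[R]_n.
Local Notation mu := (@lebesgue_row R n).
Implicit Types (f g h kap ker : E -> R[i]) (x y z w : E) (m : 'rV[int]_n).

Definition lat N m : E := \row_i (2 ^- N * (m ord0 i)%:~R).

Lemma gbox_lat N m : gbox N (lat N m) = dyadic_box N m.
Proof.
rewrite dyadic_boxE /gbox /lat; congr box.
by apply/rowP => i; rewrite !mxE mulrDr mulr1.
Qed.

Lemma dyadic_box_index N m x : dyadic_box N m x -> m = dyadic_index N x.
Proof.
move=> h; apply/rowP => i; rewrite mxE; apply/esym/floor_def.
have := h i; rewrite intrD ler_pdivrMl ?exprn_gt0// => /andP[-> /=].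
by rewrite mulrC ltr_pdivlMr ?exprn_gt0// mulrC.
Qed.

Lemma dyadic_avgE N f x : dyadic_avg N f x = bmean N (lat N (dyadic_index N x)) f.
Proof.
rewrite /dyadic_avg -(@fsbig_widen _ _ _ _ [set dyadic_index N x]) //; last first.
  move=> m [_ /= mx]; rewrite indicE memNset ?mul0r// => hm.
  by apply: mx; exact: dyadic_box_index.
rewrite fsbig_set1 indicE mem_set ?mul1r; last exact: dyadic_indexP.
by rewrite /bmean gbox_lat -exprM -cintegral_mkcond.
Qed.

Lemma nonneg_side (j : int) : 1 <= 2 ^ (- j) :> R -> exists J : nat, j = - J%:Z.
Proof.
case: j => [[|j]|j] h; first by exists 0%N.
  move: h; rewrite -exprnN invr_ge1 ?unitfE ?gt_eqF ?exprn_gt0//.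
  by rewrite lt_geF// exprn_egt1// ltr1n.
by exists j.+1; rewrite NegzE.
Qed.

Lemma lebesgue_dyadic_cube (J : nat) m :
  mu (dyadic_cube (- J%:Z) m) = (((2 ^+ J) ^+ n)%:E)%E.
Proof.
rewrite /dyadic_cube opprK -exprnP.
pose I i : set R := `]2 ^+ J * (m ord0 i)%:~R, 2 ^+ J * ((m ord0 i)%:~R + 1)[%classic.
rewrite (_ : [set x | _] = [set x | forall i, I i (x ord0 i)]); last first.
  by apply/seteqP; split => x hx i; have := hx i; rewrite /I /= in_itv.
rewrite lebesgue_row_cyl; last by move=> i; exact: measurable_itv.
have l i : lebesgue_measure (I i) = (2 ^+ J)%:E.
  rewrite /I lebesgue_measure_itv/= lte_fin ltr_pM2l ?exprn_gt0// ltrDl ltr01.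
  by rewrite -EFinB; congr EFin; ring.
rewrite (eq_bigr (fun=> (2 ^+ J)%:E)) => [|i _]; last exact: l.
by rewrite big_const card_ord; elim: n => [|k IH] //=; rewrite IH exprS EFinM.
Qed.

Definition cube_index (N J : nat) m (t : {ffun 'I_n -> 'I_(2 ^ (N + J))}) : 'rV[int]_n :=
  \row_i (m ord0 i * (2 ^ (N + J))%N%:Z + (t i : nat)%:Z).

Lemma cube_boxes N J m x : (exists t, dyadic_box N (@cube_index N J m t) x) <->
  forall i, 2 ^+ J * (m ord0 i)%:~R <= x ord0 i < 2 ^+ J * ((m ord0 i)%:~R + 1).
Proof.
have e0 : 0 < (2 ^+ N : R) by rewrite exprn_gt0.
have e1 : 2 ^- N * (2 ^ (N + J))%N%:R = 2 ^+ J :> R.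
  by rewrite natrX exprD mulrA mulVf ?mul1r// gt_eqF.
split=> [[t ht] i|hx].
  have E1 : 2 ^- N * (m ord0 i * (2 ^ (N + J))%N%:Z + (t i : nat)%:Z)%:~R =
      2 ^+ J * (m ord0 i)%:~R + 2 ^- N * (t i : nat)%:R :> R.
    by rewrite intrD intrM -!pmulrn mulrDr mulrCA e1 mulrC.
  have := ht i; rewrite mxE !mulrDr E1 !mulr1.
  have t1 : (t i : nat).+1%:R <= (2 ^ (N + J))%N%:R :> R by rewrite ler_nat.
  have := ler_wpM2l (ltW (_ : 0 < 2 ^- N :> R)) t1; rewrite invr_gt0 => /(_ e0).
  have t2 : (t i : nat).+1%:R = (t i : nat)%:R + 1 :> R by rewrite natr1.
  rewrite e1 t2 mulrDr mulr1.
  have : 0 <= 2 ^- N * (t i : nat)%:R :> R by rewrite mulr_ge0// invr_ge0 ltW.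
  move: (2 ^- N * (t i : nat)%:R) => v; move: (2 ^- N : R) (2 ^+ J : R) (2 ^+ J * (m ord0 i)%:~R : R) => w c u h1 h2 /andP[h3 h4].
  by apply/andP; split; lra.
pose k i := Num.floor (2 ^+ N * x ord0 i).
have kP i : (k i)%:~R <= 2 ^+ N * x ord0 i < (k i)%:~R + 1.
  by have := floor_itv (2 ^+ N * x ord0 i); rewrite intrD.
pose L := (2 ^ (N + J))%N.
have LE : 2 ^+ N * 2 ^+ J = L%:~R :> R by rewrite -pmulrn /L natrX exprD.
have hk i : m ord0 i * L%:Z <= k i < m ord0 i * L%:Z + L%:Z.
  have /andP[h1 h2] := hx i; have /andP[h3 h4] := kP i; apply/andP; split.
    rewrite -ltzD1 -(ltr_int R) intrD intrM -LE; apply: le_lt_trans h4.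
    by move: h1; rewrite -(ler_pM2l e0) mulrA mulrC.
  rewrite -(ltr_int R) intrD intrM -LE; apply: le_lt_trans h3 _.
  move: h2; rewrite -(ltr_pM2l e0) mulrA; move: (2 ^+ N * 2 ^+ J) => c; lra.
have ht i : (absz (k i - m ord0 i * L%:Z)%R < L)%N.
  by have /andP[h1 h2] := hk i; rewrite -ltz_nat gez0_abs ?subr_ge0// ltrBlDl.
exists [ffun i => Ordinal (ht i)] => i.
have /andP[h1 h2] := hk i; rewrite mxE ffunE /= gez0_abs ?subr_ge0// addrC subrK.
have /andP[h3 h4] := kP i.
rewrite ler_pdivrMl// h3 /= mulrC ltr_pdivlMr// mulrC; exact: h4.
Qed.

(** Off the cube [f] is [0] almost everywhere, hence so are its means over the
    remaining dyadic cubes. *)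
Lemma cube_avg N J m f beta : cbump beta -> cintegral setT beta = 1 ->
  (forall x, 1 <= `|x| -> beta x = 0) -> clocally_integrable f ->
  dsupport (regular_dist f) `<=` dyadic_cube (- J%:Z) m ->
  let pt := fun t : {ffun 'I_n -> 'I_(2 ^ (N + J))} => lat N (cube_index m t) in
  grid_for N pt f /\ dyadic_avg N f = gavg N pt f.
Proof.
move=> bb b1 bs lf fQ pt.
have ae := dsupport_ae lf bb b1 bs fQ.
have [mf fK] := lf.
have sub x : dyadic_cube (- J%:Z) m x -> exists t, gbox N (pt t) x.
  move=> hx; suff [t ht] : exists t, dyadic_box N (@cube_index N J m t) x by exists t; rewrite gbox_lat.
  apply/cube_boxes => i; have := hx i; rewrite opprK -exprnP => /andP[h1 h2].
  by rewrite (ltW h1).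
have uniq x m' : gbox N (lat N m') x -> m' = dyadic_index N x.
  by rewrite gbox_lat; exact: dyadic_box_index.
have ae2 : {ae mu, forall x, (forall t, ~ gbox N (pt t) x) -> f x = 0}.
  by apply: filterS ae => x h hx; apply: h => /sub[t] /hx.
have gr : grid_for N pt f.
  split=> //.
  - move=> y; have [[t ht]|h] := pselect (exists t, gbox N (pt t) y).
      rewrite (bigD1 t)//= big1 ?addr0 ?indicE ?leq_b1//; first by case: (_ \in _).
      move=> s st; rewrite indicE memNset// => hs; move/eqP: st; apply.
      apply/ffunP => i; apply/val_inj/eqP; rewrite /= -eqz_nat; apply/eqP.
      have /rowP/(_ i) : cube_index m s = cube_index m t by rewrite (uniq _ _ hs) (uniq _ _ ht).
      by rewrite !mxE => /addrI.
    by rewrite big1// => t _; rewrite indicE memNset// => ht; apply: h; exists t.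
  - move=> y; have [h|h] := pselect (exists t, gbox N (pt t) y); [by left|right].
    exists (lat N (dyadic_index N y)); split; first by rewrite gbox_lat; exact: dyadic_indexP.
    move=> x hx t ht; apply: h; exists t; move: (uniq _ _ hx) (uniq _ _ ht) => h1 h2.
    rewrite /pt h2 -h1 gbox_lat; exact: dyadic_indexP.
  - split => //.
    pose r : R := 2 ^+ J * (\sum_i `|(m ord0 i)%:~R| + 1).
    have s0 : 0 <= \sum_i `|(m ord0 i)%:~R : R| by apply: sumr_ge0.
    have r0 : 0 <= r by rewrite mulr_ge0 ?exprn_ge0// addr_ge0.
    pose K := [set y : E | `|y - 0| <= r].
    have cK : compact K by exact: cball_compact.
    have mK : measurable K.
      rewrite -[K]setTI; apply: (@measurable_fun_le _ _ _ setT) => //; first by apply: continuous_measurable_row; exact: continuous_norm_sub.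
    have QK x : dyadic_cube (- J%:Z) m x -> K x.
      move=> hx; rewrite /K /= subr0; apply/row_norm_le => // i.
      have := hx i; rewrite opprK -exprnP.
      have : `|(m ord0 i)%:~R : R| <= \sum_i `|(m ord0 i)%:~R|.
        by rewrite [leRHS](bigD1 i)//= lerDl sumr_ge0.
      rewrite /r; move: (\sum_i _) (x ord0 i) s0 => S c S0; move: ((m ord0 i)%:~R) => u.
      rewrite ler_norml => /andP[u1 u2] /andP[h1 h2]; rewrite ler_norml; apply/andP; split.
        apply: le_trans (ltW h1); rewrite -mulrN; apply: ler_wpM2l; first exact: exprn_ge0.
        lra.
      apply: le_trans (ltW h2) _; apply: ler_wpM2l; first exact: exprn_ge0.
      lra.
    rewrite (_ : (\int[mu]_x _)%E = (\int[mu]_(x in K) (normc (f x))%:E)%E); first exact: fK.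
    rewrite [RHS]integral_mkcond; apply: ge0_ae_eq_integral => //.
    - by apply/measurable_EFinP; exact: cmeasurable_normc.
    - apply/(measurable_restrictT _ mK); apply: measurable_funTS.
      by apply/measurable_EFinP; exact: cmeasurable_normc.
    - by move=> x _; rewrite lee_fin cnorm_ge0.
    - by move=> x _; rewrite patchE; case: ifPn => // _; rewrite lee_fin cnorm_ge0.
    - apply: filterS ae => x hx _; rewrite patchE; case: ifPn => // xK.
      by rewrite hx ?Normc.normc0// => /QK Kx; move: xK; rewrite mem_set.
split=> //; apply/funext => x; rewrite dyadic_avgE.
have hx : gbox N (lat N (dyadic_index N x)) x by rewrite gbox_lat; exact: dyadic_indexP.
have [[t ht]|h] := pselect (exists t, gbox N (pt t) x).
  by rewrite (gavg_in gr ht) /pt (uniq _ _ ht).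
rewrite gavg_out; last by move=> t ht; apply: h; exists t.
rewrite /bmean -[RHS](mulr0 ((2 ^+ N) ^+ n)%:C); congr (_ * _).
transitivity (cintegral setT (fun _ : E => 0 : R[i])); last exact: cintegral0.
apply: eq_cintegral_ae.
- by apply: cmeasurableM => //; apply: cmeasurable_indic; exact: measurable_gbox.
- exact: cmeasurable_cst.
- apply: filterS ae2 => y hy; rewrite indicE.
  case: (boolP (_ \in _)); rewrite ?mul0r// inE => hy2; rewrite hy ?mulr0// => t ht.
  by apply: h; exists t; rewrite /pt (uniq _ _ ht) -(uniq _ _ hy2).
Qed.

End dyadic_grid.

(** * Littlewood-Paley pieces of a dilated wavelet *)
Section wavelet_pieces.
Context {R : realType} {n : nat}.
Local Notation normc := (@Normc.normc R).
Local Notation Re := (@complex.Re R).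
Local Notation Im := (@complex.Im R).
Local Notation E := 'rV[R]_n.
Local Notation mu := (@lebesgue_row R n).
Local Notation ift := (@inverse_fourier R n).
Implicit Types (f g h b kap ker : E -> R[i]) (x y z w c : E).

Lemma pmass_wt (p : R) A h (D r : R) c : 0 < p -> n.+1%:R <= A%:R * p -> 0 <= D -> 0 < r ->
  cmeasurable h -> (forall x, normc (h x) <= D * wt r A c x) ->
  (pmass p h <= (D `^ p * (r ^- n * @weight_mass R n))%:E)%E.
Proof.
move=> p0 Ap D0 r0 mh hD.
apply: (@le_trans _ _ (\int[mu]_x ((D `^ p)%:E * ((1 + r * `|x - c|) ^- n.+1)%:E))%E).
  apply: ge0_le_integral => //.
  - by move=> x _; rewrite lee_fin powR_ge0.
  - by apply/measurable_EFinP; exact: measurable_normc_powR.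
  - apply/measurable_EFinP; apply: measurable_funM; first exact: measurable_cst.
    exact: measurable_weight (ltW r0).
  - move=> x _; rewrite -EFinM lee_fin.
    apply: (@le_trans _ _ ((D * wt r A c x) `^ p)).
      apply: ge0_ler_powR (hD x); rewrite ?nnegrE ?cnorm_ge0 ?(ltW p0)//.
      exact: mulr_ge0 D0 (wt_ge0 _ _ _ (ltW r0)).
    rewrite (powRM _ D0 (wt_ge0 _ _ _ (ltW r0))); apply: (ler_wpM2l (powR_ge0 _ _)).
    by rewrite -wtE; exact: wt_powR (ltW r0) Ap.
rewrite ge0_integralZl_EFin ?powR_ge0//.
- by rewrite (weight_integral c r0) -EFinM lexx.
- by move=> x _; rewrite lee_fin; apply: weight_ge0; exact: mulr_ge0 (ltW r0) (normr_ge0 _).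
- by apply/measurable_EFinP; exact: measurable_weight (ltW r0).
Qed.

(** The dilation that preserves the [L1] norm. *)
Definition scaled m c b x := ((2 ^+ m) ^+ n)%:C * b (2 ^+ m *: (x - c)).

Lemma scaledE m c b x : scaled m c b x = ((2 ^+ m) ^+ n)%:C * b (- (2 ^+ m *: c) + 2 ^+ m *: x).
Proof. by rewrite /scaled scalerBr addrC. Qed.

Lemma scaled_cbump m c b : cbump b -> cbump (scaled m c b).
Proof.
move=> bb; have m0 : (2 ^+ m : R) != 0 by rewrite gt_eqF// exprn_gt0.
have := cbumpZ ((2 ^+ m) ^+ n)%:C (cbump_affine (- (2 ^+ m *: c)) m0 bb).
by congr cbump; apply/funext => x; rewrite scaledE.
Qed.

Lemma cintegral_scaled m c b : cintegrable b -> cintegral setT (scaled m c b) = cintegral setT b.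
Proof.
move=> bi; have m0 : (2 ^+ m : R) != 0 by rewrite gt_eqF// exprn_gt0.
have ai := cintegrable_affine (- (2 ^+ m *: c)) m0 bi.
rewrite (eq_cintegral _ (scaledE m c b)) (cintegralZ _ ai).
rewrite (cintegral_affine (- (2 ^+ m *: c)) m0 bi).
by rewrite ger0_norm ?exprn_ge0.
Qed.

Lemma cmass_scaled m c b : cintegrable b -> cmass (scaled m c b) = cmass b.
Proof.
move=> bi; have m0 : 0 < (2 ^+ m : R) by rewrite exprn_gt0.
have [mb _] := bi.
have mn := cmeasurable_normc mb.
rewrite /cmass; congr fine.
rewrite (ge0_integral_row_affine (- (2 ^+ m *: c)) (lt0r_neq0 m0) (F := fun x => (normc (b x))%:E)).
- rewrite (gtr0_norm m0) -ge0_integralZl_EFin ?exprn_ge0 ?(ltW m0)//.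
  + apply: eq_integral => x _; rewrite -EFinM scaledE Normc.normcM cnorm_real ger0_norm// !exprn_ge0.
  + by move=> x _; rewrite lee_fin cnorm_ge0.
  + by apply/measurable_EFinP; apply: (measurableT_comp mn); exact: measurable_affine.
- exact/measurable_EFinP.
- by move=> x; rewrite lee_fin cnorm_ge0.
Qed.

Variable phi0 : E -> R[i].
Hypothesis LP : LP_generator phi0.

Section mean_zero.
Variables (b : E -> R[i]) (rho : R).
Hypotheses (bb : cbump b) (rho0 : 0 <= rho) (br : forall x, rho <= `|x| -> b x = 0).

Lemma scaled_supp m c y : scaled m c b y != 0 -> `|y - c| <= rho * 2 ^- m.
Proof.
move=> h; rewrite leNgt; apply/negP => hy; move: h; rewrite /scaled br ?mulr0 ?eqxx//.
rewrite normrZ ger0_norm ?exprn_ge0// mulrC -ler_pdivrMr ?exprn_gt0//; exact: ltW.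
Qed.

(** The wavelet is small compared with the kernel, and its mean is zero. *)
Lemma scaled_low_piece A : cintegral setT b = 0 -> exists2 C : R, 0 <= C &
  forall k m c x, (k <= m)%N ->
  normc (cconv (scaled m c b) (psi phi0 k) x) <=
  C * ((2 ^+ k) ^+ n * (2 ^+ k * 2 ^- m)) * wt (2 ^+ k) A c x.
Proof.
move=> b0; have [C C0 hC] := psi_kdecay LP A.
exists (C * rho * (1 + rho) ^+ A * cmass b).
  by rewrite mulr_ge0 ?cmass_ge0// mulr_ge0 ?exprn_ge0 ?addr_ge0// mulr_ge0.
move=> k m c x km; have [_ hk] := hC k.
have bi := cbump_integrable bb.
have si := cbump_integrable (scaled_cbump m c bb).
have s0 : cintegral setT (scaled m c b) = 0 by rewrite (cintegral_scaled _ _ bi).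
have r0 : 0 <= (2 ^+ k : R) by rewrite exprn_ge0.
have mp := proj1 (psi_integrable LP k).
pose D := C * rho * (1 + rho) ^+ A * ((2 ^+ k) ^+ n * (2 ^+ k * 2 ^- m)) * wt (2 ^+ k) A c x.
have ci := cconv_integrand_integrable x si mp (psi_bounded LP k).
have zi := cintegrableZ (psi phi0 k (x - c)) si.
have -> : cconv (scaled m c b) (psi phi0 k) x =
    cintegral setT (fun y => scaled m c b y * psi phi0 k (x - y) - psi phi0 k (x - c) * scaled m c b y).
  by rewrite (cintegralB ci zi) (cintegralZ _ si) s0 mulr0 subr0.
apply: (@le_trans _ _ (D * cmass (scaled m c b))); last first.
  rewrite cmass_scaled// /D; apply: eqle; ring.
apply: (le_normc_cintegral (h := fun y => D * normc (scaled m c b y)) (cintegrableB ci zi)).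
- by apply: measurable_funM => //; apply: cmeasurable_normc; case: si.
- move=> y; have <- : x - c + (c - y) = x - y by rewrite addrA subrK.
  rewrite [psi phi0 k (x - c) * _]mulrC -mulrBr mulrC.
  rewrite Normc.normcM; have [->|sy] := eqVneq (scaled m c b y) 0.
    by rewrite Normc.normc0 !mulr0.
  apply: (ler_wpM2r (cnorm_ge0 _)).
  apply: (le_trans (hk (x - c) (c - y))); rewrite /D wtE.
  have := scaled_supp sy; rewrite distrC.
  move: `|c - y| (normr_ge0 (c - y)) (weight_ge0 A (mulr_ge0 r0 (normr_ge0 (x - c)))) => u u0.
  move: ((1 + 2 ^+ k * `|x - c|) ^- A) => W W0 hu.
  have e0 : 0 <= 2 ^- m :> R by rewrite invr_ge0 exprn_ge0.
  have h1 : 2 ^+ k * u <= rho * (2 ^+ k * 2 ^- m) by rewrite mulrCA; exact: ler_wpM2l.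
  have h2 : 2 ^+ k * 2 ^- m <= 1 :> R.
    by rewrite ler_pdivrMr ?exprn_gt0// mul1r ler_eXn2l// ltr1n.
  have h3 : 0 <= 2 ^+ k * 2 ^- m :> R by exact: mulr_ge0.
  move: (2 ^+ k * u) (mulr_ge0 r0 u0) h1 => v v0 h1.
  move: (2 ^+ k * 2 ^- m) h2 h3 h1 => e e1 e00 h1.
  have h4 : (1 + v) ^+ A <= (1 + rho) ^+ A.
    by apply: lerXn2r; rewrite ?nnegrE ?addr_ge0// lerD2l; apply: (le_trans h1); exact: ler_piMr.
  have k0 : 0 <= (2 ^+ k) ^+ n :> R by rewrite !exprn_ge0.
  move: ((1 + v) ^+ A) ((1 + rho) ^+ A) (exprn_ge0 A (addr_ge0 ler01 v0)) h4 => P Q P0 h4.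
  move: ((2 ^+ k) ^+ n) k0 => K k0.
  have h5 : v * P <= rho * e * Q by apply: ler_pM.
  have -> : C * (K * v * P * W) = (C * K * W) * (v * P) by ring.
  have -> : C * rho * Q * (K * e) * W = (C * K * W) * (rho * e * Q) by ring.
  apply: ler_wpM2l h5; exact: mulr_ge0 (mulr_ge0 C0 k0) W0.
- have D0 : 0 <= D.
    apply: mulr_ge0 (wt_ge0 _ _ _ r0); rewrite mulr_ge0 ?mulr_ge0 ?exprn_ge0 ?addr_ge0 ?invr_ge0//.
  by rewrite (cmassZ D0 si).
Qed.

Lemma enorm_le_norm x : enorm x <= n%:R * `|x|.
Proof.
have h := dotp_le x x; rewrite -(@ler_pXn2r _ 2)//; last 2 first.
- by rewrite nnegrE sqrtr_ge0.
- by rewrite nnegrE mulr_ge0.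
rewrite /enorm sqr_sqrtr; last by apply: sumr_ge0 => i _; exact: sqr_ge0.
apply: (le_trans (ler_norm _)); apply: (le_trans h); rewrite exprMn.
move: `|x| (normr_ge0 x) => u u0; rewrite -mulrA -expr2; apply: ler_wpM2r; first exact: sqr_ge0.
by rewrite -natrX ler_nat; case: (n) => // l; rewrite expnS expn1 leq_pmulr.
Qed.

Lemma LP_symbol_support j xi : (0 < j)%N -> LP_symbol phi0 j xi != 0 ->
  2 ^+ j <= 2 * n%:R * (1 + `|xi|).
Proof.
case: j => // j _ h; have [_ s1 s2] := LP.
have e0 : 0 < (2 ^+ j : R) by rewrite exprn_gt0.
have h1 : 1 < enorm (2 ^- j *: xi).
  rewrite ltNge; apply/negP => hx; move: h; rewrite /= (s1 _ hx).
  rewrite (s1 (2 ^- j.+1 *: xi)) ?subrr ?eqxx//; apply: le_trans hx; rewrite !enormZ.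
  apply: ler_wpM2r; first exact: sqrtr_ge0.
  rewrite !ger0_norm ?invr_ge0 ?exprn_ge0// lef_pV2 ?posrE ?exprn_gt0//.
  by rewrite ler_eXn2l// ltr1n.
have := lt_le_trans h1 (enorm_le_norm _); rewrite normrZ ger0_norm ?invr_ge0 ?exprn_ge0//.
rewrite mulrCA ltr_pdivlMl// mulr1 => h2.
have := normr_ge0 xi; move: `|xi| h2 => u h2 u0.
rewrite exprS -mulrA; apply: ler_wpM2l => //; apply: ltW; apply: (lt_le_trans h2).
by apply: ler_wpM2l => //; rewrite lerDr.
Qed.

(** On the Fourier side the [j]-th symbol lives at frequencies of size [2 ^+
    j], where the transform of [b] is small. *)
Lemma bump_piece_small (L : nat) : exists2 C : R, 0 <= C & forall j x, (0 < j)%N ->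
  normc (cconv b (psi phi0 j) x) <= C * (2 ^- j) ^+ L.
Proof.
have [C C0 hC] := ift_decay (L + n.+1) bb.
have [G G0 hG] := cbump_bounded (LP_cbump LP).
pose K := 2 * G * C * (2 * n%:R) ^+ L.
have K0 : 0 <= K by rewrite mulr_ge0 ?exprn_ge0 ?mulr_ge0.
exists (K * @weight_mass R n); first by rewrite mulr_ge0 ?weight_mass_ge0.
move=> j x j0; have bi := cbump_integrable bb.
have gi := cbump_integrable (LP_symbol_cbump LP j).
have mK : cmeasurable2 (fun y xi => wave (x - y) xi).
  have := wave_measurable2 (R := R) (n := n).
  move=> [m1 m2]; have ms : measurable_fun setT (fun p : E * E => (x - p.1, p.2)).
    apply: measurable_fun_pair => //.
    have := measurable_lin2 x (-1) 0; congr measurable_fun; apply/funext => p.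
    by rewrite scaleN1r scale0r addr0.
  split.
    rewrite (_ : (fun _ => _) = (fun p : E * E => Re (wave p.1 p.2)) \o (fun p : E * E => (x - p.1, p.2))) //.
    exact: measurableT_comp.
  rewrite (_ : (fun _ => _) = (fun p : E * E => Im (wave p.1 p.2)) \o (fun p : E * E => (x - p.1, p.2))) //.
  exact: measurableT_comp.
have [_ i2 e] := cfubini_kernel bi gi mK (fun y => waver_measurable (x - y))
  (fun xi => cmeasurable_reflect x (wave_measurable xi)) (fun y xi => eqle (normc_wave (x - y) xi)).
have -> : cconv b (psi phi0 j) x =
    cintegral setT (fun y => cintegral setT (fun xi => b y * (LP_symbol phi0 j xi * wave (x - y) xi))).
  apply: eq_cintegral => y; rewrite (cintegralZ (b y)); last exact: cintegrable_wave.
  by rewrite /psi iftE.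
rewrite e {e}.
apply: (le_normc_cintegral (h := fun xi => K * (2 ^- j) ^+ L * (1 + 1 * `|xi - 0|) ^- n.+1) i2).
- by apply: measurable_funM => //; exact: measurable_weight.
- move=> xi; have -> : cintegral setT (fun y => b y * (LP_symbol phi0 j xi * wave (x - y) xi)) =
      (LP_symbol phi0 j xi * wave x xi) * ift b (- xi).
    rewrite iftE -(cintegralZ _ (cintegrable_wave _ bi)); apply: eq_cintegral => y.
    rewrite waveDl [wave (- xi) y]waveC.
    have -> : wave (- y) xi = wave y (- xi) by rewrite /wave dotpNl dotpNr.
    ring.
  rewrite !Normc.normcM normc_wave mulr1.
  have [->|gx] := eqVneq (LP_symbol phi0 j xi) 0.
    rewrite Normc.normc0 mul0r; apply: mulr_ge0; first by rewrite mulr_ge0 ?exprn_ge0 ?invr_ge0 ?exprn_ge0.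
    by apply: weight_ge0; exact: mulr_ge0 ler01 (normr_ge0 _).
  have sup := LP_symbol_support j0 gx.
  have g2 : normc (LP_symbol phi0 j xi) <= 2 * G.
    case: (j) j0 => // j' _ /=; apply: (le_trans (cnormB _ _)).
    by have := hG (2 ^- j'.+1 *: xi); have := hG (2 ^- j' *: xi); lra.
  have := hC (- xi); rewrite normrN mul1r subr0.
  move: (normc (ift b (- xi))) (cnorm_ge0 (ift b (- xi))) => v v0.
  move: (normc (LP_symbol phi0 j xi)) (cnorm_ge0 (LP_symbol phi0 j xi)) g2 => g g0 g2.
  move: sup; have : 1 <= 1 + `|xi| by rewrite lerDl normr_ge0.
  move: (1 + `|xi|) => u u1 sup hv.
  have u0 : 0 < u by exact: lt_le_trans u1.
  have e0 : 0 < (2 ^+ j : R) by rewrite exprn_gt0.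
  have h1 : 1 <= (2 * n%:R) ^+ L * (2 ^- j) ^+ L * u ^+ L.
    rewrite -!exprMn; apply: exprn_ege1; rewrite mulrAC ler_pdivlMr// mul1r; exact: sup.
  rewrite /K ler_pdivlMr ?exprn_gt0//.
  apply: (@le_trans _ _ (g * v * u ^+ n.+1 * ((2 * n%:R) ^+ L * (2 ^- j) ^+ L * u ^+ L))).
    by apply: ler_peMr h1; rewrite mulr_ge0 ?exprn_ge0 ?(ltW u0)// mulr_ge0.
  move: hv; rewrite exprD => hv.
  have h2 : g * (u ^+ L * u ^+ n.+1 * v) <= 2 * G * C.
    apply: ler_pM => //; by rewrite !mulr_ge0 ?exprn_ge0 ?(ltW u0).
  have P0 : 0 <= (2 * n%:R) ^+ L * (2 ^- j) ^+ L :> R by rewrite mulr_ge0 ?exprn_ge0 ?invr_ge0 ?exprn_ge0 ?mulr_ge0.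
  move: ((2 * n%:R) ^+ L) ((2 ^- j) ^+ L) (u ^+ L) (u ^+ n.+1) P0 h2 => P Q U W P0 h2.
  have -> : g * v * W * (P * Q * U) = (g * (U * W * v)) * (P * Q) by ring.
  have -> : 2 * G * C * P * Q = (2 * G * C) * (P * Q) by ring.
  exact: ler_wpM2r.
- under eq_integral do rewrite EFinM.
  rewrite ge0_integralZl_EFin//.
  + by rewrite (weight_integral 0 ltr01) expr1n invr1 mul1r -EFinM lee_fin mulrAC lexx.
  + by apply/measurable_EFinP; exact: measurable_weight.
  + by rewrite mulr_ge0// exprn_ge0// invr_ge0 exprn_ge0.
Qed.

(** A statement in space: kernel and [b] are both concentrated near [0]. *)
Lemma bump_piece_decay (A : nat) : exists2 C : R, 0 <= C & forall j x,
  normc (cconv b (psi phi0 j) x) <= C * wt 1 A 0 x.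
Proof.
have [C C0 hC] := psi_kdecay LP (A + n.+1).
have [D D0 hD] := cbump_bounded bb.
pose K := D * (1 + rho) ^+ A * C.
have K0 : 0 <= K by rewrite mulr_ge0// mulr_ge0 ?exprn_ge0 ?addr_ge0.
exists (K * @weight_mass R n); first by rewrite mulr_ge0 ?weight_mass_ge0.
move=> j x; have [hk _] := hC j; have bi := cbump_integrable bb.
have mp := proj1 (psi_integrable LP j).
have r0 : 0 < (2 ^+ j : R) by rewrite exprn_gt0.
have w0 : 0 <= wt 1 A 0 x by exact: wt_ge0.
apply: (le_normc_cintegral (h := fun y => K * wt 1 A 0 x * (2 ^+ j) ^+ n * (1 + 2 ^+ j * `|y - x|) ^- n.+1)
  (cconv_integrand_integrable x bi mp (psi_bounded LP j))).
- by apply: measurable_funM => //; exact: measurable_weight (ltW r0).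
- move=> y; rewrite Normc.normcM.
  have W0 : 0 <= (1 + 2 ^+ j * `|y - x|) ^- n.+1.
    by apply: weight_ge0; exact: mulr_ge0 (ltW r0) (normr_ge0 _).
  have kk : 0 <= (2 ^+ j) ^+ n :> R by rewrite !exprn_ge0.
  have [ry|yr] := leP rho `|y|.
    by rewrite br// Normc.normc0 mul0r; exact: mulr_ge0 (mulr_ge0 (mulr_ge0 K0 w0) kk) W0.
  have := hk (x - y); rewrite distrC.
  move: (hD y) (cnorm_ge0 (b y)) (cnorm_ge0 (psi phi0 j (x - y))).
  move: (normc (b y)) (normc (psi phi0 j (x - y))) => B P hB B0 P0 hP.
  have h1 : 1 <= (1 + rho) ^+ A * (1 + 2 ^+ j * `|y - x|) ^+ A * wt 1 A 0 x.
    rewrite wtE subr0 mul1r ler_pdivlMr ?mul1r; last first.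
      by apply: exprn_gt0; rewrite ltr_pwDl// normr_ge0.
    have := weight_submul y (x - y) A ler01; rewrite !mul1r [y + _]addrC subrK distrC => h.
    apply: (le_trans h); apply: ler_pM; rewrite ?exprn_ge0 ?addr_ge0 ?normr_ge0//.
      by apply: lerXn2r; rewrite ?nnegrE ?addr_ge0 ?normr_ge0// lerD2l ltW.
    apply: lerXn2r; rewrite ?nnegrE ?addr_ge0 ?normr_ge0//.
    rewrite lerD2l; apply: ler_peMl; first exact: normr_ge0.
    by apply: exprn_ege1; rewrite ler1n.
  move: (wt 1 A 0 x) w0 h1 => w w0.
  move: hP W0; have : 0 < 1 + 2 ^+ j * `|y - x|.
    by rewrite ltr_pwDl//; exact: mulr_ge0 (ltW r0) (normr_ge0 _).
  move: (1 + 2 ^+ j * `|y - x|) => u u0; rewrite exprD invfM => hP W0 h1.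
  move: ((2 ^+ j) ^+ n) kk hP => k k0 hP.
  apply: (@le_trans _ _ (D * (C * (k * (u ^- A * u ^- n.+1))))).
    exact: ler_pM.
  have Q0 : 0 <= D * C * k * u ^- n.+1 * u ^- A.
    apply: mulr_ge0 (mulr_ge0 (mulr_ge0 (mulr_ge0 D0 C0) k0) W0) _.
    by rewrite invr_ge0 exprn_ge0 ?(ltW u0).
  apply: (@le_trans _ _ (D * C * k * u ^- n.+1 * u ^- A * ((1 + rho) ^+ A * u ^+ A * w))).
    have -> : D * (C * (k * (u ^- A * u ^- n.+1))) = D * C * k * u ^- n.+1 * u ^- A by ring.
    exact: ler_peMr.
  have ua : u ^+ A != 0 by rewrite gt_eqF// exprn_gt0.
  rewrite /K; move: (u ^+ A) (u ^- n.+1) ((1 + rho) ^+ A) ua => a v s ua.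
  apply: eqle; field; exact: ua.
- under eq_integral do rewrite EFinM.
  rewrite ge0_integralZl_EFin//.
  + rewrite (weight_integral x r0) -EFinM lee_fin.
    have : (2 ^+ j) ^+ n != 0 :> R by rewrite gt_eqF// exprn_gt0.
    have -> : (2 ^+ j) ^- n = ((2 ^+ j) ^+ n)^-1 :> R by [].
    move: ((2 ^+ j) ^+ n) (wt 1 A 0 x) => k w kn; apply: eqle; field; exact: kn.
  + by apply/measurable_EFinP; exact: measurable_weight (ltW r0).
  + by apply: mulr_ge0 (mulr_ge0 K0 w0) _; rewrite !exprn_ge0.
Qed.

(** Smallness and decay are combined by taking the geometric mean of
    [bump_piece_small] and [bump_piece_decay]. *)
Lemma bump_piece_fast (A L : nat) : exists2 C : R, 0 <= C & forall j x, (0 < j)%N ->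
  normc (cconv b (psi phi0 j) x) <= C * (2 ^- j) ^+ L * wt 1 A 0 x.
Proof.
have [C C0 hC] := bump_piece_small (L + L).
have [D D0 hD] := bump_piece_decay (A + A).
exists (C + D); first exact: addr_ge0.
move=> j x j0; have := hC j x j0; have := hD j x.
have e0 : 0 <= (2 ^- j) ^+ L :> R by rewrite exprn_ge0// invr_ge0 exprn_ge0.
have w0 := wt_ge0 A 0 x ler01.
have -> : wt 1 (A + A) 0 x = wt 1 A 0 x * wt 1 A 0 x by rewrite !wtE exprD invfM.
rewrite exprD; move: ((2 ^- j) ^+ L) (wt 1 A 0 x) (normc _) (cnorm_ge0 (cconv b (psi phi0 j) x)) e0 w0.
move=> e w v v0 e0 w0 h1 h2.
have s0 : 0 <= (C + D) * e * w by exact: mulr_ge0 (mulr_ge0 (addr_ge0 C0 D0) e0) w0.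
rewrite -(@ler_pXn2r _ 2) ?nnegrE//.
apply: (@le_trans _ _ ((C * (e * e)) * (D * (w * w)))); first by rewrite expr2; apply: ler_pM.
have -> : C * (e * e) * (D * (w * w)) = (C * D) * ((e * w) ^+ 2) by ring.
have -> : ((C + D) * e * w) ^+ 2 = (C + D) ^+ 2 * (e * w) ^+ 2 by ring.
apply: ler_wpM2r; first exact: sqr_ge0.
by nra.
Qed.

(** Littlewood-Paley kernels of positive index are dilates of one another. *)
Lemma scaled_high_piece m j c x : (0 < j)%N ->
  cconv (scaled m c b) (psi phi0 (m + j)) x =
  ((2 ^+ m) ^+ n)%:C * cconv b (psi phi0 j) (2 ^+ m *: (x - c)).
Proof.
move=> j0; have m0 : 0 < (2 ^+ m : R) by rewrite exprn_gt0.
have pE z : psi phi0 (m + j) z = ((2 ^+ m) ^+ n)%:C * psi phi0 j (2 ^+ m *: z).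
  case: (j) j0 => // i _; rewrite addnS !(psiS LP) !(low_scale LP) !scalerA -!exprD.
  have -> : (2 ^+ (m + i).+1) ^+ n = (2 ^+ m) ^+ n * (2 ^+ i.+1) ^+ n :> R by rewrite -exprMn -exprD addnS.
  have -> : (2 ^+ (m + i)) ^+ n = (2 ^+ m) ^+ n * (2 ^+ i) ^+ n :> R by rewrite -exprMn -exprD.
  have RC (s t : R) : (s * t)%:C = s%:C * t%:C by rewrite rmorphM.
  by rewrite !RC [(i.+1 + m)%N]addnC [(i + m)%N]addnC addnS mulrBr !mulrA.
have bi := cbump_integrable bb.
have ci := cconv_integrand_integrable x (cbump_integrable (scaled_cbump m c bb))
  (proj1 (psi_integrable LP (m + j))) (psi_bounded LP (m + j)).
have n0 : (2 ^- m : R) != 0 by rewrite invr_eq0 gt_eqF.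
have di := cconv_integrand_integrable (2 ^+ m *: (x - c)) bi (proj1 (psi_integrable LP j)) (psi_bounded LP j).
have nE : `|2 ^- m| = 2 ^- m :> R by rewrite ger0_norm// invr_ge0 ltW.
transitivity (cintegral setT (fun y => scaled m c b y * psi phi0 (m + j) (x - y))); first by [].
rewrite (cintegral_affine c n0 ci) nE.
transitivity (((2 ^- m) ^+ n)%:C * cintegral setT (fun y =>
   (((2 ^+ m) ^+ n)%:C * ((2 ^+ m) ^+ n)%:C) * (b y * psi phi0 j (2 ^+ m *: (x - c) - y)))).
  congr (_ * _); apply: eq_cintegral => y.
  rewrite /scaled pE [c + _]addrC addrK scalerA (mulfV (lt0r_neq0 m0)) scale1r.
  have -> : 2 ^+ m *: (x - (2 ^- m *: y + c)) = 2 ^+ m *: (x - c) - y.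
    by rewrite [2 ^- m *: y + c]addrC opprD addrA scalerBr scalerA (mulfV (lt0r_neq0 m0)) scale1r.
  ring.
rewrite (cintegralZ _ di) !mulrA -!rmorphM; congr (_%:C * _).
by rewrite -!exprMn mulVf ?gt_eqF// mul1r.
Qed.

(** Mean zero takes care of [k <= m], smoothness of [k > m]. *)
Lemma scaled_piece_pmass (p : R) : 0 < p -> p <= 1 -> cintegral setT b = 0 ->
  exists2 C : R, 0 <= C & forall k m c,
  (pmass p (cconv (scaled m c b) (psi phi0 k)) <=
   (C * (2 `^ (- p)) ^+ ((k - m) + (m - k)) / scale_wt (n := n) p k)%:E)%E.
Proof.
move=> p0 p1 b0.
(* [A] makes the weight integrable to the power [p]; [L] pays for the Besov
   weight and leaves a decay of ratio [2 `^ (- p)] *)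
pose A := Num.bound (n.+1%:R / p); pose L := Num.bound (n%:R / p + 1).
have Ap : n.+1%:R <= A%:R * p.
  rewrite -ler_pdivrMr//; apply: le_trans (ltW (archi_boundP _)) _ => //.
  by rewrite divr_ge0 ?ler0n ?(ltW p0).
have Lp : n%:R + p <= L%:R * p.
  rewrite -ler_pdivrMr// mulrDl mulfV ?gt_eqF//; apply: ltW; apply: archi_boundP.
  by rewrite addr_ge0// divr_ge0 ?ler0n ?(ltW p0).
have [C1 C10 h1] := scaled_low_piece A b0.
have [C2 C20 h2] := bump_piece_fast A L.
have W0 := @weight_mass_ge0 R n.
pose W := @weight_mass R n.
exists ((C1 `^ p + C2 `^ p) * W); first by rewrite mulr_ge0 ?addr_ge0 ?powR_ge0.
move=> k m c; have sw : 0 < scale_wt (n := n) p k by exact: scale_wt_gt0.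
have r0 i : 0 < (2 ^+ i : R) by rewrite exprn_gt0.
have z0 i : 0 <= (2 `^ (- p)) ^+ i :> R by rewrite exprn_ge0 ?powR_ge0.
have mh : cmeasurable (cconv (scaled m c b) (psi phi0 k)).
  by case: (piece_integrable LP k (cbump_integrable (scaled_cbump m c bb))).
have [km|mk] := leqP k m.
- rewrite (eqP (km : (k - m == 0)%N)) add0n.
  have V0 : 0 <= (2 ^+ k) ^+ n * (2 ^+ k * 2 ^- m) :> R.
    by rewrite !mulr_ge0 ?invr_ge0 ?exprn_ge0.
  have hh x := h1 k m c x km.
  apply: (le_trans (pmass_wt p0 Ap (mulr_ge0 C10 V0) (r0 k) mh hh)).
  rewrite lee_fin ler_pdivlMr// -(scale_low (n := n) p km) (powRM _ C10 V0).
  move: sw; set V := (_ * _) `^ p; move: (scale_wt p k) => s s0.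
  have -> : C1 `^ p * V * ((2 ^+ k) ^- n * W) * s =
    C1 `^ p * (W * (s * (V * (2 ^+ k) ^- n))) by ring.
  have -> : (C1 `^ p + C2 `^ p) * W * (s * (V * (2 ^+ k) ^- n)) =
    (C1 `^ p + C2 `^ p) * (W * (s * (V * (2 ^+ k) ^- n))) by ring.
  apply: ler_wpM2r; last by rewrite lerDl powR_ge0.
  by rewrite !mulr_ge0 ?powR_ge0 ?invr_ge0 ?exprn_ge0// ltW.
- rewrite (eqP (ltnW mk : (m - k == 0)%N)) addn0.
  pose j := (k - m)%N; have j0 : (0 < j)%N by rewrite subn_gt0.
  have kE : k = (m + j)%N by rewrite subnKC// ltnW.
  have V0 : 0 <= (2 ^+ m) ^+ n * (C2 * (2 ^- j) ^+ L) :> R.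
    by rewrite !mulr_ge0 ?exprn_ge0 ?invr_ge0 ?exprn_ge0.
  have hh x : normc (cconv (scaled m c b) (psi phi0 k) x) <=
      (2 ^+ m) ^+ n * (C2 * (2 ^- j) ^+ L) * wt (2 ^+ m) A c x.
    rewrite kE scaled_high_piece// Normc.normcM cnorm_real ger0_norm ?exprn_ge0//.
    rewrite -mulrA; apply: ler_wpM2l; first by rewrite !exprn_ge0.
    have := h2 j (2 ^+ m *: (x - c)) j0.
    by rewrite !wtE subr0 mul1r normrZ gtr0_norm.
  apply: (le_trans (pmass_wt p0 Ap V0 (r0 m) mh hh)).
  rewrite lee_fin ler_pdivlMr// -/j.
  have e0 : 0 <= (2 ^- j) ^+ L :> R by rewrite exprn_ge0 ?invr_ge0 ?exprn_ge0.
  have u0 : 0 < (2 ^+ m) ^+ n :> R by rewrite !exprn_gt0.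
  have w0 : 0 < (2 ^+ j) ^+ n :> R by rewrite !exprn_gt0.
  rewrite (powRM _ (ltW u0) (mulr_ge0 C20 e0)) (powRM _ C20 e0).
  have sE : scale_wt (n := n) p k = ((2 ^+ m) ^+ n) `^ (1 - p) * ((2 ^+ j) ^+ n) `^ (1 - p).
    by rewrite /scale_wt kE exprD exprMn (powRM _ (ltW u0) (ltW w0)).
  have uE : ((2 ^+ m) ^+ n) `^ (1 - p) * ((2 ^+ m) ^+ n) `^ p = (2 ^+ m) ^+ n :> R.
    by rewrite -powRD ?(lt0r_neq0 u0) ?implybT// subrK powRr1// ltW.
  have jE : ((2 ^+ j) ^+ n) `^ (1 - p) * ((2 ^- j) ^+ L) `^ p <= (2 `^ (- p)) ^+ j :> R.
    have -> : ((2 ^- j) ^+ L) `^ p = 2 `^ (- (j%:R * L%:R * p)) :> R.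
      rewrite exprVn -exprM powR_inv ?exprn_gt0// -(powR_mulrn _ (ler0n R 2)) -powRrM natrM.
      by congr (_ `^ _); ring.
    rewrite -exprM -(powR_mulrn _ (ler0n R 2)) -powRrM -powRD ?pnatr_eq0 ?implybT//.
    rewrite -(powR_mulrn j (powR_ge0 _ _)) -powRrM; apply: ler_powR; first by rewrite ler1n.
    rewrite natrM; have := ler0n R j; have := ler0n R n; move: Lp.
    move: (j%:R) (n%:R) (L%:R) => a d l hl d0 a0.
    have : 0 <= a * (l * p - d - p) by rewrite mulr_ge0//; lra.
    have : 0 <= a * (d * p) by rewrite (mulr_ge0 a0)// mulr_ge0// ltW.
    by lra.
  rewrite sE -/W.
  move: jE; set J := _ * _ => jE.
  have -> : ((2 ^+ m) ^+ n) `^ p * (C2 `^ p * ((2 ^- j) ^+ L) `^ p) *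
     ((2 ^+ m) ^- n * W) * (((2 ^+ m) ^+ n) `^ (1 - p) * ((2 ^+ j) ^+ n) `^ (1 - p)) =
     C2 `^ p * W * J.
    rewrite /J; move: uE u0; move: ((2 ^+ m) ^+ n : R) (((2 ^+ m) ^+ n) `^ p) (((2 ^+ m) ^+ n) `^ (1 - p)).
    move=> u u2 u1 uE u0; rewrite -uE; field; rewrite -uE in u0.
    by move: u0; have [->|?] := eqVneq u1 0; rewrite ?mul0r ?ltxx//; have [->|?] := eqVneq u2 0; rewrite ?mulr0 ?ltxx.
  apply: ler_pM => //; rewrite ?mulr_ge0 ?powR_ge0//.
  by apply: ler_wpM2r => //; rewrite lerDr powR_ge0.
Qed.

End mean_zero.
End wavelet_pieces.

(** * Sums of wavelets at distinct scales *)
Section bump_sums.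
Context {R : realType} {n : nat}.
Local Notation normc := (@Normc.normc R).
Local Notation E := 'rV[R]_n.
Local Notation mu := (@lebesgue_row R n).
Implicit Types (f g h b kap ker : E -> R[i]) (x y z w c : E).
Variable phi0 : E -> R[i].
Hypothesis LP : LP_generator phi0.
Variables (b : E -> R[i]) (rho : R).
Hypotheses (bb : cbump b) (rho0 : 0 <= rho) (br : forall x, rho <= `|x| -> b x = 0).
Hypothesis b0 : cintegral setT b = 0.
Variable p : R.
Hypotheses (p0 : 0 < p) (p1 : p <= 1).
Local Notation s := (n%:R / p - n%:R : R).
Local Notation scale_wt := (scale_wt (n := n) p).

(** Indexing the scales by the rank in [T] makes them pairwise distinct, one
    wavelet for each frequency. *)
Definition bump_sum (T : finType) (N0 : nat) (c : T -> E) (lam : R) x :=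
  lam%:C * \sum_u scaled (N0 + enum_rank u) (c u) b x.

Lemma bump_sum_integrable (T : finType) N0 (c : T -> E) lam : cintegrable (bump_sum N0 c lam).
Proof.
apply: cintegrableZ; apply: cintegrable_sum => u.
exact: cbump_integrable (scaled_cbump _ _ bb).
Qed.

Lemma bump_sum_piece (T : finType) N0 (c : T -> E) lam k x :
  cconv (bump_sum N0 c lam) (psi phi0 k) x =
  \sum_u lam%:C * cconv (scaled (N0 + enum_rank u) (c u) b) (psi phi0 k) x.
Proof.
have ci u := cconv_integrand_integrable x (cbump_integrable (scaled_cbump (N0 + enum_rank u) (c u) bb))
  (proj1 (psi_integrable LP k)) (psi_bounded LP k).
rewrite (eq_bigr (fun u => cintegral setT (fun y => lam%:C *
  (scaled (N0 + enum_rank u) (c u) b y * psi phi0 k (x - y))))); last first.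
  by move=> u _; rewrite (cintegralZ _ (ci u)).
rewrite -(cintegral_sum _ (fun u => cintegrableZ lam%:C (ci u))).
apply: eq_cintegral => y; rewrite /bump_sum -mulr_sumr -mulr_suml mulrA; exact: erefl.
Qed.

Lemma sum_rank_dist (T : finType) (N0 k : nat) (z : R) : 0 <= z -> z < 1 ->
  \sum_(u : T) z ^+ ((k - (N0 + enum_rank u)) + ((N0 + enum_rank u) - k)) <= 2 / (1 - z).
Proof.
move=> z0 z1.
apply: le_trans (sum_geometric_dist k (N0 + #|T|) z0 z1).
rewrite (reindex (@enum_val T (mem T))) /=; last first.
  by exists (@enum_rank T) => u _; [exact: enum_valK|exact: enum_rankK].
rewrite big_split_ord /=.
rewrite (eq_bigr (fun i : 'I_#|T| => z ^+ ((N0 + i - k) + (k - (N0 + i))))); last first.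
  by move=> i _; rewrite enum_valK addnC.
by rewrite lerDr; apply: sumr_ge0 => i _; exact: exprn_ge0.
Qed.

Lemma bump_sum_pmass : exists z C : R, [/\ 0 <= z, z < 1, 0 < C &
  forall (T : finType) N0 (c : T -> E) lam k, 0 <= lam ->
  (pmass p (cconv (bump_sum N0 c lam) (psi phi0 k)) <=
   (lam `^ p * C * (\sum_(u : T) z ^+ ((k - (N0 + enum_rank u)) + ((N0 + enum_rank u) - k)))
      / scale_wt k)%:E)%E].
Proof.
have [C C0 hC] := scaled_piece_pmass LP bb rho0 br p0 p1 b0.
exists (2 `^ (- p)), (C + 1); split; rewrite ?powR_ge0// ?ltr_wpDl//.
  by apply: powR2_lt1; rewrite oppr_lt0.
move=> T N0 c lam k lam0.
have si u := cbump_integrable (scaled_cbump (N0 + enum_rank u) (c u) bb).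
pose P u := cconv (scaled (N0 + enum_rank u) (c u) b) (psi phi0 k).
have mP u : cmeasurable (P u) by case: (piece_integrable LP k (si u)).
pose F u x := lam * normc (P u x).
have F0 u x : 0 <= F u x by rewrite mulr_ge0 ?cnorm_ge0.
have mF u : measurable_fun setT (F u).
  by apply: measurable_funM; [exact: measurable_cst|exact: cmeasurable_normc].
have mh : cmeasurable (cconv (bump_sum N0 c lam) (psi phi0 k)).
  by case: (piece_integrable LP k (bump_sum_integrable N0 c lam)).
have hF x : normc (cconv (bump_sum N0 c lam) (psi phi0 k) x) <= \sum_u F u x.
  rewrite bump_sum_piece; apply: (le_trans (cnorm_sum _ _ _)); apply: ler_sum => u _.
  by rewrite Normc.normcM cnorm_real ger0_norm// /F /P lexx.
apply: (le_trans (pmass_le p0 p1 mh mF F0 hF)).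
have iF u : (\int[mu]_x ((F u x) `^ p)%:E = (lam `^ p)%:E * pmass p (P u))%E.
  rewrite /pmass -ge0_integralZl_EFin ?powR_ge0//.
  - by apply: eq_integral => x _; rewrite -EFinM /F (powRM _ lam0 (cnorm_ge0 _)).
  - by move=> x _; rewrite lee_fin powR_ge0.
  - by apply/measurable_EFinP; exact: measurable_normc_powR.
rewrite (eq_bigr _ (fun u _ => iF u)).
apply: (@le_trans _ _ (\sum_u (lam `^ p * ((C + 1) * (2 `^ (- p)) ^+ ((k - (N0 + enum_rank u)) + ((N0 + enum_rank u) - k)) / scale_wt k))%:E)%E).
  apply: lee_sum => u _; rewrite EFinM; apply: lee_pmul => //; rewrite ?lee_fin ?powR_ge0 ?pmass_ge0//.
  apply: (le_trans (hC k (N0 + enum_rank u)%N (c u))); rewrite lee_fin.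
  apply: ler_wpM2r; first by rewrite invr_ge0 ltW// scale_wt_gt0.
  by apply: ler_wpM2r; [rewrite exprn_ge0 ?powR_ge0|rewrite lerDl].
rewrite sumEFin lee_fin -mulr_sumr -mulr_suml -mulr_sumr !mulrA; exact: lexx.
Qed.

(** The [k]-th term is dominated by a sum of [z ^+ |k - m|] over distinct [m],
    which is bounded uniformly in [k] and whose sum over [k] is of order
    [#|T|]. So its [q / p]-th powers still sum to the order of [#|T|]. *)
Lemma bump_sum_norm (q : \bar R) : (p%:E <= q)%E -> exists2 K : R, 0 < K &
  forall (T : finType) N0 (c : T -> E) lam, 0 <= lam -> (0 < #|T|)%N ->
  (besov_norm phi0 s p q (regular_dist (bump_sum N0 c lam)) <=
   (lam * K * (#|T|%:R) `^ (fine q^-1))%:E)%E.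
Proof.
move=> pq; have [z [C [z0 z1 C0 hC]]] := bump_sum_pmass.
pose H := 2 / (1 - z).
have H0 : 0 < H by rewrite divr_gt0// subr_gt0.
exists ((C * H) `^ p^-1); first by rewrite powR_gt0// mulr_gt0.
move=> T N0 c lam lam0 T0.
have tf := tempered_regular (bump_sum_integrable N0 c lam).
have lp0 : 0 <= lam `^ p by exact: powR_ge0.
have CH0 : 0 <= C * H by rewrite mulr_ge0// ltW.
pose cc k := \sum_(u : T) z ^+ ((k - (N0 + enum_rank u)) + ((N0 + enum_rank u) - k)).
have cc0 k : 0 <= cc k by apply: sumr_ge0 => u _; exact: exprn_ge0.
have ccH k : cc k <= H by exact: sum_rank_dist.
have sE k : scale_wt k * (lam `^ p * C * cc k / scale_wt k) = lam `^ p * C * cc k.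
  by rewrite mulrC divfK// gt_eqF// scale_wt_gt0.
have lpE : (lam `^ p * (C * H)) `^ p^-1 = lam * (C * H) `^ p^-1.
  by rewrite (powRM _ lp0 CH0) -powRrM mulfV ?gt_eqF// powRr1.
(* for an infinite exponent the uniform bound is enough *)
case: q pq => [q pq|_|//]; last first.
  rewrite invey/= powRr0 mulr1 -lpE; apply: (besov_ub_sup p0 tf (fun k => hC T N0 c lam k lam0)) => k.
  rewrite sE -mulrA; apply: (ler_wpM2l lp0); apply: ler_wpM2l (ccH k); exact: ltW.
have q0 : 0 < q by apply: lt_le_trans p0 _; rewrite -lee_fin.
have -> : fine (q%:E)^-1 = q^-1 by rewrite inver gt_eqF.
have th1 : 1 <= q / p by rewrite ler_pdivlMr// mul1r -lee_fin.
have th0 : 0 <= q / p - 1 by rewrite subr_ge0.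
pose D := lam `^ p * (C * H).
have D0 : 0 <= D by exact: mulr_ge0.
apply: (le_trans (besov_ub (S := D `^ (q / p) * #|T|%:R) p0 q0 tf (fun k => hC T N0 c lam k lam0) _)).
  move=> K; rewrite (eq_bigr (fun k : 'I_K => (lam `^ p * C * cc k) `^ (q / p))); last by move=> k _; rewrite sE.
  have DE : D `^ (q / p) = (lam `^ p * C) `^ (q / p) * H `^ (q / p - 1) * H.
    rewrite /D mulrA powRM ?(ltW H0) ?mulr_ge0 ?(ltW C0)// (powR_pred _ H0); ring.
  apply: (@le_trans _ _ (\sum_(k < K) (lam `^ p * C) `^ (q / p) * H `^ (q / p - 1) * cc k)).
    apply: ler_sum => k _; rewrite powRM ?mulr_ge0 ?(ltW C0)// -mulrA.
    apply: ler_wpM2l; first exact: powR_ge0.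
    have [->|ck] := eqVneq (cc k) 0; first by rewrite powR0 ?mulr0// gt_eqF// (lt_le_trans ltr01).
    have ck1 : 0 < cc k by rewrite lt_neqAle eq_sym ck cc0.
    rewrite (powR_pred _ ck1) mulrC; apply: ler_wpM2r => //.
    by apply: ge0_ler_powR; rewrite ?nnegrE ?(ltW H0).
  rewrite -mulr_sumr DE -[leRHS]mulrA; apply: ler_wpM2l; first by rewrite mulr_ge0 ?powR_ge0.
  rewrite /cc exchange_big /=; apply: (@le_trans _ _ (\sum_(u : T) H)); last by rewrite sumr_const mulr_natr.
  by apply: ler_sum => u _; exact: sum_geometric_dist.
rewrite lee_fin powRM ?powR_ge0// -powRrM.
have -> : q / p * q^-1 = p^-1 by rewrite mulrAC mulfV ?gt_eqF// mul1r.
rewrite /D lpE; exact: lexx.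
Qed.

End bump_sums.

(** * Lower bounds by oscillation *)
Section oscillation.
Context {R : realType}.
Implicit Types (t x : R).

Lemma sin_int_period (z : int) t : sin (2 * pi * z%:~R + t) = sin t.
Proof.
have pn (m : nat) x : sin (2 * pi * m%:R + x) = sin x.
  rewrite addrC -[RHS](periodicn (@sinD2pi R) m x); congr (sin (_ + _)).
  by rewrite -[in RHS]mulr_natr -[in RHS]mulr_natr; ring.
case: z => m; first exact: pn.
have -> : (Negz m)%:~R = - m.+1%:R :> R by rewrite NegzE mulrNz.
rewrite -[LHS](pn m.+1); congr sin; move: (m.+1%:R : R) => u; ring.
Qed.

Lemma sin_half_period t : 0 <= t -> t <= 1 -> 0 <= sin (pi * t).
Proof.
move=> t0 t1; apply: sin_ge0_pi; rewrite mulr_ge0 ?pi_ge0//=.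
by apply: ler_piMr => //; exact: pi_ge0.
Qed.

Lemma sin_second_half t : 1 <= t -> t <= 2 -> sin (pi * t) <= 0.
Proof.
move=> t1 t2; have -> : pi * t = pi * (t - 1) + pi by ring.
by rewrite sinDpi oppr_le0; apply: sin_half_period; lra.
Qed.

Lemma sin_middle t : 1 / 4 <= t -> t <= 3 / 4 -> 1 / 2 <= sin (pi * t).
Proof.
move=> t1 t2; have p0 : 0 < pi :> R by exact: pi_gt0.
have [x xE] : {x : R | x = pi * (t - 1 / 2)} by eexists.
have -> : pi * t = x + pi / 2 by rewrite xE; field.
rewrite sinDpihalf.
have hx : - (pi / 4) <= x <= pi / 4.
  by rewrite xE; apply/andP; split; nra.
have c0 : 0 <= cos x by apply: cos_ge0_pihalf; case/andP: hx => ? ?; apply/andP; split; lra.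
have : 0 <= cos (x *+ 2).
  have -> : x *+ 2 = x + x by rewrite mulr2n.
  apply: cos_ge0_pihalf; case/andP: hx => ? ?; apply/andP; split; lra.
have -> : cos (x *+ 2) = 2 * cos x ^+ 2 - 1 by rewrite cos_mulr2n mulr_natl.
move: (cos x) c0 => c c0 h; nra.
Qed.

End oscillation.

Section step_lower.
Context {R : realType} {n : nat}.
Local Notation normc := (@Normc.normc R).
Local Notation Re := (@complex.Re R).
Local Notation Im := (@complex.Im R).
Local Notation E := 'rV[R]_n.
Local Notation mu := (@lebesgue_row R n).
Implicit Types (f g h b kap ker : E -> R[i]) (x y z w c : E).

Lemma interpolate_L1 (p : R) h (S : R) : 0 < p -> p <= 1 -> cmeasurable h -> 0 <= S ->
  (forall x, normc (h x) <= S) ->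
  (\int[mu]_x (normc (h x))%:E <= (S `^ (1 - p))%:E * pmass p h)%E.
Proof.
move=> p0 p1 mh S0 hS; have mp := measurable_normc_powR p mh.
rewrite /pmass -ge0_integralZl_EFin ?powR_ge0//; last 2 first.
- by move=> x _; rewrite lee_fin powR_ge0.
- exact/measurable_EFinP.
apply: ge0_le_integral => //.
- by move=> x _; rewrite lee_fin cnorm_ge0.
- by apply/measurable_EFinP; exact: cmeasurable_normc.
- apply/measurable_EFinP; apply: measurable_funM => //.
- move=> x _; rewrite -EFinM lee_fin.
  have [e|v] := eqVneq (normc (h x)) 0; first by rewrite {1}e mulr_ge0 ?powR_ge0.
  have v0 : 0 < normc (h x) by rewrite lt_neqAle eq_sym v cnorm_ge0.
  have vE : normc (h x) = (normc (h x)) `^ (1 - p) * (normc (h x)) `^ p.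
    by rewrite -powRD ?v ?implybT// subrK powRr1// cnorm_ge0.
  rewrite {1}vE; apply: ler_wpM2r; first exact: powR_ge0.
  by apply: ge0_ler_powR; rewrite ?nnegrE ?subr_ge0 ?cnorm_ge0.
Qed.

Variable phi0 : E -> R[i].
Hypothesis LP : LP_generator phi0.

Lemma psi_mass_bound : exists2 C : R, 0 < C & forall k, cmass (psi phi0 k) <= C.
Proof.
have [C C0 hC] := psi_kdecay LP n.+1.
exists (C * @weight_mass R n + 1); first by rewrite ltr_wpDl// mulr_ge0 ?weight_mass_ge0.
move=> k; have [hk _] := hC k; have r0 : 0 < (2 ^+ k : R) by rewrite exprn_gt0.
have k0 : 0 < (2 ^+ k) ^+ n :> R by rewrite exprn_gt0.
apply: (@le_trans _ _ (C * @weight_mass R n)); last by rewrite lerDl.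
rewrite -lee_fin -cmassE; last exact: psi_integrable.
apply: (@le_trans _ _ (\int[mu]_x ((C * (2 ^+ k) ^+ n)%:E * ((1 + 2 ^+ k * `|x - 0|) ^- n.+1)%:E))%E).
  apply: ge0_le_integral => //.
  - by move=> x _; rewrite lee_fin cnorm_ge0.
  - by apply/measurable_EFinP; apply: cmeasurable_normc; case: (psi_integrable LP k).
  - apply/measurable_EFinP; apply: measurable_funM => //; exact: measurable_weight (ltW r0).
  - by move=> x _; rewrite -EFinM lee_fin subr0 -mulrA; exact: hk.
rewrite ge0_integralZl_EFin ?mulr_ge0 ?(ltW k0)//.
- rewrite (weight_integral 0 r0) -EFinM lee_fin.
  have e : (2 ^+ k) ^+ n * (2 ^+ k) ^- n = 1 :> R by rewrite mulfV ?gt_eqF.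
  have -> : C * (2 ^+ k) ^+ n * ((2 ^+ k) ^- n * @weight_mass R n) = C * ((2 ^+ k) ^+ n * (2 ^+ k) ^- n) * @weight_mass R n by ring.
  by rewrite e mulr1 lexx.
- by apply/measurable_EFinP; exact: measurable_weight (ltW r0).
Qed.

Lemma cmass_reflect f x : cintegrable f -> cmass (fun y => f (x - y)) = cmass f.
Proof.
move=> [mf _]; have mn := cmeasurable_normc mf; rewrite /cmass; congr fine.
rewrite [RHS](ge0_integral_row_affine x (r := -1) (F := fun z => (normc (f z))%:E)).
- rewrite normrN1 expr1n mul1e; apply: eq_integral => y _.
  by rewrite scaleN1r.
- by rewrite oppr_eq0 oner_eq0.
- exact/measurable_EFinP.
- by move=> z; rewrite lee_fin cnorm_ge0.
Qed.

(** The Fourier transform of a piece at [xi], computed by [ft_psi]. *)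
Lemma wave_pairing f k xi : cintegrable f ->
  cintegral setT (fun x => wave x (- xi) * cconv f (psi phi0 k) x) =
  LP_const phi0 * LP_symbol phi0 k xi * cintegral setT (fun y => f y * wave y (- xi)).
Proof.
move=> fi; have pi := psi_integrable LP k.
have [_ _ ->] := cconv_pairing fi pi (psi_bounded LP k) (wave_measurable (- xi))
  (fun x => eqle (normc_wave x (- xi))).
have wi := cintegrableM fi (wave_measurable (- xi)) (fun x => eqle (normc_wave x (- xi))).
rewrite -(cintegralZ _ wi); apply: eq_cintegral => y.
have pw : cintegrable (fun x => psi phi0 k x * wave x (- xi)).
  exact: (cintegrableM pi (wave_measurable (- xi)) (fun x => eqle (normc_wave x (- xi)))).
have vi : cintegrable (fun x => wave x (- xi) * psi phi0 k (x - y)).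
  apply: eq_cintegrable (cintegrableM (cintegrable_translate (- y) pi) (wave_measurable (- xi)) (fun x => eqle (normc_wave x (- xi)))) => x.
  by rewrite addrC mulrC.
rewrite (cintegral_translate y vi).
transitivity (f y * (wave y (- xi) * (LP_const phi0 * LP_symbol phi0 k xi))); last by ring.
rewrite -(ft_psi LP) -(cintegralZ _ pw); congr (_ * _); apply: eq_cintegral => x.
by rewrite waveDl addrAC subrr add0r; ring.
Qed.

Lemma cintegral_Im f : cintegral setT (fun x => (Im (f x))%:C) = (Im (cintegral setT f))%:C.
Proof.
Transparent cintegral.
apply: complexP => //=; rewrite /Rintegral /= integral0_eq//.
Opaque cintegral.
Qed.

Lemma sine_pairing (G : E -> R) xi : cintegrable (fun y => (G y)%:C) ->
  normc (cintegral setT (fun y => (G y * sin (2 * pi * dotp y xi))%:C)) <=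
  normc (cintegral setT (fun y => (G y)%:C * wave y (- xi))).
Proof.
move=> Gi; set f := fun y => (G y)%:C * wave y (- xi).
have fi : cintegrable f := cintegrableM Gi (wave_measurable (- xi)) (fun x => eqle (normc_wave x (- xi))).
have -> : cintegral setT (fun y => (G y * sin (2 * pi * dotp y xi))%:C) =
   (Im (cintegral setT (fun y => - f y)))%:C.
  rewrite -cintegral_Im; apply: eq_cintegral => y; congr (_%:C).
  rewrite /f /wave /cis dotpNr mulrN sinN /=; ring.
rewrite (cintegralN fi) cnorm_real; apply: (le_trans (Im_le_normc _)).
by rewrite cnormN.
Qed.

Variables (i0 : 'I_n).
Local Notation e0 := (unit_row i0 : E).

(** What averaging leaves of wavelets whose two bumps lie in adjacent cubes. *)
Definition dipoles N (T : finType) (a : T -> E) y : R :=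
  \sum_t (\1_(gbox N (a t)) y - \1_(gbox N (a t + 2 ^- N *: e0)) y).

Lemma dipoles_integrable N (T : finType) (a : T -> E) (A : R) :
  cintegrable (fun y => (A * dipoles N a y)%:C).
Proof.
have h : cintegrable (fun y => \sum_t ((\1_(gbox N (a t)) y : R[i]) - \1_(gbox N (a t + 2 ^- N *: e0)) y)).
  by apply: cintegrable_sum => t; apply: cintegrableB; exact: gbox_cintegrable.
apply: eq_cintegrable (cintegrableZ A%:C h) => y; rewrite rmorphM /dipoles rmorph_sum.
congr (_ * _); apply: eq_bigr => t _; by rewrite !indic_real -rmorphB.
Qed.

(** The sine has period two cubes and is aligned with the dipole, so it has
    the sign of the dipole everywhere; it is at least [1 / 2] in the middle of
    the positive cube. *)
Lemma dipole_sine N (a y : E) (z : int) : 2 ^+ N * a ord0 i0 = 2 * z%:~R ->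
  1 / 2 * \1_(gbox N.+1 (a + const_mx (2 ^- N / 4))) y <=
  (\1_(gbox N (a)) y - \1_(gbox N (a + 2 ^- N *: e0)) y) * sin (pi * (2 ^+ N * y ord0 i0)) :> R.
Proof.
move=> ha; pose t : R := 2 ^+ N * (y ord0 i0 - a ord0 i0).
have E0 : 0 < (2 ^+ N : R) by rewrite exprn_gt0.
have d0 : 0 < (2 ^- N : R) by rewrite invr_gt0.
have dE : 2 ^+ N * 2 ^- N = 1 :> R by rewrite mulfV ?gt_eqF.
have -> : sin (pi * (2 ^+ N * y ord0 i0)) = sin (pi * t).
  have -> : pi * (2 ^+ N * y ord0 i0) = 2 * pi * z%:~R + pi * t.
    by rewrite /t mulrBr ha; ring.
  exact: sin_int_period.
have sub : gbox N.+1 (a + const_mx (2 ^- N / 4)) y -> gbox N a y /\ (1 / 4 <= t /\ t <= 3 / 4).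
  move=> h; split.
    move=> i; have := h i; rewrite !mxE exprS invfM.
    by move: (2 ^- N) d0 => d d0 /andP[h1 h2]; apply/andP; split; lra.
  have := h i0; rewrite !mxE exprS invfM /t => /andP[h1 h2].
  have g1 := ler_wpM2l (ltW E0) h1; have g2 := ler_wpM2l (ltW E0) (ltW h2).
  have q1 : 2 ^+ N * (2 ^- N / 4) = 1 / 4 :> R by rewrite mulrA dE.
  have q2 : 2 ^+ N * (2^-1 / 2 ^+ N) = 1 / 2 :> R by rewrite mulrCA dE mulr1 div1r.
  move: g1 g2; rewrite !mulrDr q1 q2 mulrN.
  by move: (2 ^+ N * a ord0 i0) (2 ^+ N * y ord0 i0) => u v; lra.
have b1 : gbox N a y -> 0 <= t /\ t < 1.
  move=> h; have := h i0; rewrite !mxE /t => /andP[h1 h2]; split.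
    by rewrite mulr_ge0 ?(ltW E0)// subr_ge0.
  have : 2 ^+ N * (y ord0 i0 - a ord0 i0) < 2 ^+ N * 2 ^- N by rewrite ltr_pM2l// ltrBlDl.
  by rewrite dE.
have b2 : gbox N (a + 2 ^- N *: e0) y -> 1 <= t /\ t <= 2.
  move=> h; have := h i0; rewrite !mxE !eqxx /= !mulr1 /t => /andP[h1 h2]; split.
    apply: (@le_trans _ _ (2 ^+ N * 2 ^- N)); first by rewrite dE.
    by apply: ler_wpM2l; [exact: ltW|lra].
  apply: (@le_trans _ _ (2 ^+ N * (2 ^- N + 2 ^- N))); last by rewrite mulrDr dE.
  by apply: ler_wpM2l; [exact: ltW|lra].
have iT (X : set E) : X y -> \1_X y = 1 :> R by move=> h; rewrite indicE mem_set.
have iF (X : set E) : ~ X y -> \1_X y = 0 :> R by move=> h; rewrite indicE memNset.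
have [ya|na] := pselect (gbox N a y).
  have nb : ~ gbox N (a + 2 ^- N *: e0) y by move=> /b2[? _]; have := b1 ya; lra.
  rewrite (iT _ ya) (iF _ nb) subr0 [1 * sin _]mul1r.
  have [ys|ns] := pselect (gbox N.+1 (a + const_mx (2 ^- N / 4)) y).
    by rewrite (iT _ ys) mulr1; have [_ [? ?]] := sub ys; exact: sin_middle.
  by rewrite (iF _ ns) mulr0; have [? ?] := b1 ya; apply: sin_half_period => //; exact: ltW.
have ns : ~ gbox N.+1 (a + const_mx (2 ^- N / 4)) y by move=> /sub[].
rewrite (iF _ ns) (iF _ na) mulr0 sub0r.
have [yb|nb] := pselect (gbox N (a + 2 ^- N *: e0) y); last by rewrite (iF _ nb) oppr0 mul0r.
rewrite (iT _ yb) mulN1r oppr_ge0; have [? ?] := b2 yb; exact: sin_second_half.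
Qed.

(** Pairing with the wave bounds the [L1] norm of the piece from below, and
    interpolation with the trivial bound on its supremum transfers this to
    [Lp]. The alignment condition says that every dipole starts at an even
    multiple of the side. *)
Lemma dipoles_oscillate (p : R) : 0 < p -> p <= 1 -> exists2 C : R, 0 < C &
  forall N (T : finType) (a : T -> E) (A : R), (0 < N)%N -> 0 < A ->
  (forall t, exists z : int, 2 ^+ N.+1 * a t ord0 i0 = 2 * z%:~R) ->
  (forall y, `|dipoles N.+1 a y| <= 1) ->
  ((C * #|T|%:R * A `^ p * (2 ^- N.+1) ^+ n)%:E <=
    pmass p (cconv (fun y => (A * dipoles N.+1 a y)%:C) (psi phi0 N)))%E.
Proof.
move=> p0 p1; have [D D0 hD] := psi_mass_bound.
have c0 := LP_const_gt0 LP.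
exists (normc (LP_const phi0) / 2 * (1 / 2) ^+ n / D `^ (1 - p)).
  by rewrite divr_gt0 ?powR_gt0// mulr_gt0 ?divr_gt0// exprn_gt0.
move=> N T a A N0 A0 ha hd; set f := fun y => _.
have fi : cintegrable f by exact: dipoles_integrable.
pose xi : E := 2 ^+ N *: e0.
have en : enorm e0 = 1 by rewrite /enorm dotp_unit_row mxE !eqxx sqrtr1.
(* the frequency at which [phi0] has already dropped from [1] to [0] between
   two scales *)
have symb : LP_symbol phi0 N xi = 1.
  have [_ s1 s2] := LP; rewrite /xi; case: (N) N0 => // k _ /=; rewrite !scalerA.
  rewrite mulVf ?gt_eqF ?exprn_gt0// scale1r exprS mulrCA mulVf ?gt_eqF ?exprn_gt0// mulr1.
  by rewrite s1 ?en// s2 ?subr0// enormZ en mulr1 ger0_norm//; lra.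
have dxi y : 2 * pi * dotp y xi = pi * (2 ^+ N.+1 * y ord0 i0).
  by rewrite /xi dotpZr dotp_unit_row exprS; ring.
set h := cconv f (psi phi0 N).
have hi : cintegrable h by exact: piece_integrable.
have psii := psi_integrable LP N.
have [mpsi _] := psii; have mn := cmeasurable_normc mpsi.
have hS x : normc (h x) <= A * D.
  apply: (le_normc_cintegral (h := fun y => A * normc (psi phi0 N (x - y)))
    (cconv_integrand_integrable x fi mpsi (psi_bounded LP N))).
  - apply: measurable_funM => //; apply: cmeasurable_normc; exact: cmeasurable_reflect.
  - move=> y; rewrite Normc.normcM; apply: ler_wpM2r; first exact: cnorm_ge0.
    by rewrite cnorm_real normrM gtr0_norm// ler_piMr// ltW.
  - have ri := cintegrable_reflect x psii.
    rewrite (cmassZ (ltW A0) ri) lee_fin; apply: (ler_wpM2l (ltW A0)).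
    by rewrite (cmass_reflect x psii); exact: hD.
have v0 : 0 < (2 ^- N.+1) ^+ n :> R by rewrite exprn_gt0// invr_gt0 exprn_gt0.
have low : A / 2 * #|T|%:R * ((1 / 2) ^+ n * (2 ^- N.+1) ^+ n) <=
    normc (cintegral setT (fun y => f y * wave y (- xi))).
  apply: le_trans (sine_pairing xi fi).
  (* a lower bound for the product of the dipoles with the sine, see
     [dipole_sine] *)
  pose sb y : R := \sum_t A / 2 * \1_(gbox N.+2 (a t + const_mx (2 ^- N.+1 / 4))) y.
  pose F y := A * dipoles N.+1 a y * sin (2 * pi * dotp y xi).
  have Fi : cintegrable (fun y => (F y)%:C).
    have ms : cmeasurable (fun y => (sin (2 * pi * dotp y xi))%:C).
      by apply: cmeasurable_real; case: (wave_measurable (R := R) (n := n) xi).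
    have sB y : normc (sin (2 * pi * dotp y xi))%:C <= 1 by rewrite cnorm_real sin_max.
    by apply: eq_cintegrable (cintegrableM fi ms sB) => y; rewrite /f -rmorphM.
  have gi t := gbox_cintegrable N.+2 (a t + const_mx (2 ^- N.+1 / 4)).
  have sbE y : (sb y)%:C = \sum_t (A / 2)%:C * \1_(gbox N.+2 (a t + const_mx (2 ^- N.+1 / 4))) y.
    by rewrite /sb rmorph_sum; apply: eq_bigr => t _; rewrite rmorphM indic_real.
  have si : cintegrable (fun y => (sb y)%:C).
    apply: (eq_cintegrable (fun y => esym (sbE y))); apply: cintegrable_sum => t.
    exact: cintegrableZ (gi t).
  have si2 : cintegral setT (fun y => (sb y)%:C) =
      (A / 2 * #|T|%:R * ((1 / 2) ^+ n * (2 ^- N.+1) ^+ n))%:C.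
    rewrite (eq_cintegral _ sbE) (cintegral_sum _ (fun t => cintegrableZ _ (gi t))).
    rewrite (eq_bigr (fun=> (A / 2 * ((1 / 2) ^+ n * (2 ^- N.+1) ^+ n))%:C)); last first.
      move=> t _; rewrite (cintegralZ _ (gi t)) cintegral_gbox -rmorphM; congr (_ * _)%:C.
      by rewrite -exprMn [2 ^+ N.+2]exprS invfM div1r.
    by rewrite sumr_const -rmorphMn; congr (_%:C); rewrite -mulr_natr; ring.
  have FS y : sb y <= F y.
    rewrite /F /dipoles -mulrA mulr_suml mulr_sumr; apply: ler_sum => t _.
    have [z hz] := ha t; have := dipole_sine y hz; rewrite -dxi => hh.
    by rewrite -mulrA; apply: (ler_wpM2l (ltW A0)); rewrite -div1r.
  have : cintegral setT (fun y => (F y)%:C) - cintegral setT (fun y => (sb y)%:C) =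
      (fine (\int[mu]_y (F y - sb y)%:E)%E)%:C.
    rewrite -(cintegralB Fi si) -cintegral_real; apply: eq_cintegral => y.
    by rewrite rmorphB.
  rewrite si2; move/eqP; rewrite subr_eq -rmorphD => /eqP ->.
  rewrite cnorm_real; apply: le_trans (ler_norm _); rewrite lerDr fine_ge0//.
  by apply: integral_ge0 => y _; rewrite lee_fin subr_ge0.
have up : ((normc (LP_const phi0) * (A / 2 * #|T|%:R * ((1 / 2) ^+ n * (2 ^- N.+1) ^+ n)))%:E <=
    ((A * D) `^ (1 - p))%:E * pmass p h)%E.
  have [mh _] := hi.
  apply: le_trans (interpolate_L1 p0 p1 mh (mulr_ge0 (ltW A0) (ltW D0)) hS).
  have wi : cintegrable (fun x => wave x (- xi) * h x).
    apply: eq_cintegrable (cintegrableM hi (wave_measurable (- xi)) (fun x => eqle (normc_wave x (- xi)))) => x.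
    exact: mulrC.
  have := normc_cintegral wi; rewrite (wave_pairing N xi fi) symb mulr1 Normc.normcM.
  rewrite (eq_integral (fun x => (normc (h x))%:E)); last first.
    by move=> x _; rewrite Normc.normcM normc_wave mul1r.
  apply: le_trans; rewrite lee_fin; apply: ler_wpM2l low; exact: cnorm_ge0.
have s0 : 0 < (A * D) `^ (1 - p) by rewrite powR_gt0// mulr_gt0.
rewrite -(@lee_pmul2l _ ((A * D) `^ (1 - p))%:E) ?lte_fin//.
apply: le_trans up; rewrite -EFinM lee_fin.
rewrite (powRM _ (ltW A0) (ltW D0)).
have AE : A `^ (1 - p) * A `^ p = A by rewrite -powRD ?(lt0r_neq0 A0) ?implybT// subrK powRr1// ltW.
have d0 : D `^ (1 - p) != 0 by rewrite gt_eqF// powR_gt0.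
rewrite -[in leRHS]AE; move: (A `^ (1 - p)) (A `^ p) (D `^ (1 - p)) d0 ((2 ^- N.+1) ^+ n) ((1 / 2) ^+ n) => a1 a2 d d0 v w.
apply: eqle; field; exact: d0.
Qed.

End step_lower.

(** * The test functions and the two bounds *)
Section test_function.
Context {R : realType} {n : nat}.
Local Notation normc := (@Normc.normc R).
Local Notation E := 'rV[R]_n.
Local Notation mu := (@lebesgue_row R n).
Implicit Types (f g h kap ker : E -> R[i]) (x y z w : E).

Lemma cube_index_inj N J (m : 'rV[int]_n) : injective (@cube_index n N J m).
Proof.
move=> s t st; apply/ffunP => i; apply/val_inj/eqP; rewrite /= -eqz_nat; apply/eqP.
by have /rowP/(_ i) := st; rewrite !mxE => /addrI.
Qed.

Lemma cintegrable_clocally f : cintegrable f -> clocally_integrable f.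
Proof.
move=> [mf fi]; split=> // K cK; apply: le_lt_trans fi.
have mK : measurable K.
  by rewrite -[K]setCK; apply: measurableC; apply: open_measurable_row; apply: closed_openC; apply: compact_closed => //; exact: norm_hausdorff.
apply: ge0_subset_integral => //; last by move=> x _; rewrite lee_fin cnorm_ge0.
by apply/measurable_EFinP; exact: cmeasurable_normc.
Qed.

Lemma dsupport_closed f (S : set E) : cmeasurable f -> closed S -> (forall x, f x != 0 -> S x) ->
  dsupport (regular_dist f) `<=` S.
Proof.
move=> mf cS fS x hx; apply: contrapT => Sx; apply: hx.
exists (~` S) => //; split; first exact: closed_openC.
move=> t [_ _ ts]; rewrite /regular_dist.
transitivity (cintegral setT (fun _ : E => 0 : R[i])); last exact: cintegral0.
apply: eq_cintegral => y; have [->|fy] := eqVneq (f y) 0; first exact: mul0r.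
have [->|ty] := eqVneq (t y) 0; first exact: mulr0.
have /ts : closure [set x | t x != 0] y by exact: subset_closure.
by move=> /(_ (fS y fy)).
Qed.

Lemma bmean_bump N (k : 'rV[int]_n) g y : cintegrable g -> cintegral setT g = 1 ->
  (forall z, g z != 0 -> dyadic_box N k z) ->
  bmean N (lat N (dyadic_index N y)) g = ((2 ^+ N) ^+ n)%:C * \1_(dyadic_box N k) y.
Proof.
move=> gi g1 gs; rewrite /bmean; congr (_ * _); rewrite gbox_lat.
have [hy|hy] := pselect (dyadic_box N k y).
  rewrite [RHS]indicE mem_set// -[RHS]g1 -(dyadic_box_index hy); apply: eq_cintegral => z.
  have [->|gz] := eqVneq (g z) 0; first by rewrite mulr0.
  by rewrite indicE mem_set ?mul1r//; exact: gs.
rewrite [RHS]indicE memNset//.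
transitivity (cintegral setT (fun _ : E => 0 : R[i])); last exact: cintegral0.
apply: eq_cintegral => z; have [->|gz] := eqVneq (g z) 0; first by rewrite mulr0.
rewrite indicE memNset ?mul0r// => hz; apply: hy.
rewrite (dyadic_box_index (gs z gz)) -(dyadic_box_index hz); exact: dyadic_indexP.
Qed.

Variables (i0 : 'I_n) (beta : E -> R[i]).
Local Notation e0 := (unit_row i0 : E).
Hypotheses (bb : cbump beta) (b1 : cintegral setT beta = 1)
  (bs : forall x, 1 / 4 <= `|x| -> beta x = 0).

(** Two translates, so that the two bumps can be put into different cubes
    while the mean is zero. *)
Definition wavelet y := beta (e0 + 1 *: y) - beta (- e0 + 1 *: y).

Lemma wavelet_cbump : cbump wavelet.
Proof. by apply: cbumpB; apply: cbump_affine; rewrite ?oner_neq0. Qed.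

Lemma wavelet_mean0 : cintegral setT wavelet = 0.
Proof.
have bi := cbump_integrable bb.
have n1 : (1 : R) != 0 by rewrite oner_neq0.
have ai a := cintegrable_affine a n1 bi.
have m1 a : cintegral setT (fun y => beta (a + 1 *: y)) = 1.
  have := cintegral_affine a n1 bi; rewrite b1 normr1 expr1n mul1r => h; exact: esym h.
by rewrite /wavelet (cintegralB (ai _) (ai _)) !m1 subrr.
Qed.

Lemma norm_unit_row : `|e0| <= 1.
Proof.
apply/row_norm_le => // i; rewrite mxE eqxx /=; case: eqP => _ /=; rewrite ?normr1 ?normr0//.
Qed.

Lemma wavelet_supp y : 5 / 4 <= `|y| -> wavelet y = 0.
Proof.
move=> h; have e := norm_unit_row.
have h1 := lerB_normD y e0; have h2 := lerB_normD y (- e0); rewrite normrN in h2.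
rewrite /wavelet !scale1r ![_ + y]addrC.
move: h1 h2; move: (@bs (y + e0)) (@bs (y - e0)).
move: `|y| `|e0| h e (`|y + e0|) (`|y - e0|) => u v hu hv s t bs1 bs2 h1 h2.
by rewrite bs1 ?bs2 ?subrr//; lra.
Qed.

Lemma scaled_wavelet k c x : scaled k c wavelet x =
  scaled k (c - 2 ^- k *: e0) beta x - scaled k (c + 2 ^- k *: e0) beta x.
Proof.
have k0 : (2 ^+ k : R) != 0 by rewrite gt_eqF// exprn_gt0.
have h1 : x - (c - 2 ^- k *: e0) = 2 ^- k *: e0 + (x - c) by rewrite opprB addrCA.
have h2 : x - (c + 2 ^- k *: e0) = - (2 ^- k *: e0) + (x - c) by rewrite opprD [- c - _]addrC addrCA.
rewrite /scaled /wavelet -mulrBr !scale1r h1 h2 ![_ *: (_ + (x - c))]scalerDr scalerN !scalerA mulfV//.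
by rewrite scale1r.
Qed.

Variables (K J : nat) (m : 'rV[int]_n).
Local Notation N := K.+1.
Local Notation T := {ffun 'I_n -> 'I_(2 ^ (K + J))}.
Let v (t : T) := cube_index m t.
Definition corner (t : T) : E := lat K (cube_index m t).
(** The midpoint of the common face of two adjacent cubes of side [2 ^- K.+1]
    in the dyadic cube of side [2 ^- K] with the given corner. *)
Definition center (t : T) : E := corner t + 2 ^- K.+2 *: (const_mx 1 + e0).

Lemma mulr2n_int (z : int) : z + z = z * 2.
Proof. by rewrite mulrDr mulr1. Qed.

Lemma corner_lat t : corner t = lat N (v t *+ 2).
Proof.
apply/rowP => i; rewrite mxE [RHS]mxE.
have -> : (v t *+ 2) ord0 i = v t ord0 i * 2 by rewrite mulr2n mxE mulr2n_int.
rewrite intrM exprS invfM; move: (2 ^- K : R) ((v t ord0 i)%:~R : R) => d u.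
by field.
Qed.

Lemma corner_next t : corner t + 2 ^- N *: e0 = lat N (v t *+ 2 + delta_mx ord0 i0).
Proof.
rewrite corner_lat; apply/rowP => i; rewrite mxE [lat _ _ _ _]mxE [RHS]mxE.
have -> : (v t *+ 2 + delta_mx ord0 i0) ord0 i = (v t *+ 2) ord0 i + (i == i0)%:R by rewrite mxE [X in _ + X]mxE eqxx.
rewrite intrD mulrDr; congr (_ + _); rewrite mxE [X in _ * X]mxE eqxx /=.
by case: (i == i0).
Qed.

Lemma gbox_corner t y : gbox N (corner t) y \/ gbox N (corner t + 2 ^- N *: e0) y ->
  dyadic_box K (v t) y.
Proof.
rewrite -gbox_lat -/(corner t) => h i.
have d0 : 0 < 2 ^- N :> R by rewrite invr_gt0 exprn_gt0.
have dE : 2 ^- K = 2 * 2 ^- N :> R by rewrite exprS invfM mulrA mulfV ?mul1r.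
move: (corner t) h => a h; rewrite mxE [const_mx _ _ _]mxE dE.
have := d0; move: h; set d := 2 ^- N => h d1.
case: h => h; have := h i; rewrite !mxE; first by rewrite -/d => /andP[? ?]; apply/andP; split; lra.
rewrite -/d; case: (i == i0); rewrite !eqxx /= ?mulr1 ?mulr0 ?addr0 => /andP[? ?]; apply/andP; split; lra.
Qed.

Lemma dipoles_le1 y : `|dipoles i0 N corner y| <= 1.
Proof.
have bd t : `|(\1_(gbox N (corner t)) y - \1_(gbox N (corner t + 2 ^- N *: e0)) y : R)| <= 1.
  by rewrite !indicE; do 2 case: (_ \in _); rewrite /= ?subrr ?subr0 ?sub0r ?normrN ?normr0 ?normr1.
have [[t ht]|h] := pselect (exists t, dyadic_box K (v t) y).
  rewrite /dipoles (bigD1 t)//= big1 ?addr0// => s st; rewrite !indicE !memNset ?subr0//.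
  - move=> hs; move/eqP: st; apply; apply: (@cube_index_inj K J m).
    by rewrite -/(v s) -/(v t) (dyadic_box_index ht) (dyadic_box_index (gbox_corner (or_intror hs))).
  - move=> hs; move/eqP: st; apply; apply: (@cube_index_inj K J m).
    by rewrite -/(v s) -/(v t) (dyadic_box_index ht) (dyadic_box_index (gbox_corner (or_introl hs))).
rewrite /dipoles big1 ?normr0// => s _; rewrite !indicE !memNset ?subr0//.
- by move=> hs; apply: h; exists s; apply: gbox_corner; right.
- by move=> hs; apply: h; exists s; apply: gbox_corner; left.
Qed.

Variable lam : R.
Local Notation f := (bump_sum wavelet K.+3 center lam).

(** At the distance [r] from the face, balls of radius [r / 4] stay inside the
    two cubes as soon as [4 * r <= d]. *)
Lemma cell_bump (c : E) (a : E) (d r : R) (sgn : bool) y : 0 < r -> 4 * r <= d ->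
  c = a + (d / 2) *: (const_mx 1 + e0) ->
  `|y - (c - (-1) ^+ sgn *: (r *: e0))| <= r / 4 ->
  forall i, (a + sgn%:R *: (d *: e0)) ord0 i < y ord0 i < (a + sgn%:R *: (d *: e0)) ord0 i + d.
Proof.
move=> r0 rd -> h i; have := le_trans (coord_le_norm _ i) h; rewrite !mxE eqxx /=.
by case: (i == i0); case: sgn {h}; rewrite /= ?expr1 ?expr0 ?mulr1 ?mulr0 ?mul0r ?mul1r ?addr0;
  move: (y ord0 i) (a ord0 i) => u w; rewrite ler_norml => /andP[? ?]; apply/andP; split; lra.
Qed.

Lemma bmean_bump_sum z : bmean N z f =
  lam%:C * \sum_t bmean N z (scaled (K.+3 + enum_rank t) (center t) wavelet).
Proof.
have si t := cbump_integrable (scaled_cbump (K.+3 + enum_rank t) (center t) wavelet_cbump).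
have ii t : cintegrable (fun y => \1_(gbox N z) y * scaled (K.+3 + enum_rank t) (center t) wavelet y).
  by apply: cintegrable_indic => //; exact: measurable_gbox.
rewrite /bmean -mulr_sumr mulrCA -(cintegral_sum _ ii); congr (_ * _).
rewrite -(cintegralZ _ (cintegrable_sum _ ii)); apply: eq_cintegral => y.
by rewrite /bump_sum mulrCA mulr_sumr.
Qed.

(** Each bump has mass [1] and lies inside one cube, whatever its scale. *)
Lemma test_avg : dyadic_avg N f = fun y => (lam * (2 ^+ N) ^+ n * dipoles i0 N corner y)%:C.
Proof.
apply/funext => y; rewrite dyadic_avgE bmean_bump_sum.
have -> : (lam * (2 ^+ N) ^+ n * dipoles i0 N corner y)%:C = lam%:C * \sum_t ((2 ^+ N) ^+ n *
    (\1_(gbox N (corner t)) y - \1_(gbox N (corner t + 2 ^- N *: e0)) y))%:C.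
  by rewrite -rmorph_sum -mulr_sumr -rmorphM mulrA.
congr (_ * _); apply: eq_bigr => t _.
set k := (K.+3 + enum_rank t)%N.
have r0 : 0 < 2 ^- k :> R by rewrite invr_gt0 exprn_gt0.
have rd : 4 * 2 ^- k <= 2 ^- N :> R.
  rewrite ler_pdivrMr ?exprn_gt0// ler_pdivlMl ?exprn_gt0// mulrC.
  have -> : (4 : R) = 2 ^+ 2 by rewrite expr2; ring.
  by rewrite -exprD ler_eXn2l ?ltr1n//; exact: (leq_addr _ K.+3).
have bi := cbump_integrable bb.
have cE : center t = corner t + (2 ^- N / 2) *: (const_mx 1 + e0).
  by rewrite /center exprS invfM mulrC.
have supp c' x : scaled k c' beta x != 0 -> `|x - c'| <= 2 ^- k / 4.
  move=> h; rewrite mulrC -[4^-1]div1r; apply: scaled_supp h => u; exact: bs.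
have s1 c' := cbump_integrable (scaled_cbump k c' bb).
have m1 c' : cintegral setT (scaled k c' beta) = 1 by rewrite cintegral_scaled.
have gE (a : E) l : (a + const_mx (2 ^- N)) ord0 l = a ord0 l + 2 ^- N by rewrite !mxE.
have in1 x : scaled k (center t - 2 ^- k *: e0) beta x != 0 -> dyadic_box N (v t *+ 2) x.
  move=> /supp h; rewrite -gbox_lat -corner_lat => i.
  have := cell_bump (sgn := false) r0 rd cE (y := x); rewrite expr0 scale1r scale0r addr0.
  by move=> /(_ h i) /andP[h1 h2]; rewrite gE (ltW h1).
have in2 x : scaled k (center t + 2 ^- k *: e0) beta x != 0 -> dyadic_box N (v t *+ 2 + delta_mx ord0 i0) x.
  move=> /supp h; rewrite -gbox_lat -corner_next => i.
  have := cell_bump (sgn := true) r0 rd cE (y := x); rewrite expr1 scaleN1r opprK scale1r.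
  by move=> /(_ h i) /andP[h1 h2]; rewrite gE (ltW h1).
transitivity (bmean N (lat N (dyadic_index N y)) (scaled k (center t - 2 ^- k *: e0) beta) -
    bmean N (lat N (dyadic_index N y)) (scaled k (center t + 2 ^- k *: e0) beta)).
  have ii c' : cintegrable (fun x => \1_(gbox N (lat N (dyadic_index N y))) x * scaled k c' beta x).
    by apply: cintegrable_indic => //; exact: measurable_gbox.
  rewrite /bmean -mulrBr -(cintegralB (ii _) (ii _)); congr (_ * _); apply: eq_cintegral => x.
  by rewrite scaled_wavelet mulrBr.
rewrite (bmean_bump y (s1 _) (m1 _) in1) (bmean_bump y (s1 _) (m1 _) in2) -mulrBr.
by rewrite rmorphM corner_next corner_lat !gbox_lat rmorphB !indic_real.
Qed.

Lemma closed_balls (I : finType) (c : I -> E) (r : R) : closed [set y | exists t, `|y - c t| <= r].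
Proof.
rewrite (_ : [set y | _] = \bigcup_(t in [set: I]) [set y | `|y - c t| <= r]); last first.
  by apply/seteqP; split => [y [t h]|y [t _ h]]; exists t.
apply: closed_bigcup => [|t _]; first exact: finite_finset.
rewrite (_ : [set y | _] = (fun y : E => `|y - c t|) @^-1` [set u | u <= r]) //.
by apply: closed_comp => [y _|]; [exact: continuous_norm_sub|exact: closed_le].
Qed.

Lemma test_supp : dsupport (regular_dist f) `<=` dyadic_cube (- J%:Z) m.
Proof.
have fi := bump_sum_integrable wavelet_cbump K.+3 center lam; have [mf _] := fi.
pose r : R := 5 / 4 * 2 ^- K.+3.
have fS y : f y != 0 -> exists t, `|y - center t| <= r.
  move=> fy; apply: contrapT => h; move/eqP: fy; apply; rewrite /bump_sum big1 ?mulr0// => t _.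
  apply/eqP; apply: contra_notT h => st; exists t.
  apply: (le_trans (scaled_supp wavelet_supp st)); rewrite /r; apply: ler_wpM2l => //.
  by rewrite lef_pV2 ?posrE ?exprn_gt0// ler_eXn2l ?ltr1n// leq_addr.
move=> y /(dsupport_closed mf (@closed_balls _ center r) fS)[t ht] i; rewrite opprK -exprnP.
have d0 : 0 < 2 ^- N :> R by rewrite invr_gt0 exprn_gt0.
have rE : r = 5 / 16 * 2 ^- N by rewrite /r !exprS !invfM; move: (2 ^- K) => d; field.
have inK z : (forall l, corner t ord0 l <= z ord0 l < corner t ord0 l + 2 ^- K) ->
    2 ^+ J * (m ord0 i)%:~R <= z ord0 i < 2 ^+ J * ((m ord0 i)%:~R + 1).
  move=> hz; have := (@cube_boxes R n K J m z).1; apply; exists t.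
  by rewrite -gbox_lat => l; have := hz l; rewrite /corner !mxE.
have dE : 2 ^- K = 2 * 2 ^- N :> R by rewrite exprS invfM mulrA mulfV ?mul1r.
rewrite dE in inK.
have := le_trans (coord_le_norm _ i) ht; rewrite rE /center.
move: (corner t) inK => a inK; rewrite !mxE eqxx /=.
have -> : 2 ^- K.+2 = 2 ^- N / 2 :> R by rewrite exprS invfM mulrC.
have := inK (a + const_mx 0); have := inK (a + const_mx (15 / 8 * 2 ^- N)).
rewrite !mxE; move: (2 ^- N) d0 inK => d d0 inK.
have p1 l : a ord0 l <= (a + const_mx (15 / 8 * d)) ord0 l < a ord0 l + 2 * d.
  by rewrite !mxE; apply/andP; split; lra.
have p2 l : a ord0 l <= (a + const_mx 0) ord0 l < a ord0 l + 2 * d.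
  by rewrite !mxE; apply/andP; split; lra.
move=> /(_ p1)/andP[_ g2] /(_ p2)/andP[g1 _].
move: g1 g2; move: (a ord0 i) (y ord0 i) => c u.
by case: (i == i0); rewrite /= ?mulr1 ?mulr0 ?addr0 ler_norml => g1 g2 /andP[? ?]; apply/andP; split; lra.
Qed.

End test_function.

Section lower_bound.
Context {R : realType} {n : nat}.
Local Notation E := 'rV[R]_n.
Variable phi0 : E -> R[i].
Hypothesis LP : LP_generator phi0.
Variables (p : R) (q : \bar R).
Hypotheses (p0 : 0 < p) (p1 : p <= 1) (pq : (p%:E <= q)%E).
Local Notation s := (n%:R / p - n%:R : R).

(** Normalizing the test function costs [M^{1/q}], and its average has a
    quasi-norm of order [M^{1/p}] in the single piece [K]. *)
Lemma Op_lower (i0 : 'I_n) : exists2 c : R, 0 < c & forall K J (m : 'rV[int]_n), (0 < K)%N ->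
  ((c * ((2 ^+ (K + J)) ^+ n) `^ (p^-1 - fine q^-1))%:E <=
   Op (dyadic_avg K.+1) (besov_norm phi0 s p q) (dyadic_cube (- J%:Z) m))%E.
Proof.
have r0 : 0 < 1 / 4 :> R by lra.
have [beta [bb b1 bs]] := unit_bump (LP_cbump LP) (LP_at0 LP) r0.
have wb := wavelet_cbump i0 bb.
have r1 : 0 <= 5 / 4 :> R by lra.
have [W W0 hW] := bump_sum_norm LP wb r1 (wavelet_supp i0 bs) (wavelet_mean0 i0 bb b1) p0 p1 pq.
have [C C0 hC] := dipoles_oscillate LP i0 p0 p1.
pose c := (C * ((2 ^- 1) ^+ n) `^ (1 - p)) `^ p^-1 / W.
have h0 : 0 < (2 ^- 1) ^+ n :> R by rewrite exprn_gt0// invr_gt0.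
exists c; first by rewrite divr_gt0// powR_gt0// mulr_gt0// powR_gt0.
move=> K J m K0; pose M : R := (2 ^+ (K + J)) ^+ n.
have M0 : 0 < M by rewrite !exprn_gt0.
have cT : #|{ffun 'I_n -> 'I_(2 ^ (K + J))}|%:R = M.
  by rewrite card_ffun !card_ord !natrX.
have T0 : (0 < #|{ffun 'I_n -> 'I_(2 ^ (K + J))}|)%N by rewrite -(ltr0n R) cT.
(* the height that makes the norm of the test function at most [1] *)
pose e := fine q^-1; pose lam := (W * M `^ e)^-1.
have lam0 : 0 < lam by rewrite invr_gt0 mulr_gt0// powR_gt0.
pose f := bump_sum (wavelet i0 beta) K.+3 (@center R n i0 K J m) lam.
have fi : cintegrable f by exact: bump_sum_integrable.
have nf : (besov_norm phi0 s p q (regular_dist f) <= 1)%E.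
  apply: (le_trans (hW _ K.+3 _ lam (ltW lam0) T0)); rewrite cT lee_fin -mulrA.
  by rewrite /lam mulVf// gt_eqF// mulr_gt0// powR_gt0.
have sf : dsupport (regular_dist f) `<=` dyadic_cube (- J%:Z) m by exact: test_supp.
apply: le_trans (ereal_sup_ubound _); last first.
  by exists f; [split => //; exact: cintegrable_clocally|].
have E0 k : 0 < (2 ^+ k) ^+ n :> R by rewrite !exprn_gt0.
pose A := lam * (2 ^+ K.+1) ^+ n.
have A0 : 0 < A by exact: mulr_gt0.
have avgE := @test_avg R n i0 beta bb b1 bs K J m lam; rewrite avgE.
have gi := dipoles_integrable i0 K.+1 (@corner R n K J m) A.
apply: le_trans (besov_term_le phi0 p0 K (tempered_regular gi) pq).
have hz t : exists z : int, 2 ^+ K.+1 * @corner R n K J m t ord0 i0 = 2 * z%:~R.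
  exists (cube_index m t ord0 i0); rewrite mxE exprS -mulrA mulVKf// gt_eqF// exprn_gt0//.
have dl y : `|dipoles i0 K.+1 (@corner R n K J m) y| <= 1 by exact: dipoles_le1.
have low := hC K _ (@corner R n K J m) A K0 A0 hz dl.
have := besov_term_powR phi0 p0 (fun y => (A * dipoles i0 K.+1 (@corner R n K J m) y)%:C) K.
set B := besov_term _ _ _ _ => BE.
have B0 : (0 <= B)%E by exact: besov_term_ge0.
rewrite -(@poweRe1 _ B)// -(mulfV (lt0r_neq0 p0)) poweRrM BE.
apply: (@le_trans _ _ (((scale_wt (n := n) p K * (C * M * A `^ p * (2 ^- K.+1) ^+ n))%:E) `^ p^-1)%E); last first.
  have sw : 0 <= scale_wt (n := n) p K by rewrite ltW// scale_wt_gt0.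
  apply: gt0_ler_poweR; rewrite ?invr_ge0 ?(ltW p0)// ?in_itv/= ?leey ?andbT.
  - by rewrite lee_fin !mulr_ge0 ?powR_ge0 ?(ltW C0) ?(ltW M0) ?exprn_ge0 ?invr_ge0.
  - by apply: mule_ge0; rewrite ?lee_fin ?pmass_ge0.
  - by rewrite EFinM; apply: lee_wpmul2l; rewrite ?lee_fin// -cT.
rewrite poweR_EFin lee_fin; apply: eqle.
have -> : scale_wt (n := n) p K * (C * M * A `^ p * (2 ^- K.+1) ^+ n) =
   C * ((2 ^- 1) ^+ n) `^ (1 - p) * (M * lam `^ p).
  have u0 := E0 K.+1; have uV : (2 ^- K.+1) ^+ n = ((2 ^+ K.+1) ^+ n)^-1 :> R by rewrite exprVn.
  have kE : (2 ^+ K) ^+ n = (2 ^+ K.+1) ^+ n * (2 ^- 1) ^+ n :> R.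
    by rewrite -exprMn exprSr expr1 mulfK.
  rewrite /scale_wt kE uV /A; move: u0 h0; move: ((2 ^+ K.+1) ^+ n) ((2 ^- 1) ^+ n) => u h u0 h0.
  rewrite (powRM _ (ltW u0) (ltW h0)) (powRM _ (ltW lam0) (ltW u0)).
  have uE : u `^ (1 - p) * u `^ p = u by rewrite -powRD ?(lt0r_neq0 u0) ?implybT// subrK powRr1// ltW.
  have -> : u `^ (1 - p) * h `^ (1 - p) * (C * M * (lam `^ p * u `^ p) * u^-1) =
    (u `^ (1 - p) * u `^ p) * u^-1 * (C * h `^ (1 - p) * (M * lam `^ p)) by ring.
  by rewrite uE mulfV ?mul1r// gt_eqF.
rewrite (powRM _ (mulr_ge0 (ltW C0) (powR_ge0 _ _)) (mulr_ge0 (ltW M0) (powR_ge0 _ _))).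
rewrite (powRM _ (ltW M0) (powR_ge0 _ _)) -powRrM mulfV ?gt_eqF// powRr1 ?(ltW lam0)//.
have ME : M `^ (p^-1 - e) = M `^ p^-1 * (M `^ e)^-1.
  by rewrite powRD ?(lt0r_neq0 M0) ?implybT// powRN.
by rewrite -/M -/e ME /c /lam invfM; ring.
Qed.

Lemma Op_upper (q' : R) : (0 < n)%N -> p <= q' -> q' <= 1 -> n%:R <= n.+1%:R * p ->
  exists C : R, forall N J (m : 'rV[int]_n), (0 < N)%N ->
  (Op (dyadic_avg N) (besov_norm phi0 s p q'%:E) (dyadic_cube (- J%:Z) m) <=
   (C * ((2 ^+ (N + J)) ^+ n) `^ (p^-1 - q'^-1))%:E)%E.
Proof.
move=> n0 pq' q1 np; have [C hC] := grid_upper LP p0 p1 pq' q1 np n0.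
have [beta [bb b1 bs]] := unit_bump (LP_cbump LP) (LP_at0 LP) ltr01.
exists C => N J m N0; apply: ge_ereal_sup => _ [f [lf nf sf] <-].
have [gr ->] := cube_avg N bb b1 bs lf sf.
have cT : #|{ffun 'I_n -> 'I_(2 ^ (N + J))}|%:R = (2 ^+ (N + J)) ^+ n :> R.
  by rewrite card_ffun !card_ord !natrX.
rewrite -cT; apply: hC => //; rewrite -(ltr0n R) cT; by rewrite !exprn_gt0.
Qed.

End lower_bound.

Local Close Scope complex_scope.

Theorem theorem10p2 (R : realType) (d : nat) (hd : (1 <= d)%N)
    (phi0 : 'rV[R]_d -> R[i]) (hphi0 : LP_generator phi0)
    (p : R) (q : \bar R) (hp0 : 0 < p) (hp1 : p <= 1) (hpq : (p%:E <= q)%E) :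
  exists c1 : R, 0 < c1 /\
    (forall (N : nat) (j : int) (mu : 'rV[int]_d),
       (10 < N)%N -> 1 <= 2 ^ (- j) :> R ->
       (c1%:E * ((2 ^+ (N * d))%:E * lebesgue_row d (dyadic_cube j mu))
                  `^ (p^-1 - fine q^-1)
        <= Op (dyadic_avg N) (besov_norm phi0 (d%:R / p - d%:R) p q)
              (dyadic_cube j mu))%E) /\
    (d%:R / (d%:R + 1) <= p -> (q <= 1)%E ->
     exists c2 : R, forall (N : nat) (j : int) (mu : 'rV[int]_d),
       (10 < N)%N -> 1 <= 2 ^ (- j) :> R ->
       (c1%:E <= Op (dyadic_avg N) (besov_norm phi0 (d%:R / p - d%:R) p q)
                    (dyadic_cube j mu)
                 / ((2 ^+ (N * d))%:E * lebesgue_row d (dyadic_cube j mu))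
                     `^ (p^-1 - fine q^-1)
              <= c2%:E)%E).
Proof.
have [c c0 hc] := Op_lower hphi0 hp0 hp1 hpq (Ordinal hd).
pose e := p^-1 - fine q^-1; pose h : R := (2 ^- 1) ^+ d.
have h0 : 0 < h by rewrite exprn_gt0// invr_gt0.
pose b N J : R := (2 ^+ (N + J)) ^+ d.
have b0 N J : 0 < b N J by rewrite !exprn_gt0.
have be0 N J : 0 < b N J `^ e by rewrite powR_gt0.
have bE N J (mu : 'rV[int]_d) :
    ((2 ^+ (N * d))%:E * lebesgue_row d (dyadic_cube (- J%:Z) mu))%E = (b N J)%:E.
  by rewrite lebesgue_dyadic_cube -EFinM exprM -exprMn -exprD.
(* the cells of the test function have side [2 ^- K] with [N = K.+1]; the
   factor [h] accounts for the shift *)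
have low N J (mu : 'rV[int]_d) : (10 < N)%N -> ((c * h `^ e * b N J `^ e)%:E <=
    Op (dyadic_avg N) (besov_norm phi0 (d%:R / p - d%:R) p q) (dyadic_cube (- J%:Z) mu))%E.
  case: N => // K K0; have K1 : (0 < K)%N by case: K K0.
  apply: le_trans (hc K J mu K1).
  rewrite lee_fin -mulrA -(powRM _ (ltW h0) (ltW (b0 _ _))) /h /b -exprMn addSn.
  have -> : 2 ^- 1 * 2 ^+ (K + J).+1 = 2 ^+ (K + J) :> R by rewrite expr1 [2 ^+ _.+1]exprS mulKf.
  exact: lexx.
exists (c * h `^ e); split; first by rewrite mulr_gt0// powR_gt0.
split=> [N j mu N10 /nonneg_side[J ->]|dp q1].
  by rewrite bE poweR_EFin -EFinM; exact: low.
case: q hpq q1 hc @e be0 low => [q pq q1 hc e be0 low|_ q1|pq]; last 2 first.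
- by rewrite leye_eq in q1.
- by rewrite leeNy_eq in pq.
have np : d%:R <= d.+1%:R * p by rewrite mulrC -ler_pdivrMr ?ltr0n// -natr1.
have q0 : 0 < q by apply: lt_le_trans hp0 _; rewrite -lee_fin.
have eE : e = p^-1 - q^-1 by rewrite /e inver gt_eqF.
have [C hC] := Op_upper hphi0 hp0 hp1 hd pq q1 np.
exists C => N j mu N10 /nonneg_side[J ->]; rewrite bE poweR_EFin -/e inver gt_eqF//.
rewrite lee_pdivlMr// lee_pdivrMr// -!EFinM low//=.
by rewrite eE; apply: hC; case: N N10.
Qed.
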